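(* Let $r>0$, let $A\in L(\mathbb R^n\times\mathbb R^n,\mathbb R^n)$, let $\pi=(\pi^{i,j})_{1\le i,j\le n}$ be a family of finite signed measures on $[-r,0]$, and let $\mathbf X$ be a delayed $\gamma$-rough path with $\gamma>\frac13$. Let $\frac13<\beta\le\gamma$ be such that $2\beta+\gamma>1$. Assume $\xi\in\mathscr D^{\beta}_{\mathbf X}([-r,0])$ and that $G\in C^4_b(\mathbb R^n\times\mathbb R^n,L(\mathbb R^d,\mathbb R^n))$; in the case $A=0$ it suffices to assume $G\in C^3_b(\mathbb R^n\times\mathbb R^n,L(\mathbb R^d,\mathbb R^n))$. Then there exists a unique path $y\in\mathscr D^\beta_{\mathbf X}([0,\infty))$, with $y_s=\xi_s$ for $-r\le s\le 0$, such that for every $0\le s<t$ $$(\delta y)_{s,t}=\int_s^tA\Big(y_\tau,\int_{-r}^0y_{\theta+\tau}\,\pi(\mathrm d\theta)\Big)\,\mathrm d\tau+\int_s^tG(y_\tau,y_{\tau-r})\,\mathrm d\mathbf X_\tau .$$ Denote this solution by $\phi^t_{\mathbf X}(\xi):=y_t$ and set $\phi_{\mathbf X}(\xi):=(\phi^t_{\mathbf X}(\xi))_{0\le t\le r}$. There exists a polynomial $Q$, depending only on $\|A\|$, $G$ and $\pi$, such that $$\|\phi_{\mathbf X}(\xi)\|_{\mathscr D^\beta_{\mathbf X}([0,r])}\le Q\big(\|\xi\|_{\mathscr D^\beta_{\mathbf X}([-r,0])},\|\mathbf X\|_{\gamma,[0,r]}\big).$$ Moreover, the map $\phi_{\mathbf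 X}:\mathscr D^\beta_{\mathbf X}([-r,0])\to\mathscr D^\beta_{\mathbf X}([0,r])$, $\xi\mapsto\phi_{\mathbf X}(\xi)$, is continuous.
   Context: For a path $m$ on an interval $J$ write $m_{s,t}=(\delta m)_{s,t}=m_t-m_s$, $\|m\|_{\infty;J}=\sup_{J}|m|$, $\|m\|_{\alpha;J}=\sup_{s\ne t\in J}|m_t-m_s|/|t-s|^{\alpha}$; for a two-parameter function $F$, $\|F\|_{\alpha;J}=\sup_{s\ne t\in J}|F_{s,t}|/|t-s|^\alpha$. Delayed rough path: for $\gamma\in(\frac13,\frac12]$, a delayed $\gamma$-rough path is a triple $\mathbf X=(X,\mathbb X,\mathbb X(-r))$ where $X:\mathbb R\to\mathbb R^d$ is locally $\gamma$-Hölder, and $\mathbb X,\mathbb X(-r):\mathbb R\times\mathbb R\to\mathbb R^d\otimes\mathbb R^d$ are continuous, have finite $\|\cdot\|_{2\gamma;J}$ on every compact interval $J$, and satisfy for $s<u<t$: $\mathbb X_{s,t}=\mathbb X_{s,u}+\mathbb X_{u,t}+X_{s,u}\otimes X_{u,t}$ and $\mathbb X_{s,t}(-r)=\mathbb X_{s,u}(-r)+\mathbb X_{u,t}(-r)+X_{s-r,u-r}\otimes X_{u,t}$. Set $\|\mathbf X\|_{\gamma,J}:=\|X\|_{\gamma;J}+\|\mathbb X\|_{2\gamma;J}+\|\mathbb X(-r)\|_{2\gamma;J}$. Controlled paths: for compact $J$, $\mathscr D^\beta_{\mathbf X}(J)$ is the Banach space of pairs $(m,m')$ (usually written $m$) with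 $m:J\to\mathbb R^n$, $m':J\to L(\mathbb R^d,\mathbb R^n)$ $\beta$-Hölder (the Gubinelli derivative), such that $m^{\#}_{s,t}:=m_{s,t}-m'_sX_{s,t}$ satisfies $\|m^\#\|_{2\beta;J}<\infty$, with norm $\|m\|_{\mathscr D^\beta_{\mathbf X}(J)}=\|m\|_{\infty;J}+\|m'\|_{\infty;J}+\|m'\|_{\beta;J}+\|m^\#\|_{2\beta;J}$. A path is in $\mathscr D^\beta_{\mathbf X}([0,\infty))$ if its restriction to every compact subinterval is controlled in this sense. The Gubinelli derivative of the solution is $y'_t=G(y_t,y_{t-r})$, $t\ge0$. Rough integral: $\zeta:[a,b]\to L(\mathbb R^d,\mathbb R^n)$ is a delayed controlled path if there are $\beta$-Hölder paths $\zeta^0,\zeta^1$ with $\zeta_{s,t}=\zeta^0_sX_{s,t}+\zeta^1_sX_{s-r,t-r}+\zeta^\#_{s,t}$ and $\|\zeta^\#\|_{2\beta;[a,b]}<\infty$; then $\int_a^b\zeta_s\,\mathrm d\mathbf X_s:=\lim_{|\Pi|\to0}\sum_{t_j\in\Pi}\big(\zeta_{t_j}X_{t_j,t_{j+1}}+\zeta^0_{t_j}\mathbb X_{t_j,t_{j+1}}+\zeta^1_{t_j}\mathbb X_{t_j,t_{j+1}}(-r)\big)$ over partitions $\Pi$ of $[a,b]$ (the limit exists when $2\beta+\gamma>1$). For $\zeta_t=G(y_t,y_{t-r})$ one takes $\zeta^0_s=\partial_1G(y_s,y_{s-r})y'_s$ and $\zeta^1_s=\partial_2G(y_s,y_{s-r})y'_{s-r}$;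 on $[0,r]$ the delayed component $y_{\cdot-r}$ and its Gubinelli derivative are those of $\xi$, and integrals over longer intervals are defined additively over the intervals $[kr,(k+1)r]$. The notation $\int_{-r}^0y_{\theta+t}\,\pi(\mathrm d\theta)$ means the vector $\big(\sum_{1\le i\le n}\int_{-r}^0y^i_{\theta+t}\,\pi^{i,j}(\mathrm d\theta)\big)_{1\le j\le n}$. $C^k_b$ is the space of functions which, together with all derivatives up to order $k$, are continuous and bounded.
   Formalization: The second argument of Q is ‖X‖_{γ;[-r,0]} + ‖𝐗‖_{γ,[0,r]} rather than ‖𝐗‖_{γ,[0,r]} alone: as stated the bound fails, e.g. A=0, G(u,v)=sin v, X_t=sin(Mt) for t<0 and 0 for t≥0, ξ=(X,1), where y' has Hölder norm of order M^β. *)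

(* Defs.v *)
From HB Require Import structures.
From mathcomp Require Import all_boot all_order all_algebra.
From mathcomp Require Import all_classical all_reals all_analysis.

Set Implicit Arguments.
Unset Strict Implicit.
Unset Printing Implicit Defensive.

Import Order.TTheory GRing.Theory Num.Theory.
Import numFieldNormedType.Exports.

Local Open Scope classical_set_scope.
Local Open Scope ring_scope.

(* Conventions.  Vectors are row vectors, and an element M of L(R^p, R^q) is a
   p x q matrix acting by [v *m M].  All norms on these spaces are the
   library's [`| _ |], the largest absolute value of an entry.  The tensor
   product of x and y is x^T *m y.  A path is a total function on R whose values
   outside its interval of definition are irrelevant. *)

Section Norms.
Context {R : realType} {V : normedModType R}.
Implicit Types (J : set R) (m : R -> V) (F : R -> R -> V) (al : R).

Definition incr m (s t : R) : V := m t - m s.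

Definition sup_norm J m : \bar R := ereal_sup [set `|m t|%:E | t in J].

Definition incr_norm al J F : \bar R :=
  ereal_sup [set (`|F p.1 p.2| / `|p.2 - p.1| `^ al)%:E
            | p in [set p : R * R | [/\ J p.1, J p.2 & p.1 != p.2]]].

Definition holder_norm al J m : \bar R := incr_norm al J (incr m).

End Norms.

Record delayed_path (R : realType) (d : nat) := DelayedPath {
  base : R -> 'rV[R]_d ;
  area : R -> R -> 'M[R]_d ;
  delayed_area : R -> R -> 'M[R]_d }.

Section RoughPaths.
Context {R : realType} {d : nat}.
Implicit Types (r gamma : R) (X : delayed_path R d).

Definition delayed_rough_path r gamma X : Prop :=
  [/\ (forall a b, a < b ->
         [/\ holder_norm gamma `[a, b] (base X) \is a fin_num,
             incr_norm (2 * gamma) `[a, b] (area X) \is a fin_num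
           & incr_norm (2 * gamma) `[a, b] (delayed_area X) \is a fin_num]),
      continuous (fun p : R * R => area X p.1 p.2),
      continuous (fun p : R * R => delayed_area X p.1 p.2),
      (forall s u t, s < u -> u < t ->
         area X s t = area X s u + area X u t
           + (incr (base X) s u)^T *m incr (base X) u t)
    & (forall s u t, s < u -> u < t ->
         delayed_area X s t = delayed_area X s u + delayed_area X u t
           + (incr (base X) (s - r) (u - r))^T *m incr (base X) u t)].

(* This norm over [0, r] does not see the increments of X over [-r, 0], on which
   the Hoelder norm of G(y_t, xi_(t-r)) depends: for X_t = sin (M t) when t < 0
   and X_t = 0 when t >= 0, with the canonical lift, n = d = 1, no drift and
   xi = (X, 1), the norms of xi over [-r, 0] and of X over [0, r] are at most
   2 and 0, and y = 0, but for G(u, v) = sin v the Gubinelli derivative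
   G(0, sin (M (t - r))) has unbounded Hoelder norms as M grows.  An a priori bound must therefore also
   involve [holder_norm gamma `[- r, 0] (base X)]. *)
Definition rough_norm gamma (J : set R) X : \bar R :=
  (holder_norm gamma J (base X) + incr_norm (2 * gamma)%R J (area X)
   + incr_norm (2 * gamma)%R J (delayed_area X))%E.

End RoughPaths.

(* A path together with its Gubinelli derivative. *)
Definition cpath (R : realType) (d n : nat) : Type :=
  ((R -> 'rV[R]_n) * (R -> 'M[R]_(d, n)))%type.

Section Controlled.
Context {R : realType} {d n : nat}.
Implicit Types (X : delayed_path R d) (beta : R) (J : set R) (m : cpath R d n).

Definition remainder X m (s t : R) : 'rV[R]_n :=
  incr m.1 s t - incr (base X) s t *m m.2 s.

Definition controlled X beta J m : Prop :=
  holder_norm beta J m.2 \is a fin_num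
  /\ incr_norm (2 * beta) J (remainder X m) \is a fin_num.

Definition ctrl_norm X beta J m : \bar R :=
  (sup_norm J m.1 + sup_norm J m.2 + holder_norm beta J m.2
   + incr_norm (2 * beta)%R J (remainder X m))%E.

End Controlled.

Section RoughIntegral.
Context {R : realType} {d n : nat}.
Implicit Types (r beta a b : R) (X : delayed_path R d)
  (zeta : R -> 'M[R]_(d, n)).

(* The derivatives zeta0 and zeta1 take their values in
   L(R^d, L(R^d, R^n)), the outer linear map being a function.  Since R^d has
   finite dimension, such a path is Hoelder continuous if and only if it is so
   in every direction v. *)
Definition delayed_controlled r X beta a b zeta
    (zeta0 zeta1 : R -> 'rV[R]_d -> 'M[R]_(d, n)) : Prop :=
  [/\ (forall s, linear (zeta0 s)) /\ (forall s, linear (zeta1 s)),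
      (forall v, holder_norm beta `[a, b] (zeta0 ^~ v) \is a fin_num),
      (forall v, holder_norm beta `[a, b] (zeta1 ^~ v) \is a fin_num)
    & incr_norm (2 * beta) `[a, b]
        (fun s t => incr zeta s t - zeta0 s (incr (base X) s t)
           - zeta1 s (incr (base X) (s - r) (t - r))) \is a fin_num].

(* The action of Z : L(R^d, L(R^d, R^n)) on R^d (x) R^d: it sends x^T *m y
   to y *m Z x. *)
Definition contract (Z : 'rV[R]_d -> 'M[R]_(d, n)) (T : 'M[R]_d) : 'rV[R]_n :=
  \sum_i row i T *m Z (delta_mx 0 i).

(* In [itv_partition a b l] the list l omits the left end point a. *)
Definition rough_sum X zeta (zeta0 zeta1 : R -> 'rV[R]_d -> 'M[R]_(d, n))
    a (l : seq R) : 'rV[R]_n :=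
  \sum_(p <- zip (a :: l) l)
    (incr (base X) p.1 p.2 *m zeta p.1
     + contract (zeta0 p.1) (area X p.1 p.2)
     + contract (zeta1 p.1) (delayed_area X p.1 p.2)).

Definition mesh_to0 a b : set_system (seq R) :=
  [set P | exists2 e, 0 < e &
     forall l, itv_partition a b l ->
       (forall p, p \in zip (a :: l) l -> p.2 - p.1 < e) -> P l].

Definition is_rough_integral r X beta a b zeta
    (zeta0 zeta1 : R -> 'rV[R]_d -> 'M[R]_(d, n)) (I : 'rV[R]_n) : Prop :=
  delayed_controlled r X beta a b zeta zeta0 zeta1
  /\ rough_sum X zeta zeta0 zeta1 a @ mesh_to0 a b --> I.

End RoughIntegral.

Section Coefficients.
Context {R : realType} {n : nat}.

(* C^k_b.  The derivatives of order j are evaluated at arbitrary fixed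
   directions v_1, ..., v_j; in finite dimension, continuity and boundedness of
   all these evaluations is that of the j-linear derivative itself. *)
Fixpoint Cb (W : normedModType R) (k : nat)
    (f : 'rV[R]_n * 'rV[R]_n -> W) : Prop :=
  [/\ continuous f,
      (exists M : R, forall x, `|f x| <= M)
    & if k is k'.+1 then
        (forall x, differentiable f x) /\ (forall v, Cb k' (fun x => 'd f x v))
      else True].

End Coefficients.

Section SignedMeasures.
Context {d : measure_display} {T : measurableType d} {R : realType}.
Implicit Type nu : {charge set T -> \bar R}.

Definition hahn_sets nu :
  {P : set T & {N : set T | hahn_decomposition nu P N}} :=
  let h := cid (Hahn_decomposition nu) in existT _ (projT1 h) (cid (projT2 h)).

Definition charge_pos nu := jordan_pos (projT2 (projT2 (hahn_sets nu))).
Definition charge_neg nu := jordan_neg (projT2 (projT2 (hahn_sets nu))).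

Definition charge_integral nu (D : set T) (f : T -> R) : R :=
  \int[charge_pos nu]_(x in D) f x - \int[charge_neg nu]_(x in D) f x.

End SignedMeasures.

Section Equation.
Context {R : realType} {d n : nat}.
Variables (r beta : R) (A : 'M[R]_(n + n, n)).
Variables (G : 'rV[R]_n * 'rV[R]_n -> 'M[R]_(d, n)).
(* Signed measures on [-r, 0] are represented by signed measures on R, of which
   only the restriction to [-r, 0] is used. *)
Variable pi : 'I_n -> 'I_n -> {charge set (measurableTypeR R) -> \bar R}.
Variable X : delayed_path R d.
Implicit Types (xi y : cpath R d n).

Definition delay_average (y : R -> 'rV[R]_n) (t : R) : 'rV[R]_n :=
  \row_j \sum_i
    charge_integral (pi i j) `[- r, 0] (fun theta => y (theta + t) 0 i).

(* A maps a pair (u, v) to row_mx u v *m A. *)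
Definition drift (y : R -> 'rV[R]_n) (s t : R) : 'rV[R]_n :=
  \row_j \int[lebesgue_measure]_(tau in `[s, t])
    (row_mx (y tau) (delay_average y tau) *m A) 0 j.

(* The integrand G(y_t, y_(t-r)) and its two derivatives, for a delayed
   component with Gubinelli derivative w. *)
Definition G_path (y : R -> 'rV[R]_n) (t : R) : 'M[R]_(d, n) :=
  G (y t, y (t - r)).
Definition G_path0 y (t : R) (v : 'rV[R]_d) : 'M[R]_(d, n) :=
  'd G (y.1 t, y.1 (t - r)) (v *m y.2 t, 0).
Definition G_path1 y (w : R -> 'M[R]_(d, n)) (t : R) (v : 'rV[R]_d)
    : 'M[R]_(d, n) :=
  'd G (y.1 t, y.1 (t - r)) (0, v *m w (t - r)).

(* The integral over [s, t], 0 <= s < t, is the sum of the integrals over the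
   nondegenerate intervals [s, t] /\ [k r, (k + 1) r].  The derivative of the
   delayed component is that of xi on the first one: at time 0 the derivatives
   of xi and of the solution may differ. *)
Definition is_delay_integral xi y (s t : R) (I : 'rV[R]_n) : Prop :=
  exists2 J : nat -> 'rV[R]_n,
    I = \sum_(k < (Num.truncn (t / r)).+1) J k
  & forall k : nat,
      let a := Num.max s (k%:R * r) in
      let b := Num.min t (k.+1%:R * r) in
      let w := if k is 0%N then xi.2 else y.2 in
      if a < b then
        is_rough_integral r X beta a b
          (G_path y.1) (G_path0 y) (G_path1 y w) (J k)
      else J k = 0.

Definition solution xi y : Prop :=
  [/\ (forall s, - r <= s <= 0 -> y.1 s = xi.1 s),
      (forall t, 0 <= t -> y.2 t = G (y.1 t, y.1 (t - r))),
      (forall a b, 0 <= a -> a < b -> controlled X beta `[a, b] y)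
    & (forall s t, 0 <= s -> s < t ->
         exists2 I, is_delay_integral xi y s t I
                  & incr y.1 s t = drift y.1 s t + I)].

End Equation.

(* Main.v *)
(* Let Xi_{s,t}(y) = X_{s,t} G(y_s, y_{s-r}) + (the area terms of the delayed rough
   integral).  Chen's relations make Xi additive up to O(|t-s|^{3 beta}), and
   3 beta > 1, so that by sewing y solves the equation if and only if
   y_t - y_s - (drift over [s, t]) - Xi_{s,t}(y) = O(|t-s|^{3 beta}) on each
   interval [kr, (k+1)r], where the delayed component is already known.  Picard
   iteration solves this on short intervals, and the same estimate for the
   difference of two solutions gives uniqueness and continuity.
   For the polynomial bound, boundedness of G and of its derivatives implies
   that the remainder y_t - y_s - (drift) - X_{s,t} G(y_s, y_{s-r}) is at most
   |t-s|^{2 beta} / h^beta at every scale h whose inverse is a large enough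
   polynomial in the norms of the data, with a term linear in sup |y| that comes
   from the drift.  Cutting [0, r] into pieces of length h bounds sup |y| by a
   polynomial plus a small multiple of sup |y|, and a Gronwall argument
   concludes. *)

Require Import Defs.
From HB Require Import structures.
From mathcomp Require Import all_boot all_order all_algebra.
From mathcomp Require Import all_classical all_reals all_analysis.
From mathcomp Require Import measurable_realfun ring lra zify.

Set Implicit Arguments.
Unset Strict Implicit.
Unset Printing Implicit Defensive.

Import Order.TTheory GRing.Theory Num.Theory.
Import numFieldNormedType.Exports.

Local Open Scope classical_set_scope.
Local Open Scope ring_scope.

(** * Bounds by iterated improvement and powers of increments *)

(** The bounds known for a solution at the start (a Davie constant, a Hoelder norm, a sup norm) are
    finite but arbitrary, while the constants to be proved may depend on the data alone. The key
    estimates are therefore improvements x -> q x + B with q < 1, whose fixed point forgets the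
    initial bound. Integrals are kept out of the analysis: the drift enters through additivity and
    Lipschitz bounds only, the rough integral through its germ only, and both are reconnected with
    the equation at the end. The delay is hidden by regarding (y, y(. - r)) as one path controlled
    by (X, X(. - r)), whose delayed half is a datum with a derivative of its own. The obstacle to a
    polynomial bound is the unbounded drift: a Gronwall factor is exponential in its rate, so it may
    be applied to the drift alone, whose rate depends on |A|, pi and r. The rough part has to
    contribute to sup |y| with a coefficient that does not grow with X or xi and is small against
    that factor. *)

Ltac pos := intros; repeat first [ done | exact: normr_ge0 | exact: powR_ge0
  | apply: addr_ge0 | apply: exprn_ge0 | apply: mulr_ge0 | rewrite invr_ge0 ].

Section Improvement.
Context {R : realType}.

Lemma expr_lt_eps (q x e : R) : 0 <= q -> q < 1 -> 0 < e ->
  exists n, q ^+ n * x < e.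
Proof.
move=> q0 q1 e0.
have h : geometric x q @ \oo --> (0 : R) by apply: cvg_geometric; rewrite ger0_norm.
move/cvgrPdist_lt : h => /(_ _ e0) [N _ /(_ N (leqnn N))] /=.
rewrite sub0r normrN => h; exists N; rewrite mulrC; exact: le_lt_trans (ler_norm _) h.
Qed.

(* If every bound x * w improves to (q * x + B) * w, then the fixed point of
   x |-> q * x + B is a bound, however bad the bound known at the start. *)
Lemma improve_bound (I : Type) (P : I -> Prop) (F w : I -> R) (q B : R) :
  0 <= q -> q < 1 -> 0 <= B -> (forall i, 0 <= w i) ->
  (exists2 x, 0 <= x & forall i, P i -> F i <= x * w i) ->
  (forall x, 0 <= x -> (forall i, P i -> F i <= x * w i) ->
     forall i, P i -> F i <= (q * x + B) * w i) ->
  forall i, P i -> F i <= B / (1 - q) * w i.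
Proof.
move=> q0 q1 B0 w0 [x0 x00 hx0] imp.
have q1' : 0 < 1 - q by rewrite subr_gt0.
set L := B / (1 - q).
have L0 : 0 <= L by apply: divr_ge0 => //; apply: ltW.
have LE : q * L + B = L.
  have hL : L * (1 - q) = B by rewrite /L divfK // gt_eqF.
  by rewrite -hL; ring.
have it n : forall i, P i -> F i <= (L + q ^+ n * x0) * w i.
  elim: n => [|n IH] i Pi.
    apply: le_trans (hx0 i Pi) _; rewrite expr0 mul1r ler_wpM2r // lerDr //.
  have := imp (L + q ^+ n * x0) _ IH i Pi.
  rewrite (_ : q * _ + B = L + q ^+ n.+1 * x0); first apply.
    by apply: addr_ge0 => //; rewrite mulr_ge0 ?exprn_ge0.
  by rewrite -{2}LE exprS; ring.
move=> i Pi; apply/ler_addgt0Pr => e e0.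
have [n hn] := expr_lt_eps (x0 * w i) q0 q1 e0.
apply: le_trans (it n i Pi) _.
by rewrite mulrDl lerD2l -mulrA ltW.
Qed.

(** The rate is part of the conclusion because the limits of dyadic sums and of Picard iterates are
    later compared with every finite stage. *)
Lemma geometric_limit (m n : nat) (u : nat -> 'M[R]_(m, n)) (c q : R) :
  0 <= q -> q < 1 -> 0 <= c ->
  (forall k, `|u k.+1 - u k| <= c * q ^+ k) ->
  {l | forall k, `|u k - l| <= c / (1 - q) * q ^+ k}.
Proof.
move=> q0 q1 c0 hu; apply: cid.
have q1' : 0 < 1 - q by rewrite subr_gt0.
(* The exact partial sum of the geometric series: with the factor 1 - q^j the induction closes as an
   equality. *)
have tele k j : `|u (k + j)%N - u k| <= c / (1 - q) * q ^+ k * (1 - q ^+ j).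
  elim: j => [|j IH]; first by rewrite addn0 expr0 !subrr normr0 mulr0.
  rewrite addnS; have -> : u (k + j).+1 - u k
      = (u (k + j).+1 - u (k + j)%N) + (u (k + j)%N - u k).
    by rewrite addrA subrK.
  apply: le_trans (ler_normD _ _) _; apply: le_trans (lerD (hu _) IH) _.
  rewrite le_eqVlt; apply/orP; left; apply/eqP.
  by rewrite exprD exprS; field; rewrite gt_eqF.
have tele' k j : `|u (k + j)%N - u k| <= c / (1 - q) * q ^+ k.
  apply: le_trans (tele k j) _; rewrite ler_piMr //.
    by rewrite mulr_ge0 ?exprn_ge0 // divr_ge0 // ltW.
  by rewrite gerBl exprn_ge0.
have : cvg (u @ \oo).
  apply: cauchy_cvg; apply: cauchy_exP => e e0.
  have [N hN] := expr_lt_eps (c / (1 - q)) q0 q1 e0.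
  exists (u N); exists N => // k /= Nk.
  rewrite -ball_normE /= distrC -(subnKC Nk); apply: le_lt_trans (tele' _ _) _.
  by rewrite mulrC.
move=> /cvg_ex[l hl]; exists l => k.
apply/ler_addgt0Pr => e e0.
move/cvgrPdist_lt : hl => /(_ _ e0) [N _ hN].
have := hN (k + N)%N (leq_addl _ _) => /= h.
rewrite distrC -(subrK (u (k + N)%N) l) -addrA addrC.
by apply: le_trans (ler_normD _ _) _; apply: lerD (tele' _ _) (ltW h).
Qed.

End Improvement.

(** * Powers of time increments *)

Section Power.
Context {R : realType}.
Variable beta : R.
Hypotheses (beta_gt : 3^-1 < beta) (beta_le : beta <= 2^-1).

Definition hpow (s t : R) : R := (t - s) `^ beta.

Let beta_gt0 : 0 < beta. Proof. by apply: lt_trans beta_gt. Qed.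
Hint Resolve beta_gt0 : core.

Lemma pw_ge0 s t : 0 <= hpow s t. Proof. exact: powR_ge0. Qed.
Hint Resolve pw_ge0 : core.

Lemma pw2_ge0 s t : 0 <= hpow s t ^+ 2. Proof. exact: exprn_ge0. Qed.
Lemma pw3_ge0 s t : 0 <= hpow s t ^+ 3. Proof. exact: exprn_ge0. Qed.

Lemma pwxx s : hpow s s = 0.
Proof. by rewrite /hpow subrr powR0 // gt_eqF. Qed.

Lemma powR_le (x y : R) : 0 <= x -> x <= y -> x `^ beta <= y `^ beta.
Proof.
by move=> x0 xy; apply: ge0_ler_powR; rewrite ?nnegrE ?(le_trans x0 xy) // ltW.
Qed.

Lemma pw_mono s t s' t' : s <= s' -> s' <= t' -> t' <= t -> hpow s' t' <= hpow s t.
Proof. by move=> *; apply: powR_le; rewrite ?subr_ge0 //; lra. Qed.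

Lemma pw_le s t h : s <= t -> t - s <= h -> hpow s t <= h `^ beta.
Proof. by move=> *; apply: powR_le; rewrite ?subr_ge0. Qed.

Lemma pow_le1 h : 0 <= h -> h <= 1 -> h `^ beta <= 1.
Proof. by move=> h0 h1; have := powR_le h0 h1; rewrite powR1. Qed.

Lemma powR_sq (x : R) : (x `^ beta) ^+ 2 = x `^ (2 * beta).
Proof. by rewrite -powR_mulrn ?powR_ge0 // -powRrM mulrC. Qed.

Lemma powR_cube (x : R) : (x `^ beta) ^+ 3 = x `^ (3 * beta).
Proof. by rewrite -powR_mulrn ?powR_ge0 // -powRrM mulrC. Qed.

(** Since 2 beta <= 1, a Lipschitz term on an interval of length at most 1 is of order 2 beta. In
    this way the drift is absorbed into remainders. *)
Lemma pow_ge_lin (x : R) : 0 <= x -> x <= 1 -> x <= (x `^ beta) ^+ 2.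
Proof.
rewrite le_eqVlt => /orP[/eqP<- _|x0 x1]; first exact: exprn_ge0 (powR_ge0 _ _).
by rewrite powR_sq; apply: ger1_powR; rewrite ?x0 ?x1 //; move: beta_le; lra.
Qed.

Lemma powRV (x : R) : 0 < x -> x^-1 `^ beta = (x `^ beta)^-1.
Proof.
move=> x0; have xb : x `^ beta != 0 by rewrite gt_eqF // powR_gt0.
by apply: (mulfI xb); rewrite -powRM ?invr_ge0 ?(ltW x0) // !divff ?powR1 // gt_eqF.
Qed.

(** The factor is h^(1 - 2 beta): [pow_ge_lin] rescaled from length 1 to length h, so that a drift
    of rate D costs D h^(1 - 2 beta) in a remainder. *)
Lemma pw_lin s t h : 0 < h -> s <= t -> t - s <= h ->
  t - s <= h / (h `^ beta) ^+ 2 * hpow s t ^+ 2.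
Proof.
move=> h0 st sth.
have := @pow_ge_lin ((t - s) / h).
rewrite divr_ge0 ?subr_ge0 ?(ltW h0) // ler_pdivrMr // mul1r => /(_ isT sth).
rewrite ler_pdivrMr // powRM ?subr_ge0 ?invr_ge0 ?(ltW h0) // => /le_trans; apply.
rewrite powRV // exprMn /hpow exprVn le_eqVlt; apply/orP; left; apply/eqP; ring.
Qed.

(** Because 3 beta > 1. Short time scales are chosen as cubes of small numbers, which replaces roots
    of order beta and keeps the dependence on the data polynomial with fixed exponents. *)
Lemma pow_small (x : R) : 0 <= x -> x <= 1 -> (x ^+ 3) `^ beta <= x.
Proof.
rewrite le_eqVlt => /orP[/eqP<- _|x0 x1].
  by rewrite expr0n /= powR0 // gt_eqF.
rewrite -(@powR_mulrn _ x 3) ?(ltW x0) // -powRrM; apply: ge1r_powR; rewrite ?x0 ?x1 //.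
by move: beta_gt; lra.
Qed.

(** This is 2^(1 - 3 beta), the factor gained when a term of order 3 beta is replaced by its values
    on the two halves of the interval. *)
Definition half_rate : R := 2 * (2^-1 `^ beta) ^+ 3.

Lemma half_rate_ge0 : 0 <= half_rate.
Proof. by rewrite mulr_ge0 // exprn_ge0 // powR_ge0. Qed.

(* This is where 3 beta > 1 enters. *)
Lemma half_rate_lt1 : half_rate < 1.
Proof.
rewrite /half_rate powR_cube.
have h2 : 2^-1 `^ (3 * beta) < 2^-1 :> R.
  have l0 : ln (2^-1 : R) < 0 by apply: ln_lt0; rewrite invr_gt0 ltr0n invf_lt1 ?ltr1n.
  rewrite -[ltRHS]lnK ?posrE ?invr_gt0 // /powR gt_eqF ?invr_gt0 // ltr_expR.
  by move: beta_gt l0; nra.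
lra.
Qed.

Lemma pw_half3 s t : s <= t -> 2 * (((t - s) / 2) `^ beta) ^+ 3 = half_rate * hpow s t ^+ 3.
Proof.
move=> st; rewrite powRM ?subr_ge0 ?invr_ge0 // /half_rate /hpow exprMn; ring.
Qed.

Lemma dyadic_rate (x : R) N : 0 <= x ->
  2 ^+ N * ((x / 2 ^+ N) `^ beta) ^+ 3 = half_rate ^+ N * (x `^ beta) ^+ 3.
Proof.
move=> x0; elim: N => [|N IH]; first by rewrite !expr0 invr1 mulr1 !mul1r.
have -> : x / 2 ^+ N.+1 = x / 2 ^+ N * 2^-1 by rewrite exprS invfM (mulrC 2^-1) mulrA.
rewrite [half_rate ^+ N.+1]exprS -(mulrA half_rate) -IH powRM ?invr_ge0 ?divr_ge0 ?exprn_ge0 //.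
rewrite exprS exprMn /half_rate; ring.
Qed.

End Power.

(** * Sewing *)

Section Sewing.
Context {R : realType} {p m : nat}.
Variable beta : R.
Hypotheses (beta_gt : 3^-1 < beta) (beta_le : beta <= 2^-1).
Local Notation pw := (hpow beta).
Local Notation q := (half_rate beta).

(** The solution of C = q C + 2, the recursion of [sew_max]: the two outer parts together cost q C,
    and isolating a cell costs two defects. *)
Definition sew_const : R := 2 / (1 - q).

Lemma sew_const_ge0 : 0 <= sew_const.
Proof. by rewrite divr_ge0 // subr_ge0 ltW // half_rate_lt1. Qed.

Lemma sew_constE : sew_const * q + 2 = sew_const.
Proof.
by rewrite /sew_const; field; rewrite subr_eq0 eq_sym lt_eqF // half_rate_lt1.
Qed.

Variables (Om : R -> R -> 'M[R]_(p, m)) (a b K : R).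
Hypotheses (K_ge0 : 0 <= K) (Om_diag : forall s, a <= s -> s <= b -> Om s s = 0).
Hypothesis Om_delta : forall s v t, a <= s -> s <= v -> v <= t -> t <= b ->
  `|Om s t - Om s v - Om v t| <= K * pw s t ^+ 3.

Lemma pw_half_le s v t : s <= v -> v <= t ->
  (v - s <= (t - s) / 2 -> pw s v ^+ 3 <= q / 2 * pw s t ^+ 3) /\
  (t - v <= (t - s) / 2 -> pw v t ^+ 3 <= q / 2 * pw s t ^+ 3).
Proof.
move=> sv vt.
have -> : q / 2 * pw s t ^+ 3 = (((t - s) / 2) `^ beta) ^+ 3.
  by rewrite mulrAC -(pw_half3 beta (le_trans sv vt)) mulrC mulKf.
by split=> h; rewrite lerXn2r ?nnegrE ?powR_ge0 // powR_le // ?subr_ge0.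
Qed.

(** Strong induction on the number of cells. Isolating the cell that contains the midpoint leaves a
    left and a right part of at most half the length each; their errors add up to a factor q, and
    two defects of [Om] are added. The constant does not see the number of points. Points of [sg]
    may coincide, as happens when a partition is clipped to a subinterval. *)
Lemma sew_max (sg : nat -> R) (sg_mono : forall i, sg i <= sg i.+1) k i :
  a <= sg i -> sg (i + k)%N <= b ->
  `|\sum_(i <= l < i + k) Om (sg l) (sg l.+1) - Om (sg i) (sg (i + k)%N)|
    <= sew_const * K * pw (sg i) (sg (i + k)%N) ^+ 3.
Proof.
have mono x y : (x <= y)%N -> sg x <= sg y.
  move=> xy; rewrite -(subnKC xy); elim: (y - x)%N => [|l IH]; first by rewrite addn0.
  by rewrite addnS; exact: le_trans IH (sg_mono _).
have rhs0 s t : 0 <= sew_const * K * pw s t ^+ 3.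
  by rewrite mulr_ge0 ?pw3_ge0 // mulr_ge0 ?sew_const_ge0.
elim/ltn_ind: k i => -[|[|k]] IH i ai ib.
- by rewrite addn0 big_geq // Om_diag ?subrr ?normr0 //; move: ib; rewrite addn0.
- by rewrite addn1 big_nat1 subrr normr0.
set j := (i + k.+2)%N in ib *.
set mid := (sg i + sg j) / 2.
have ij : sg i <= sg j by apply: mono; rewrite leq_addr.
(* [l] is the first index whose successor lies at or beyond the midpoint, hence neither [sg i, sg l]
   nor [sg l.+1, sg j] exceeds half of the length. *)
have [l [il lj lm ml]] : exists l, [/\ (i <= l)%N, (l < j)%N, sg l <= mid & mid <= sg l.+1].
  have : exists n, mid <= sg (i + n).+1.
    by exists k.+1; rewrite -addnS -/j /mid; lra.
  case/ex_minnP => n hn nmin.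
  have nk : (n <= k.+1)%N by apply: nmin; rewrite -addnS -/j /mid; lra.
  exists (i + n)%N; split => //; first by rewrite leq_addr.
    by rewrite /j addnS ltnS leq_add2l.
  case: n hn nmin nk => [|n] hn nmin nk; first by rewrite addn0 /mid; lra.
  by rewrite addnS; case: (leP (sg (i + n).+1) mid) => // /ltW /nmin; rewrite ltnn.
have ail : sg i <= sg l by exact: mono.
have lj' : sg l.+1 <= sg j by exact: mono.
have ll : sg l <= sg l.+1 by [].
rewrite (big_cat_nat (n := l)) //=; last by rewrite ltnW.
rewrite (big_cat_nat (m := l) (n := l.+1)) //= big_nat1.
have E1 : l = (i + (l - i))%N by rewrite subnKC.
have E2 : j = (l.+1 + (j - l.+1))%N by rewrite subnKC.
have jE : j = (i + k.+2)%N by [].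
have L1 : (l - i < k.+2)%N by clear -lj il jE; clearbody j; lia.
have L2 : (j - l.+1 < k.+2)%N by clear -lj il jE; clearbody j; lia.
have := IH _ L1 i ai; rewrite -E1 => /(_ (le_trans (le_trans ll lj') ib)) H1.
have := IH _ L2 l.+1 (le_trans ai (le_trans ail ll)); rewrite -E2 => /(_ ib) H2.
have [M1 _] := pw_half_le ail (le_trans ll lj').
have /M1 h1 : sg l - sg i <= (sg j - sg i) / 2 by move: lm; rewrite /mid; lra.
have [_ M2] := pw_half_le (le_trans ail ll) lj'.
have /M2 h2 : sg j - sg l.+1 <= (sg j - sg i) / 2 by move: ml; rewrite /mid; lra.
have D1 := Om_delta ai ail (le_trans ll lj') ib.
have D2 := Om_delta (le_trans ai ail) ll lj' ib.
have h3 : pw (sg l) (sg j) ^+ 3 <= pw (sg i) (sg j) ^+ 3.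
  by rewrite lerXn2r ?nnegrE ?pw_ge0 //; apply: pw_mono => //; exact: le_trans ll lj'.
set S1 := \sum_(i <= _ < l) _ in H1 *; set S2 := \sum_(l.+1 <= _ < j) _ in H2 *.
have -> : S1 + (Om (sg l) (sg l.+1) + S2) - Om (sg i) (sg j)
  = (S1 - Om (sg i) (sg l)) + (S2 - Om (sg l.+1) (sg j))
    - (Om (sg i) (sg j) - Om (sg i) (sg l) - Om (sg l) (sg j))
    - (Om (sg l) (sg j) - Om (sg l) (sg l.+1) - Om (sg l.+1) (sg j)).
  move: S1 S2 {H1 H2} (Om (sg l) (sg l.+1)) (Om (sg i) (sg j)) (Om (sg i) (sg l))
    (Om (sg l.+1) (sg j)) (Om (sg l) (sg j)) => x1 x2 x3 x4 x5 x6 x7.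
  by apply/matrixP => ? ?; rewrite !mxE; ring.
set w := pw (sg i) (sg j) ^+ 3 in h1 h2 h3 *.
have T1 : sew_const * K * pw (sg i) (sg l) ^+ 3 <= sew_const * K * (q / 2 * w).
  by rewrite ler_wpM2l // mulr_ge0 ?sew_const_ge0.
have T2 : sew_const * K * pw (sg l.+1) (sg j) ^+ 3 <= sew_const * K * (q / 2 * w).
  by rewrite ler_wpM2l // mulr_ge0 ?sew_const_ge0.
have T3 : K * pw (sg l) (sg j) ^+ 3 <= K * w by rewrite ler_wpM2l.
apply: le_trans (ler_normB _ _) _; apply: le_trans (lerD (ler_normB _ _) (lexx _)) _.
apply: le_trans (lerD (lerD (ler_normD _ _) (lexx _)) (lexx _)) _.
have -> : sew_const * K * w = sew_const * K * (q / 2 * w) + sew_const * K * (q / 2 * w) + K * w + K * w.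
  by rewrite -{1}sew_constE; field.
apply: lerD; last exact: le_trans D2 T3.
apply: lerD => //.
by apply: lerD; [exact: le_trans H1 T1|exact: le_trans H2 T2].
Qed.

(** Cutting at the midpoint improves a bound C to q C + K, whatever finite C is known. This turns
    the unspecified constant of a Davie estimate into an explicit one. *)
Lemma sew_improve (F : R -> R -> 'M[R]_(p, m)) :
  (forall s v t, a <= s -> s <= v -> v <= t -> t <= b -> F s t = F s v + F v t) ->
  (exists C, forall s t, a <= s -> s <= t -> t <= b ->
     `|F s t - Om s t| <= C * pw s t ^+ 3) ->
  forall s t, a <= s -> s <= t -> t <= b ->
     `|F s t - Om s t| <= sew_const * K * pw s t ^+ 3.
Proof.
move=> Fadd [C hC].
have q1 := half_rate_lt1 beta_gt.
pose P (x : R * R) := [/\ a <= x.1, x.1 <= x.2 & x.2 <= b].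
have : forall x, P x -> `|F x.1 x.2 - Om x.1 x.2| <= K / (1 - q) * pw x.1 x.2 ^+ 3.
  apply: improve_bound => //; first exact: half_rate_ge0.
  - by move=> x; exact: pw3_ge0.
  - exists `|C| => // -[s t] [/= h1 h2 h3]; apply: le_trans (hC _ _ h1 h2 h3) _.
    by rewrite ler_wpM2r ?pw3_ge0 // ler_norm.
  move=> x x0 IH [s t] [/= h1 h2 h3].
  pose v := (s + t) / 2.
  have sv : s <= v by rewrite /v; lra.
  have vt : v <= t by rewrite /v; lra.
  have vb : v <= b by apply: le_trans h3.
  have av : a <= v by apply: le_trans sv.
  have I1 := IH (s, v) (And3 h1 sv vb); have I2 := IH (v, t) (And3 av vt h3).
  rewrite /= in I1 I2.
  have [M1 M2] := pw_half_le sv vt.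
  have /M1 e1 : v - s <= (t - s) / 2 by rewrite /v; lra.
  have /M2 e2 : t - v <= (t - s) / 2 by rewrite /v; lra.
  have D := Om_delta h1 sv vt h3.
  rewrite (Fadd s v t) //.
  have -> : F s v + F v t - Om s t = (F s v - Om s v) + (F v t - Om v t)
     - (Om s t - Om s v - Om v t).
    move: (F s v) (F v t) (Om s t) (Om s v) (Om v t) => x1 x2 x3 x4 x5.
    by apply/matrixP => ? ?; rewrite !mxE; ring.
  apply: le_trans (ler_normB _ _) _; apply: le_trans (lerD (ler_normD _ _) (lexx _)) _.
  have -> : (q * x + K) * pw s t ^+ 3
    = x * (q / 2 * pw s t ^+ 3) + x * (q / 2 * pw s t ^+ 3) + K * pw s t ^+ 3 by field.
  apply: lerD => //; apply: lerD.
    by apply: le_trans I1 _; rewrite ler_wpM2l.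
  by apply: le_trans I2 _; rewrite ler_wpM2l.
move=> H s t h1 h2 h3; apply: le_trans (H (s, t) (And3 h1 h2 h3)) _.
rewrite ler_wpM2r ?pw3_ge0 // /sew_const mulrAC ler_wpM2r ?invr_ge0 ?subr_ge0 ?(ltW q1) //.
by rewrite ler_peMl // ler1n.
Qed.

Lemma big_nat_double (F : nat -> 'M[R]_(p, m)) k :
  \sum_(0 <= i < 2 * k) F i = \sum_(0 <= i < k) (F (2 * i)%N + F (2 * i).+1).
Proof.
elim: k => [|k IH]; first by rewrite muln0 !big_geq.
by rewrite mulnS !big_nat_recr //= IH addrA.
Qed.

(** [F] is the limit of the sums of [Om] over the dyadic partitions of [a, b] cut off at t. One
    refinement adds at most 2^N defects of cells of length (b - a) / 2^N, which is geometric of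
    ratio q; [sew_max] then gives a constant valid for every [s, t]. *)
Lemma sew_exists : a <= b -> exists F : R -> 'M[R]_(p, m),
  forall s t, a <= s -> s <= t -> t <= b ->
    `|F t - F s - Om s t| <= sew_const * K * pw s t ^+ 3.
Proof.
move=> ab.
have q1 := half_rate_lt1 beta_gt; have q0 := half_rate_ge0 beta.
pose len N : R := (b - a) / 2 ^+ N.
have len0 N : 0 <= len N by rewrite divr_ge0 ?subr_ge0 ?exprn_ge0.
pose tau N (i : nat) : R := a + len N * i%:R.
have tauS N i : tau N i.+1 = tau N i + len N by rewrite /tau -natr1; ring.
have tau_mono N i : tau N i <= tau N i.+1 by rewrite tauS lerDl.
have tau0 N : tau N 0%N = a by rewrite /tau mulr0 addr0.
have tau2 N i : tau N.+1 (2 * i)%N = tau N i.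
  rewrite /tau /len natrM exprS; field.
  by rewrite expf_neq0.
have tauN N : tau N (2 ^ N)%N = b.
  rewrite /tau /len natrX divfK ?expf_neq0 //; ring.
have taua N i : a <= tau N i by rewrite /tau lerDl mulr_ge0.
pose mn (x y : R) := Num.min x y.
pose J N t := \sum_(0 <= i < 2 ^ N) Om (mn (tau N i) t) (mn (tau N i.+1) t).
pose c := K * ((b - a) `^ beta) ^+ 3.
have c0 : 0 <= c by rewrite mulr_ge0 // exprn_ge0 // powR_ge0.
have mnm x y t : x <= y -> mn x t <= mn y t by move=> xy; rewrite /mn le_min !ge_min xy lexx orbT.
have mnl x y t : x <= y -> mn y t - mn x t <= y - x.
  move=> xy; rewrite /mn; case: (leP y t); case: (leP x t); lra.
have cell N : 2 ^+ N * (K * (len N `^ beta) ^+ 3) = c * q ^+ N.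
  by rewrite mulrCA dyadic_rate ?subr_ge0 // /c; ring.
have sumcell N (f : nat -> 'M[R]_(p, m)) :
    (forall i, `|f i| <= K * (len N `^ beta) ^+ 3) ->
    `|\sum_(0 <= i < 2 ^ N) f i| <= c * q ^+ N.
  move=> hf; apply: le_trans (ler_norm_sum _ _ _) _.
  apply: le_trans (ler_sum _ (fun i _ => hf i)) _.
  by rewrite sumr_const_nat subn0 -mulr_natl natrX cell.
have Jstep t : a <= t -> t <= b -> forall N, `|J N.+1 t - J N t| <= c * q ^+ N.
  move=> at_ tb N; rewrite /J expnS big_nat_double -sumrB; apply: sumcell => i.
  have -> : tau N.+1 (2 * i).+2 = tau N i.+1 by rewrite -(tau2 N i.+1) mulnS.
  rewrite tau2.
  set x := mn (tau N i) t; set z := mn (tau N i.+1) t; set y := mn (tau N.+1 _) t.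
  have xy : x <= y by rewrite /x /y -(tau2 N i); apply: mnm; exact: tau_mono.
  have yz : y <= z by rewrite /z /y -(tau2 N i.+1) mulnS; apply: mnm; exact: tau_mono.
  have -> : Om x y + Om y z - Om x z = - (Om x z - Om x y - Om y z).
    by move: (Om x y) (Om y z) (Om x z) => x1 x2 x3; apply/matrixP => ? ?; rewrite !mxE; ring.
  rewrite normrN; apply: le_trans (Om_delta _ xy yz _) _.
  - by rewrite /x /mn le_min taua.
  - by rewrite /z /mn ge_min tb orbT.
  rewrite ler_wpM2l // lerXn2r ?nnegrE ?powR_ge0 // powR_le // ?subr_ge0 ?(le_trans xy) //.
  have := mnl _ _ t (tau_mono N i); rewrite -/x -/z; have := tauS N i; lra.
have {}Jstep t : a <= t -> t <= b -> exists l, forall k,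
    `|J k t - l| <= c / (1 - q) * q ^+ k.
  by move=> h1 h2; have [l hl] := geometric_limit q0 q1 c0 (Jstep t h1 h2); exists l.
have [F hF] : exists F : R -> 'M[R]_(p, m), forall t, a <= t -> t <= b ->
    forall k, `|J k t - F t| <= c / (1 - q) * q ^+ k.
  have : forall t, exists l, a <= t -> t <= b -> forall k, `|J k t - l| <= c / (1 - q) * q ^+ k.
    move=> t; have [h1|h1] := leP a t; last by exists 0.
    have [h2|h2] := leP t b; last by exists 0.
    by have [l hl] := Jstep t h1 h2; exists l.
  by move/choice => [F hF]; exists F.
exists F => s t as_ st tb.
apply/ler_addgt0Pr => e e0.
pose c' := c / (1 - q).
have c'0 : 0 <= c' by rewrite divr_ge0 // subr_ge0 ltW.
have [N hN] := expr_lt_eps (c' + c' + c) q0 q1 e0.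
have F1 := hF t (le_trans as_ st) tb N; have F2 := hF s as_ (le_trans st tb) N.
(* The dyadic partition clipped to [s, t]: its end points are exactly s and t, so that [sew_max]
   applies to it. *)
pose sg i := mn (Num.max (tau N i) s) t.
have sg_mono i : sg i <= sg i.+1 by apply: mnm; rewrite ge_max !le_max tau_mono lexx orbT.
have sg0 : sg 0%N = s by rewrite /sg tau0 (max_idPr as_) /mn (min_idPl st).
have sgN : sg (2 ^ N)%N = t.
  by rewrite /sg tauN (max_idPl (le_trans st tb)) /mn (min_idPr tb).
have S := @sew_max sg sg_mono (2 ^ N)%N 0%N.
rewrite !add0n sg0 sgN in S; have {}S := S as_ tb.
(* Cell by cell, the difference of the two cut-off sums agrees with the clipped sum, except on the
   cell with s inside, where one defect is left. *)
have E : `|J N t - J N s - \sum_(0 <= i < 2 ^ N) Om (sg i) (sg i.+1)| <= c * q ^+ N.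
  rewrite /J -!sumrB; apply: sumcell => i.
  have cell0 : 0 <= K * (len N `^ beta) ^+ 3.
    by rewrite mulr_ge0 // exprn_ge0 // powR_ge0.
  rewrite /sg; have := taua N i; have := tau_mono N i; have := tauS N i.
  move: (tau N i) (tau N i.+1) => x y xy' xy ax.
  have [ys|sy] := leP y s.
    have xs : x <= s by exact: le_trans ys.
    rewrite ?(max_idPr xs) ?(max_idPr ys) /mn ?(min_idPl (le_trans xs st)).
    rewrite ?(min_idPl (le_trans ys st)) ?(min_idPl xs) ?(min_idPl ys) ?(min_idPl st).
    by rewrite subrr sub0r normrN Om_diag ?normr0 // (le_trans st).
  have [sx|xs] := leP s x.
    rewrite ?(max_idPl sx) ?(max_idPl (ltW sy)) /mn ?(min_idPr sx) ?(min_idPr (ltW sy)).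
    by rewrite Om_diag ?subr0 ?subrr ?normr0 // (le_trans st).
  rewrite ?(max_idPl (ltW sy)) ?(max_idPr (ltW xs)) /mn ?(min_idPl (ltW xs)).
  rewrite ?(min_idPr (ltW sy)) ?(min_idPl st) ?(min_idPl (le_trans (ltW xs) st)).
  have h1 : s <= Num.min y t by rewrite le_min (ltW sy) st.
  apply: le_trans (Om_delta ax (ltW xs) h1 _) _.
    by rewrite ge_min tb orbT.
  rewrite ler_wpM2l // lerXn2r ?nnegrE ?powR_ge0 // powR_le //.
    by rewrite subr_ge0 (le_trans (ltW xs)).
  have : Num.min y t <= y by rewrite ge_min lexx.
  by lra.
set S0 := \sum_(0 <= i < 2 ^ N) _ in S E.
have -> : F t - F s - Om s t = - (J N t - F t) + (J N s - F s)
    + (J N t - J N s - S0) + (S0 - Om s t).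
  move: {F1 F2} (F t) (F s) (Om s t) (J N t) (J N s) S0 {S E} => x1 x2 x3 x4 x5 x6.
  by apply/matrixP => ? ?; rewrite !mxE; ring.
apply: le_trans (ler_normD _ _) _; rewrite addrC; apply: lerD => //.
apply: le_trans (ler_normD _ _) _; apply: le_trans (lerD (ler_normD _ _) (lexx _)) _.
rewrite normrN; apply: le_trans (lerD (lerD F1 F2) E) _.
by apply: le_trans (ltW hN); rewrite -/c' le_eqVlt; apply/orP; left; apply/eqP; ring.
Qed.

End Sewing.

(** * The germ of the delayed rough integral *)

Ltac mxring := apply/matrixP => ? ?; rewrite !mxE; ring.

Section Germ.
Context {R : realType} {n d : nat}.
Variables (E H U W : normedModType R).
Local Notation Y := 'rV[R]_n.
Local Notation M := 'M[R]_(d, n).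
Local Notation XX := 'rV[R]_d.

(* The values of (X, X(. - r)), of the two Gubinelli derivatives, of
   (y, y(. - r)) and of the two areas lie in E, H, U and W.  The four-point
   estimates gc_G4, gc_T4 and gc_P4 serve to compare two solutions. *)
Record germ_coeff (L : R) (G : U -> M) (DG : U -> U -> M) (act : E -> H -> U)
    (PP : U -> H -> W -> Y) (tens : E -> XX -> W) : Prop := GermCoeff {
  gc_L : 1 <= L;
  gc_G : forall p, `|G p| <= L;
  gc_Gl : forall p q, `|G p - G q| <= L * `|p - q|;
  gc_G4 : forall p q p' q', `|G p - G q - (G p' - G q')| <=
    L * (`|(p - q) - (p' - q')| + (`|p - p'| + `|q - q'|) * `|p' - q'|);
  gc_DB : forall p v w, DG p (v - w) = DG p v - DG p w;
  gc_D : forall p v, `|DG p v| <= L * `|v|;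
  gc_Dl : forall p q v, `|DG p v - DG q v| <= L * `|p - q| * `|v|;
  gc_T : forall p q, `|G q - G p - DG p (q - p)| <= L * `|q - p| ^+ 2;
  gc_T4 : forall p q p' q',
    `|(G q - G p - DG p (q - p)) - (G q' - G p' - DG p' (q' - p'))| <=
    L * (`|(q - p) - (q' - p')| * (`|q - p| + `|q' - p'|)
         + (`|p - p'| + `|q - q'|) * (`|q - p| + `|q' - p'|) ^+ 2);
  gc_AB : forall z a b, act z (a - b) = act z a - act z b;
  gc_A : forall z a, `|act z a| <= L * `|z| * `|a|;
  gc_PB : forall p a b t, PP p (a - b) t = PP p a t - PP p b t;
  gc_PT : forall p a t t', PP p a (t + t') = PP p a t + PP p a t';
  gc_P : forall p a t, `|PP p a t| <= L * `|a| * `|t|;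
  gc_Pl : forall p q a t, `|PP p a t - PP q a t| <= L * `|p - q| * `|a| * `|t|;
  gc_P4 : forall p q p' q' a t,
    `|PP p a t - PP q a t - (PP p' a t - PP q' a t)| <=
    L * (`|(p - q) - (p' - q')| + (`|p - p'| + `|q - q'|) * `|p' - q'|) * `|a| * `|t|;
  gc_chen : forall p a z x, PP p a (tens z x) = x *m DG p (act z a);
  gc_M : forall (x : XX) (g : M), `|x *m g| <= L * `|x| * `|g| }.

Variables (L : R) (G : U -> M) (DG : U -> U -> M) (act : E -> H -> U)
  (PP : U -> H -> W -> Y) (tens : E -> XX -> W).
Hypothesis gc : germ_coeff L G DG act PP tens.

Let L1 := gc_L gc.
Let L0 : 0 <= L. Proof. exact: le_trans L1. Qed.
Hint Resolve L0 : core.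

Definition rem (u : R -> U) (al : R -> H) (Z : R -> R -> E) s v :=
  u v - u s - act (Z s v) (al s).
Definition taylor p q := G q - G p - DG p (q - p).
Definition germ (u : R -> U) (al : R -> H) (X : R -> R -> XX) (T : R -> R -> W) s t :=
  X s t *m G (u s) + PP (u s) (al s) (T s t).

Lemma germ_delta u al X T Z s v t : X s t = X s v + X v t ->
  T s t = T s v + T v t + tens (Z s v) (X v t) ->
  germ u al X T s t - germ u al X T s v - germ u al X T v t =
  - (X v t *m (taylor (u s) (u v) + DG (u s) (rem u al Z s v))
     + (PP (u v) (al v) (T v t) - PP (u s) (al s) (T v t))).
Proof.
move=> eX eT; rewrite /germ eX eT !(gc_PT gc) (gc_chen gc) mulmxDl /taylor /rem.
rewrite !(gc_DB gc) !(mulmxDr, mulmxN).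
move: (PP _ _ _) (PP _ _ _) (PP _ _ _) (X v t *m _) (X v t *m _) (X v t *m _)
  (X v t *m _) (X v t *m _) (X s v *m _) => *.
mxring.
Qed.

(** [w] stands for (t - s)^beta. Each surviving term of [germ_delta] pairs an increment of X with a
    quantity of order 2 beta, or an area with one of order beta. *)
Lemma germ_delta_le u al X T Z s v t w kap Nu Nr Na Nb :
  0 <= w -> 0 <= kap -> 0 <= Nu -> 0 <= Nr -> 0 <= Na -> 0 <= Nb ->
  X s t = X s v + X v t ->
  T s t = T s v + T v t + tens (Z s v) (X v t) ->
  `|X v t| <= kap * w -> `|T v t| <= kap * w ^+ 2 ->
  `|u v - u s| <= Nu * w -> `|rem u al Z s v| <= Nr * w ^+ 2 ->
  `|al v| <= Na -> `|al v - al s| <= Nb * w ->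
  `|germ u al X T s t - germ u al X T s v - germ u al X T v t|
   <= L * kap * (L * (Nu ^+ 2 + Nr) + (Nu * Na + Nb)) * w ^+ 3.
Proof.
move=> w0 k0 u0 r0 a0 b0 eX eT hX hT hu hr ha hb.
have w20 : 0 <= w ^+ 2 by apply: exprn_ge0.
rewrite (germ_delta _ _ eX eT) normrN; apply: le_trans (ler_normD _ _) _.
have -> : L * kap * (L * (Nu ^+ 2 + Nr) + (Nu * Na + Nb)) * w ^+ 3 =
  L * (kap * w) * (L * (Nu * w) ^+ 2 + L * (Nr * w ^+ 2))
  + (L * (Nu * w) * Na * (kap * w ^+ 2) + L * (Nb * w) * (kap * w ^+ 2)) by ring.
apply: lerD.
  apply: le_trans (gc_M gc _ _) _; apply: ler_pM; rewrite ?mulr_ge0 //.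
    by rewrite ler_wpM2l.
  apply: le_trans (ler_normD _ _) _; apply: lerD.
    apply: le_trans (gc_T gc _ _) _; rewrite ler_wpM2l // lerXn2r // nnegrE ?mulr_ge0 //.
  by apply: le_trans (gc_D gc _ _) _; rewrite ler_wpM2l.
rewrite (_ : PP (u v) (al v) (T v t) - PP (u s) (al s) (T v t)
  = (PP (u v) (al v) (T v t) - PP (u s) (al v) (T v t)) + PP (u s) (al v - al s) (T v t)); last first.
  by rewrite (gc_PB gc) addrA subrK.
apply: le_trans (ler_normD _ _) _; apply: lerD.
  apply: le_trans (gc_Pl gc _ _ _ _) _.
  by apply: ler_pM => //; rewrite ?mulr_ge0 //; apply: ler_pM => //;
    rewrite ?mulr_ge0 // ler_wpM2l.
apply: le_trans (gc_P gc _ _ _) _.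
by apply: ler_pM => //; rewrite ?mulr_ge0 // ler_wpM2l.
Qed.

Definition diff_const (K : R) : R :=
  L * K * (L * (2 * K + 8 * K ^+ 2 + K + 1))
  + L * K * (K * (1 + 2 * K) + K + K + 1).

(** The differences are arranged so that each summand has one factor comparing the two solutions,
    hence the linearity in [dl]. The Taylor remainders and the area terms require the four-point
    estimates. The arrangement keeps the coefficients of the first solution, which is why [al] and
    its remainder are bounded for that solution. *)
Lemma germ_diff_le (u u' : R -> U) (al al' : R -> H) X T Z s v t w K dl :
  0 <= w -> 0 <= K -> 0 <= dl ->
  X s t = X s v + X v t ->
  T s t = T s v + T v t + tens (Z s v) (X v t) ->
  `|X v t| <= K * w -> `|T v t| <= K * w ^+ 2 ->
  `|u v - u s| <= K * w -> `|u' v - u' s| <= K * w ->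
  `|rem u al Z s v| <= K * w ^+ 2 ->
  `|al v| <= K -> `|al v - al s| <= K * w ->
  `|u s - u' s| <= dl -> `|u v - u' v| <= dl ->
  `|(u v - u s) - (u' v - u' s)| <= dl * w ->
  `|rem u al Z s v - rem u' al' Z s v| <= dl * w ^+ 2 ->
  `|al v - al' v| <= dl ->
  `|(al v - al s) - (al' v - al' s)| <= dl * w ->
  `|(germ u al X T s t - germ u' al' X T s t)
    - (germ u al X T s v - germ u' al' X T s v)
    - (germ u al X T v t - germ u' al' X T v t)| <= diff_const K * dl * w ^+ 3.
Proof.
move=> w0 K0 dl0 eX eT hX hT hu hu' hr ha hb ds dv duv dr da dav.
have w20 : 0 <= w ^+ 2 by apply: exprn_ge0.
have Kw : 0 <= K * w by rewrite mulr_ge0.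
have dw : 0 <= dl * w by rewrite mulr_ge0.
have Kw2 : 0 <= K * w ^+ 2 by rewrite mulr_ge0.
rewrite (_ : _ - _ = (germ u al X T s t - germ u al X T s v - germ u al X T v t)
    - (germ u' al' X T s t - germ u' al' X T s v - germ u' al' X T v t)); last first.
  move: (germ u al X T s t) (germ u al X T s v) (germ u al X T v t)
    (germ u' al' X T s t) (germ u' al' X T s v) (germ u' al' X T v t) => *; mxring.
rewrite !(germ_delta _ _ eX eT).
set r := rem u al Z s v in hr dr *; set r' := rem u' al' Z s v in dr *.
set t0 := T v t in hT *; set x := X v t in hX *.
have -> : - (x *m (taylor (u s) (u v) + DG (u s) r) + (PP (u v) (al v) t0 - PP (u s) (al s) t0))
  - - (x *m (taylor (u' s) (u' v) + DG (u' s) r') + (PP (u' v) (al' v) t0 - PP (u' s) (al' s) t0))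
  = - (x *m ((taylor (u s) (u v) - taylor (u' s) (u' v))
             + ((DG (u s) r - DG (u' s) r) + DG (u' s) (r - r')))
       + ((PP (u v) (al v) t0 - PP (u s) (al v) t0 - (PP (u' v) (al v) t0 - PP (u' s) (al v) t0))
         + (PP (u' v) (al v - al' v) t0 - PP (u' s) (al v - al' v) t0)
         + (PP (u s) (al v - al s) t0 - PP (u' s) (al v - al s) t0)
         + PP (u' s) ((al v - al s) - (al' v - al' s)) t0)).
  rewrite !(gc_DB gc) !(gc_PB gc) !(mulmxDr, mulmxN).
  move: (x *m _) (x *m _) (x *m _) (x *m _) (x *m _) (PP (u v) (al v) t0)
    (PP (u s) (al s) t0) (PP (u' v) (al' v) t0) (PP (u' s) (al' s) t0)
    (PP (u s) (al v) t0) (PP (u' v) (al v) t0) (PP (u' s) (al v) t0)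
    (PP (u' s) (al' v) t0) (PP (u' s) (al s) t0) => *; mxring.
rewrite normrN; have -> : diff_const K * dl * w ^+ 3 =
    L * (K * w) * (L * (dl * w * (K * w + K * w) + (dl + dl) * (K * w + K * w) ^+ 2)
      + (L * dl * (K * w ^+ 2) + L * (dl * w ^+ 2)))
    + (L * (dl * w + (dl + dl) * (K * w)) * K * (K * w ^+ 2)
    + L * (K * w) * dl * (K * w ^+ 2) + L * dl * (K * w) * (K * w ^+ 2)
    + L * (dl * w) * (K * w ^+ 2)).
  by rewrite /diff_const; ring.
apply: le_trans (ler_normD _ _) _; apply: lerD.
  apply: le_trans (gc_M gc _ _) _; apply: ler_pM; rewrite ?mulr_ge0 //.
    by rewrite ler_wpM2l.
  apply: le_trans (ler_normD _ _) _; apply: lerD.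
    apply: le_trans (gc_T4 gc _ _ _ _) _; rewrite ler_wpM2l //; apply: lerD.
      by apply: ler_pM => //; rewrite ?addr_ge0 //; apply: lerD.
    apply: ler_pM; rewrite ?addr_ge0 ?exprn_ge0 ?addr_ge0 //; first exact: lerD.
    by rewrite lerXn2r ?nnegrE ?addr_ge0 //; apply: lerD.
  apply: le_trans (ler_normD _ _) _; apply: lerD.
    apply: le_trans (gc_Dl gc _ _ _) _; apply: ler_pM; rewrite ?mulr_ge0 //.
    by rewrite ler_wpM2l.
  by apply: le_trans (gc_D gc _ _) _; rewrite ler_wpM2l.
have mul3 (x1 x2 x3 y1 y2 y3 : R) : 0 <= x1 -> 0 <= x2 -> 0 <= x3 ->
    x1 <= y1 -> x2 <= y2 -> x3 <= y3 -> L * x1 * x2 * x3 <= L * y1 * y2 * y3.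
  move=> *; apply: ler_pM => //; rewrite ?mulr_ge0 //.
  by apply: ler_pM => //; rewrite ?mulr_ge0 // ler_wpM2l.
apply: le_trans (ler_normD _ _) _; apply: lerD; last first.
  apply: le_trans (gc_P gc _ _ _) _.
  by apply: ler_pM => //; rewrite ?mulr_ge0 // ler_wpM2l.
apply: le_trans (ler_normD _ _) _; apply: lerD; last first.
  by apply: le_trans (gc_Pl gc _ _ _ _) _; apply: mul3.
apply: le_trans (ler_normD _ _) _; apply: lerD; last first.
  by apply: le_trans (gc_Pl gc _ _ _ _) _; apply: mul3.
apply: le_trans (gc_P4 gc _ _ _ _ _ _) _; apply: mul3 => //.
apply: lerD => //; apply: ler_pM; rewrite ?addr_ge0 //; exact: lerD.
Qed.

End Germ.

(** * Growth of controlled paths and of their germs *)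

Section Germs.
Context {R : realType} {n d : nat}.
Variables (r beta : R).
Hypotheses (beta_gt : 3^-1 < beta) (beta_le : beta <= 2^-1).
Local Notation pw := (hpow beta).
Local Notation V := 'rV[R]_n.
Local Notation M := 'M[R]_(d, n).
Local Notation U := (V * V)%type.
Local Notation H := (M * M)%type.
Local Notation E := ('rV[R]_d * 'rV[R]_d)%type.
Local Notation W := ('M[R]_d * 'M[R]_d)%type.

(** (X, X(. - r)) drives the pair (y, y(. - r)), with one Gubinelli derivative in each component.
    The integrator is X alone, so two areas suffice instead of the four of a rough path over the
    pair. *)
Definition pair_act (z : E) (a : H) : U := (z.1 *m a.1, z.2 *m a.2).
Definition pair_tens (z : E) (x : 'rV[R]_d) : W := (z.1^T *m x, z.2^T *m x).

Variables (L : R) (G : U -> M) (DG : U -> U -> M) (PP : U -> H -> W -> V).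
Hypothesis gc : germ_coeff L G DG pair_act PP pair_tens.
Variable X : delayed_path R d.

Let L1 := gc_L gc.
Let L0 : 0 <= L. Proof. exact: le_trans L1. Qed.

Implicit Types (y e : cpath R d n) (a b : R) (f : R -> R -> V).

Definition rough_bd K a b := forall s t, a <= s -> s <= t -> t <= b ->
  [/\ `|incr (base X) s t| <= K * pw s t,
      `|incr (base X) (s - r) (t - r)| <= K * pw s t,
      `|area X s t| <= K * pw s t ^+ 2 & `|delayed_area X s t| <= K * pw s t ^+ 2].

Definition chen := (forall s u t, s <= u -> u <= t ->
     area X s t = area X s u + area X u t
           + (incr (base X) s u)^T *m incr (base X) u t)
  /\ (forall s u t, s <= u -> u <= t ->
         delayed_area X s t = delayed_area X s u + delayed_area X u t
           + (incr (base X) (s - r) (u - r))^T *m incr (base X) u t).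

Definition holder_bd K a b y := forall s t, a <= s -> s <= t -> t <= b ->
  `|y.2 t - y.2 s| <= K * pw s t.
Definition rem_bd K a b y := forall s t, a <= s -> s <= t -> t <= b ->
  `|remainder X y s t| <= K * pw s t ^+ 2.
Definition sup_bd K a b (m : R -> M) := forall t, a <= t -> t <= b -> `|m t| <= K.

Definition ctrl_bd K a b y :=
  [/\ sup_bd K a b y.2, holder_bd K a b y & rem_bd K a b y].

Definition add_incr f a b := forall s v t, a <= s -> s <= v -> v <= t -> t <= b ->
  f s t = f s v + f v t.

(** The delayed component is a datum [e] with its own Gubinelli derivative, and not a shift of [y]:
    on an interval of length r it is known, and the rough term has no delay in the unknown. *)
Definition delay_pair y e t : U := (y.1 t, e.1 (t - r)).
Definition delay_deriv y e t : H := (y.2 t, e.2 (t - r)).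
Definition delay_germ y e : R -> R -> V :=
  germ G PP (delay_pair y e) (delay_deriv y e) (incr (base X))
    (fun s t => (area X s t, delayed_area X s t)).

(* Davie's notion of solution: the germ replaces the integral. *)
Definition davie f y e (Y : R -> V) a b := exists C, forall s t,
  a <= s -> s <= t -> t <= b -> `|Y t - Y s - f s t - delay_germ y e s t| <= C * pw s t ^+ 3.

Lemma pair_le (V1 V2 : normedModType R) (x : V1) (z : V2) K :
  `|x| <= K -> `|z| <= K -> `|(x, z)| <= K.
Proof. by move=> h1 h2; rewrite prod_normE ge_max h1 h2. Qed.

Lemma pw_shift c s t : pw (s - c) (t - c) = pw s t.
Proof. by rewrite /hpow; congr (_ `^ _); ring. Qed.

Lemma incrD (m : R -> 'rV[R]_d) s v t : incr m s t = incr m s v + incr m v t.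
Proof. by rewrite /incr; mxring. Qed.

Lemma path_incr K N k eps y a b s t : 0 <= K ->
  (`|incr (base X) s t| <= K * pw s t) -> `|y.2 s| <= N ->
  `|remainder X y s t| <= k * pw s t ^+ 2 -> 0 <= k -> pw s t <= eps ->
  `|y.1 t - y.1 s| <= (L * K * N + k * eps) * pw s t.
Proof.
move=> K0 hX hN hr k0 he.
have -> : y.1 t - y.1 s = incr (base X) s t *m y.2 s + remainder X y s t.
  by rewrite [RHS]addrC /remainder subrK.
apply: le_trans (ler_normD _ _) _; rewrite mulrDl; apply: lerD.
  apply: le_trans (gc_M gc _ _) _.
  rewrite (_ : L * K * N * pw s t = L * (K * pw s t) * N); last by ring.
  by apply: ler_pM; rewrite ?mulr_ge0 // ler_wpM2l.
apply: le_trans hr _; rewrite expr2 mulrA ler_wpM2r ?pw_ge0 //.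
by rewrite ler_wpM2l.
Qed.

(** The constant of [germ_delta_le] for increments 2 Lam^3 + x, remainders K2 + Lam, derivatives Lam
    with Hoelder constant K1 + Lam, where [Lam] bounds the known data. *)
Definition delta_bd (Lam x K1 K2 : R) : R :=
  Lam ^+ 2 * (Lam * ((2 * Lam ^+ 3 + x) ^+ 2 + K2 + Lam)
              + (2 * Lam ^+ 3 + x) * Lam + K1 + Lam).

Section Growth.
Variables (Lam K1 K2 eps a b : R) (y e : cpath R d n).
Hypotheses (L_le : L <= Lam) (K1_ge0 : 0 <= K1) (K2_ge0 : 0 <= K2)
  (eps_ge0 : 0 <= eps) (eps_le1 : eps <= 1).
Hypotheses (Xch : chen) (Xbd : rough_bd Lam a b) (ebd : ctrl_bd Lam (a - r) (b - r) e).
Hypotheses (y1 : sup_bd Lam a b y.2) (y2 : holder_bd K1 a b y) (y3 : rem_bd K2 a b y).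
Hypothesis pw_eps : forall s t, a <= s -> s <= t -> t <= b -> pw s t <= eps.

Let Lam1 : 1 <= Lam. Proof. exact: le_trans L1 L_le. Qed.
Let Lam0 : 0 <= Lam. Proof. exact: le_trans Lam1. Qed.
Hint Resolve Lam0 : core.

Let LLam : L * Lam * Lam <= Lam ^+ 3.
Proof. by rewrite !exprS expr0 mulr1 -mulrA ler_wpM2r // mulr_ge0. Qed.

Let Lam13 : Lam <= Lam ^+ 3.
Proof. by rewrite exprS ler_peMr // exprn_ege1. Qed.

(** The remainder bound [K2], which may be large, enters through K2 * eps only and is harmless on
    short intervals. *)
Lemma growth_y s t : a <= s -> s <= t -> t <= b ->
  `|y.1 t - y.1 s| <= (Lam ^+ 3 + K2 * eps) * pw s t.
Proof.
move=> h1 h2 h3; have [hX _ _ _] := Xbd h1 h2 h3.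
apply: le_trans (path_incr a b Lam0 hX (y1 h1 (le_trans h2 h3)) (y3 h1 h2 h3) K2_ge0
   (pw_eps h1 h2 h3)) _.
by rewrite ler_wpM2r ?pw_ge0 // lerD2r.
Qed.

Lemma growth_u s t : a <= s -> s <= t -> t <= b ->
  `|delay_pair y e t - delay_pair y e s| <= (2 * Lam ^+ 3 + K2 * eps) * pw s t.
Proof.
move=> h1 h2 h3; have [hX hXr _ _] := Xbd h1 h2 h3.
have h1' : a - r <= s - r by lra. have h2' : s - r <= t - r by lra.
have h3' : t - r <= b - r by lra. have h4 : s - r <= b - r by lra.
have [e1 _ e3] := ebd.
apply: (@pair_le _ _ (y.1 t - y.1 s) (e.1 (t - r) - e.1 (s - r))).
  apply: le_trans (growth_y h1 h2 h3) _; rewrite ler_wpM2r ?pw_ge0 // lerD2r.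
  by rewrite mulr_natl mulr2n lerDl exprn_ge0.
have := @path_incr Lam Lam Lam 1 e a b (s - r) (t - r) Lam0.
rewrite !pw_shift => /(_ hXr (e1 _ h1' h4)); have := e3 _ _ h1' h2' h3'.
rewrite pw_shift => hr /(_ hr Lam0 _)/le_trans; apply.
  by apply: le_trans (pw_eps h1 h2 h3) _.
rewrite ler_wpM2r ?pw_ge0 // mulr1 mulr_natl mulr2n.
by rewrite -[leLHS]addr0 lerD ?mulr_ge0 // lerD.
Qed.

Lemma growth_germ s v t : a <= s -> s <= v -> v <= t -> t <= b ->
  `|delay_germ y e s t - delay_germ y e s v - delay_germ y e v t|
    <= delta_bd Lam (K2 * eps) K1 K2 * pw s t ^+ 3.
Proof.
move=> h1 h2 h3 h4.
have x0 : 0 <= K2 * eps by rewrite mulr_ge0.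
have h5 : v <= b by lra. have h6 : a <= v by lra. have h7 : s <= t by lra.
have [hX _ hA hB] := Xbd h6 h3 h4.
have m1 : pw s v <= pw s t by apply: pw_mono.
have m2 : pw v t <= pw s t by apply: pw_mono.
have p0 := pw_ge0 beta.
have [e1 e2 e3] := ebd.
have k1 : a - r <= s - r by lra. have k2 : s - r <= v - r by lra.
have k3 : v - r <= b - r by lra. have k4 : a - r <= v - r by lra.
have [c1 c2] := Xch.
apply: le_trans (@germ_delta_le _ _ _ _ _ _ _ _ _ _ _ _ _ gc (delay_pair y e)
  (delay_deriv y e) _ _ (fun s t => (incr (base X) s t, incr (base X) (s - r) (t - r)))
  s v t (pw s t) Lam (2 * Lam ^+ 3 + K2 * eps) (K2 + Lam) Lam (K1 + Lam) _ _ _ _ _ _ _ _ _ _ _ _ _ _) _ => //.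
- by rewrite addr_ge0 // mulr_ge0 // exprn_ge0.
- by rewrite addr_ge0.
- by rewrite addr_ge0.
- exact: incrD.
- by rewrite (c1 s v t) // (c2 s v t).
- by apply: le_trans hX _; rewrite ler_wpM2l.
- by apply: pair_le; [apply: le_trans hA _|apply: le_trans hB _];
    rewrite ler_wpM2l // lerXn2r ?nnegrE.
- apply: le_trans (growth_u h1 h2 h5) _; rewrite ler_wpM2l //.
  by rewrite addr_ge0 // mulr_ge0 // exprn_ge0.
- apply: (@pair_le _ _ (remainder X y s v) (remainder X e (s - r) (v - r))).
    apply: le_trans (y3 h1 h2 h5) _; apply: ler_pM => //; first by rewrite exprn_ge0.
      by rewrite lerDl.
    by rewrite lerXn2r ?nnegrE.
  apply: le_trans (e3 _ _ k1 k2 k3) _; rewrite pw_shift; apply: ler_pM => //.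
  - by rewrite exprn_ge0.
  - by rewrite lerDr.
  - by rewrite lerXn2r ?nnegrE.
- by apply: pair_le; [exact: y1|exact: e1].
- apply: (@pair_le _ _ (y.2 v - y.2 s) (e.2 (v - r) - e.2 (s - r))).
    by apply: le_trans (y2 h1 h2 h5) _; apply: ler_pM => //; rewrite lerDl.
  apply: le_trans (e2 _ _ k1 k2 k3) _; rewrite pw_shift; apply: ler_pM => //.
  by rewrite lerDr.
rewrite ler_wpM2r ?exprn_ge0 // /delta_bd expr2.
set A := 2 * Lam ^+ 3 + K2 * eps.
have A0 : 0 <= A by rewrite addr_ge0 // mulr_ge0 // exprn_ge0.
have A20 : 0 <= A * A by rewrite mulr_ge0.
apply: ler_pM.
- by rewrite mulr_ge0.
- apply: addr_ge0; first by rewrite mulr_ge0 // addr_ge0 // addr_ge0.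
  by rewrite addr_ge0 ?mulr_ge0 // addr_ge0.
- by rewrite ler_wpM2r.
rewrite !addrA -[leRHS]addrA -[leRHS]addrA -[leLHS]addrA -[leLHS]addrA lerD2r.
by rewrite ler_wpM2r // !addr_ge0.
Qed.

Lemma dgermxx s : a <= s -> s <= b -> delay_germ y e s s = 0.
Proof.
move=> h1 h2; have [_ _ hA hB] := Xbd h1 (lexx s) h2.
have p0 : pw s s = 0 by apply: pwxx.
rewrite p0 expr0n mulr0 !normr_le0 in hA hB.
rewrite /delay_germ /germ (eqP hA) (eqP hB) /incr subrr mul0mx add0r.
apply/eqP; rewrite -normr_le0; apply: le_trans (gc_P gc _ _ _) _.
by rewrite mulr_ge0_le0 ?mulr_ge0 //; apply: pair_le; rewrite normr0.
Qed.

(** Sewing makes the Davie constant explicit. In the second bound, dropping the area part of the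
    germ costs Lam^3 at order 2 beta, while the sewing error, of order 3 beta, keeps a spare factor
    eps. *)
Lemma growth_davie f Y : add_incr f a b -> davie f y e Y a b ->
  forall s t, a <= s -> s <= t -> t <= b ->
  `|Y t - Y s - f s t - delay_germ y e s t|
     <= sew_const beta * delta_bd Lam (K2 * eps) K1 K2 * pw s t ^+ 3 /\
  `|Y t - Y s - f s t - incr (base X) s t *m G (delay_pair y e s)|
     <= (Lam ^+ 3 + sew_const beta * eps * delta_bd Lam (K2 * eps) K1 K2) * pw s t ^+ 2.
Proof.
move=> fadd hY s t h1 h2 h3.
have db0 : 0 <= delta_bd Lam (K2 * eps) K1 K2.
  by rewrite mulr_ge0 ?exprn_ge0 // !addr_ge0 // mulr_ge0 // !addr_ge0 //
    ?mulr_ge0 // ?exprn_ge0 // ?addr_ge0 // ?mulr_ge0 // exprn_ge0.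
have B1 : `|Y t - Y s - f s t - delay_germ y e s t|
     <= sew_const beta * delta_bd Lam (K2 * eps) K1 K2 * pw s t ^+ 3.
  apply: (@sew_improve _ _ _ beta beta_gt (delay_germ y e) a b _ db0 _ (fun s t => Y t - Y s - f s t)) => //.
  - exact: growth_germ.
  - by move=> s' v t' g1 g2 g3 g4; rewrite (fadd s' v t') //; mxring.
split=> //.
have [_ _ hA hB] := Xbd h1 h2 h3.
rewrite (_ : _ - _ *m _ = (Y t - Y s - f s t - delay_germ y e s t)
  + PP (delay_pair y e s) (delay_deriv y e s) (area X s t, delayed_area X s t)); last first.
  by rewrite /delay_germ /germ; move: (PP _ _ _) (_ *m _) => *; mxring.
apply: le_trans (ler_normD _ _) _; rewrite addrC mulrDl; apply: lerD.
  apply: le_trans (gc_P gc _ _ _) _.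
  have -> : Lam ^+ 3 * pw s t ^+ 2 = Lam * Lam * (Lam * pw s t ^+ 2) by ring.
  apply: ler_pM; rewrite ?mulr_ge0 //; last exact: pair_le.
  apply: ler_pM => //; apply: pair_le; first exact: y1 (le_trans h2 h3).
  by have [e1 _ _] := ebd; apply: e1; lra.
apply: le_trans B1 _; set db := delta_bd _ _ _ _ in db0 *.
rewrite (_ : _ * pw s t ^+ 3 = sew_const beta * pw s t * db * pw s t ^+ 2); last by ring.
by rewrite ler_wpM2r ?pw2_ge0 // ler_wpM2r // ler_wpM2l ?sew_const_ge0 // pw_eps.
Qed.

End Growth.

End Germs.

(** * Picard iteration *)

Section GermDifferences.
Context {R : realType} {n d : nat}.
Variables (r beta : R).
Hypotheses (beta_gt : 3^-1 < beta) (beta_le : beta <= 2^-1).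
Local Notation pw := (hpow beta).
Local Notation V := 'rV[R]_n.
Local Notation M := 'M[R]_(d, n).
Local Notation U := (V * V)%type.
Local Notation H := (M * M)%type.
Local Notation W := ('M[R]_d * 'M[R]_d)%type.

Variables (L : R) (G : U -> M) (DG : U -> U -> M) (PP : U -> H -> W -> V).
Hypothesis gc : germ_coeff L G DG (@pair_act R n d) PP (@pair_tens R d).
Variable X : delayed_path R d.
Local Notation rough_bd := (rough_bd r beta X).
Local Notation holder_bd := (holder_bd beta).
Local Notation ctrl_bd := (ctrl_bd beta X).
Local Notation dgerm := (delay_germ r G PP X).
Local Notation davie := (davie r beta G PP X).

Let L1 := gc_L gc.
Let L0 : 0 <= L. Proof. exact: le_trans L1. Qed.

Implicit Types (y e : cpath R d n) (a b : R) (f : R -> R -> V).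

Section Contraction.
Variables (K Dl x eps phi a b : R) (y1 y2 e1 e2 : cpath R d n) (f1 f2 : R -> R -> V)
  (Y1 Y2 : R -> V).
Hypotheses (LK : L <= K) (Dl0 : 0 <= Dl) (x0 : 0 <= x) (phi0 : 0 <= phi)
  (eps0 : 0 <= eps) (eps1 : eps <= 1) (ab1 : b - a <= 1).
Hypotheses (Xch : chen r X) (Xbd : rough_bd K a b).
Hypotheses (he1 : ctrl_bd K (a - r) (b - r) e1) (he2 : ctrl_bd K (a - r) (b - r) e2)
  (hy1 : ctrl_bd K a b y1) (hy2 : ctrl_bd K a b y2).
Hypothesis pw_eps : forall s t, a <= s -> s <= t -> t <= b -> pw s t <= eps.
Hypotheses (ini1 : `|y1.1 a - y2.1 a| <= Dl) (ini2 : `|y1.2 a - y2.2 a| <= Dl).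
Hypothesis dy2 : holder_bd x a b (y1 - y2).
Hypothesis dy3 : forall s t, a <= s -> s <= t -> t <= b ->
  `|remainder X y1 s t - remainder X y2 s t| <= x * pw s t ^+ 2.
Hypothesis de1 : forall s, a - r <= s -> s <= b - r -> `|e1.1 s - e2.1 s| <= Dl.
Hypothesis de2 : forall s, a - r <= s -> s <= b - r -> `|e1.2 s - e2.2 s| <= Dl.
Hypothesis de3 : holder_bd Dl (a - r) (b - r) (e1 - e2).
Hypothesis de4 : forall s t, a - r <= s -> s <= t -> t <= b - r ->
  `|remainder X e1 s t - remainder X e2 s t| <= Dl * pw s t ^+ 2.
Hypotheses (f1add : add_incr f1 a b) (f2add : add_incr f2 a b).
Hypothesis df : forall s t, a <= s -> s <= t -> t <= b ->
  `|f1 s t - f2 s t| <= phi * (t - s).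
Hypotheses (hY1 : davie f1 y1 e1 Y1 a b) (hY2 : davie f2 y2 e2 Y2 a b).

(** The prefactor K^2 + 2 comes from [d0], which dominates the distances of the pairs, of their
    increments and of their derivatives; the bracket adds up the constants of [contr_holder] and
    [contr_rem]. What makes a contraction possible is that the distance [x] occurs multiplied by
    eps. *)
Definition contr_const : R :=
  (K ^+ 2 + 2) * (1 + L * (1 + 2 * (3 * K ^+ 3)) + (K ^+ 3 + K ^+ 2)
    + 2 * (sew_const beta * diff_const L (3 * K ^+ 3))).

Let K1 : 1 <= K. Proof. exact: le_trans L1 LK. Qed.
Let K0 : 0 <= K. Proof. exact: le_trans K1. Qed.
Let p0 := pw_ge0 beta.
Let d0 := (K ^+ 2 + 2) * (Dl + eps * x).
Let ex0 : 0 <= eps * x. Proof. by rewrite mulr_ge0. Qed.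
Let d00 : 0 <= d0.
Proof. by rewrite mulr_ge0 // addr_ge0 // exprn_ge0. Qed.
Let Dd0 : Dl + eps * x <= d0.
Proof. by rewrite ler_peMl ?addr_ge0 // (le_trans (y := 2)) ?ler1n // lerDr exprn_ge0. Qed.
Hint Resolve K0 ex0 d00 Dl0 x0 eps0 p0 : core.
Let K3 : 0 <= 3 * K ^+ 3. Proof. by rewrite mulr_ge0 ?exprn_ge0. Qed.

Lemma contr_deriv t : a <= t -> t <= b -> `|y1.2 t - y2.2 t| <= Dl + eps * x.
Proof.
move=> h1 h2.
rewrite (_ : y1.2 t - y2.2 t = (y1.2 a - y2.2 a) + ((y1 - y2).2 t - (y1 - y2).2 a)).
  apply: le_trans (ler_normD _ _) _; apply: lerD => //.
  apply: le_trans (dy2 (lexx a) h1 h2) _; rewrite mulrC ler_wpM2r //.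
  exact: pw_eps.
by rewrite /=; mxring.
Qed.

Lemma contr_incr s t : a <= s -> s <= t -> t <= b ->
  `|(y1.1 t - y1.1 s) - (y2.1 t - y2.1 s)| <= (K ^+ 2 + 1) * (Dl + eps * x) * pw s t.
Proof.
move=> h1 h2 h3; have [hX _ _ _] := Xbd h1 h2 h3.
rewrite (_ : _ - _ = incr (base X) s t *m (y1.2 s - y2.2 s)
   + (remainder X y1 s t - remainder X y2 s t)); last first.
  by rewrite /remainder mulmxBr /incr; move: (_ *m _) (_ *m _) => *; mxring.
apply: le_trans (ler_normD _ _) _; rewrite mulrDl mul1r mulrDl; apply: lerD.
  apply: le_trans (gc_M gc _ _) _.
  rewrite (_ : _ * _ * pw s t = K * (K * pw s t) * (Dl + eps * x)); last by ring.
  apply: ler_pM; rewrite ?mulr_ge0 //.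
    by apply: ler_pM => //.
  exact: contr_deriv h1 (le_trans h2 h3).
apply: le_trans (dy3 h1 h2 h3) _; rewrite expr2 mulrA ler_wpM2r //.
apply: le_trans (ler_wpM2l x0 (pw_eps h1 h2 h3)) _.
by rewrite mulrC lerDr.
Qed.

Lemma contr_sup t : a <= t -> t <= b -> `|y1.1 t - y2.1 t| <= d0.
Proof.
move=> h1 h2.
rewrite (_ : _ - _ = (y1.1 a - y2.1 a) + ((y1.1 t - y1.1 a) - (y2.1 t - y2.1 a))); last first.
  by mxring.
apply: le_trans (ler_normD _ _) _.
apply: le_trans (lerD ini1 (contr_incr (lexx a) h1 h2)) _.
rewrite /d0 (_ : K ^+ 2 + 2 = 1 + (K ^+ 2 + 1)); last by ring.
rewrite [leRHS]mulrDl mul1r; apply: lerD; first by rewrite lerDl.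
rewrite ler_piMr ?mulr_ge0 ?addr_ge0 ?exprn_ge0 //.
by apply: le_trans (pw_eps (lexx a) h1 h2) eps1.
Qed.

Lemma contr_e s t : a <= s -> s <= t -> t <= b ->
  `|(e1.1 (t - r) - e1.1 (s - r)) - (e2.1 (t - r) - e2.1 (s - r))| <= d0 * pw s t.
Proof.
move=> h1 h2 h3; have [_ hX _ _] := Xbd h1 h2 h3.
have h1' : a - r <= s - r by lra. have h2' : s - r <= t - r by lra.
have h3' : t - r <= b - r by lra. have h4' : s - r <= b - r by lra.
rewrite (_ : _ - _ = incr (base X) (s - r) (t - r) *m (e1.2 (s - r) - e2.2 (s - r))
   + (remainder X e1 (s - r) (t - r) - remainder X e2 (s - r) (t - r))); last first.
  by rewrite /remainder mulmxBr /incr; move: (_ *m _) (_ *m _) => *; mxring.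
apply: le_trans (ler_normD _ _) _.
apply: (le_trans (y := (K ^+ 2 * Dl + Dl) * pw s t)).
  rewrite mulrDl; apply: lerD.
    apply: le_trans (gc_M gc _ _) _.
    rewrite (_ : _ * _ * pw s t = K * (K * pw s t) * Dl); last by ring.
    apply: ler_pM; rewrite ?mulr_ge0 //; last exact: de2.
    by apply: ler_pM => //.
  apply: le_trans (de4 h1' h2' h3') _; rewrite pw_shift expr2 mulrA ler_wpM2r //.
  by rewrite ler_piMr //; apply: le_trans (pw_eps h1 h2 h3) eps1.
rewrite ler_wpM2r // (_ : K ^+ 2 * Dl + Dl = (K ^+ 2 + 1) * Dl); last by ring.
apply: ler_pM; rewrite ?addr_ge0 ?exprn_ge0 //; last by rewrite lerDl.
by rewrite lerD2l ler1n.
Qed.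

Lemma contr_pair_incr s t : a <= s -> s <= t -> t <= b ->
  `|(delay_pair r y1 e1 t - delay_pair r y1 e1 s)
    - (delay_pair r y2 e2 t - delay_pair r y2 e2 s)| <= d0 * pw s t.
Proof.
move=> h1 h2 h3; apply: (@pair_le _ _ _ ((y1.1 t - y1.1 s) - (y2.1 t - y2.1 s))
  ((e1.1 (t - r) - e1.1 (s - r)) - (e2.1 (t - r) - e2.1 (s - r)))); last exact: contr_e.
apply: le_trans (contr_incr h1 h2 h3) _; rewrite ler_wpM2r // /d0 ler_wpM2r ?addr_ge0 //.
by rewrite lerD2l ler1n.
Qed.

Lemma contr_pair t : a <= t -> t <= b ->
  `|delay_pair r y1 e1 t - delay_pair r y2 e2 t| <= d0.
Proof.
move=> h1 h2; apply: (@pair_le _ _ _ (y1.1 t - y2.1 t) (e1.1 (t - r) - e2.1 (t - r))).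
  exact: contr_sup.
by apply: le_trans (le_trans _ Dd0); [apply: de1; lra|rewrite lerDl].
Qed.

Lemma contr_alpha t : a <= t -> t <= b ->
  `|delay_deriv r y1 e1 t - delay_deriv r y2 e2 t| <= d0.
Proof.
move=> h1 h2; apply: le_trans _ Dd0.
apply: (@pair_le _ _ _ (y1.2 t - y2.2 t) (e1.2 (t - r) - e2.2 (t - r))).
  exact: contr_deriv.
by apply: (le_trans (y := Dl)); [apply: de2; lra|rewrite lerDl].
Qed.

Lemma contr_growth (y e : cpath R d n) : ctrl_bd K (a - r) (b - r) e -> ctrl_bd K a b y ->
  forall s t, a <= s -> s <= t -> t <= b ->
  `|delay_pair r y e t - delay_pair r y e s| <= 3 * K ^+ 3 * pw s t.
Proof.
move=> he [y_1 y_2 y_3] s t h1 h2 h3.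
apply: le_trans (growth_u gc LK K0 eps0 eps1 Xbd he y_1 y_3 pw_eps h1 h2 h3) _.
rewrite ler_wpM2r // (_ : 3 * K ^+ 3 = 2 * K ^+ 3 + K ^+ 3); last by ring.
rewrite lerD2l; apply: (le_trans (y := K)); first by rewrite ler_piMr.
by rewrite exprS ler_peMr // exprn_ege1.
Qed.

Lemma contr_holder s t : a <= s -> s <= t -> t <= b ->
  `|(G (delay_pair r y1 e1 t) - G (delay_pair r y1 e1 s))
    - (G (delay_pair r y2 e2 t) - G (delay_pair r y2 e2 s))|
  <= contr_const * (Dl + eps * x) * pw s t.
Proof.
move=> h1 h2 h3; have h4 := le_trans h1 h2; have h5 := le_trans h2 h3.
apply: le_trans (gc_G4 gc _ _ _ _) _.
apply: (le_trans (y := L * (d0 * pw s t + (d0 + d0) * (3 * K ^+ 3 * pw s t)))).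
  rewrite ler_wpM2l //; apply: lerD; first exact: contr_pair_incr.
  apply: ler_pM; rewrite ?addr_ge0 //; last exact: contr_growth.
  by apply: lerD; apply: contr_pair.
rewrite (_ : L * _ = (L * (1 + 2 * (3 * K ^+ 3))) * ((K ^+ 2 + 2) * (Dl + eps * x)) * pw s t);
  last by rewrite /d0; ring.
rewrite ler_wpM2r // mulrA ler_wpM2r ?addr_ge0 // mulrC /contr_const ler_wpM2l //.
  by rewrite addr_ge0 ?exprn_ge0.
rewrite -addrA -addrA [leRHS]addrCA lerDl /diff_const.
by have h := sew_const_ge0 beta_gt; pos.
Qed.

(** [Y1] and [Y2] are the next iterates in the Picard scheme, and the solutions themselves in the
    stability estimate. The difference of the two germs is sewn as one germ; the drifts are compared
    directly, a Lipschitz term being of order 2 beta. *)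
Lemma contr_rem s t : a <= s -> s <= t -> t <= b ->
  `|(Y1 t - Y1 s - incr (base X) s t *m G (delay_pair r y1 e1 s))
    - (Y2 t - Y2 s - incr (base X) s t *m G (delay_pair r y2 e2 s))|
  <= (contr_const * (Dl + eps * x) + phi) * pw s t ^+ 2.
Proof.
move=> h1 h2 h3; have h4 := le_trans h1 h2; have h5 := le_trans h2 h3.
have [he11 he12 he13] := he1; have [he21 he22 he23] := he2.
have [hy11 hy12 hy13] := hy1; have [hy21 hy22 hy23] := hy2.
pose K' := 3 * K ^+ 3.
have KK' : K <= K'.
  rewrite /K' (_ : 3 * K ^+ 3 = K ^+ 3 + 2 * K ^+ 3); last by ring.
  rewrite -[leLHS]addr0 lerD ?mulr_ge0 ?exprn_ge0 //.
  by rewrite exprS ler_peMr // exprn_ege1.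
pose dl := d0 + x + Dl.
have dl0 : 0 <= dl by rewrite !addr_ge0.
have dd : d0 <= dl by rewrite /dl -addrA lerDl addr_ge0.
have xd : x <= dl by rewrite /dl addrAC lerDr addr_ge0.
have Dd : Dl <= dl by rewrite /dl lerDr addr_ge0.
have dc0 : 0 <= diff_const L K'.
  by rewrite /diff_const /K'; pos.
have up (k1 k2 w : R) : 0 <= w -> k1 <= k2 -> k1 * w <= k2 * w.
  by move=> *; rewrite ler_wpM2r.
have S : forall s t, a <= s -> s <= t -> t <= b ->
    `|((Y1 t - Y1 s - f1 s t) - (Y2 t - Y2 s - f2 s t)) - (dgerm y1 e1 s t - dgerm y2 e2 s t)|
    <= sew_const beta * (diff_const L K' * dl) * pw s t ^+ 3.
  apply: (@sew_improve _ _ _ beta beta_gt (fun s t => dgerm y1 e1 s t - dgerm y2 e2 s t) a b _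
    _ _ (fun s t => (Y1 t - Y1 s - f1 s t) - (Y2 t - Y2 s - f2 s t))).
  - by rewrite mulr_ge0.
  - move=> s' v t' g1 g2 g3 g4.
    have g5 : a <= v by lra. have g6 : v <= b by lra.
    have m1 : pw s' v <= pw s' t' by apply: pw_mono.
    have m2 : pw v t' <= pw s' t' by apply: pw_mono.
    have m3 : pw s' v ^+ 2 <= pw s' t' ^+ 2 by rewrite lerXn2r ?nnegrE.
    have m4 : pw v t' ^+ 2 <= pw s' t' ^+ 2 by rewrite lerXn2r ?nnegrE.
    have [hX _ hA hB] := Xbd g5 g3 g4.
    have q1 : a - r <= s' - r by lra. have q2 : s' - r <= v - r by lra.
    have q3 : v - r <= b - r by lra. have q4 : a - r <= v - r by lra.
    have [c1 c2] := Xch.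
    have mm k1 k2 w1 w2 : 0 <= k1 -> 0 <= w1 -> k1 <= k2 -> w1 <= w2 -> k1 * w1 <= k2 * w2 :> R.
      by move=> *; apply: ler_pM.
    apply: (@germ_diff_le _ _ _ _ _ _ _ _ _ _ _ _ _ gc (delay_pair r y1 e1) (delay_pair r y2 e2)
      (delay_deriv r y1 e1) (delay_deriv r y2 e2) _ _
      (fun s t => (incr (base X) s t, incr (base X) (s - r) (t - r)))
      s' v t' (pw s' t') K' dl) => //.
    + exact: incrD.
    + by rewrite (c1 s' v t') // (c2 s' v t').
    + by apply: le_trans hX _; apply: mm.
    + by apply: pair_le; [apply: le_trans hA _|apply: le_trans hB _]; apply: mm; rewrite ?pw2_ge0.
    + by apply: le_trans (contr_growth he1 hy1 g1 g2 g6) _; apply: mm.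
    + by apply: le_trans (contr_growth he2 hy2 g1 g2 g6) _; apply: mm.
    + apply: (@pair_le _ _ _ (remainder X y1 s' v) (remainder X e1 (s' - r) (v - r))).
        by apply: le_trans (hy13 _ _ g1 g2 g6) _; apply: mm; rewrite ?pw2_ge0.
      apply: le_trans (he13 _ _ q1 q2 q3) _; rewrite pw_shift.
      by apply: mm; rewrite ?pw2_ge0.
    + apply: pair_le; apply: le_trans KK'; [exact: hy11|exact: he11].
    + apply: (@pair_le _ _ _ (y1.2 v - y1.2 s') (e1.2 (v - r) - e1.2 (s' - r))).
        by apply: le_trans (hy12 _ _ g1 g2 g6) _; apply: mm.
      by apply: le_trans (he12 _ _ q1 q2 q3) _; rewrite pw_shift; apply: mm.
    + by apply: le_trans (contr_pair g1 (le_trans g2 g6)) dd.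
    + by apply: le_trans (contr_pair g5 g6) dd.
    + by apply: le_trans (contr_pair_incr g1 g2 g6) _; apply: mm.
    + apply: (@pair_le _ _ _ (remainder X y1 s' v - remainder X y2 s' v)
       (remainder X e1 (s' - r) (v - r) - remainder X e2 (s' - r) (v - r))).
        by apply: le_trans (dy3 g1 g2 g6) _; apply: mm; rewrite ?pw2_ge0.
      by apply: le_trans (de4 q1 q2 q3) _; rewrite pw_shift; apply: mm; rewrite ?pw2_ge0.
    + by apply: le_trans (contr_alpha g5 g6) dd.
    + apply: (@pair_le _ _ _ ((y1.2 v - y1.2 s') - (y2.2 v - y2.2 s'))
        ((e1.2 (v - r) - e1.2 (s' - r)) - (e2.2 (v - r) - e2.2 (s' - r)))).
        rewrite (_ : _ - _ = (y1 - y2).2 v - (y1 - y2).2 s'); last by rewrite /=; mxring.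
        by apply: le_trans (dy2 g1 g2 g6) _; apply: mm.
      rewrite (_ : _ - _ = (e1 - e2).2 (v - r) - (e1 - e2).2 (s' - r)); last by rewrite /=; mxring.
      by apply: le_trans (de3 q1 q2 q3) _; rewrite pw_shift; apply: mm.
  - by move=> s' v t' g1 g2 g3 g4; rewrite (f1add g1 g2 g3 g4) (f2add g1 g2 g3 g4); mxring.
  - have [C1 hC1] := hY1; have [C2 hC2] := hY2; exists (C1 + C2) => s' t' g1 g2 g3.
    rewrite (_ : _ - _ = (Y1 t' - Y1 s' - f1 s' t' - dgerm y1 e1 s' t')
      - (Y2 t' - Y2 s' - f2 s' t' - dgerm y2 e2 s' t')); last by mxring.
    by apply: le_trans (ler_normB _ _) _; rewrite mulrDl; apply: lerD; [exact: hC1|exact: hC2].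
have {}S := S s t h1 h2 h3.
have [_ _ hA hB] := Xbd h1 h2 h3.
set TT := (area X s t, delayed_area X s t).
have hT : `|TT| <= K * pw s t ^+ 2 by apply: pair_le.
set P1 := PP (delay_pair r y1 e1 s) (delay_deriv r y1 e1 s) TT.
set P2 := PP (delay_pair r y2 e2 s) (delay_deriv r y2 e2 s) TT.
have HP : `|P1 - P2| <= (K ^+ 3 + K ^+ 2) * d0 * pw s t ^+ 2.
  rewrite (_ : P1 - P2 = (P1 - PP (delay_pair r y2 e2 s) (delay_deriv r y1 e1 s) TT)
     + PP (delay_pair r y2 e2 s) (delay_deriv r y1 e1 s - delay_deriv r y2 e2 s) TT); last first.
    by rewrite (gc_PB gc) addrA subrK.
  apply: le_trans (ler_normD _ _) _.
  rewrite (_ : _ * _ * _ = K * d0 * K * (K * pw s t ^+ 2) + K * d0 * (K * pw s t ^+ 2));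
    last by ring.
  apply: lerD.
    apply: le_trans (gc_Pl gc _ _ _ _) _.
    apply: ler_pM; rewrite ?mulr_ge0 //; apply: ler_pM; rewrite ?mulr_ge0 //.
      by apply: ler_pM => //; apply: contr_pair.
    by apply: pair_le; [exact: hy11|apply: he11; lra].
  apply: le_trans (gc_P gc _ _ _) _.
  by apply: ler_pM; rewrite ?mulr_ge0 //; apply: ler_pM => //; apply: contr_alpha.
rewrite (_ : _ - _ = ((Y1 t - Y1 s - f1 s t) - (Y2 t - Y2 s - f2 s t)
    - (dgerm y1 e1 s t - dgerm y2 e2 s t)) + (P1 - P2) + (f1 s t - f2 s t)); last first.
  rewrite /delay_germ /germ -/TT -/P1 -/P2; clear S HP; clearbody P1 P2; move: (_ *m _) (_ *m _) => *; mxring.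
apply: le_trans (ler_normD _ _) _; rewrite mulrDl; apply: lerD; last first.
  apply: le_trans (df h1 h2 h3) _; rewrite ler_wpM2l //.
  have ts1 : t - s <= 1 by apply: le_trans (lerB h3 h1) ab1.
  by apply: pow_ge_lin => //; rewrite subr_ge0.
apply: le_trans (ler_normD _ _) _; apply: le_trans (lerD S HP) _.
have pe := pw_eps h1 h2 h3.
(* [dl] contains x without a factor eps; the spare power of |t - s| between the orders 3 beta and 2
   beta supplies it. *)
have dle : dl * pw s t <= 2 * d0.
  apply: le_trans (ler_wpM2l dl0 pe) _; rewrite (_ : 2 * d0 = d0 + d0); last by ring.
  rewrite /dl -addrA mulrDl (mulrDl x).
  apply: lerD; first by rewrite ler_piMr.
  by apply: le_trans Dd0; rewrite addrC (mulrC x) lerD2r ler_piMr.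
rewrite (_ : _ * pw s t ^+ 3 = sew_const beta * diff_const L K' * (dl * pw s t) * pw s t ^+ 2);
  last by ring.
rewrite -mulrDl ler_wpM2r ?pw2_ge0 //.
apply: (le_trans (y := sew_const beta * diff_const L K' * (2 * d0) + (K ^+ 3 + K ^+ 2) * d0)).
  by rewrite lerD2r ler_wpM2l // mulr_ge0 ?sew_const_ge0.
rewrite (_ : _ + _ = (K ^+ 2 + 2) * ((K ^+ 3 + K ^+ 2) + 2 * (sew_const beta * diff_const L K'))
   * (Dl + eps * x)); last by rewrite /d0; ring.
rewrite ler_wpM2r ?addr_ge0 // /contr_const ler_wpM2l ?addr_ge0 ?exprn_ge0 //.
rewrite -/K' -[leRHS]addrA lerDr addr_ge0 // mulr_ge0 // addr_ge0 // mulr_ge0 //.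
Qed.

Lemma contr_const_ge1 : 1 <= contr_const.
Proof.
rewrite /contr_const.
have h1 : 1 <= K ^+ 2 + 2 by rewrite (le_trans (y := 2)) ?ler1n // lerDr exprn_ge0.
rewrite -[leLHS]mulr1; apply: ler_pM => //.
by rewrite -addrA -addrA lerDl /diff_const; have h := sew_const_ge0 beta_gt; pos.
Qed.

End Contraction.
End GermDifferences.

(** * Picard iteration on a short interval *)

Section PicardIteration.
Context {R : realType} {n d : nat}.
Variables (r beta : R).
Hypotheses (beta_gt : 3^-1 < beta) (beta_le : beta <= 2^-1).
Local Notation pw := (hpow beta).
Local Notation V := 'rV[R]_n.
Local Notation M := 'M[R]_(d, n).
Local Notation U := (V * V)%type.
Local Notation H := (M * M)%type.
Local Notation E := ('rV[R]_d * 'rV[R]_d)%type.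
Local Notation W := ('M[R]_d * 'M[R]_d)%type.

Variables (L : R) (G : U -> M) (DG : U -> U -> M) (PP : U -> H -> W -> V).
Hypothesis gc : germ_coeff L G DG (@pair_act R n d) PP (@pair_tens R d).
Variable X : delayed_path R d.
Local Notation rough_bd := (rough_bd r beta X).
Local Notation holder_bd := (holder_bd beta).
Local Notation rem_bd := (rem_bd beta X).
Local Notation ctrl_bd := (ctrl_bd beta X).
Local Notation dgerm := (delay_germ r G PP X).
Local Notation davie := (davie r beta G PP X).

Let L1 := gc_L gc.
Let L0 : 0 <= L. Proof. exact: le_trans L1. Qed.

Implicit Types (y e : cpath R d n) (a b : R) (f : R -> R -> V).

(** The interval begins at -r because the drift at times in [0, T] looks back over a time r. *)
Definition hol K T (y : R -> V) := forall s t, - r <= s -> s <= t -> t <= T ->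
  `|y t - y s| <= K * pw s t.

(* These are the only properties of the drift that matter. *)
Record drift_ok (CA : R) (f : (R -> V) -> R -> R -> V) : Prop := DriftOk {
  dr_CA : 0 <= CA;
  dr_add : forall (y : R -> V) K T, hol K T y -> add_incr (f y) 0 T;
  dr_diff : forall (y z : R -> V) K m T, hol K T y -> hol K T z ->
    (forall t, - r <= t -> t <= T -> `|y t - z t| <= m) ->
    forall s t, 0 <= s -> s <= t -> t <= T -> `|f y s t - f z s t| <= CA * m * (t - s);
  dr_bd : forall (y : R -> V) K m T, hol K T y -> (forall t, - r <= t -> t <= T -> `|y t| <= m) ->
    forall s t, 0 <= s -> s <= t -> t <= T -> `|f y s t| <= CA * m * (t - s) }.

Lemma le_geometric (x B c q : R) : 0 <= q -> q < 1 ->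
  (forall k, x <= B + c * q ^+ k) -> x <= B.
Proof.
move=> q0 q1 h; apply/ler_addgt0Pr => e e0.
have [k hk] := expr_lt_eps c q0 q1 e0.
by apply: le_trans (h k) _; rewrite lerD2l mulrC ltW.
Qed.

Lemma ctrl_bd_mono K K' a b y : K <= K' -> ctrl_bd K a b y -> ctrl_bd K' a b y.
Proof.
move=> KK [h1 h2 h3]; split.
- by move=> t ? ?; apply: le_trans (h1 t _ _) KK.
- by move=> s t ? ? ?; apply: le_trans (h2 s t _ _ _) _ => //; rewrite ler_wpM2r ?pw_ge0.
- by move=> s t ? ? ?; apply: le_trans (h3 s t _ _ _) _ => //; rewrite ler_wpM2r ?pw2_ge0.
Qed.

Lemma delta_bd_mono (Lam x x' K1 K2 : R) : 0 <= Lam -> 0 <= x -> x <= x' ->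
  delta_bd Lam x K1 K2 <= delta_bd Lam x' K1 K2.
Proof.
move=> l0 x0 xx; rewrite /delta_bd ler_wpM2l ?exprn_ge0 // !lerD2r; apply: lerD.
  rewrite ler_wpM2l // !lerD2r lerXn2r ?nnegrE ?lerD2l //; last by pos; lra.
  by pos.
by rewrite ler_wpM2r // lerD2l.
Qed.

(** Serves at fixed s and t, to pass to the limit in the Davie estimates of the iterates; therefore
    no power of |t - s| is kept. *)
Lemma dgerm_lip y1 y2 e s t kap K du da : 0 <= kap -> 0 <= K ->
  `|incr (base X) s t| <= kap -> `|area X s t| <= kap -> `|delayed_area X s t| <= kap ->
  `|y1.2 s| <= K -> `|e.2 (s - r)| <= K ->
  `|y1.1 s - y2.1 s| <= du -> `|y1.2 s - y2.2 s| <= da ->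
  `|dgerm y1 e s t - dgerm y2 e s t| <= L * kap * (L * du) + (L * du * K * kap + L * da * kap).
Proof.
move=> k0 K0 hX hA hB hy he hu ha.
have dle : `|delay_pair r y1 e s - delay_pair r y2 e s| <= du.
  apply: (@pair_le _ _ _ (y1.1 s - y2.1 s) (e.1 (s - r) - e.1 (s - r))) => //.
  by rewrite subrr normr0; apply: le_trans hu.
have ale : `|delay_deriv r y1 e s - delay_deriv r y2 e s| <= da.
  apply: (@pair_le _ _ _ (y1.2 s - y2.2 s) (e.2 (s - r) - e.2 (s - r))) => //.
  by rewrite subrr normr0; apply: le_trans ha.
rewrite /delay_germ /germ; set T := (_, _).
have hT : `|T| <= kap by apply: pair_le.
rewrite (_ : _ - _ = incr (base X) s t *m (G (delay_pair r y1 e s) - G (delay_pair r y2 e s))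
  + ((PP (delay_pair r y1 e s) (delay_deriv r y1 e s) T
     - PP (delay_pair r y2 e s) (delay_deriv r y1 e s) T)
   + PP (delay_pair r y2 e s) (delay_deriv r y1 e s - delay_deriv r y2 e s) T)); last first.
  rewrite mulmxBr (gc_PB gc).
  by move: (_ *m _) (_ *m _) (PP _ _ _) (PP _ _ _) (PP _ _ _) => *; mxring.
apply: le_trans (ler_normD _ _) _; apply: lerD.
  apply: le_trans (gc_M gc _ _) _; apply: ler_pM; rewrite ?mulr_ge0 // ?ler_wpM2l //.
  by apply: le_trans (gc_Gl gc _ _) _; rewrite ler_wpM2l.
apply: le_trans (ler_normD _ _) _; apply: lerD.
  apply: le_trans (gc_Pl gc _ _ _ _) _.
  apply: ler_pM; rewrite ?mulr_ge0 //; apply: ler_pM; rewrite ?mulr_ge0 // ?ler_wpM2l //.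
  exact: pair_le.
apply: le_trans (gc_P gc _ _ _) _.
by apply: ler_pM; rewrite ?mulr_ge0 // ler_wpM2l.
Qed.

Section Picard.
Variables (CA : R) (f : (R -> V) -> R -> R -> V).
Hypothesis fok : drift_ok CA f.
Let CA0 := dr_CA fok.
Variables (Lam Mp Kp a b eps : R) (p : R -> V) (e : cpath R d n).
Hypotheses (r_ge0 : 0 <= r) (LLam : L <= Lam) (Mp0 : 0 <= Mp) (Kp0 : 0 <= Kp) (a0 : 0 <= a) (ab : a <= b)
  (ab1 : b - a <= 1).
Hypotheses (Xch : chen r X) (Xbd : rough_bd Lam a b) (ebd : ctrl_bd Lam (a - r) (b - r) e).
Hypotheses (hp : hol Kp a p) (hM : forall t, - r <= t -> t <= a -> `|p t| <= Mp).

(** [pic_D] is the rate of the drift while |y| <= Mp + 1. [pic_K2] adds to it the area part Lam^3 of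
    the remainder and room for the sewing error. [pic_K1] is a Lipschitz bound of G times the
    increment bound of [growth_u], with K2 * eps replaced by 1. *)
Definition pic_D := CA * (Mp + 1).
Definition pic_K2 := Lam ^+ 3 + 2 + pic_D.
Definition pic_K1 := Lam * (2 * Lam ^+ 3 + 1).
Definition pic_K := Lam + pic_K1 + pic_K2.
Hypotheses (eps0 : 0 <= eps) (eps1 : eps <= 1).
Hypothesis pw_eps : forall s t, a <= s -> s <= t -> t <= b -> pw s t <= eps.
(** [small1] and [small2] make an iteration respect the bounds of [pic_inv], [small3] keeps the path
    within 1 of its value at a, and [small4] makes the iteration contract by 1/2. *)
Hypothesis small1 : pic_K2 * eps <= 1.
Hypothesis small2 : sew_const beta * eps * delta_bd Lam 1 pic_K1 pic_K2 <= 1.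
Hypothesis small3 : (Lam ^+ 3 + 1) * eps <= 1.
Hypothesis small4 : (contr_const beta L pic_K + CA * (pic_K ^+ 2 + 2)) * eps <= 2^-1.

Let Lam1 : 1 <= Lam. Proof. exact: le_trans L1 LLam. Qed.
Let Lam0 : 0 <= Lam. Proof. exact: le_trans Lam1. Qed.
Let D0 : 0 <= pic_D. Proof. by rewrite /pic_D; pos. Qed.
Let K10 : 0 <= pic_K1. Proof. by rewrite /pic_K1; pos. Qed.
Let K20 : 0 <= pic_K2. Proof. by rewrite /pic_K2; pos. Qed.
Let K0 : 0 <= pic_K. Proof. by rewrite /pic_K; pos. Qed.
Let LamK : Lam <= pic_K. Proof. by rewrite /pic_K -addrA lerDl addr_ge0. Qed.
Let K1K : pic_K1 <= pic_K. Proof. by rewrite /pic_K addrAC lerDr addr_ge0. Qed.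
Let K2K : pic_K2 <= pic_K. Proof. by rewrite /pic_K lerDr addr_ge0. Qed.
Let x0 : 0 <= pic_K2 * eps. Proof. by rewrite mulr_ge0. Qed.
Let ra : - r <= a. Proof. by apply: le_trans a0; rewrite oppr_le0. Qed.

(** The value and the derivative at a are prescribed, so that seminorms alone measure the distance
    of two iterates. The path agrees with [p] on the whole past, which the drift sees. *)
Definition pic_inv (z : cpath R d n) :=
  [/\ (forall t, t <= a -> z.1 t = p t), sup_bd Lam a b z.2, holder_bd pic_K1 a b z,
      rem_bd pic_K2 a b z & z.2 a = G (p a, e.1 (a - r))].

(** A relation, since sewing provides the next iterate through an existence statement. The constant
    is common to all iterates, which is what survives in the limit. *)
Definition pic_step (z z' : cpath R d n) :=
  (forall t, z'.2 t = G (z.1 t, e.1 (t - r))) /\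
  (forall s t, a <= s -> s <= t -> t <= b -> `|z'.1 t - z'.1 s - f z.1 s t - dgerm z e s t|
     <= sew_const beta * delta_bd Lam 1 pic_K1 pic_K2 * pw s t ^+ 3).

Let Kz := Kp + (Lam ^+ 3 + 1).

Lemma pic_incr z : pic_inv z -> forall s t, a <= s -> s <= t -> t <= b ->
  `|z.1 t - z.1 s| <= (Lam ^+ 3 + 1) * pw s t.
Proof.
move=> [z1 z2 z3 z4 z5] s t h1 h2 h3.
apply: le_trans (growth_y gc LLam K20 Xbd z2 z4 pw_eps h1 h2 h3) _.
by rewrite ler_wpM2r ?pw_ge0 // lerD2l.
Qed.

Lemma pic_hol z : pic_inv z -> hol Kz b z.1.
Proof.
move=> iz s t h1 h2 h3; have [z1 z2 z3 z4 z5] := iz.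
have [ta|/ltW at_] := leP t a.
  rewrite !z1 //; last exact: le_trans ta.
  by apply: le_trans (hp h1 h2 ta) _; rewrite ler_wpM2r ?pw_ge0 // lerDl; pos.
have [as_|/ltW sa] := leP a s.
  by apply: le_trans (pic_incr iz as_ h2 h3) _; rewrite ler_wpM2r ?pw_ge0 // lerDr.
rewrite (_ : z.1 t - z.1 s = (z.1 t - z.1 a) + (p a - p s)); last first.
  by rewrite (z1 a) // (z1 s) //; mxring.
apply: le_trans (ler_normD _ _) _; rewrite /Kz (addrC Kp) mulrDl; apply: lerD.
  apply: le_trans (pic_incr iz (lexx a) at_ h3) _; rewrite ler_wpM2l //; first by pos.
  by apply: pw_mono.
by apply: le_trans (hp h1 sa (lexx a)) _; rewrite ler_wpM2l // pw_mono.
Qed.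

Lemma pic_sup z : pic_inv z -> forall t, - r <= t -> t <= b -> `|z.1 t| <= Mp + 1.
Proof.
move=> iz t h1 h2; have [z1 _ _ _ _] := iz.
have [ta|/ltW at_] := leP t a.
  by rewrite z1 //; apply: le_trans (hM h1 ta) _; rewrite lerDl.
rewrite (_ : z.1 t = p a + (z.1 t - z.1 a)); last by rewrite (z1 a) //; mxring.
apply: le_trans (ler_normD _ _) _; apply: lerD; first exact: hM.
apply: le_trans (pic_incr iz (lexx a) at_ h2) _; apply: le_trans small3.
by rewrite ler_wpM2l ?pw_eps //; pos.
Qed.

Lemma pic_add z : pic_inv z -> add_incr (f z.1) a b.
Proof.
move=> iz s v t h1 h2 h3 h4.
by apply: (dr_add fok (pic_hol iz)) => //; apply: le_trans h1.
Qed.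

Lemma pic_next z : pic_inv z -> exists z', pic_inv z' /\ pic_step z z'.
Proof.
move=> iz; have [z1 z2 z3 z4 z5] := iz.
have db0 : 0 <= delta_bd Lam (pic_K2 * eps) pic_K1 pic_K2 by rewrite /delta_bd; pos.
have dble : delta_bd Lam (pic_K2 * eps) pic_K1 pic_K2 <= delta_bd Lam 1 pic_K1 pic_K2.
  exact: delta_bd_mono.
have [F hF] := sew_exists beta_gt db0
  (dgermxx beta_gt gc z e Xbd)
  (growth_germ beta_gt gc LLam K10 K20 eps0 eps1 Xch Xbd ebd z2 z3 z4 pw_eps) ab.
have fadd := pic_add iz.
pose z' : cpath R d n := (fun t => if t <= a then p t else p a + f z.1 a t + (F t - F a),
  fun t => G (z.1 t, e.1 (t - r))).
have faa : f z.1 a a = 0.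
  by have /eqP := fadd a a a (lexx _) (lexx _) (lexx _) ab; rewrite -subr_eq0 opprD addrA subrr
    sub0r oppr_eq0 => /eqP.
have z'E t : a <= t -> z'.1 t = p a + f z.1 a t + (F t - F a).
  move=> at_; rewrite /z' /=; case: (leP t a) => // ta.
  have -> : t = a by apply/le_anti/andP.
  by rewrite faa addr0 subrr addr0.
have z'incr s t : a <= s -> s <= t -> t <= b ->
    z'.1 t - z'.1 s - f z.1 s t = F t - F s.
  move=> h1 h2 h3; rewrite !z'E //; last exact: le_trans h2.
  by rewrite (fadd a s t) //; mxring.
have step : pic_step z z'.
  split=> // s t h1 h2 h3; rewrite z'incr //; apply: le_trans (hF s t h1 h2 h3) _.
  by rewrite ler_wpM2r ?pw3_ge0 // ler_wpM2l ?sew_const_ge0.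
exists z'; split=> //; split.
- by move=> t ta; rewrite /z' /= ta.
- by move=> t _ _; apply: le_trans (gc_G gc _) LLam.
- move=> s t h1 h2 h3; apply: le_trans (gc_Gl gc _ _) _.
  rewrite /pic_K1 -mulrA; apply: ler_pM => //.
  apply: le_trans (growth_u gc LLam K20 eps0 eps1 Xbd ebd z2 z4 pw_eps h1 h2 h3) _.
  by rewrite ler_wpM2r ?pw_ge0 // lerD2l.
- move=> s t h1 h2 h3.
  have hd : davie (f z.1) z e z'.1 a b.
    by exists (sew_const beta * delta_bd Lam 1 pic_K1 pic_K2) => *; apply: step.2.
  have [_ hr] := growth_davie beta_gt gc LLam K10 K20 eps0 eps1 Xch Xbd ebd z2 z3 z4 pw_eps
    fadd hd h1 h2 h3.
  rewrite (_ : remainder X z' s t = (z'.1 t - z'.1 s - f z.1 s t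
     - incr (base X) s t *m G (delay_pair r z e s)) + f z.1 s t); last first.
    by rewrite /remainder /incr /=; move: (_ *m _) => *; mxring.
  apply: le_trans (ler_normD _ _) _; rewrite /pic_K2 mulrDl; apply: lerD.
    apply: le_trans hr _; rewrite ler_wpM2r ?pw2_ge0 // lerD2l.
    apply: (le_trans (y := 1)); last by rewrite ler1n.
    by apply: le_trans small2; rewrite ler_wpM2l // mulr_ge0 ?sew_const_ge0.
  have h4 : 0 <= s by apply: le_trans h1.
  apply: le_trans (dr_bd fok (pic_hol iz) (pic_sup iz) h4 h2 h3) _.
  rewrite -/pic_D ler_wpM2l // pow_ge_lin // ?subr_ge0 //.
  by apply: le_trans (lerB h3 h1) ab1.
by rewrite /z' /= z1.
Qed.

(** The path with constant derivative after a has zero remainder there, hence satisfies all bounds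
    of the invariant. *)
Lemma pic_init : exists z, pic_inv z.
Proof.
pose g := G (p a, e.1 (a - r)).
exists ((fun t => if t <= a then p t else p a + incr (base X) a t *m g), fun _ => g).
split=> //=.
- by move=> t ->.
- by move=> t _ _ /=; apply: le_trans (gc_G gc _) LLam.
- by move=> s t _ _ _ /=; rewrite subrr normr0 mulr_ge0 ?pw_ge0.
move=> s t h1 h2 h3.
have E t' : a <= t' -> (if t' <= a then p t' else p a + incr (base X) a t' *m g)
   = p a + incr (base X) a t' *m g.
  move=> at_; case: (leP t' a) => // ta.
  have -> : t' = a by apply/le_anti/andP.
  by rewrite /incr subrr mul0mx addr0.
rewrite /remainder /= [incr _ s t in X in `|X|]/incr !E //; last exact: le_trans h2.
rewrite (incrD (base X) a s t) mulmxDl (_ : _ - _ = 0).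
  by rewrite normr0; have h := pw2_ge0 beta s t; apply: mulr_ge0.
by move: (_ *m _) (_ *m _) => *; mxring.
Qed.

Definition pic_close (x : R) (z1 z2 : cpath R d n) := holder_bd x a b (z1 - z2) /\
  forall s t, a <= s -> s <= t -> t <= b ->
  `|remainder X z1 s t - remainder X z2 s t| <= x * pw s t ^+ 2.

Lemma pic_close_sup x z1 z2 : 0 <= x -> pic_inv z1 -> pic_inv z2 -> pic_close x z1 z2 ->
  forall t, t <= b -> `|z1.1 t - z2.1 t| <= (pic_K ^+ 2 + 2) * (eps * x).
Proof.
move=> x_0 i1 i2 [hx1 hx2] t tb.
have [i11 _ _ _ i15] := i1; have [i21 _ _ _ i25] := i2.
have [ta|/ltW at_] := leP t a.
  by rewrite i11 // i21 // subrr normr0; pos.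
rewrite -(add0r (eps * x)).
have XbdK : rough_bd pic_K a b.
  move=> s t' h1 h2 h3; have [e1 e2 e3 e4] := Xbd h1 h2 h3.
  by split; [apply: le_trans e1 _|apply: le_trans e2 _|apply: le_trans e3 _|apply: le_trans e4 _];
    rewrite ler_wpM2r ?pw_ge0 ?pw2_ge0.
apply: (contr_sup gc (le_trans LLam LamK) (lexx 0) x_0 eps0 eps1 XbdK pw_eps _ _ hx1 hx2) => //.
- by rewrite i11 // i21 // subrr normr0.
- by rewrite i15 // i25 // subrr normr0.
Qed.

Lemma pic_contract x z1 z2 z1' z2' : 0 <= x -> pic_inv z1 -> pic_inv z2 ->
  pic_inv z1' -> pic_inv z2' ->
  pic_step z1 z1' -> pic_step z2 z2' -> pic_close x z1 z2 -> pic_close (x / 2) z1' z2'.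
Proof.
move=> x_0 i1 i2 i1' i2' s1 s2 hx; have [hx1 hx2] := hx.
have XbdK : rough_bd pic_K a b.
  move=> s t' h1 h2 h3; have [e1 e2 e3 e4] := Xbd h1 h2 h3.
  by split; [apply: le_trans e1 _|apply: le_trans e2 _|apply: le_trans e3 _|apply: le_trans e4 _];
    rewrite ler_wpM2r ?pw_ge0 ?pw2_ge0.
have [i11 i12 i13 i14 i15] := i1; have [i21 i22 i23 i24 i25] := i2.
have c1 : ctrl_bd pic_K a b z1.
  split; [move=> t *; apply: le_trans (i12 t _ _) _ |move=> s t *; apply: le_trans (i13 s t _ _ _) _
    |move=> s t *; apply: le_trans (i14 s t _ _ _) _] => //; by rewrite ler_wpM2r ?pw_ge0 ?pw2_ge0.
have c2 : ctrl_bd pic_K a b z2.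
  split; [move=> t *; apply: le_trans (i22 t _ _) _ |move=> s t *; apply: le_trans (i23 s t _ _ _) _
    |move=> s t *; apply: le_trans (i24 s t _ _ _) _] => //; by rewrite ler_wpM2r ?pw_ge0 ?pw2_ge0.
have ce := ctrl_bd_mono LamK ebd.
have LK := le_trans LLam LamK.
have ini1 : `|z1.1 a - z2.1 a| <= 0 by rewrite i11 // i21 // subrr normr0.
have ini2 : `|z1.2 a - z2.2 a| <= 0 by rewrite i15 // i25 // subrr normr0.
have de1 : forall s, a - r <= s -> s <= b - r -> `|e.1 s - e.1 s| <= 0.
  by move=> *; rewrite subrr normr0.
have de2 : forall s, a - r <= s -> s <= b - r -> `|e.2 s - e.2 s| <= 0.
  by move=> *; rewrite subrr normr0.
have de3 : holder_bd 0 (a - r) (b - r) (e - e).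
  by move=> s t _ _ _; rewrite subrr /= subrr normr0 mul0r.
have de4 : forall s t, a - r <= s -> s <= t -> t <= b - r ->
  `|remainder X e s t - remainder X e s t| <= 0 * pw s t ^+ 2.
  by move=> *; rewrite subrr normr0 mul0r.
pose ph := CA * ((pic_K ^+ 2 + 2) * (eps * x)).
have ph0 : 0 <= ph by rewrite /ph; pos.
have df : forall s t, a <= s -> s <= t -> t <= b -> `|f z1.1 s t - f z2.1 s t| <= ph * (t - s).
  move=> s t h1 h2 h3; apply: (dr_diff fok (pic_hol i1) (pic_hol i2)) => //.
    by move=> t' _; apply: pic_close_sup.
  by apply: le_trans h1.
have d1 : davie (f z1.1) z1 e z1'.1 a b.
  by exists (sew_const beta * delta_bd Lam 1 pic_K1 pic_K2) => *; apply: s1.2.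
have d2 : davie (f z2.1) z2 e z2'.1 a b.
  by exists (sew_const beta * delta_bd Lam 1 pic_K1 pic_K2) => *; apply: s2.2.
have sm : contr_const beta L pic_K * (0 + eps * x) + ph <= x / 2.
  rewrite add0r (_ : _ + _ = (contr_const beta L pic_K + CA * (pic_K ^+ 2 + 2)) * eps * x);
    last by rewrite /ph; ring.
  by rewrite mulrC; apply: ler_wpM2l.
split=> s t h1 h2 h3.
  change (`|z1'.2 t - z2'.2 t - (z1'.2 s - z2'.2 s)| <= x / 2 * pw s t).
  rewrite !s1.1 !s2.1.
  have := contr_holder beta_gt gc LK (lexx 0) x_0 eps0 eps1 XbdK ce c2 pw_eps ini1 ini2 hx1 hx2
    de1 de2 de4 h1 h2 h3.
  rewrite (_ : _ - _ - (_ - _) = G (z1.1 t, e.1 (t - r)) - G (z2.1 t, e.1 (t - r)) -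
     (G (z1.1 s, e.1 (s - r)) - G (z2.1 s, e.1 (s - r)))).
    move=> /le_trans; apply; rewrite ler_wpM2r ?pw_ge0 //.
    by apply: le_trans sm; rewrite lerDl.
  by rewrite /delay_pair; move: (G _) (G _) (G _) (G _) => *; mxring.
have := contr_rem beta_gt beta_le gc LK (lexx 0) x_0 ph0 eps0 eps1 ab1 Xch XbdK ce ce c1 c2
   pw_eps ini1 ini2 hx1 hx2 de1 de2 de3 de4 (pic_add i1) (pic_add i2) df d1 d2 h1 h2 h3.
rewrite {1 2}/remainder !s1.1 !s2.1 => /le_trans; apply.
by rewrite ler_wpM2r ?pw2_ge0.
Qed.

(** Only the paths are passed to the limit, pointwise. The derivative of each iterate is G of the
    preceding path, so it converges as well, and the Davie estimate persists with the common
    constant of [pic_step]. *)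
Lemma pic_limit : exists y : R -> V,
  [/\ (forall t, t <= a -> y t = p t), hol Kz b y
    & davie (f y) (y, fun t => G (y t, e.1 (t - r))) e y a b].
Proof.
have [nx hnx] : exists nx : cpath R d n -> cpath R d n, forall z, pic_inv z ->
    pic_inv (nx z) /\ pic_step z (nx z).
  have : forall z, exists z', pic_inv z -> pic_inv z' /\ pic_step z z'.
    move=> z; have [iz|niz] := pselect (pic_inv z); last by exists z.
    by have [z' hz'] := pic_next iz; exists z'.
  by move/choice => [nx hnx]; exists nx.
have [z0 iz0] := pic_init.
pose zs k := iter k nx z0.
have iz k : pic_inv (zs k) by elim: k => //= k IH; have [] := hnx _ IH.
have sz k : pic_step (zs k) (zs k.+1) by have [] := hnx _ (iz k).
(* The first two iterates both have seminorms at most [pic_K]. *)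
pose X0 := 2 * pic_K.
pose q : R := 2^-1.
have X00 : 0 <= X0 by rewrite mulr_ge0.
have q0 : 0 <= q by rewrite invr_ge0.
have q1 : q < 1 by rewrite invf_lt1 ?ltr1n.
have X0q k : 0 <= X0 * q ^+ k by rewrite mulr_ge0 ?exprn_ge0.
have cz k : pic_close (X0 * q ^+ k) (zs k) (zs k.+1).
  elim: k => [|k IH].
    have [_ _ a3 a4 _] := iz 0%N; have [_ _ b3 b4 _] := iz 1%N.
    rewrite expr0 mulr1; split=> s t h1 h2 h3.
      rewrite (_ : _ - _ = ((zs 0%N).2 t - (zs 0%N).2 s) - ((zs 1%N).2 t - (zs 1%N).2 s)); last first.
        by rewrite [LHS]/=; mxring.
      apply: le_trans (ler_normB _ _) _; apply: le_trans (lerD (a3 _ _ h1 h2 h3) (b3 _ _ h1 h2 h3)) _.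
      by rewrite -mulrDl ler_wpM2r ?pw_ge0 // /X0 mulr_natl mulr2n lerD.
    apply: le_trans (ler_normB _ _) _; apply: le_trans (lerD (a4 _ _ h1 h2 h3) (b4 _ _ h1 h2 h3)) _.
    by rewrite -mulrDl ler_wpM2r ?pw2_ge0 // /X0 mulr_natl mulr2n lerD.
  rewrite (_ : X0 * q ^+ k.+1 = X0 * q ^+ k / 2); last by rewrite exprS /q; ring.
  exact: pic_contract (X0q k) (iz k) (iz k.+1) (iz k.+1) (iz k.+2) (sz k) (sz k.+1) IH.
pose c := (pic_K ^+ 2 + 2) * (eps * X0).
have c0 : 0 <= c by rewrite /c; pos.
have dz k t : t <= b -> `|(zs k.+1).1 t - (zs k).1 t| <= c * q ^+ k.
  move=> tb; rewrite distrC; apply: le_trans (pic_close_sup (X0q k) (iz k) (iz k.+1) (cz k) tb) _.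
  by rewrite /c !mulrA.
pose c2 := c / (1 - q).
have c20 : 0 <= c2 by rewrite divr_ge0 // subr_ge0 ltW.
have [ell hell] : exists ell : R -> V, forall t, t <= b -> forall k,
    `|(zs k).1 t - ell t| <= c2 * q ^+ k.
  have : forall t, exists l, t <= b -> forall k, `|(zs k).1 t - l| <= c2 * q ^+ k.
    move=> t; have [tb|] := leP t b; last by exists 0.
    have [l hl] := @geometric_limit _ _ _ (fun k => (zs k).1 t) c q q0 q1 c0 (fun k => dz k t tb).
    by exists l.
  by move/choice => [ell hell]; exists ell.
have ellp t : t <= a -> ell t = p t.
  move=> ta; apply/eqP; rewrite -subr_eq0 -normr_le0; apply: (@le_geometric _ _ c2 q) => // k.
  rewrite add0r distrC; have [i1 _ _ _ _] := iz k; rewrite -(i1 t ta).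
  by apply: hell; apply: le_trans ab.
have hl : hol Kz b ell.
  move=> s t h1 h2 h3; apply: (@le_geometric _ _ (c2 + c2) q) => // k.
  rewrite (_ : ell t - ell s = ((zs k).1 t - (zs k).1 s)
     + (((zs k).1 s - ell s) - ((zs k).1 t - ell t))); last by mxring.
  apply: le_trans (ler_normD _ _) _; apply: lerD; first exact: pic_hol.
  apply: le_trans (ler_normB _ _) _; rewrite mulrDl.
  by apply: lerD; apply: hell => //; apply: le_trans h3.
exists ell; split=> //.
set C := sew_const beta * delta_bd Lam 1 pic_K1 pic_K2.
exists C => s t h1 h2 h3.
have sb := le_trans h2 h3.
have [hX _ hA hB] := Xbd h1 h2 h3.
have XX (w : R) : 0 <= w -> w <= 1 -> Lam * w <= Lam by move=> *; rewrite ler_piMr.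
have p1 : pw s t <= 1 by apply: le_trans (pw_eps h1 h2 h3) eps1.
have p2 : pw s t ^+ 2 <= 1 by rewrite exprn_ile1 ?pw_ge0.
have {}hX := le_trans hX (XX _ (pw_ge0 _ _ _) p1).
have {}hA := le_trans hA (XX _ (pw2_ge0 _ _ _) p2).
have {}hB := le_trans hB (XX _ (pw2_ge0 _ _ _) p2).
pose yy : cpath R d n := (ell, fun t => G (ell t, e.1 (t - r))).
(* [dgerm_lip] with distances c2 q^k of the paths and 2 L c2 q^k of the derivatives. The step from
   k.+1 to k.+2 involves the path of index k through the derivative, so all errors are measured by
   q^k. *)
pose c3 := L * Lam * (L * c2) + (L * c2 * Lam * Lam + L * (L * (2 * c2)) * Lam).
apply: (@le_geometric _ _ (c2 + c2 + CA * c2 * (t - s) + c3) q) => // k.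
have [sz1 sz2] := sz k.+1.
have qk : q ^+ k.+2 <= q ^+ k.
  by rewrite exprS exprS mulrA ler_piMl ?exprn_ge0 // mulr_ile1 // ltW.
have qk1 : q ^+ k.+1 <= q ^+ k by rewrite exprS ler_piMl ?exprn_ge0 // ltW.
rewrite (_ : _ - _ - _ - _ = ((zs k.+2).1 t - (zs k.+2).1 s - f (zs k.+1).1 s t - dgerm (zs k.+1) e s t)
   + (- ((zs k.+2).1 t - ell t) + ((zs k.+2).1 s - ell s)
      + (f (zs k.+1).1 s t - f ell s t) + (dgerm (zs k.+1) e s t - dgerm yy e s t))); last first.
  rewrite -/yy; move: (f _ _ _) (f _ _ _) (dgerm _ _ _ _) (dgerm _ _ _ _) => *; mxring.
apply: le_trans (ler_normD _ _) _; apply: lerD; first exact: sz2.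
rewrite !mulrDl.
have hm k' t' : (k <= k')%N -> t' <= b -> `|(zs k').1 t' - ell t'| <= c2 * q ^+ k.
  move=> kk tb; apply: le_trans (hell t' tb k') _; rewrite ler_wpM2l //.
  by rewrite ler_wiXn2l // ltW.
have k1 : (k <= k.+1)%N by [].
have k2 : (k <= k.+2)%N by rewrite leqW.
apply: le_trans (ler_normD _ _) _; apply: lerD.
  apply: le_trans (ler_normD _ _) _; apply: lerD.
    apply: le_trans (ler_normD _ _) _; rewrite normrN; apply: lerD; exact: hm.
  rewrite (_ : CA * c2 * (t - s) * q ^+ k = CA * (c2 * q ^+ k) * (t - s)); last by ring.
  apply: (dr_diff fok (pic_hol (iz k.+1)) hl _ _ h2 h3); first by move=> t' _; apply: hm.
  by apply: le_trans h1.
have [_ i2 _ _ _] := iz k.+1; have [e1 _ _] := ebd.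
have sr : a - r <= s - r by rewrite lerB.
have sr' : s - r <= b - r by rewrite lerB.
apply: le_trans (@dgerm_lip (zs k.+1) yy e s t Lam Lam (c2 * q ^+ k) (L * (2 * c2 * q ^+ k))
  Lam0 Lam0 hX hA hB (i2 s h1 sb) (e1 _ sr sr') (hm _ _ k1 sb) _) _; last first.
  by rewrite le_eqVlt; apply/orP; left; apply/eqP; rewrite /c3; ring.
rewrite (sz k).1 /yy /=; apply: le_trans (gc_Gl gc _ _) _; rewrite ler_wpM2l //.
apply: (@pair_le _ _ _ ((zs k).1 s - ell s) (e.1 (s - r) - e.1 (s - r))).
  apply: le_trans (hm _ _ (leqnn k) sb) _; rewrite -mulrA mulr_natl mulr2n lerDl.
  by rewrite mulr_ge0 ?exprn_ge0.
by rewrite subrr normr0; pos.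
Qed.

End Picard.
End PicardIteration.

(** * A priori bounds *)

Section Bootstrap.
Context {R : realType} {n d : nat}.
Variables (r beta : R).
Hypotheses (beta_gt : 3^-1 < beta) (beta_le : beta <= 2^-1).
Local Notation pw := (hpow beta).
Local Notation V := 'rV[R]_n.
Local Notation M := 'M[R]_(d, n).
Local Notation U := (V * V)%type.
Local Notation H := (M * M)%type.
Local Notation E := ('rV[R]_d * 'rV[R]_d)%type.
Local Notation W := ('M[R]_d * 'M[R]_d)%type.

Variables (L : R) (G : U -> M) (DG : U -> U -> M) (PP : U -> H -> W -> V).
Hypothesis gc : germ_coeff L G DG (@pair_act R n d) PP (@pair_tens R d).
Variable X : delayed_path R d.
Local Notation rough_bd := (rough_bd r beta X).
Local Notation holder_bd := (holder_bd beta).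
Local Notation rem_bd := (rem_bd beta X).
Local Notation ctrl_bd := (ctrl_bd beta X).
Local Notation dgerm := (delay_germ r G PP X).
Local Notation davie := (davie r beta G PP X).

Let L1 := gc_L gc.
Let L0 : 0 <= L. Proof. exact: le_trans L1. Qed.

Implicit Types (y e : cpath R d n) (a b : R) (f : R -> R -> V).
Local Notation hol := (hol r beta).
Local Notation drift_ok := (drift_ok r beta).

(** The length h depends on the bounds [Lam] and [Mp], but neither on the Hoelder constant [Kp] of
    the past nor on the position of the interval. Steps of equal length can be chained as long as
    these two bounds hold. *)
Lemma local_exists CA (f : (R -> V) -> R -> R -> V) Lam Mp : drift_ok CA f -> 0 <= r -> L <= Lam -> 0 <= Mp -> chen r X ->
  exists2 h, 0 < h & forall a b Kp (p : R -> V) e,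
    0 <= Kp -> 0 <= a -> a <= b -> b - a <= h -> rough_bd Lam a b ->
    ctrl_bd Lam (a - r) (b - r) e -> hol Kp a p ->
    (forall t, - r <= t -> t <= a -> `|p t| <= Mp) ->
    exists y : R -> V, [/\ (forall t, t <= a -> y t = p t), (exists K, hol K b y)
    & davie (f y) (y, fun t => G (y t, e.1 (t - r))) e y a b].
Proof.
move=> fok r0 LLam Mp0 Xch.
have CA0 := dr_CA fok.
have Lam1 : 1 <= Lam by apply: le_trans L1 LLam.
have Lam0 : 0 <= Lam by apply: le_trans Lam1.
set K1 := pic_K1 Lam; set K2 := pic_K2 CA Lam Mp; set K := pic_K CA Lam Mp.
have K10 : 0 <= K1 by rewrite /K1 /pic_K1; pos.
have K20 : 0 <= K2 by rewrite /K2 /pic_K2 /pic_D; pos.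
have K0 : 0 <= K by rewrite /K /pic_K -/K1 -/K2; pos.
have sc0 := sew_const_ge0 beta_gt.
have LK : L <= K by rewrite (le_trans LLam) // /K /pic_K -addrA lerDl addr_ge0.
have cc0 : 0 <= contr_const beta L K.
  by apply: le_trans (contr_const_ge1 beta_gt gc LK).
have db0 : 0 <= delta_bd Lam 1 K1 K2 by rewrite /delta_bd; pos.
set S1 := sew_const beta * delta_bd Lam 1 K1 K2.
set S2 := contr_const beta L K + CA * (K ^+ 2 + 2).
(* 1 / N meets all smallness conditions at once; on an interval of length N^-3 the powers of
   increments are at most 1 / N by [pow_small]. *)
pose N := 1 + K2 + S1 + (Lam ^+ 3 + 1) + 2 * S2.
have S10 : 0 <= S1 by rewrite mulr_ge0.
have S20 : 0 <= S2 by rewrite /S2; pos.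
have S30 : 0 <= Lam ^+ 3 + 1 by pos.
have N1 : 1 <= N by rewrite /N; lra.
have N0 : 0 < N by apply: lt_le_trans N1.
have inN x : x <= N -> x * N^-1 <= 1 by move=> xN; rewrite ler_pdivrMr // mul1r.
have e0 : 0 <= N^-1 by rewrite invr_ge0 ltW.
have e1 : N^-1 <= 1 by rewrite invf_le1.
exists (N^-1 ^+ 3); first by rewrite exprn_gt0 // invr_gt0.
move=> a b Kp p e Kp0 a0 ab abh Xbd ebd hp hM.
have pe : forall s t, a <= s -> s <= t -> t <= b -> pw s t <= N^-1.
  move=> s t h1 h2 h3; apply: le_trans (pow_small beta_gt e0 e1).
  by apply: pw_le => //; apply: le_trans abh; rewrite lerB.
have ab1 : b - a <= 1 by apply: le_trans abh _; rewrite exprn_ile1.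
have [||||y [h1 h2 h3]] := @pic_limit _ _ _ _ _ beta_gt beta_le _ _ _ _ gc _ _ _ fok Lam Mp Kp a b N^-1 p e
  r0 LLam Mp0 Kp0 a0 ab ab1 Xch Xbd ebd hp hM e0 e1 pe.
- by apply: inN; rewrite /N -/K2; lra.
- rewrite -/K1 -/K2 mulrAC -/S1; apply: inN; rewrite /N; lra.
- by apply: inN; rewrite /N; lra.
- rewrite -/K -/S2; have : 2 * S2 * N^-1 <= 1 by apply: inN; rewrite /N; lra.
  by rewrite -mulrA => h; lra.
by exists y; split=> //; exists (Kp + (Lam ^+ 3 + 1)).
Qed.

Section Apriori.
Variables (CA : R) (f : (R -> V) -> R -> R -> V).
Hypothesis fok : drift_ok CA f.
Let CA0 := dr_CA fok.
Variables (Lam a T M : R) (y : R -> V) (e : cpath R d n).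
Hypotheses (r_gt0 : 0 < r) (LLam : L <= Lam) (M0 : 0 <= M) (a0 : 0 <= a) (aT : a <= T)
  (Tr : T - a <= r).
Hypotheses (Xch : chen r X) (Xbd : rough_bd Lam a T) (ebd : ctrl_bd Lam (a - r) (T - r) e).
Hypotheses (yhol : exists K, hol K T y) (hM : forall t, - r <= t -> t <= T -> `|y t| <= M).
Let yy : cpath R d n := (y, fun t => G (y t, e.1 (t - r))).
Hypothesis ydav : davie (f y) yy e y a T.
Let D := CA * M.
Let u := delay_pair r yy e.
(* For a solution, rho is of order 2 beta.  The bound rho_bd 1 h holds for tiny
   h because y solves the equation.  As long as scale_ok h holds, rho_bd 1 h
   improves to rho_bd 8^-1 h, which leaves enough room to pass from h to 2 h:
   hence rho_bd 1 h holds up to the scale allowed by scale_ok, which is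
   polynomial in the data. *)
Definition rho (s t : R) : V := y t - y s - f y s t - incr (base X) s t *m G (u s).
(** The number 18 = 4 + 4 + 1 + 8 + 1 adds up the five terms of the sewing error in [rho_next]; the
    factor 16 leaves room for the improvement to 1/8 and for the defect in [rho_double]. *)
Definition mu : R := (16 * (1 + 18 * sew_const beta))^-1.

Let Lam1 : 1 <= Lam. Proof. exact: le_trans L1 LLam. Qed.
Let Lam0 : 0 <= Lam. Proof. exact: le_trans Lam1. Qed.
Let D0 : 0 <= D. Proof. by rewrite /D; pos. Qed.
Let sc0 := sew_const_ge0 beta_gt.

Lemma mu_gt0 : 0 < mu.
Proof. by rewrite invr_gt0; move: sc0; lra. Qed.
Lemma mu_le : 16 * mu <= 1.
Proof.
by rewrite /mu invfM mulrA divff // mul1r invf_le1 //; move: sc0; lra.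
Qed.
Lemma mu_sew : mu * (1 + 18 * sew_const beta) <= 8^-1.
Proof.
rewrite /mu invfM -mulrA mulVf ?mulr1; last by move: sc0; lra.
by lra.
Qed.

Lemma f_le s t : a <= s -> s <= t -> t <= T -> `|f y s t| <= D * (t - s).
Proof.
move=> h1 h2 h3; have [K hK] := yhol.
by apply: (dr_bd fok hK hM) => //; apply: le_trans h1.
Qed.

Lemma f_add : add_incr (f y) a T.
Proof.
have [K hK] := yhol; move=> s v t h1 h2 h3 h4.
by apply: (dr_add fok hK) => //; apply: le_trans h1.
Qed.

(** Lam^6 h^beta is the factor Lam^3 of the rough terms times an increment of order Lam^3 h^beta; D
    h is the increment of the drift. *)
Definition scale_ok h := [/\ 0 < h, h <= 1, Lam ^+ 6 * h `^ beta <= mu & Lam ^+ 3 * (D * h) <= mu].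
Definition rho_bd c h := forall s t, a <= s -> s <= t -> t <= T -> t - s <= h ->
  `|rho s t| <= c / h `^ beta * pw s t ^+ 2.

Lemma rem_local h s t : scale_ok h -> rho_bd 1 h -> a <= s -> s <= t -> t <= T -> t - s <= h ->
  `|remainder X yy s t| <= ((h `^ beta)^-1 + D * (h / (h `^ beta) ^+ 2)) * pw s t ^+ 2.
Proof.
move=> [h0 _ _ _] hr h1 h2 h3 h4.
rewrite (_ : remainder X yy s t = rho s t + f y s t); last first.
  by rewrite /remainder /rho /incr /=; move: (_ *m _) => *; mxring.
apply: le_trans (ler_normD _ _) _; rewrite mulrDl; apply: lerD.
  by have := hr s t h1 h2 h3 h4; rewrite div1r.
apply: le_trans (f_le h1 h2 h3) _; rewrite -[leRHS]mulrA ler_wpM2l //.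
exact: pw_lin.
Qed.

Section Scale.
Variable h : R.
Hypotheses (hok : scale_ok h) (hrho : rho_bd 1 h).
Let eps := h `^ beta.
Let K2 := eps^-1 + D * (h / eps ^+ 2).

Let h0 : 0 < h. Proof. by case: hok. Qed.
Let e0 : 0 < eps. Proof. exact: powR_gt0. Qed.
Let e1 : eps <= 1. Proof. by case: hok => ? ? _ _; apply: pow_le1 => //; apply: ltW. Qed.
Let K20 : 0 <= K2. Proof. by rewrite /K2; have := ltW e0; have := ltW h0; pos. Qed.
Let Lam_le k l : (k <= l)%N -> Lam ^+ k <= Lam ^+ l.
Proof. by move=> kl; rewrite ler_weXn2l. Qed.
Let Leps : Lam ^+ 3 * eps <= mu.
Proof.
case: hok => _ _ h1 _; apply: le_trans h1; rewrite ler_wpM2r ?(ltW e0) //; exact: Lam_le.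
Qed.
Let epsK2 : eps * K2 = 1 + D * h / eps.
Proof. by rewrite /K2; field; rewrite gt_eqF. Qed.

Section Interval.
Variables (s0 t0 : R).
Hypotheses (as0 : a <= s0) (st0 : s0 <= t0) (t0T : t0 <= T) (sth : t0 - s0 <= h).

Let Xbd' : rough_bd Lam s0 t0.
Proof. by move=> s t h1 h2 h3; apply: Xbd => //; [apply: le_trans h1|apply: le_trans t0T]. Qed.
Let ebd' : ctrl_bd Lam (s0 - r) (t0 - r) e.
Proof.
have [e_1 e_2 e_3] := ebd.
have ar : a - r <= s0 - r by rewrite lerB.
have tr : t0 - r <= T - r by rewrite lerB.
split.
- by move=> t h1 h2; apply: e_1; [apply: le_trans h1|apply: le_trans tr].
- by move=> s t h1 h2 h3; apply: e_2 => //; [apply: le_trans h1|apply: le_trans tr].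
- by move=> s t h1 h2 h3; apply: e_3 => //; [apply: le_trans h1|apply: le_trans tr].
Qed.
Let pwe s t : s0 <= s -> s <= t -> t <= t0 -> pw s t <= eps.
Proof. by move=> *; apply: pw_le => //; apply: le_trans sth; rewrite lerB. Qed.
Let y1 : sup_bd Lam s0 t0 yy.2.
Proof. by move=> t _ _; apply: le_trans (gc_G gc _) LLam. Qed.
Let y3 : rem_bd K2 s0 t0 yy.
Proof.
move=> s t h1 h2 h3; apply: rem_local => //.
- exact: le_trans h1.
- exact: le_trans t0T.
- by apply: le_trans sth; rewrite lerB.
Qed.

Lemma incr_local s t : s0 <= s -> s <= t -> t <= t0 ->
  `|u t - u s| <= (2 * Lam ^+ 3 + K2 * eps) * pw s t.
Proof. exact: (growth_u gc LLam K20 (ltW e0) e1 Xbd' ebd' y1 y3 pwe). Qed.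

Let K1 := Lam * (2 * Lam ^+ 3 + K2 * eps).
Let K10 : 0 <= K1. Proof. by rewrite /K1; have := ltW e0; pos. Qed.
Let y2 : holder_bd K1 s0 t0 yy.
Proof.
move=> s t h1 h2 h3; apply: le_trans (gc_Gl gc _ _) _; rewrite /K1 -mulrA.
by apply: ler_pM => //; apply: incr_local.
Qed.

(** The remainder bound K2 is of order 1 / eps, but so is the target: after multiplication by eps,
    K2 occurs in the combination eps^2 K2 = eps + D h, which [scale_ok] makes small. *)
Lemma rho_next : `|rho s0 t0| <= 8^-1 / eps * pw s0 t0 ^+ 2.
Proof.
have fadd : add_incr (f y) s0 t0.
  move=> s v t h1 h2 h3 h4; apply: f_add => //; first exact: le_trans h1.
  exact: le_trans t0T.
have dav : davie (f y) yy e y s0 t0.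
  have [C hC] := ydav; exists C => s t h1 h2 h3; apply: hC => //; first exact: le_trans h1.
  exact: le_trans t0T.
have [_] := growth_davie beta_gt gc LLam K10 K20 (ltW e0) e1 Xch Xbd' ebd' y1 y2 y3 pwe fadd dav
  (lexx s0) st0 (lexx t0).
move=> /le_trans; apply; rewrite ler_wpM2r ?pw2_ge0 // ler_pdivlMr //.
apply: le_trans mu_sew.
pose z := eps * (K2 * eps).
have zE : z = eps + D * h by rewrite /z (mulrC K2) epsK2; field; rewrite gt_eqF.
have Dh0 : 0 <= D * h by rewrite mulr_ge0 // ltW.
(* eps times the increment constant 2 Lam^3 + K2 eps of [incr_local]. *)
pose S := 2 * Lam ^+ 3 * eps + z.
have S0 : 0 <= S by rewrite /S /z; have := ltW e0; pos.
have [_ _ c1 c2] := hok; rewrite -/eps in c1.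
have LS : Lam ^+ 3 * S <= 4 * mu.
  have : Lam ^+ 3 * eps <= Lam ^+ 6 * eps by rewrite ler_wpM2r ?(ltW e0) // Lam_le.
  rewrite /S zE (_ : Lam ^+ 3 * (2 * Lam ^+ 3 * eps + (eps + D * h)) =
    2 * (Lam ^+ 6 * eps) + Lam ^+ 3 * eps + Lam ^+ 3 * (D * h)); last by ring.
  by lra.
have m0 := mu_gt0; have m1 := mu_le.
have L31 : 1 <= Lam ^+ 3 by apply: exprn_ege1.
have S1 : S <= 1.
  apply: (le_trans (y := Lam ^+ 3 * S)); first by rewrite ler_peMl.
  by lra.
have zS : z <= S by rewrite /S lerDr; have := ltW e0; pos.
have SS : Lam ^+ 3 * S ^+ 2 <= 4 * mu.
  apply: le_trans LS; rewrite ler_wpM2l ?exprn_ge0 // expr2 ler_piMl //.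
have Sz : Lam ^+ 3 * z <= 4 * mu by apply: le_trans LS; rewrite ler_wpM2l ?exprn_ge0.
have t3 : Lam ^+ 4 * eps ^+ 2 <= mu.
  apply: le_trans c1; rewrite expr2 mulrA; apply: (le_trans (y := Lam ^+ 4 * eps)).
    by rewrite ler_piMr // mulr_ge0 ?exprn_ge0 // ltW.
  by rewrite ler_wpM2r ?(ltW e0) // Lam_le.
have t5 : Lam ^+ 3 * eps ^+ 2 <= mu.
  by apply: le_trans t3; rewrite ler_wpM2r ?exprn_ge0 ?(ltW e0) // Lam_le.
have t4 : 2 * Lam ^+ 3 * eps * S <= 8 * mu.
  rewrite (_ : 2 * _ * _ * _ = 2 * (Lam ^+ 3 * S) * eps); last by ring.
  apply: (le_trans (y := 2 * (Lam ^+ 3 * S))); last by lra.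
  by rewrite ler_piMr //; pos.
rewrite (_ : (_ + _) * eps = Lam ^+ 3 * eps + sew_const beta *
   (Lam ^+ 3 * S ^+ 2 + Lam ^+ 3 * z + Lam ^+ 4 * eps ^+ 2 + 2 * Lam ^+ 3 * eps * S
     + Lam ^+ 3 * eps ^+ 2)); last by rewrite /delta_bd /K1 /S /z; ring.
rewrite [leRHS]mulrDr mulr1; apply: lerD.
  by apply: le_trans c1; rewrite ler_wpM2r ?(ltW e0) // Lam_le.
rewrite (_ : mu * _ = sew_const beta * (18 * mu)); last by ring.
by rewrite ler_wpM2l //; lra.
Qed.

End Interval.

(** [rho] is additive up to X_{v,t} (G(u v) - G(u s)), which [scale_ok] bounds with the constant 1 /
    (4 h^beta). With 1 / (8 h^beta) from each half the total is 1 / (2 h^beta), at most 1 / (2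
    h)^beta because beta <= 1. *)
Lemma rho_double : scale_ok (h * 2) -> rho_bd 1 (h * 2).
Proof.
move=> _ s t h1 h2 h3 h4.
pose v := (s + t) / 2.
have sv : s <= v by rewrite /v; lra.
have vt : v <= t by rewrite /v; lra.
have av : a <= v by lra.
have vT : v <= T by lra.
have svh : v - s <= h by rewrite /v; lra.
have vth : t - v <= h by rewrite /v; lra.
rewrite (_ : rho s t = rho s v + rho v t + incr (base X) v t *m (G (u v) - G (u s))); last first.
  rewrite /rho (f_add h1 sv vt h3) (incrD (base X) s v t) mulmxDl mulmxBr.
  by move: (_ *m _) (_ *m _) (_ *m _) => *; mxring.
have R1 := rho_next h1 sv vT svh.
have R2 := rho_next av vt h3 vth.
have I1 := incr_local h1 vT svh (lexx s) sv (lexx v).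
have m1 : pw s v <= pw s t by apply: pw_mono.
have m2 : pw v t <= pw s t by apply: pw_mono.
have p0 := pw_ge0 beta.
have q1 : pw s v ^+ 2 <= pw s t ^+ 2 by rewrite lerXn2r ?nnegrE.
have q2 : pw v t ^+ 2 <= pw s t ^+ 2 by rewrite lerXn2r ?nnegrE.
have [hX _ _ _] := Xbd av vt h3.
have e81 : 0 <= 8^-1 / eps by rewrite divr_ge0 // ltW.
have Dh0 : 0 <= D * h by rewrite mulr_ge0 // ltW.
have Nu0 : 0 <= 2 * Lam ^+ 3 + K2 * eps by have := ltW e0; pos.
have [_ _ c1 c2] := hok; rewrite -/eps in c1.
have R3 : `|incr (base X) v t *m (G (u v) - G (u s))| <= (4^-1 / eps) * pw s t ^+ 2.
  apply: le_trans (gc_M gc _ _) _.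
  apply: (le_trans (y := Lam * (Lam * pw s t) * (Lam * ((2 * Lam ^+ 3 + K2 * eps) * pw s t)))).
    apply: ler_pM; rewrite ?mulr_ge0 //.
      by apply: ler_pM => //; apply: le_trans hX _; rewrite ler_wpM2l.
    apply: le_trans (gc_Gl gc _ _) _; apply: ler_pM => //.
    by apply: le_trans I1 _; rewrite ler_wpM2l.
  rewrite (_ : Lam * _ * _ = (Lam ^+ 3 * (2 * Lam ^+ 3 + K2 * eps)) * pw s t ^+ 2); last by ring.
  rewrite ler_wpM2r ?exprn_ge0 // ler_pdivlMr //.
  rewrite (_ : _ * eps = 2 * (Lam ^+ 6 * eps) + Lam ^+ 3 * eps * (eps * K2)); last by ring.
  rewrite epsK2 (_ : _ * (1 + _) = Lam ^+ 3 * eps + Lam ^+ 3 * (D * h)); last first.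
    by field; rewrite gt_eqF.
  by have := mu_le; have := Leps; lra.
apply: (le_trans (y := (2^-1 / eps) * pw s t ^+ 2)).
  apply: le_trans (ler_normD _ _) _.
  apply: le_trans (lerD (ler_normD _ _) R3) _.
  apply: le_trans (lerD (lerD R1 R2) (lexx _)) _.
  apply: le_trans (lerD (lerD (ler_wpM2l e81 q1) (ler_wpM2l e81 q2)) (lexx _)) _.
  by rewrite -!mulrDl (_ : 8^-1 + 8^-1 + 4^-1 = 2^-1 :> R) //; field.
rewrite ler_wpM2r ?exprn_ge0 // div1r -invfM lef_pV2 ?posrE ?mulr_gt0 ?powR_gt0 ?mulr_gt0 //.
rewrite powRM ?(ltW h0) // -/eps [leRHS]mulrC ler_wpM2l ?(ltW e0) //.
by rewrite ler1_powR ?ler1n //; move: beta_le; lra.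
Qed.

End Scale.

Lemma scale_ok_le h h' : 0 < h -> h <= h' -> scale_ok h' -> scale_ok h.
Proof.
move=> h0 hh [g0 g1 g2 g3]; split=> //; first exact: le_trans g1.
- by apply: le_trans g2; rewrite ler_wpM2l ?exprn_ge0 // powR_le // ltW.
- by apply: le_trans g3; rewrite ler_wpM2l ?exprn_ge0 // ler_wpM2l.
Qed.

(** Dyadic scales are climbed from below. At scale h / 2^j the bound follows from the Davie constant
    of y, which influences the number j of doublings but not the bound reached at h. *)
Lemma rho_all h : scale_ok h -> rho_bd 8^-1 h.
Proof.
move=> hok; have [h0 h1 _ _] := hok.
suff P : rho_bd 1 h by move=> s t *; apply: (rho_next hok P).
have [j hj] : exists j : nat, rho_bd 1 (h / 2 ^+ j).
  have [C hC] := ydav.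
  pose N2 := Lam ^+ 3 + `|C| * pw a T.
  have N20 : 0 <= N2 by rewrite /N2; pos.
  (* A scale below dl^3 has its power beta at most dl, so that the inverse of this power exceeds N2,
     the crude constant for [rho]. *)
  pose dl := (N2 + 1)^-1.
  have dl0 : 0 < dl by rewrite invr_gt0 ltr_wpDl.
  have dl1 : dl <= 1 by rewrite invf_le1 ?lerDr // ltr_wpDl.
  have q1 : (2^-1 : R) < 1 by rewrite invf_lt1 ?ltr1n.
  have dl3 : 0 < dl ^+ 3 by rewrite exprn_gt0.
  have q0 : 0 <= (2^-1 : R) by rewrite invr_ge0.
  have [j hj] := expr_lt_eps h q0 q1 dl3.
  exists j => s t g1 g2 g3 g4.
  have [hX _ hA hB] := Xbd g1 g2 g3.
  have rho2 : `|rho s t| <= N2 * pw s t ^+ 2.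
    rewrite (_ : rho s t = (y t - y s - f y s t - dgerm yy e s t)
      + PP (u s) (delay_deriv r yy e s) (area X s t, delayed_area X s t)); last first.
      by rewrite /rho /delay_germ /germ -/u; move: (PP _ _ _) (_ *m _) => *; mxring.
    apply: le_trans (ler_normD _ _) _; rewrite addrC /N2 mulrDl; apply: lerD.
      apply: le_trans (gc_P gc _ _ _) _.
      rewrite (_ : Lam ^+ 3 * _ = Lam * Lam * (Lam * pw s t ^+ 2)); last by ring.
      apply: ler_pM; rewrite ?mulr_ge0 //; last exact: pair_le.
      apply: ler_pM => //; apply: pair_le.
        by apply: le_trans (gc_G gc _) LLam.
      have [e_1 _ _] := ebd; apply: e_1; first by rewrite lerB.
      by rewrite lerB // (le_trans g2).
    apply: le_trans (hC s t g1 g2 g3) _.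
    rewrite (_ : `|C| * _ * _ = `|C| * (pw a T * pw s t ^+ 2)); last by ring.
    apply: le_trans (ler_wpM2r (pw3_ge0 _ _ _) (ler_norm C)) _.
    by rewrite ler_wpM2l // exprS ler_wpM2r ?pw2_ge0 // pw_mono.
  apply: le_trans rho2 _; rewrite ler_wpM2r ?pw2_ge0 // div1r.
  have hj0 : 0 < h / 2 ^+ j by rewrite divr_gt0 ?exprn_gt0.
  have N2p : 0 < N2.
    apply: ltr_pwDl; first by rewrite exprn_gt0 // (lt_le_trans ltr01 Lam1).
    by rewrite mulr_ge0 ?pw_ge0.
  rewrite -[leLHS]invrK lef_pV2 ?posrE ?invr_gt0 ?powR_gt0 //.
  apply: (le_trans (y := dl)); last first.
    by rewrite /dl lef_pV2 ?posrE ?lerDl // ltr_wpDl.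
  apply: le_trans (pow_small beta_gt (ltW dl0) dl1).
  by apply: powR_le => //; [exact: ltW|rewrite -exprVn mulrC ltW].
elim: j hj => [|j IH]; first by rewrite expr0 divr1.
move=> hj; apply: IH.
have hj1 : 0 < h / 2 ^+ j.+1 by rewrite divr_gt0 ?exprn_gt0.
have hj0 : 0 < h / 2 ^+ j by rewrite divr_gt0 ?exprn_gt0.
have le1 k : h / 2 ^+ k <= h by rewrite ler_piMr ?(ltW h0) // invf_le1 ?exprn_gt0 // exprn_ege1 ?ler1n.
have E : h / 2 ^+ j = h / 2 ^+ j.+1 * 2 by rewrite exprS; field; rewrite expf_neq0.
rewrite E; apply: rho_double => //; first exact: scale_ok_le hok.
by rewrite -E; exact: scale_ok_le hok.
Qed.

End Apriori.
End Bootstrap.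

(** * The rough part at an explicit scale *)

Section BoundedScale.
Context {R : realType} {n d : nat}.
Variables (r beta : R).
Hypotheses (beta_gt : 3^-1 < beta) (beta_le : beta <= 2^-1).
Local Notation pw := (hpow beta).
Local Notation V := 'rV[R]_n.
Local Notation M := 'M[R]_(d, n).
Local Notation U := (V * V)%type.
Local Notation H := (M * M)%type.
Local Notation W := ('M[R]_d * 'M[R]_d)%type.

Variables (L : R) (G : U -> M) (DG : U -> U -> M) (PP : U -> H -> W -> V).
Hypothesis gc : germ_coeff L G DG (@pair_act R n d) PP (@pair_tens R d).
Variable X : delayed_path R d.
Local Notation rough_bd := (rough_bd r beta X).
Local Notation ctrl_bd := (ctrl_bd beta X).
Local Notation davie := (davie r beta G PP X).

Let L1 := gc_L gc.
Let L0 : 0 <= L. Proof. exact: le_trans L1. Qed.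

Implicit Types (y e : cpath R d n) (a b : R) (f : R -> R -> V).
Local Notation hol := (hol r beta).
Local Notation drift_ok := (drift_ok r beta).

Lemma nat_above (x : R) : 0 <= x -> exists2 k : nat, x <= k%:R & k%:R <= x + 1.
Proof.
move=> x0; exists (Num.truncn x).+1.
  have /andP[h1 h2] := truncn_itv x0.
  exact: ltW.
by have /andP[h1 h2] := truncn_itv x0; rewrite -natr1 lerD2r.
Qed.

Lemma chop_bound (F : R -> R -> V) a T h v : 0 < h -> 0 <= v -> add_incr F a T ->
  (forall s t, a <= s -> s <= t -> t <= T -> t - s <= h -> `|F s t| <= v) ->
  forall s t, a <= s -> s <= t -> t <= T -> `|F s t| <= ((t - s) / h + 1) * v.
Proof.
move=> h0 v0 Fadd Fh s t h1 h2 h3.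
have P k : forall s, a <= s -> s <= t -> t - s <= k.+1%:R * h -> `|F s t| <= k.+1%:R * v.
  elim: k => [|k IH] s' g1 g2; first by rewrite !mul1r; exact: Fh.
  rewrite -natr1 mulrDl mul1r => g3.
  have [sh|/ltW hs] := leP (s' + h) t.
    rewrite (Fadd s' (s' + h) t) // ?lerDl ?(ltW h0) //.
    apply: le_trans (ler_normD _ _) _; rewrite mulrDl mul1r addrC; apply: lerD.
      by apply: IH => //; [apply: le_trans g1 _; rewrite lerDl ltW|lra].
    by apply: Fh; rewrite // ?lerDl ?(ltW h0) ?(le_trans sh) //; lra.
  rewrite mulrDl mul1r; apply: le_trans (_ : v <= _); last by rewrite lerDr mulr_ge0.
  by apply: Fh => //; lra.
have ts0 : 0 <= t - s by rewrite subr_ge0.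
have [k hk1 hk2] := nat_above (divr_ge0 ts0 (ltW h0)).
rewrite ler_pdivrMr // in hk1.
case: k hk1 hk2 => [|k] hk1 hk2.
  rewrite mul0r subr_le0 in hk1; have -> : t = s by apply/le_anti/andP.
  rewrite subrr mul0r add0r mul1r; apply: Fh => //; first exact: le_trans h2 h3.
  by rewrite subrr ltW.
by apply: le_trans (P k s h1 h2 hk1) _; rewrite ler_wpM2r.
Qed.

Section RoughPart.
Variables (CA : R) (f : (R -> V) -> R -> R -> V).
Hypothesis fok : drift_ok CA f.
Let CA0 := dr_CA fok.
Variables (Lam a T M : R) (y : R -> V) (e : cpath R d n).
Hypotheses (r_gt0 : 0 < r) (LLam : L <= Lam) (M0 : 0 <= M) (a0 : 0 <= a) (aT : a <= T)
  (Tr : T - a <= r).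
Hypotheses (Xch : chen r X) (Xbd : rough_bd Lam a T) (ebd : ctrl_bd Lam (a - r) (T - r) e).
Hypotheses (yhol : exists K, hol K T y) (hM : forall t, - r <= t -> t <= T -> `|y t| <= M).
Let yy : cpath R d n := (y, fun t => G (y t, e.1 (t - r))).
Hypothesis ydav : davie (f y) yy e y a T.
Variable b : R.
Hypothesis b_ge : (mu beta)^-1 <= b.
Local Notation mu := (mu beta).
Let mu0 : 0 < mu. Proof. exact: mu_gt0. Qed.
Let mu1 : mu <= 1. Proof. by have := mu_le beta_gt; move: mu0; lra. Qed.
Let b1 : 1 <= b. Proof. by apply: le_trans b_ge; rewrite invf_ge1. Qed.
Let b0 : 0 < b. Proof. by apply: lt_le_trans b1. Qed.
Let Lam1 : 1 <= Lam. Proof. exact: le_trans L1 LLam. Qed.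
Let Lam0 : 0 < Lam. Proof. exact: lt_le_trans Lam1. Qed.
Let D := CA * M.
Let D0 : 0 <= D. Proof. by rewrite /D; pos. Qed.

(* The parameter b is taken large to make the contribution of the sup norm of y
   to rough_part small. *)
Definition scale_inv : R := Lam ^+ 3 * (CA * M) / mu + b ^+ 3 * Lam ^+ 18.
Let si1 : b ^+ 3 * Lam ^+ 18 <= scale_inv.
Proof. by rewrite /scale_inv lerDr; have := ltW mu0; have := ltW Lam0; pos. Qed.
Let bL1 : 1 <= b * Lam ^+ 6.
Proof. by rewrite -[leLHS]mulr1; apply: ler_pM => //; rewrite exprn_ege1. Qed.
Let bL3 : b ^+ 3 * Lam ^+ 18 = (b * Lam ^+ 6) ^+ 3.
Proof. by rewrite exprMn -exprM. Qed.
Let si0 : 0 < scale_inv.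
Proof. by apply: lt_le_trans si1; rewrite bL3 exprn_gt0 // (lt_le_trans ltr01). Qed.
Let h := scale_inv^-1.
Let h0 : 0 < h. Proof. by rewrite invr_gt0. Qed.

Let bL0 : 0 < b * Lam ^+ 6. Proof. exact: lt_le_trans bL1. Qed.
(** b^3 Lam^18 is the cube of b Lam^6, so [pow_small] applies; this is the origin of the exponent
    18. *)
Let heps : h `^ beta <= (b * Lam ^+ 6)^-1.
Proof.
have i1 : (b * Lam ^+ 6)^-1 <= 1 by rewrite invf_le1.
have i0 : 0 <= (b * Lam ^+ 6)^-1 by rewrite invr_ge0 ltW.
apply: le_trans (pow_small beta_gt i0 i1).
apply: powR_le => //; first exact: ltW.
by rewrite exprVn -bL3 lef_pV2 ?posrE // bL3 exprn_gt0.
Qed.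

Lemma scale_inv_ok : scale_ok beta CA Lam M h.
Proof.
split=> //.
- rewrite invf_le1 // (le_trans _ si1) // bL3 exprn_ege1 //.
- apply: le_trans (ler_wpM2l _ heps) _; first by rewrite exprn_ge0 // ltW.
  rewrite invfM mulrCA divff ?mulr1 ?expf_neq0 ?gt_eqF //.
  by rewrite -[leRHS]invrK lef_pV2 ?posrE // invr_gt0.
- rewrite mulrA /h ler_pdivrMr //.
  rewrite (_ : mu * scale_inv = Lam ^+ 3 * (CA * M) + mu * (b ^+ 3 * Lam ^+ 18)); last first.
    by rewrite /scale_inv; field; rewrite gt_eqF.
  by rewrite lerDl; have := ltW b0; have := ltW Lam0; have := ltW mu0; pos.
Qed.

(** There are about r / h pieces, each contributing at most 2 Lam^3 h^beta, and 1 / h is affine in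
    M. The coefficient of M is thus a multiple of Lam^6 h^beta <= 1 / b: it is free of Lam, and a
    large b makes it small. *)
Lemma rough_part s t : a <= s -> s <= t -> t <= T ->
  `|y t - y s - f y s t| <= 2 * r / (b * mu) * D + 2 * (r * (b ^+ 3 * Lam ^+ 18) + 1).
Proof.
move=> h1 h2 h3.
have ok := scale_inv_ok.
have e0 : 0 < h `^ beta by apply: powR_gt0.
have F1 := rho_all beta_gt beta_le gc fok LLam M0 a0 Xch Xbd ebd yhol hM ydav ok.
have Fa : add_incr (fun s t => y t - y s - f y s t) a T.
  move=> s' v t' g1 g2 g3 g4.
  by rewrite (f_add fok a0 yhol g1 g2 g3 g4); mxring.
pose v := 2 * (Lam ^+ 3 * h `^ beta).
have L3 : 0 <= Lam ^+ 3 by rewrite exprn_ge0 // ltW.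
have v0 : 0 <= v by rewrite /v; have := ltW e0; pos.
have st : forall s t, a <= s -> s <= t -> t <= T -> t - s <= h -> `|y t - y s - f y s t| <= v.
  move=> s' t' g1 g2 g3 g4; have [hX _ _ _] := Xbd g1 g2 g3.
  have pe : pw s' t' <= h `^ beta by apply: pw_le.
  rewrite (_ : _ - _ = incr (base X) s' t' *m G (delay_pair r yy e s')
    + rho r G X f y e s' t'); last by rewrite /rho -/yy; move: (_ *m _) => *; mxring.
  apply: le_trans (ler_normD _ _) _; rewrite /v mulr_natl mulr2n; apply: lerD.
    apply: le_trans (gc_M gc _ _) _.
    rewrite (_ : Lam ^+ 3 * _ = Lam * (Lam * h `^ beta) * Lam); last by ring.
    apply: ler_pM; rewrite ?mulr_ge0 //; last by apply: le_trans (gc_G gc _) LLam.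
    apply: ler_pM => //; apply: le_trans hX _; rewrite ler_wpM2l //; exact: ltW.
  apply: le_trans (F1 s' t' g1 g2 g3 g4) _.
  apply: (le_trans (y := 8^-1 / h `^ beta * (h `^ beta) ^+ 2)).
    rewrite ler_wpM2l //; first by rewrite divr_ge0 // ltW.
    by rewrite lerXn2r ?nnegrE ?pw_ge0 ?(ltW e0).
  rewrite expr2 mulrA divfK ?gt_eqF // ler_wpM2r ?(ltW e0) //.
  by apply: le_trans (exprn_ege1 3 Lam1); rewrite invf_le1 // ler1n.
apply: le_trans (chop_bound h0 v0 Fa st h1 h2 h3) _.
have tsr : t - s <= r by apply: le_trans Tr; rewrite lerB.
apply: (le_trans (y := (r / h + 1) * v)).
  by rewrite ler_wpM2r // lerD2r ler_wpM2r // invr_ge0 ltW.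
rewrite /h invrK /scale_inv -/D.
have c1 : Lam ^+ 6 * h `^ beta <= b^-1.
  apply: le_trans (ler_wpM2l _ heps) _; first by rewrite exprn_ge0 // ltW.
  by rewrite invfM mulrCA divff ?mulr1 ?expf_neq0 ?gt_eqF.
have c2 : Lam ^+ 3 * h `^ beta <= 1.
  apply: (le_trans (y := Lam ^+ 6 * h `^ beta)).
    by rewrite ler_wpM2r ?(ltW e0) // ler_weXn2l.
  by apply: le_trans c1 _; rewrite invf_le1.
have -> : (r * (Lam ^+ 3 * D / mu + b ^+ 3 * Lam ^+ 18) + 1) * v
  = 2 * r / mu * D * (Lam ^+ 6 * h `^ beta) + 2 * (r * (b ^+ 3 * Lam ^+ 18) + 1) * (Lam ^+ 3 * h `^ beta).
  by rewrite /v; field; rewrite gt_eqF.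
have r0 := ltW r_gt0; have m0 := ltW mu0; have bb := ltW b0; have ll := ltW Lam0.
apply: lerD.
  rewrite (_ : 2 * r / (b * mu) * D = 2 * r / mu * D * b^-1); last by field; rewrite !gt_eqF.
  by rewrite ler_wpM2l //; pos.
by rewrite ler_piMr //; pos.
Qed.

End RoughPart.

End BoundedScale.

(** * Polynomial a priori bounds *)

Section Uniform.
Context {R : realType} {n d : nat}.
Variables (r beta : R).
Hypotheses (beta_gt : 3^-1 < beta) (beta_le : beta <= 2^-1).
Local Notation pw := (hpow beta).
Local Notation V := 'rV[R]_n.
Local Notation M := 'M[R]_(d, n).
Local Notation U := (V * V)%type.
Local Notation H := (M * M)%type.
Local Notation W := ('M[R]_d * 'M[R]_d)%type.
Variables (L : R) (G : U -> M) (DG : U -> U -> M) (PP : U -> H -> W -> V).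
Hypothesis gc : germ_coeff L G DG (@pair_act R n d) PP (@pair_tens R d).
Let L1 := gc_L gc.
Let L0 : 0 <= L. Proof. exact: le_trans L1. Qed.
Local Notation hol := (hol r beta).
Local Notation drift_ok := (drift_ok r beta).

(** Two improvements are nested. Given a bound M of |y|, the rough part is at most Vc, affine in M,
    and the drift is absorbed on steps of length tau, where CA tau <= 1/2; a step doubles the bound,
    up to Vc. The number J of steps depends on CA and r only, so b can be fixed in advance to make
    the coefficient of M after J steps at most 1/2. The outer improvement then removes M. *)
Lemma apriori_sup CA : 0 <= CA -> 0 < r ->
  exists2 C, 0 <= C & forall X (f : (R -> V) -> R -> R -> V), drift_ok CA f -> chen r X ->
  forall Lam a T m0 (y : R -> V) (e : cpath R d n),
    L <= Lam -> 0 <= m0 -> 0 <= a -> a <= T -> T - a <= r -> rough_bd r beta X Lam a T ->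
    ctrl_bd beta X Lam (a - r) (T - r) e -> (exists K, hol K T y) ->
    (forall t, - r <= t -> t <= a -> `|y t| <= m0) ->
    davie r beta G PP X (f y) (y, fun t => G (y t, e.1 (t - r))) e y a T ->
    forall t, - r <= t -> t <= T -> `|y t| <= C * (m0 + Lam ^+ 18).
Proof.
move=> CA0 r_gt0.
pose tau := (2 * CA + 1)^-1.
have tau0 : 0 < tau by rewrite invr_gt0; lra.
have CAtau : CA * tau <= 2^-1 by rewrite ler_pdivrMr; lra.
have [J hJ _] := nat_above (divr_ge0 (ltW r_gt0) (ltW tau0)).
rewrite ler_pdivrMr // in hJ.
have mu0 := mu_gt0 beta_gt; have m0' := ltW mu0; have r0 := ltW r_gt0.
(* With this b, the coefficient of M after J steps, 4 * 2^J r CA / (b mu), is at most 1/2. *)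
pose b := (mu beta)^-1 * (1 + 8 * 2 ^+ J * r * CA).
have bmu : b * mu beta = 1 + 8 * 2 ^+ J * r * CA by rewrite /b mulrAC mulVf ?mul1r // gt_eqF.
have bmu1 : 0 <= 8 * 2 ^+ J * r * CA by pos.
have b_ge : (mu beta)^-1 <= b.
  rewrite /b; apply: ler_peMr; first by rewrite invr_ge0.
  by rewrite lerDl.
have b0 : 0 <= b by apply: le_trans b_ge; rewrite invr_ge0.
have J1 : 1 <= 2 ^+ J :> R by rewrite exprn_ege1 // ler1n.
pose C := 2 * 2 ^+ J * (1 + 4 * (r * b ^+ 3 + 1)).
exists C; first by rewrite /C; pos.
move=> X f fok Xch Lam a T m0 y e LLam mm0 a0 aT Tr Xbd ebd yhol hm0 ydav.
have Lam1 : 1 <= Lam by apply: le_trans L1 LLam.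
have Lam0 : 0 <= Lam by apply: le_trans Lam1.
have L18 : 1 <= Lam ^+ 18 by apply: exprn_ege1.
pose Pb := 2 * (r * (b ^+ 3 * Lam ^+ 18) + 1).
have Pb0 : 0 <= Pb by rewrite /Pb; pos.
have [K hK] := yhol.
have key : forall t, (- r <= t /\ t <= T) -> `|y t| <= (2 ^+ J * (m0 + 2 * Pb)) / (1 - 2^-1) * 1.
  apply: improve_bound => //.
  - by rewrite invf_lt1 ?ltr1n.
  - by pos.
  - exists (m0 + `|K| * pw a T); first by have := pw_ge0 beta a T; pos.
    move=> t [h1 h2]; rewrite mulr1.
    have [ta|/ltW at_] := leP t a; first by apply: le_trans (hm0 t h1 ta) _; rewrite lerDl; have := pw_ge0 beta a T; pos.
    have ra : - r <= a by lra.
    rewrite (_ : y t = y a + (y t - y a)); last by mxring.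
    apply: le_trans (ler_normD _ _) _; apply: lerD; first exact: hm0.
    apply: le_trans (hK _ _ ra at_ h2) _.
    apply: le_trans (ler_wpM2r (pw_ge0 _ _ _) (ler_norm K)) _.
    by rewrite ler_wpM2l // pw_mono.
  move=> M M0 hM t [h1 h2]; rewrite mulr1.
  have {}hM t' : - r <= t' -> t' <= T -> `|y t'| <= M.
    by move=> g1 g2; rewrite -[M]mulr1; apply: hM.
  pose Vc := 2 * r / (b * mu beta) * (CA * M) + Pb.
  have Vc0 : 0 <= Vc by rewrite /Vc; pos.
  have RP := rough_part beta_gt beta_le gc fok r_gt0 LLam M0 a0 Tr Xch Xbd ebd yhol hM ydav b_ge.
  rewrite -/Pb -/Vc in RP.
  (* Solves m (j + 1) = 2 (m j + Vc) with m 0 = m0. *)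
  pose m j := 2 ^+ j * (m0 + 2 * Vc) - 2 * Vc.
  have m_pos j : 0 <= m j.
    rewrite /m; have : 1 <= 2 ^+ j :> R by rewrite exprn_ege1 // ler1n.
    by move=> h; have : 0 <= (2 ^+ j - 1) * (m0 + 2 * Vc); [rewrite mulr_ge0 ?subr_ge0 //; pos|lra].
  have G_ j : forall t, - r <= t -> t <= T -> t <= a + j%:R * tau -> `|y t| <= m j.
    elim: j => [|j IH] t' g1 g2.
      rewrite mul0r addr0 => g3; rewrite /m expr0 mul1r addrK; exact: hm0.
    move=> g3.
    (* On the current step the drift costs at most half of a bound of |y| up to the time considered,
       which the inner improvement absorbs. *)
    have : forall x, (- r <= x /\ x <= T /\ x <= a + j.+1%:R * tau) ->
        `|y x| <= (m j + Vc) / (1 - 2^-1) * 1.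
      apply: improve_bound => //.
      - by rewrite invf_lt1 ?ltr1n.
      - exact: addr_ge0.
      - by exists M => // x [k1 [k2 _]]; rewrite mulr1; apply: hM.
      move=> x x0 hx z [k1 [k2 k3]]; rewrite mulr1.
      have {}hx z' : - r <= z' -> z' <= z -> `|y z'| <= x.
        move=> i1 i2; rewrite -[x]mulr1; apply: hx; split=> //.
        by split; [apply: le_trans k2|apply: le_trans k3].
      have [za|/ltW az] := leP z (a + j%:R * tau).
        by apply: le_trans (IH z k1 k2 za) _; rewrite [leRHS]addrCA lerDl addr_ge0 // mulr_ge0 // invr_ge0.
      pose s := a + j%:R * tau.
      have as_ : a <= s by rewrite /s lerDl mulr_ge0 // ltW.
      have rs : - r <= s by lra.
      have sT : s <= T by apply: le_trans k2.
      rewrite (_ : y z = y s + (y z - y s - f y s z) + f y s z); last by mxring.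
      apply: le_trans (ler_normD _ _) _; rewrite addrC; apply: lerD.
        have hKz : hol K z y by move=> s' t'' i1 i2 i3; apply: hK => //; apply: le_trans k2.
        have s0 : 0 <= s by apply: le_trans as_.
        apply: le_trans (dr_bd fok hKz hx s0 az (lexx z)) _.
        have zs : z - s <= tau by move: k3; rewrite -natr1 /s; lra.
        apply: (le_trans (y := CA * x * tau)); first by rewrite ler_wpM2l // mulr_ge0.
        by rewrite mulrAC ler_wpM2r.
      apply: le_trans (ler_normD _ _) _; apply: lerD; first exact: IH.
      exact: RP.
    move=> /(_ t' (conj g1 (conj g2 g3))) /le_trans; apply.
    rewrite mulr1 (_ : 1 - 2^-1 = 2^-1 :> R); last by field.
    by rewrite invrK /m exprS; lra.
  have tJ : t <= a + J%:R * tau by lra.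
  apply: le_trans (G_ J t h1 h2 tJ) _.
  apply: (le_trans (y := 2 ^+ J * (m0 + 2 * Vc))); first by rewrite /m gerBl mulr_ge0.
  rewrite (_ : 2 ^+ J * (m0 + 2 * Vc) = 2 ^+ J * 4 * r * CA / (b * mu beta) * M + 2 ^+ J * (m0 + 2 * Pb)); last first.
    by rewrite /Vc; field; rewrite !gt_eqF //; apply: lt_le_trans b_ge; rewrite invr_gt0.
  rewrite lerD2r ler_wpM2r // ler_pdivrMr; last by rewrite bmu; lra.
  by rewrite bmu; lra.
move=> t h1 h2; apply: le_trans (key t (conj h1 h2)) _.
rewrite mulr1 (_ : 1 - 2^-1 = 2^-1 :> R); last by field.
rewrite invrK /C /Pb.
have J0 : 0 <= 2 ^+ J :> R by apply: le_trans J1.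
rewrite (_ : 2 ^+ J * _ * 2 = 2 * 2 ^+ J * (m0 + 4 * (r * b ^+ 3 * Lam ^+ 18 + 1))); last by ring.
rewrite -[leRHS]mulrA; apply: ler_wpM2l; first by pos.
have q0 : 0 <= r * b ^+ 3 by pos.
move: q0 L18; set s := r * b ^+ 3; set w := Lam ^+ 18 => q0 L18.
have : 0 <= (s + 1) * m0 by pos.
by nra.
Qed.

(** Below the scale h of [rho_all] the local estimates apply. Above it, increments are bounded by
    sup norms, and 1 <= Q (t - s)^beta because 1 / h^beta <= 1 / h <= Q. The exponent 40 = 4 + 2 *
    18 comes from Y^4 Q^2 with Q = c Y^18. *)
Lemma apriori_ctrl CA : 0 <= CA -> 0 < r ->
  exists2 C, 0 <= C & forall X (f : (R -> V) -> R -> R -> V), drift_ok CA f -> chen r X ->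
  forall Lam a T M (y : R -> V) (e : cpath R d n),
    L <= Lam -> 0 <= M -> 0 <= a -> a <= T -> rough_bd r beta X Lam a T ->
    ctrl_bd beta X Lam (a - r) (T - r) e -> (exists K, hol K T y) ->
    (forall t, - r <= t -> t <= T -> `|y t| <= M) ->
    davie r beta G PP X (f y) (y, fun t => G (y t, e.1 (t - r))) e y a T ->
    ctrl_bd beta X (C * (Lam + M) ^+ 40) a T (y, fun t => G (y t, e.1 (t - r))).
Proof.
move=> CA0 r_gt0.
have mu0 := mu_gt0 beta_gt; have m0 := ltW mu0.
have mu1 : mu beta <= 1 by have := mu_le beta_gt; lra.
pose b := (mu beta)^-1.
have b1 : 1 <= b by rewrite invf_ge1.
have b0 : 0 <= b by apply: le_trans b1.
pose c := CA / mu beta + b ^+ 3.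
have c1 : 1 <= c.
  by apply: (le_trans (exprn_ege1 3 b1)); rewrite lerDr; pos.
have c0 : 0 <= c by apply: le_trans c1.
exists (4 * c ^+ 2); first by pos.
move=> X f fok Xch Lam a T M y e LLam M0 a0 aT Xbd ebd yhol hM ydav.
have Lam1 : 1 <= Lam by apply: le_trans L1 LLam.
have Lam0 : 0 <= Lam by apply: le_trans Lam1.
pose Y := Lam + M.
have LY : Lam <= Y by rewrite lerDl.
have MY : M <= Y by rewrite lerDr.
have Y1 : 1 <= Y by apply: le_trans LY.
have Y0 : 0 <= Y by apply: le_trans Y1.
have YX k l : (k <= l)%N -> Y ^+ k <= Y ^+ l by move=> kl; rewrite ler_weXn2l.
pose Q := c * Y ^+ 18.
have Q1 : 1 <= Q by rewrite -[leLHS]mulr1; apply: ler_pM => //; rewrite exprn_ege1.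
have Q0 : 0 <= Q by apply: le_trans Q1.
have hb : (mu beta)^-1 <= b by [].
have ok := scale_inv_ok beta_gt gc fok LLam M0 hb.
have F1 := rho_all beta_gt beta_le gc fok LLam M0 a0 Xch Xbd ebd yhol hM ydav ok.
set si := scale_inv beta CA Lam M b in ok F1.
set h := si^-1 in ok F1.
have [h0 h1 o1 o2] := ok.
set eps := h `^ beta in o1 F1.
have e0 : 0 < eps by apply: powR_gt0.
have siQ : si <= Q.
  rewrite /si /scale_inv /Q /c mulrDl; apply: lerD; last first.
    by rewrite ler_wpM2l ?exprn_ge0 // lerXn2r ?nnegrE.
  rewrite (_ : Lam ^+ 3 * (CA * M) / mu beta = CA / mu beta * (Lam ^+ 3 * M)); last by ring.
  rewrite ler_wpM2l //; first by pos.
  apply: (le_trans (y := Y ^+ 3 * Y)); last by rewrite -exprSr YX.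
  by apply: ler_pM; rewrite ?exprn_ge0 // lerXn2r ?nnegrE.
have qQ : eps^-1 <= Q.
  apply: le_trans siQ; rewrite -[leRHS]invrK lef_pV2 ?posrE // -/h.
  by apply: ger1_powR; [rewrite h0 h1|move: beta_le; lra].
have eQ : 1 <= eps * Q by rewrite -ler_pdivrMl // mulr1.
have R1 : rho_bd r beta G X f a T y e 1 h.
  move=> s t g1 g2 g3 g4; apply: le_trans (F1 s t g1 g2 g3 g4) _.
  rewrite ler_wpM2r ?pw2_ge0 // ler_wpM2r ?invr_ge0 ?(ltW e0) // invf_le1 // ler1n //.
have Dh : CA * M * h <= 1.
  apply: (le_trans (y := Lam ^+ 3 * (CA * M * h))); last by apply: le_trans o2 mu1.
  by rewrite ler_peMl ?exprn_ege1 //; have := ltW h0; pos.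
have big s t : s <= t -> h < t - s -> 1 <= Q * pw s t.
  move=> st hts; apply: le_trans eQ _; rewrite mulrC ler_wpM2l //.
  by apply: powR_le => //; apply: ltW.
have DhQ : CA * M * (h / eps) <= Q.
  rewrite mulrA; apply: le_trans (ler_wpM2r _ Dh) _; first by rewrite invr_ge0 ltW.
  by rewrite mul1r.
have DhQ2 : CA * M * (h / eps ^+ 2) <= Q ^+ 2.
  rewrite (_ : _ * _ = CA * M * (h / eps) * eps^-1); last by field; rewrite gt_eqF.
  by rewrite expr2; apply: ler_pM => //; [have := ltW h0; have := ltW e0; pos|rewrite invr_ge0 ltW].
have QE : 4 * c ^+ 2 * Y ^+ 40 = 4 * Y ^+ 4 * Q ^+ 2 by rewrite /Q; ring.
rewrite -/Y QE.
have Q2 : Q <= Q ^+ 2 by rewrite expr2 ler_peMl.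
have Y41 : 1 <= Y ^+ 4 by apply: exprn_ege1.
have Y4Q : Y ^+ 4 * Q <= Y ^+ 4 * Q ^+ 2 by rewrite ler_wpM2l // exprn_ge0.
have YQ : Y ^+ 4 <= Y ^+ 4 * Q by rewrite ler_peMr // exprn_ge0.
have Q2Y : Q ^+ 2 <= Y ^+ 4 * Q ^+ 2 by rewrite ler_peMl // exprn_ge0.
have Q20 : 0 <= Q ^+ 2 by rewrite exprn_ge0.
split.
- move=> t _ _ /=; apply: le_trans (gc_G gc _) _; apply: (le_trans LLam).
  by apply: (le_trans LY); have := YX 1%N 4%N isT; rewrite expr1; lra.
- move=> s t g1 g2 g3.
  have [ts|ts] := leP (t - s) h; last first.
    have bg := big s t g2 ts.
    apply: (le_trans (y := 2 * Y)).
      apply: le_trans (ler_normB _ _) _; rewrite mulr_natl mulr2n.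
      by apply: lerD; apply: le_trans (gc_G gc _) _; apply: le_trans LY.
    apply: (le_trans (y := 2 * Y * (Q * pw s t))); first by rewrite ler_peMr // mulr_ge0.
    rewrite mulrA ler_wpM2r ?pw_ge0 //.
    have : Y * Q <= Y ^+ 4 * Q by rewrite ler_wpM2r //; apply: (YX 1%N 4%N).
    by have : 0 <= Y ^+ 4 * Q; [pos|lra].
  apply: le_trans (gc_Gl gc _ _) _.
  have sT : s <= t by [].
  have := incr_local beta_gt beta_le gc fok LLam M0 a0 Xbd ebd yhol hM ok R1 g1 g3 ts (lexx s) g2 (lexx t).
  move=> hI; apply: (le_trans (ler_pM L0 (normr_ge0 _) LLam hI)).
  rewrite [leLHS]mulrA ler_wpM2r ?pw_ge0 // -/h -/eps.
  rewrite (_ : (eps^-1 + CA * M * (h / eps ^+ 2)) * eps = 1 + CA * M * (h / eps)); last first.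
    by field; rewrite gt_eqF.
  apply: (le_trans (y := Y * (2 * Y ^+ 3 + (1 + Q)))).
    apply: ler_pM => //; first by have := ltW h0; have := ltW e0; pos.
    apply: lerD; first by rewrite ler_wpM2l // lerXn2r ?nnegrE.
    by rewrite lerD2l.
  rewrite (_ : Y * _ = 2 * Y ^+ 4 + Y + Y * Q); last by ring.
  have : Y * Q <= Y ^+ 4 * Q by rewrite ler_wpM2r //; apply: (YX 1%N 4%N).
  have := YX 1%N 4%N isT; rewrite expr1; lra.
move=> s t g1 g2 g3.
have [ts|ts] := leP (t - s) h.
  have := rem_local beta_le fok M0 a0 yhol hM ok R1 g1 g2 g3 ts.
  move=> /le_trans; apply; rewrite ler_wpM2r ?pw2_ge0 // -/eps.
  by lra.
have bg := big s t g2 ts.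
have [hX _ _ _] := Xbd s t g1 g2 g3.
have aT' : - r <= s by move: r_gt0; lra.
have tr : - r <= t by apply: le_trans g2.
rewrite /remainder /incr; apply: le_trans (ler_normB _ _) _.
have p0 := pw_ge0 beta s t.
have bg2 : 1 <= (Q * pw s t) ^+ 2 by rewrite exprn_ege1.
apply: (le_trans (y := 2 * Y * (Q * pw s t) ^+ 2 + Y ^+ 3 * pw s t * (Q * pw s t))).
  apply: lerD.
    apply: (le_trans (y := 2 * Y)); last by rewrite ler_peMr // mulr_ge0.
    apply: le_trans (ler_normB _ _) _; rewrite mulr_natl mulr2n.
    by apply: lerD; apply: le_trans MY; apply: hM => //; apply: le_trans g3.
  apply: (le_trans (y := Y ^+ 3 * pw s t)); last by rewrite ler_peMr //; pos.
  apply: le_trans (gc_M gc _ _) _.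
  rewrite (_ : Y ^+ 3 * _ = Y * (Y * pw s t) * Y); last by ring.
  apply: ler_pM; rewrite ?mulr_ge0 //; last first.
    by apply: le_trans (gc_G gc _) _; apply: le_trans LY.
  apply: ler_pM => //; first by apply: le_trans LY.
  by apply: le_trans hX _; rewrite ler_wpM2r.
rewrite (_ : _ + _ = (2 * Y * Q ^+ 2 + Y ^+ 3 * Q) * pw s t ^+ 2); last by ring.
rewrite ler_wpM2r ?exprn_ge0 //.
have : Y * Q ^+ 2 <= Y ^+ 4 * Q ^+ 2 by rewrite ler_wpM2r //; apply: (YX 1%N 4%N).
have : Y ^+ 3 * Q <= Y ^+ 4 * Q by rewrite ler_wpM2r // YX.
by lra.
Qed.

End Uniform.

(** * Dependence on the data *)

Section Stability.
Context {R : realType} {n d : nat}.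
Variables (r beta : R).
Hypotheses (beta_gt : 3^-1 < beta) (beta_le : beta <= 2^-1).
Local Notation pw := (hpow beta).
Local Notation V := 'rV[R]_n.
Local Notation M := 'M[R]_(d, n).
Local Notation U := (V * V)%type.
Local Notation H := (M * M)%type.
Local Notation E := ('rV[R]_d * 'rV[R]_d)%type.
Local Notation W := ('M[R]_d * 'M[R]_d)%type.

Variables (L : R) (G : U -> M) (DG : U -> U -> M) (PP : U -> H -> W -> V).
Hypothesis gc : germ_coeff L G DG (@pair_act R n d) PP (@pair_tens R d).
Variable X : delayed_path R d.
Local Notation rough_bd := (rough_bd r beta X).
Local Notation holder_bd := (holder_bd beta).
Local Notation ctrl_bd := (ctrl_bd beta X).
Local Notation davie := (davie r beta G PP X).

Let L1 := gc_L gc.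
Let L0 : 0 <= L. Proof. exact: le_trans L1. Qed.

Implicit Types (y e : cpath R d n) (a b : R) (f : R -> R -> V).
Local Notation hol := (hol r beta).
Local Notation drift_ok := (drift_ok r beta).

Lemma rough_sub K a b a' b' : a <= a' -> b' <= b -> rough_bd K a b -> rough_bd K a' b'.
Proof. by move=> aa bb hX s t h1 h2 h3; apply: hX => //; [apply: le_trans h1|apply: le_trans bb]. Qed.

Lemma ctrl_sub K a b a' b' y : a <= a' -> b' <= b -> ctrl_bd K a b y -> ctrl_bd K a' b' y.
Proof.
move=> aa bb [h1 h2 h3]; split.
- by move=> t g1 g2; apply: h1; [apply: le_trans g1|apply: le_trans bb].
- by move=> s t g1 g2 g3; apply: h2 => //; [apply: le_trans g1|apply: le_trans bb].
- by move=> s t g1 g2 g3; apply: h3 => //; [apply: le_trans g1|apply: le_trans bb].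
Qed.

Lemma davie_sub f y e Y a b a' b' : a <= a' -> b' <= b -> davie f y e Y a b -> davie f y e Y a' b'.
Proof.
move=> aa bb [C hC]; exists C => s t h1 h2 h3.
by apply: hC => //; [apply: le_trans h1|apply: le_trans bb].
Qed.

Lemma add_sub f a b a' b' : a <= a' -> b' <= b -> add_incr f a b -> add_incr f a' b'.
Proof.
move=> aa bb hf s v t h1 h2 h3 h4.
by apply: hf => //; [apply: le_trans h1|apply: le_trans bb].
Qed.

Definition sol_pair (y : R -> V) e : cpath R d n := (y, fun t => G (y t, e.1 (t - r))).

Definition data_close Dl a b e1 e2 :=
  [/\ forall s, a <= s -> s <= b -> `|e1.1 s - e2.1 s| <= Dl,
      forall s, a <= s -> s <= b -> `|e1.2 s - e2.2 s| <= Dl,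
      holder_bd Dl a b (e1 - e2)
    & forall s t, a <= s -> s <= t -> t <= b ->
        `|remainder X e1 s t - remainder X e2 s t| <= Dl * pw s t ^+ 2].

Lemma data_close_sub Dl Dl' a b a' b' e1 e2 : Dl <= Dl' -> a <= a' -> b' <= b ->
  data_close Dl a b e1 e2 -> data_close Dl' a' b' e1 e2.
Proof.
move=> dd aa bb [h1 h2 h3 h4]; split.
- by move=> s g1 g2; apply: le_trans (h1 s _ _) dd; [apply: le_trans g1|apply: le_trans bb].
- by move=> s g1 g2; apply: le_trans (h2 s _ _) dd; [apply: le_trans g1|apply: le_trans bb].
- move=> s t g1 g2 g3; apply: le_trans (h3 s t _ g2 _) _; rewrite ?ler_wpM2r ?pw_ge0 //.
    exact: le_trans g1.
  exact: le_trans bb.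
- move=> s t g1 g2 g3; apply: le_trans (h4 s t _ g2 _) _; rewrite ?ler_wpM2r ?pw2_ge0 //.
    exact: le_trans g1.
  exact: le_trans bb.
Qed.

Section Diff.
Variables (CA : R) (f : (R -> V) -> R -> R -> V).
Hypothesis fok : drift_ok CA f.
Let CA0 := dr_CA fok.
Variables (K : R).
Hypotheses (r_gt0 : 0 < r) (LK : L <= K) (Xch : chen r X).
Let K1 : 1 <= K. Proof. exact: le_trans LK. Qed.
Let K0 : 0 <= K. Proof. exact: le_trans K1. Qed.

(** The constants of the rough part and of the drift together, as in [small4]; eps is chosen so that
    S eps = 1/2. *)
Let S := contr_const beta L K + CA * (K ^+ 2 + 2).
Let S1 : 1 <= S.
Proof.
apply: (le_trans (contr_const_ge1 beta_gt gc LK)); rewrite /S lerDl.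
by pos.
Qed.
Let S0 : 0 < S. Proof. exact: lt_le_trans S1. Qed.
Let eps := (2 * S)^-1.
Let eps0 : 0 < eps. Proof. by rewrite invr_gt0 mulr_gt0. Qed.
Let eps1 : eps <= 1.
Proof. by rewrite invf_le1 ?mulr_gt0 //; move: S1; lra. Qed.
Let h := eps ^+ 3.
Let h0 : 0 < h. Proof. by rewrite exprn_gt0. Qed.
Let h1 : h <= 1. Proof. by rewrite exprn_ile1 // ltW. Qed.
Let heps : h `^ beta <= eps. Proof. exact: pow_small (ltW eps0) eps1. Qed.
Let Seps : S * eps = 2^-1.
Proof. by rewrite /eps invfM mulrCA divff ?mulr1 // gt_eqF. Qed.

Section Pair.
Variables (y1 y2 : R -> V) (e1 e2 : cpath R d n).
Local Notation yy1 := (sol_pair y1 e1).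
Local Notation yy2 := (sol_pair y2 e2).

(** With the solutions as their own next iterates, the contraction estimates improve a distance x to
    x / 2 + S L m; the starting distance 2 K is available since both solutions are controlled. The
    derivatives at a are at distance L m, which is why L m replaces m throughout. *)
Lemma local_diff a b m : 0 <= m -> 0 <= a -> a <= b -> b - a <= h -> rough_bd K a b ->
  ctrl_bd K (a - r) (b - r) e1 -> ctrl_bd K (a - r) (b - r) e2 ->
  ctrl_bd K a b yy1 -> ctrl_bd K a b yy2 ->
  (exists K, hol K b y1) -> (exists K, hol K b y2) ->
  davie (f y1) yy1 e1 y1 a b -> davie (f y2) yy2 e2 y2 a b ->
  data_close m (a - r) (b - r) e1 e2 ->
  (forall t, - r <= t -> t <= a -> `|y1 t - y2 t| <= m) ->
  [/\ forall t, - r <= t -> t <= b -> `|y1 t - y2 t| <= 2 * L * (K ^+ 2 + 2) * m,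
      holder_bd (2 * S * L * m) a b (yy1 - yy2)
    & forall s t, a <= s -> s <= t -> t <= b ->
      `|remainder X yy1 s t - remainder X yy2 s t| <= 2 * S * L * m * pw s t ^+ 2].
Proof.
move=> m0 a0 ab abh Xbd he1 he2 hy1 hy2 [H1 hol1] [H2 hol2] d1 d2 hm past.
have ra : - r <= a by move: r_gt0; lra.
have mLm : m <= L * m by rewrite ler_peMl.
have Lm0 : 0 <= L * m by rewrite mulr_ge0.
have [de1 de2 de3 de4] := data_close_sub mLm (lexx _) (lexx _) hm.
have [dm1 _ _ _] := hm.
have ini1 : `|yy1.1 a - yy2.1 a| <= L * m by apply: le_trans (past a ra (lexx a)) mLm.
have ini2 : `|yy1.2 a - yy2.2 a| <= L * m.
  rewrite /=; apply: le_trans (gc_Gl gc _ _) _; rewrite ler_wpM2l //.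
  apply: (@pair_le _ _ _ (y1 a - y2 a) (e1.1 (a - r) - e2.1 (a - r))).
    exact: past.
  by apply: dm1; rewrite lerB.
have pe : forall s t, a <= s -> s <= t -> t <= b -> pw s t <= eps.
  move=> s t g1 g2 g3; apply: le_trans heps; apply: pw_le => //.
  by apply: le_trans abh; rewrite lerB.
have ab1 : b - a <= 1 by apply: le_trans abh h1.
(* The boolean selects the seminorm, so that the Hoelder and the remainder distances improve
   simultaneously with the same x. *)
pose P (z : bool * (R * R)) := [/\ a <= z.2.1, z.2.1 <= z.2.2 & z.2.2 <= b].
pose F (z : bool * (R * R)) := let s := z.2.1 in let t := z.2.2 in
  if z.1 then `|(yy1 - yy2).2 t - (yy1 - yy2).2 s|
  else `|remainder X yy1 s t - remainder X yy2 s t|.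
pose w (z : bool * (R * R)) := if z.1 then pw z.2.1 z.2.2 else pw z.2.1 z.2.2 ^+ 2.
have split_P x : (forall z, P z -> F z <= x * w z) ->
   holder_bd x a b (yy1 - yy2) /\ forall s t, a <= s -> s <= t -> t <= b ->
      `|remainder X yy1 s t - remainder X yy2 s t| <= x * pw s t ^+ 2.
  move=> H; split=> s t g1 g2 g3; first exact: (H (true, (s, t)) (And3 g1 g2 g3)).
  exact: (H (false, (s, t)) (And3 g1 g2 g3)).
have e0 := ltW eps0.
have hK1 : hol (`|H1| + `|H2|) b y1.
  move=> s t g1 g2 g3; apply: le_trans (hol1 s t g1 g2 g3) _; rewrite ler_wpM2r ?pw_ge0 //.
  by rewrite (le_trans (ler_norm H1)) // lerDl.
have hK2 : hol (`|H1| + `|H2|) b y2.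
  move=> s t g1 g2 g3; apply: le_trans (hol2 s t g1 g2 g3) _; rewrite ler_wpM2r ?pw_ge0 //.
  by rewrite (le_trans (ler_norm H2)) // lerDr.
have fa1 : add_incr (f y1) a b by apply: add_sub (dr_add fok hK1).
have fa2 : add_incr (f y2) a b by apply: add_sub (dr_add fok hK2).
have supx x : 0 <= x -> holder_bd x a b (yy1 - yy2) ->
   (forall s t, a <= s -> s <= t -> t <= b ->
      `|remainder X yy1 s t - remainder X yy2 s t| <= x * pw s t ^+ 2) ->
   forall t, - r <= t -> t <= b -> `|y1 t - y2 t| <= (K ^+ 2 + 2) * (L * m + eps * x).
  move=> x0 q1 q2 t g1 g2.
  have [ta|/ltW at_] := leP t a.
    apply: le_trans (past t g1 ta) _; apply: (le_trans mLm).
    apply: (le_trans (y := L * m + eps * x)); first by rewrite lerDl mulr_ge0.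
    rewrite ler_peMl ?addr_ge0 ?mulr_ge0 //.
    by rewrite (le_trans (y := 2)) ?ler1n // lerDr exprn_ge0.
  exact: (contr_sup gc LK Lm0 x0 e0 eps1 Xbd pe ini1 ini2 q1 q2 at_ g2).
have key : forall z, P z -> F z <= (S * (L * m)) / (1 - 2^-1) * w z.
  apply: improve_bound => //.
  - by rewrite invf_lt1 ?ltr1n.
  - by rewrite mulr_ge0 // ltW.
  - by move=> [[] [s t]]; rewrite /w /= ?pw_ge0 ?pw2_ge0.
  - exists (2 * K); first by rewrite mulr_ge0.
    have [_ a2 a3] := hy1; have [_ b2 b3] := hy2.
    move=> [[] [s t]] [/= g1 g2 g3]; rewrite /F /w /= mulr_natl mulr2n mulrDl.
      rewrite (_ : _ - _ = (yy1.2 t - yy1.2 s) - (yy2.2 t - yy2.2 s)); last first.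
        by rewrite [LHS]/=; mxring.
      by apply: le_trans (ler_normB _ _) _; apply: lerD; [exact: a2|exact: b2].
    by apply: le_trans (ler_normB _ _) _; apply: lerD; [exact: a3|exact: b3].
  move=> x x0 /split_P[q1 q2].
  pose ph := CA * ((K ^+ 2 + 2) * (L * m + eps * x)).
  have ex0 : 0 <= eps * x by rewrite mulr_ge0.
  have ph0 : 0 <= ph by rewrite /ph; pos.
  have df : forall s t, a <= s -> s <= t -> t <= b -> `|f y1 s t - f y2 s t| <= ph * (t - s).
    move=> s t g1 g2 g3; apply: (dr_diff fok hK1 hK2) => //; first exact: supx.
    exact: le_trans g1.
  have sm : contr_const beta L K * (L * m + eps * x) + ph = 2^-1 * x + S * (L * m).
    by rewrite /ph -Seps /S; ring.
  move=> [[] [s t]] [/= g1 g2 g3]; rewrite /F /w /= -sm.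
    change (`|yy1.2 t - yy2.2 t - (yy1.2 s - yy2.2 s)| <=
      (contr_const beta L K * (L * m + eps * x) + ph) * pw s t).
    have := contr_holder beta_gt gc LK Lm0 x0 e0 eps1 Xbd he2 hy2 pe ini1 ini2 q1 q2
      de1 de2 de4 g1 g2 g3.
    rewrite (_ : _ - _ - (_ - _) = yy1.2 t - yy2.2 t - (yy1.2 s - yy2.2 s)).
      by move=> /le_trans; apply; rewrite ler_wpM2r ?pw_ge0 // lerDl.
    rewrite /delay_pair /sol_pair /=; move: (G _) (G _) (G _) (G _) => *; mxring.
  exact: (contr_rem beta_gt beta_le gc LK Lm0 x0 ph0 e0 eps1 ab1 Xch Xbd he1 he2 hy1 hy2
   pe ini1 ini2 q1 q2 de1 de2 de3 de4 fa1 fa2 df d1 d2 g1 g2 g3).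
have E : S * (L * m) / (1 - 2^-1) = 2 * S * L * m by field.
rewrite E in key.
have [q1 q2] := split_P _ key.
split=> // t g1 g2.
have x0 : 0 <= 2 * S * L * m by rewrite -!mulrA mulr_ge0 // mulr_ge0 // ltW.
apply: le_trans (supx _ x0 q1 q2 t g1 g2) _.
rewrite le_eqVlt; apply/orP; left; apply/eqP.
rewrite (_ : eps * (2 * S * L * m) = 2 * (S * eps) * (L * m)); last by ring.
by rewrite Seps; field.
Qed.

End Pair.

(** The number of steps and the factor [rh] per step depend on the data through K alone, so the
    solution is Lipschitz in the data on bounded sets. Distances at times more than h apart are
    recovered from sup norms, at the price of powers of 1 / h^beta. The case Dl = 0 gives
    uniqueness. *)
Lemma global_diff : exists2 C, 0 <= C &
  forall (y1 y2 : R -> V) (e1 e2 : cpath R d n) a T Dl, 0 <= Dl -> 0 <= a -> a <= T -> T - a <= r ->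
  rough_bd K a T ->
  ctrl_bd K (a - r) (T - r) e1 -> ctrl_bd K (a - r) (T - r) e2 ->
  ctrl_bd K a T (sol_pair y1 e1) -> ctrl_bd K a T (sol_pair y2 e2) ->
  (exists K, hol K T y1) -> (exists K, hol K T y2) ->
  davie (f y1) (sol_pair y1 e1) e1 y1 a T -> davie (f y2) (sol_pair y2 e2) e2 y2 a T ->
  data_close Dl (a - r) (T - r) e1 e2 ->
  (forall t, - r <= t -> t <= a -> `|y1 t - y2 t| <= Dl) ->
  [/\ forall t, - r <= t -> t <= T -> `|y1 t - y2 t| <= C * Dl,
      holder_bd (C * Dl) a T ((sol_pair y1 e1) - (sol_pair y2 e2))
    & forall s t, a <= s -> s <= t -> t <= T ->
      `|remainder X (sol_pair y1 e1) s t - remainder X (sol_pair y2 e2) s t| <= C * Dl * pw s t ^+ 2].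
Proof.
have [J hJ _] := nat_above (divr_ge0 (ltW r_gt0) (ltW h0)).
rewrite ler_pdivrMr // in hJ.
pose rh := 2 * L * (K ^+ 2 + 2).
have rh1 : 1 <= rh.
  rewrite /rh; have : 1 <= L * (K ^+ 2 + 2).
    by rewrite -[leLHS]mulr1; apply: ler_pM => //; rewrite (le_trans (y := 2)) ?ler1n // lerDr exprn_ge0.
  by rewrite -mulrA; lra.
have rh0 : 0 <= rh by apply: le_trans rh1.
pose e' := h `^ beta.
have e'0 : 0 < e' by apply: powR_gt0.
have e'1 : 1 <= e'^-1 by rewrite invf_ge1 // pow_le1 // ltW.
have e'n : 0 <= e'^-1 by rewrite invr_ge0 ltW.
have S0' := ltW S0.
pose C := rh ^+ J * (1 + 2 * S * L + 2 * L * e'^-1 + (2 * e'^-1 ^+ 2 + K * L * L * e'^-1)).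
exists C; first by rewrite /C; pos.
move=> y1 y2 e1 e2 a T Dl Dl0 a0 aT Tr Xbd he1 he2 hy1 hy2 [H1 hl1] [H2 hl2] d1 d2 hm past.
have hs1 b : b <= T -> exists K, hol K b y1.
  by move=> bT; exists H1 => s t g1 g2 g3; apply: hl1 => //; apply: le_trans bT.
have hs2 b : b <= T -> exists K, hol K b y2.
  by move=> bT; exists H2 => s t g1 g2 g3; apply: hl2 => //; apply: le_trans bT.
have loc s b m : a <= s -> s <= b -> b <= T -> b - s <= h -> Dl <= m ->
  (forall t, - r <= t -> t <= s -> `|y1 t - y2 t| <= m) ->
  [/\ forall t, - r <= t -> t <= b -> `|y1 t - y2 t| <= rh * m,
      holder_bd (2 * S * L * m) s b ((sol_pair y1 e1) - (sol_pair y2 e2))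
    & forall s' t, s <= s' -> s' <= t -> t <= b ->
      `|remainder X (sol_pair y1 e1) s' t - remainder X (sol_pair y2 e2) s' t| <= 2 * S * L * m * pw s' t ^+ 2].
  move=> g1 g2 g3 g4 g5 g6.
  have as_ : a - r <= s - r by rewrite lerB.
  have bT : b - r <= T - r by rewrite lerB.
  apply: (local_diff (le_trans Dl0 g5) (le_trans a0 g1) g2 g4 (rough_sub g1 g3 Xbd)
    (ctrl_sub as_ bT he1) (ctrl_sub as_ bT he2) (ctrl_sub g1 g3 hy1) (ctrl_sub g1 g3 hy2)
    (hs1 b g3) (hs2 b g3) (davie_sub g1 g3 d1) (davie_sub g1 g3 d2)
    (data_close_sub g5 as_ bT hm) g6).
have steps j : forall t, - r <= t -> t <= T -> t <= a + j%:R * h -> `|y1 t - y2 t| <= rh ^+ j * Dl.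
  elim: j => [|j IH] t g1 g2.
    by rewrite mul0r addr0 expr0 mul1r; apply: past.
  rewrite -natr1 mulrDl mul1r => g3.
  have rhj : Dl <= rh ^+ j * Dl by rewrite ler_peMl // exprn_ege1.
  have [ts|/ltW st] := leP t (a + j%:R * h).
    apply: le_trans (IH t g1 g2 ts) _; rewrite ler_wpM2r // exprS ler_peMl // exprn_ge0 //.
  have sT : a + j%:R * h <= T by apply: le_trans g2.
  have as_ : a <= a + j%:R * h by rewrite lerDl mulr_ge0 // ltW.
  have tsh : t - (a + j%:R * h) <= h by lra.
  have IH' t' : - r <= t' -> t' <= a + j%:R * h -> `|y1 t' - y2 t'| <= rh ^+ j * Dl.
    by move=> k1 k2; apply: IH => //; apply: le_trans sT.
  have [K_ _ _] := loc _ _ _ as_ st g2 tsh rhj IH'.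
  by rewrite exprS -mulrA; apply: K_.
pose m := rh ^+ J * Dl.
have m0 : 0 <= m by rewrite mulr_ge0 // exprn_ge0.
have Dm : Dl <= m by rewrite ler_peMl // exprn_ege1.
have sup t : - r <= t -> t <= T -> `|y1 t - y2 t| <= m.
  by move=> g1 g2; apply: steps => //; lra.
have ra : - r <= a by move: r_gt0; lra.
have Gd t : a <= t -> t <= T -> `|(sol_pair y1 e1).2 t - (sol_pair y2 e2).2 t| <= L * m.
  move=> g1 g2; apply: le_trans (gc_Gl gc _ _) _; rewrite ler_wpM2l //.
  apply: (@pair_le _ _ _ (y1 t - y2 t) (e1.1 (t - r) - e2.1 (t - r))).
    by apply: sup => //; apply: le_trans g1.
  by have [dm1 _ _ _] := hm; apply: le_trans (dm1 _ _ _) Dm; rewrite lerB.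
have CE : C * Dl = m + 2 * S * L * m + 2 * L * m * e'^-1 + (2 * m * e'^-1 ^+ 2 + K * L * L * m * e'^-1).
  by rewrite /C /m; ring.
have c1 : 0 <= 2 * S * L * m by pos.
have c2 : 0 <= 2 * L * m * e'^-1 by pos.
have c3 : 0 <= 2 * m * e'^-1 ^+ 2 + K * L * L * m * e'^-1 by pos.
have loc' s t : a <= s -> s <= t -> t <= T -> t - s <= h ->
   holder_bd (2 * S * L * m) s t ((sol_pair y1 e1) - (sol_pair y2 e2)) /\
   `|remainder X (sol_pair y1 e1) s t - remainder X (sol_pair y2 e2) s t| <= 2 * S * L * m * pw s t ^+ 2.
  move=> g1 g2 g3 g4; have st t' : - r <= t' -> t' <= s -> `|y1 t' - y2 t'| <= m.
    by move=> k1 k2; apply: sup => //; apply: le_trans k2 (le_trans g2 g3).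
  by have [_ q2 q3] := loc s t m g1 g2 g3 g4 Dm st; split=> //; apply: q3.
have big s t : s <= t -> h < t - s -> 1 <= e'^-1 * pw s t.
  move=> st hts; rewrite ler_pdivlMl // mulr1.
  by apply: powR_le => //; apply: ltW.
split.
- by move=> t g1 g2; apply: le_trans (sup t g1 g2) _; rewrite CE; lra.
- move=> s t g1 g2 g3.
  have [ts|ts] := leP (t - s) h.
    have [q1 _] := loc' s t g1 g2 g3 ts.
    apply: le_trans (q1 s t (lexx s) g2 (lexx t)) _; rewrite ler_wpM2r ?pw_ge0 // CE.
    by lra.
  have bg := big s t g2 ts.
  rewrite (_ : _ - _ = ((sol_pair y1 e1).2 t - (sol_pair y2 e2).2 t) - ((sol_pair y1 e1).2 s - (sol_pair y2 e2).2 s)); last by rewrite [LHS]/=; mxring.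
  apply: le_trans (ler_normB _ _) _.
  apply: le_trans (lerD (Gd t (le_trans g1 g2) g3) (Gd s g1 (le_trans g2 g3))) _.
  apply: (le_trans (y := 2 * L * m * (e'^-1 * pw s t))).
    rewrite (_ : L * m + L * m = 2 * L * m); last by ring.
    by rewrite ler_peMr //; pos.
  by rewrite mulrA ler_wpM2r ?pw_ge0 // CE; lra.
move=> s t g1 g2 g3.
have [ts|ts] := leP (t - s) h.
  have [_ q1] := loc' s t g1 g2 g3 ts.
  by apply: le_trans q1 _; rewrite ler_wpM2r ?pw2_ge0 // CE; lra.
have bg := big s t g2 ts.
have p0 := pw_ge0 beta s t.
have bg2 : 1 <= (e'^-1 * pw s t) ^+ 2 by rewrite exprn_ege1.
have [hX _ _ _] := Xbd s t g1 g2 g3.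
rewrite (_ : _ - _ = ((y1 t - y2 t) - (y1 s - y2 s)) - incr (base X) s t *m ((sol_pair y1 e1).2 s - (sol_pair y2 e2).2 s)); last first.
  by rewrite /remainder mulmxBr /incr /=; move: (_ *m _) (_ *m _) => *; mxring.
apply: le_trans (ler_normB _ _) _.
apply: (le_trans (y := 2 * m * (e'^-1 * pw s t) ^+ 2 + K * L * L * m * pw s t * (e'^-1 * pw s t))).
  apply: lerD.
    apply: (le_trans (y := 2 * m)); last by rewrite ler_peMr // mulr_ge0.
    apply: le_trans (ler_normB _ _) _; rewrite mulr_natl mulr2n.
    apply: lerD; apply: sup => //.
    - by apply: (le_trans ra); apply: le_trans g2.
    - exact: (le_trans ra).
    - exact: le_trans g3.
  apply: (le_trans (y := K * L * L * m * pw s t)); last by rewrite ler_peMr //; pos.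
  apply: le_trans (gc_M gc _ _) _.
  rewrite (_ : K * L * L * m * pw s t = L * (K * pw s t) * (L * m)); last by ring.
  apply: ler_pM; rewrite ?mulr_ge0 //; first by rewrite ler_wpM2l.
  by apply: Gd => //; apply: le_trans g3.
rewrite (_ : _ + _ = (2 * m * e'^-1 ^+ 2 + K * L * L * m * e'^-1) * pw s t ^+ 2); last by ring.
by rewrite ler_wpM2r ?exprn_ge0 // CE; lra.
Qed.

End Diff.
End Stability.

(** * The method of steps *)

Section MethodOfSteps.
Context {R : realType} {n d : nat}.
Variables (r beta : R).
Hypotheses (beta_gt : 3^-1 < beta) (beta_le : beta <= 2^-1).
Local Notation pw := (hpow beta).
Local Notation V := 'rV[R]_n.
Local Notation M := 'M[R]_(d, n).
Local Notation U := (V * V)%type.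
Local Notation H := (M * M)%type.
Local Notation E := ('rV[R]_d * 'rV[R]_d)%type.
Local Notation W := ('M[R]_d * 'M[R]_d)%type.

Variables (L : R) (G : U -> M) (DG : U -> U -> M) (PP : U -> H -> W -> V).
Hypothesis gc : germ_coeff L G DG (@pair_act R n d) PP (@pair_tens R d).
Variable X : delayed_path R d.
Local Notation rough_bd := (rough_bd r beta X).
Local Notation ctrl_bd := (ctrl_bd beta X).
Local Notation dgerm := (delay_germ r G PP X).
Local Notation davie := (davie r beta G PP X).

Let L1 := gc_L gc.
Let L0 : 0 <= L. Proof. exact: le_trans L1. Qed.

Implicit Types (e : cpath R d n) (a b : R) (f : R -> R -> V).
Local Notation hol := (hol r beta).
Local Notation drift_ok := (drift_ok r beta).
Local Notation sol_path := (@sol_pair R n d r G).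

(** A germ uses the paths at its left end point only, so the defect is under control even when t
    lies beyond c, up to which [y] and the datum are known to be controlled. *)
Lemma germ_cross K a c b y e : L <= K -> c <= b -> chen r X -> rough_bd K a b ->
  ctrl_bd K (a - r) (c - r) e -> ctrl_bd K a c y ->
  exists2 C, 0 <= C & forall s v t, a <= s -> s <= v -> v <= c -> v <= t -> t <= b ->
    `|dgerm y e s t - dgerm y e s v - dgerm y e v t| <= C * pw s t ^+ 3.
Proof.
move=> LK cb [c1 c2] Xbd [e1 e2 e3] [y1 y2 y3].
have K0 : 0 <= K by apply: le_trans LK.
pose Nu := L * K * K + K * pw a b.
have Nu0 : 0 <= Nu by rewrite /Nu; have := pw_ge0 beta a b; pos.
exists (L * K * (L * (Nu ^+ 2 + K) + (Nu * K + K))); first by pos.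
move=> s v t h1 h2 vc h3 h4.
have av := le_trans h1 h2; have vb := le_trans h3 h4.
have p0 := pw_ge0 beta.
have m1 : pw s v <= pw s t by apply: pw_mono.
have m2 : pw v t <= pw s t by apply: pw_mono.
have m3 : pw s v <= pw a b by apply: pw_mono.
have q1 : pw s v ^+ 2 <= pw s t ^+ 2 by rewrite lerXn2r ?nnegrE.
have q2 : pw v t ^+ 2 <= pw s t ^+ 2 by rewrite lerXn2r ?nnegrE.
have [hX _ hA hB] := Xbd v t av h3 h4.
have [gX gXr _ _] := Xbd s v h1 h2 vb.
have s1 : a - r <= s - r by rewrite lerB.
have s2 : s - r <= v - r by rewrite lerB.
have s3 : v - r <= c - r by rewrite lerB.
have s4 : s - r <= c - r by apply: le_trans s3.
have r1 := y3 s v h1 h2 vc.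
have r2 := e3 _ _ s1 s2 s3; rewrite pw_shift in r2.
apply: (@germ_delta_le _ _ _ _ _ _ _ _ _ _ _ _ _ gc (delay_pair r y e)
  (delay_deriv r y e) _ _ (fun s t => (incr (base X) s t, incr (base X) (s - r) (t - r)))
  s v t (pw s t) K Nu K K K) => //.
- exact: incrD.
- by rewrite (c1 s v t) // (c2 s v t).
- by apply: le_trans hX _; rewrite ler_wpM2l.
- by apply: pair_le; [apply: le_trans hA _|apply: le_trans hB _]; rewrite ler_wpM2l.
- apply: (le_trans (y := Nu * pw s v)); last by rewrite ler_wpM2l.
  apply: (@pair_le _ _ _ (y.1 v - y.1 s) (e.1 (v - r) - e.1 (s - r))).
    exact: (path_incr gc a b K0 gX (y1 s h1 (le_trans h2 vc)) r1 K0 m3).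
  rewrite -(pw_shift beta r s v) in gXr r2 m3 *.
  exact: (path_incr gc a b K0 gXr (e1 _ s1 s4) r2 K0 m3).
- apply: (@pair_le _ _ _ (remainder X y s v) (remainder X e (s - r) (v - r))).
    by apply: le_trans r1 _; rewrite ler_wpM2l.
  by apply: le_trans r2 _; rewrite ler_wpM2l.
- by apply: pair_le; [exact: y1|apply: e1 => //; exact: le_trans s2].
- apply: (@pair_le _ _ _ (y.2 v - y.2 s) (e.2 (v - r) - e.2 (s - r))).
    by apply: le_trans (y2 s v h1 h2 vc) _; rewrite ler_wpM2l.
  by apply: le_trans (e2 _ _ s1 s2 s3) _; rewrite pw_shift ler_wpM2l.
Qed.

(** For s < c < t the increment is split at c, and [germ_cross] bounds the defect of the germ
    there. *)
Lemma davie_patch K a c b f y e (Y : R -> V) : L <= K -> a <= c -> c <= b -> chen r X ->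
  rough_bd K a b -> ctrl_bd K (a - r) (c - r) e -> ctrl_bd K a c y -> add_incr f a b ->
  davie f y e Y a c -> davie f y e Y c b -> davie f y e Y a b.
Proof.
move=> LK ac cb Xch Xbd he hy fa [C1 hC1] [C2 hC2].
have [C3 _ hC3'] := germ_cross LK cb Xch Xbd he hy.
have hC3 s t h1 h2 h3 h4 := hC3' s c t h1 h2 (lexx c) h3 h4.
exists (`|C1| + `|C2| + `|C3|) => s t h1 h2 h3.
have up x C : x <= C * pw s t ^+ 3 -> x <= `|C| * pw s t ^+ 3.
  by move=> /le_trans; apply; rewrite ler_wpM2r ?pw3_ge0 // ler_norm.
have b1 (C C' : R) : 0 <= C' -> `|C| * pw s t ^+ 3 <= (`|C| + C') * pw s t ^+ 3.
  by move=> C0; rewrite ler_wpM2r ?pw3_ge0 // lerDl.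
have n1 := normr_ge0 C1; have n2 := normr_ge0 C2; have n3 := normr_ge0 C3.
have [tc|/ltW ct] := leP t c.
  apply: le_trans (up _ _ (hC1 s t h1 h2 tc)) _.
  by rewrite ler_wpM2r ?pw3_ge0 //; lra.
have [cs|/ltW sc] := leP c s.
  apply: le_trans (up _ _ (hC2 s t cs h2 h3)) _.
  by rewrite ler_wpM2r ?pw3_ge0 //; lra.
have m1 : pw s c ^+ 3 <= pw s t ^+ 3 by rewrite lerXn2r ?nnegrE ?pw_ge0 // pw_mono.
have m2 : pw c t ^+ 3 <= pw s t ^+ 3 by rewrite lerXn2r ?nnegrE ?pw_ge0 // pw_mono.
rewrite (_ : _ - _ - _ - _ = (Y c - Y s - f s c - dgerm y e s c) + (Y t - Y c - f c t - dgerm y e c t)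
   - (dgerm y e s t - dgerm y e s c - dgerm y e c t)); last first.
  by rewrite (fa s c t) //; move: (dgerm _ _ _ _) (dgerm _ _ _ _) (dgerm _ _ _ _) => *; mxring.
apply: le_trans (ler_normB _ _) _; rewrite !mulrDl; apply: lerD; last first.
  by apply: up; apply: hC3.
apply: le_trans (ler_normD _ _) _; apply: lerD.
  apply: le_trans (hC1 s c h1 sc (lexx c)) _; apply: le_trans (_ : `|C1| * pw s c ^+ 3 <= _).
    by rewrite ler_wpM2r ?pw3_ge0 // ler_norm.
  by rewrite ler_wpM2l.
apply: le_trans (hC2 c t (lexx c) ct h3) _; apply: le_trans (_ : `|C2| * pw c t ^+ 3 <= _).
  by rewrite ler_wpM2r ?pw3_ge0 // ler_norm.
by rewrite ler_wpM2l.
Qed.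

Section Global.
Variables (CA : R) (f : (R -> V) -> R -> R -> V).
Hypothesis fok : drift_ok CA f.
Let CA0 := dr_CA fok.
Hypotheses (r_gt0 : 0 < r) (Xch : chen r X).
Hypothesis Xbd : forall a b, 0 <= a -> exists K, rough_bd K a b.

Lemma hol_ext K T (y y' : R -> V) : (forall t, - r <= t -> t <= T -> y t = y' t) ->
  hol K T y -> hol K T y'.
Proof.
move=> E H s t h1 h2 h3; rewrite -!E //; [exact: H|exact: le_trans h3|exact: le_trans h2].
Qed.

Lemma ctrl_ext K a b (y y' : cpath R d n) : (forall t, a <= t -> t <= b -> y.1 t = y'.1 t) ->
  (forall t, a <= t -> t <= b -> y.2 t = y'.2 t) -> ctrl_bd K a b y -> ctrl_bd K a b y'.
Proof.
move=> E1 E2 [h1 h2 h3]; split.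
- by move=> t g1 g2; rewrite -E2 //; apply: h1.
- move=> s t g1 g2 g3; rewrite -!E2 //; [exact: h2|exact: le_trans g3|exact: le_trans g2].
- move=> s t g1 g2 g3; have := h3 s t g1 g2 g3; rewrite /remainder /incr.
  by rewrite !E1 ?E2 // ?(le_trans g1) // (le_trans g2).
Qed.

Lemma davie_ext a b (y y' : R -> V) e e' : 0 <= a ->
  (exists K, hol K b y) -> (forall t, - r <= t -> t <= b -> y t = y' t) ->
  (forall t, a - r <= t -> t <= b - r -> e.1 t = e'.1 t) ->
  (forall t, a - r <= t -> t <= b - r -> e.2 t = e'.2 t) ->
  davie (f y) (sol_path y e) e y a b -> davie (f y') (sol_path y' e') e' y' a b.
Proof.
move=> a0 [K hK] E E1 E2 [C hC]; exists C => s t h1 h2 h3.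
have s0 : 0 <= s by apply: le_trans h1.
have rs : - r <= s by move: r_gt0; lra.
have sb := le_trans h2 h3.
have sr : a - r <= s - r by rewrite lerB.
have sr' : s - r <= b - r by rewrite lerB.
have fE : f y s t = f y' s t.
  (* The paths agree on [-r, b] only; [dr_diff] with distance 0 shows that the drift does not see
     the rest. *)
  have zero : forall t, - r <= t -> t <= b -> `|y t - y' t| <= 0.
    by move=> t' g1 g2; rewrite E // subrr normr0.
  have := dr_diff fok hK (hol_ext E hK) zero s0 h2 h3.
  by rewrite mulr0 mul0r normr_le0 subr_eq0 => /eqP.
have := hC s t h1 h2 h3.
rewrite /delay_germ /germ /delay_pair /delay_deriv /sol_pair /= fE.
by rewrite (E t) ?(le_trans rs) // (E s) // E1 // E2.
Qed.

(** The a priori bound M holds with the same value on every [a, T j] on which a solution exists.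
    Hence [local_exists] yields the same step length each time, and a + r is reached after finitely
    many steps. *)
Lemma extend_delay a (p : R -> V) e : 0 <= a -> (exists K, hol K a p) ->
  (exists K, ctrl_bd K (a - r) a e) ->
  exists y : R -> V, [/\ (forall t, t <= a -> y t = p t), (exists K, hol K (a + r) y)
    & davie (f y) (sol_path y e) e y a (a + r)].
Proof.
move=> a0 [Kp0 hp0] [Ke he].
have [KX hX] := Xbd (a + r) a0.
pose Kp := `|Kp0|; pose Lam := L + `|KX| + `|Ke|.
have Kp_ge0 : 0 <= Kp by exact: normr_ge0.
have hp : hol Kp a p.
  by move=> s t *; apply: le_trans (hp0 s t _ _ _) _ => //; rewrite ler_wpM2r ?pw_ge0 // ler_norm.
have LLam : L <= Lam by rewrite /Lam -addrA lerDl addr_ge0.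
have XLam : KX <= Lam.
  by apply: (le_trans (ler_norm KX)); rewrite /Lam; have := normr_ge0 Ke; move: L0; lra.
have eLam : Ke <= Lam.
  by apply: (le_trans (ler_norm Ke)); rewrite /Lam; have := normr_ge0 KX; move: L0; lra.
have Lam0 : 0 <= Lam by apply: le_trans LLam.
have {}hX : rough_bd Lam a (a + r).
  move=> s t g1 g2 g3; have [q1 q2 q3 q4] := hX s t g1 g2 g3.
  by split; [apply: le_trans q1 _|apply: le_trans q2 _|apply: le_trans q3 _|apply: le_trans q4 _];
    rewrite ler_wpM2r ?pw_ge0 ?pw2_ge0.
have {}he : ctrl_bd Lam (a - r) (a + r - r) e by rewrite addrK; apply: ctrl_bd_mono he.
have ra : - r <= a by move: r_gt0; lra.
pose m0 := `|p a| + Kp * pw (- r) a.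
have m00 : 0 <= m0 by rewrite /m0; have := pw_ge0 beta (- r) a; have := normr_ge0 (Kp0); pos.
have hm0 t : - r <= t -> t <= a -> `|p t| <= m0.
  move=> h1 h2; rewrite (_ : p t = p a - (p a - p t)); last by mxring.
  apply: le_trans (ler_normB _ _) _; apply: lerD => //.
  by apply: le_trans (hp t a h1 h2 (lexx a)) _; rewrite ler_wpM2l // pw_mono.
have [C1 C10 Hsup] := apriori_sup beta_gt beta_le gc CA0 r_gt0.
have [C2 C20 Hctrl] := apriori_ctrl beta_gt beta_le gc CA0 r_gt0.
pose M := C1 * (m0 + Lam ^+ 18).
have M0 : 0 <= M by rewrite /M; pos.
have [h h0 Hloc] := local_exists beta_gt beta_le gc fok (ltW r_gt0) LLam M0 Xch.
(* The cap a + r is the time up to which [e], known on [a - r, a], serves as delayed component. *)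
pose T (j : nat) := Num.min (a + j%:R * h) (a + r).
have aT j : a <= T j by rewrite /T le_min !lerDl mulr_ge0 // ltW.
have Tr j : T j <= a + r by rewrite /T ge_min lexx orbT.
have TS j : T j <= T j.+1.
  by rewrite /T le_min !ge_min lexx orbT andbT -natr1 mulrDl mul1r addrA lerDl ltW.
have TSh j : T j.+1 - T j <= h.
  rewrite /T -natr1 mulrDl mul1r; case: (leP (a + j%:R * h) (a + r));
    case: (leP (a + (j%:R * h + h)) (a + r)); move: h0; lra.
have Tl j : a + r - a <= r -> T j - a <= r by have := Tr j; lra.
have [J hJ _] := nat_above (divr_ge0 (ltW r_gt0) (ltW h0)).
rewrite ler_pdivrMr // in hJ.
have TJ : T J = a + r by rewrite /T; apply/min_idPr; rewrite lerD2l.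
suff step j : exists y : R -> V, [/\ (forall t, t <= a -> y t = p t), (exists K, hol K (T j) y)
    & davie (f y) (sol_path y e) e y a (T j)].
  by have := step J; rewrite TJ.
elim: j => [|j [y [ya yh yd]]].
  have T0 : T 0%N = a by rewrite /T mul0r addr0; apply/min_idPl; rewrite lerDl ltW.
  rewrite T0; exists p; split=> //; first by exists Kp.
  exists 0 => s t h1 h2 h3.
  have -> : t = s by apply/le_anti; rewrite h2 (le_trans h3).
  have -> : dgerm (sol_path p e) e s s = 0.
    by apply: (dgermxx beta_gt gc _ _ hX) => //; apply: (le_trans h2); apply: (le_trans h3); rewrite lerDl ltW.
  have -> : f p s s = 0.
    have s0 : 0 <= s by apply: le_trans h1.
    have := dr_add fok hp s0 (lexx s) (lexx s) (le_trans h2 h3).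
    by move=> /eqP; rewrite -subr_eq0 opprD addrA subrr sub0r oppr_eq0 => /eqP.
  by rewrite ?(subrr, subr0) normr0 mul0r.
have ebT i : T i - r <= a + r - r by rewrite lerB.
have heT := ctrl_sub (lexx (a - r)) (ebT j) he.
have hXT := rough_sub (lexx a) (Tr j) hX.
have py t : - r <= t -> t <= a -> `|y t| <= m0 by move=> h1 h2; rewrite ya //; apply: hm0.
have hM : forall t, - r <= t -> t <= T j -> `|y t| <= M.
  apply: (Hsup X f fok Xch Lam a (T j) m0 y e LLam m00 a0 (aT j) _ hXT heT yh py yd).
  by apply: Tl; lra.
have hyc := Hctrl X f fok Xch Lam a (T j) M y e LLam M0 a0 (aT j) hXT heT yh hM yd.
have [Ky0 hKy0] := yh.
have hKy : hol `|Ky0| (T j) y.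
  by move=> s t *; apply: le_trans (hKy0 s t _ _ _) _ => //; rewrite ler_wpM2r ?pw_ge0 // ler_norm.
have hXn : rough_bd Lam (T j) (T j.+1) by apply: rough_sub (aT j) (Tr _) hX.
have hen : ctrl_bd Lam (T j - r) (T j.+1 - r) e.
  by apply: ctrl_sub he => //; rewrite lerB.
have [y' [ya' [Ky' yh'] yd']] := Hloc (T j) (T j.+1) `|Ky0| y e (normr_ge0 _)
   (le_trans a0 (aT j)) (TS j) (TSh j) hXn hen hKy hM.
exists y'; split.
- by move=> t ta; rewrite ya' ?ya // (le_trans ta).
- by exists Ky'.
have yd2 : davie (f y') (sol_path y' e) e y' a (T j).
  by apply: davie_ext yd => // t _ tT; rewrite ya'.
pose K2 := Lam + C2 * (Lam + M) ^+ 40.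
have K20 : 0 <= C2 * (Lam + M) ^+ 40 by pos.
have LamK2 : Lam <= K2 by rewrite lerDl.
have cK2 : C2 * (Lam + M) ^+ 40 <= K2 by rewrite lerDr.
apply: (@davie_patch K2 a (T j) (T j.+1) (f y') _ _ _ (le_trans LLam LamK2) (aT j) (TS j) Xch _ _ _ _ yd2 yd').
- move=> s t g1 g2 g3; have [q1 q2 q3 q4] := hX s t g1 g2 (le_trans g3 (Tr _)).
  by split; [apply: le_trans q1 _|apply: le_trans q2 _|apply: le_trans q3 _|apply: le_trans q4 _];
    rewrite ler_wpM2r ?pw_ge0 ?pw2_ge0.
- exact: ctrl_bd_mono LamK2 heT.
- have := ctrl_bd_mono cK2 hyc; apply: ctrl_ext => t g1 g2 /=; by rewrite ya'.
- by apply: add_sub (dr_add fok yh').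
Qed.

Variable xi : cpath R d n.
Hypothesis xi_ctrl : exists K, ctrl_bd K (- r) 0 xi.
Hypothesis xi_hol : exists K, hol K 0 xi.1.

Definition datum_at (k : nat) (y : R -> V) : cpath R d n :=
  (y, if k is 0%N then xi.2 else fun t => G (y t, y (t - r))).

(** The third clause makes the last interval available as the datum of the next one. *)
Definition glob_state (k : nat) (y : R -> V) :=
  [/\ (forall t, t <= 0 -> y t = xi.1 t), (exists K, hol K (k%:R * r) y),
      (exists K, ctrl_bd K (k%:R * r - r) (k%:R * r) (datum_at k y))
    & forall j, (j < k)%N -> let e := datum_at j y in
        davie (f y) (sol_path y e) e y (j%:R * r) (j%:R * r + r)].

Lemma kr_ge0 k : 0 <= k%:R * r. Proof. by rewrite mulr_ge0 // ltW. Qed.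
Lemma krS k : k.+1%:R * r = k%:R * r + r. Proof. by rewrite -natr1 mulrDl mul1r. Qed.

Lemma hol_ctrl_bd k (y : R -> V) e : (exists K, hol K (k%:R * r + r) y) ->
  (exists K, ctrl_bd K (k%:R * r - r) (k%:R * r) e) ->
  davie (f y) (sol_path y e) e y (k%:R * r) (k%:R * r + r) ->
  exists K, ctrl_bd K (k%:R * r) (k%:R * r + r) (sol_path y e).
Proof.
move=> [Ky hy] [Ke he] hd.
have [KX hX] := Xbd (k%:R * r + r) (kr_ge0 k).
pose Lam := L + `|KX| + `|Ke|.
have LLam : L <= Lam by rewrite /Lam -addrA lerDl addr_ge0.
have XLam : KX <= Lam.
  by apply: (le_trans (ler_norm KX)); rewrite /Lam; have := normr_ge0 Ke; move: L0; lra.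
have eLam : Ke <= Lam.
  by apply: (le_trans (ler_norm Ke)); rewrite /Lam; have := normr_ge0 KX; move: L0; lra.
have {}hX : rough_bd Lam (k%:R * r) (k%:R * r + r).
  move=> s t g1 g2 g3; have [q1 q2 q3 q4] := hX s t g1 g2 g3.
  by split; [apply: le_trans q1 _|apply: le_trans q2 _|apply: le_trans q3 _|apply: le_trans q4 _];
    rewrite ler_wpM2r ?pw_ge0 ?pw2_ge0.
have {}he : ctrl_bd Lam (k%:R * r - r) (k%:R * r + r - r) e by rewrite addrK; apply: ctrl_bd_mono he.
have [C2 C20 Hctrl] := apriori_ctrl beta_gt beta_le gc CA0 r_gt0.
set T := k%:R * r + r in hy hX he *.
have r0 : 0 <= T by rewrite /T addr_ge0 ?kr_ge0 // ltW.
have r0' : - r <= T by move: r_gt0; lra.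
pose M := `|y T| + `|Ky| * pw (- r) T.
have M0 : 0 <= M by rewrite /M; have := pw_ge0 beta (- r) T; pos.
exists (C2 * (Lam + M) ^+ 40).
apply: (Hctrl X f fok Xch) => //.
- exact: kr_ge0.
- by rewrite lerDl ltW.
- by exists Ky.
move=> t h1 h2; rewrite (_ : y t = y T - (y T - y t)); last by mxring.
apply: le_trans (ler_normB _ _) _; apply: lerD => //.
apply: le_trans (hy t T h1 h2 (lexx _)) _; apply: le_trans (ler_wpM2r (pw_ge0 _ _ _) (ler_norm Ky)) _.
by rewrite ler_wpM2l // pw_mono.
Qed.

Lemma glob_step k (y : R -> V) : glob_state k y ->
  exists y', glob_state k.+1 y' /\ forall t, t <= k%:R * r -> y' t = y t.
Proof.
move=> [y0 yh yc yd].
have [y' [E yh' yd']] := extend_delay (kr_ge0 k) yh yc.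
exists y'; split=> //.
have datE j t : (j <= k)%N -> t <= k%:R * r -> (datum_at j y).2 t = (datum_at j y').2 t.
  move=> jk tk; case: j jk => //= j jk; rewrite !E // (le_trans _ tk) // gerBl ltW //.
have yd2 j : (j < k.+1)%N -> let e := datum_at j y' in
    davie (f y') (sol_path y' e) e y' (j%:R * r) (j%:R * r + r).
  rewrite ltnS leq_eqVlt => /orP[/eqP-> e|jk e].
    apply: davie_ext (yd') => //; first exact: kr_ge0.
      by move=> t _; rewrite addrK => tk; rewrite /= E.
    by move=> t _; rewrite addrK => tk; apply: datE.
  have jkr : j%:R * r + r <= k%:R * r by rewrite -krS ler_wpM2r ?ler_nat // ltW.
  apply: davie_ext (yd j jk) => //; first exact: kr_ge0.
  - by have [K hK] := yh; exists K => s t *; apply: hK => //; apply: le_trans jkr.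
  - by move=> t _ tj; rewrite E // (le_trans tj).
  - move=> t _; rewrite addrK => tj; rewrite /= E // (le_trans tj) //.
    by apply: le_trans jkr; rewrite lerDl ltW.
  - move=> t _; rewrite addrK => tj; apply: datE; first exact: ltnW.
    by rewrite (le_trans tj) //; apply: le_trans jkr; rewrite lerDl ltW.
split=> //.
- by move=> t t0; rewrite E ?y0 // (le_trans t0) ?kr_ge0.
- by rewrite krS.
rewrite krS addrK.
have yc' : exists K, ctrl_bd K (k%:R * r - r) (k%:R * r) (datum_at k y').
  have [K hK] := yc; exists K; apply: ctrl_ext hK => t _ tk; first by rewrite /= E.
  exact: datE.
exact: (hol_ctrl_bd yh' yc' (yd2 k (ltnSn k))).
Qed.

Lemma global_exists : exists y : R -> V, (forall t, t <= 0 -> y t = xi.1 t) /\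
  forall k, [/\ exists K, hol K (k%:R * r) y,
    exists K, ctrl_bd K (k%:R * r - r) (k%:R * r) (datum_at k y)
  & let e := datum_at k y in davie (f y) (sol_path y e) e y (k%:R * r) (k%:R * r + r)].
Proof.
have [nx hnx] : exists nx : nat -> (R -> V) -> (R -> V), forall k y, glob_state k y ->
    glob_state k.+1 (nx k y) /\ forall t, t <= k%:R * r -> nx k y t = y t.
  have H k : exists nx : (R -> V) -> (R -> V), forall y, glob_state k y ->
    glob_state k.+1 (nx y) /\ forall t, t <= k%:R * r -> nx y t = y t.
    have : forall y, exists y', glob_state k y ->
      glob_state k.+1 y' /\ forall t, t <= k%:R * r -> y' t = y t.
      move=> y; have [gy|ngy] := pselect (glob_state k y); last by exists y.
      by have [y' hy'] := glob_step gy; exists y'.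
    by move/choice => [nx hnx]; exists nx.
  by move/choice: H => [nx hnx]; exists nx.
pose ys := fix ys k := if k is k'.+1 then nx k' (ys k') else xi.1.
have gs k : glob_state k (ys k).
  elim: k => [|k IH]; last by have [] := hnx k _ IH.
  split=> //; rewrite mul0r //; first by rewrite sub0r; case: xi_ctrl => K hK; exists K; apply: ctrl_ext hK.
have ysE k j t : t <= k%:R * r -> ys (k + j)%N t = ys k t.
  move=> tk; elim: j => [|j IH]; first by rewrite addn0.
  rewrite addnS /=; have [_ ->] := hnx _ _ (gs (k + j)%N) => //.
  by rewrite (le_trans tk) // ler_wpM2r ?ler_nat ?leq_addr // ltW.
(* Later stages do not change earlier values, and the index is large enough: t <= (truncn (t / r) +
   1) r, also for negative t. *)
pose y t := ys (Num.truncn (t / r)).+1 t.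
have yE k t : t <= k%:R * r -> y t = ys k t.
  move=> tk; rewrite /y; set N := (Num.truncn (t / r)).+1.
  have tN : t <= N%:R * r.
    have [t0|/ltW t0] := leP 0 t; last by apply: (le_trans t0); apply: kr_ge0.
    rewrite -ler_pdivrMr //; have := truncn_itv (divr_ge0 t0 (ltW r_gt0)).
    by move=> /andP[_ /ltW].
  have [kN|/ltnW Nk] := leqP k N.
    by rewrite -(subnKC kN) ysE.
  by rewrite -(subnKC Nk) ysE.
exists y; split.
  by move=> t t0; rewrite (yE 0%N) ?mul0r.
move=> k.
have yy k' t : - r <= t -> t <= k'%:R * r -> ys k' t = y t by move=> _ tk; rewrite (yE k').
have [_ [K1 h1] [K2 h2] _] := gs k.
have [_ [K3 h3] _ h4] := gs k.+1.
have mono k' : k'%:R * r - r <= k'%:R * r by rewrite gerBl ltW.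
have dE k' t : (k' <= k.+1)%N -> t <= k'%:R * r -> (datum_at k (ys k')).2 t = (datum_at k y).2 t.
  move=> _ tk; rewrite /datum_at; case: (k) => //= _.
  rewrite !(yE k') // (le_trans _ tk) // gerBl ltW //.
split.
- by exists K1; apply: hol_ext h1; apply: yy.
- exists K2; apply: ctrl_ext h2 => t _ tk; first by rewrite /= (yE k).
  by apply: dE.
have e1 : k%:R * r <= k.+1%:R * r by rewrite krS lerDl ltW.
apply: davie_ext (h4 k (ltnSn k)) => //=.
- exact: kr_ge0.
- by exists K3; rewrite -krS.
- by move=> t q1; rewrite -krS; apply: yy.
- by move=> t _; rewrite addrK => tk; rewrite (yE k.+1) // (le_trans tk).
- by move=> t _; rewrite addrK => tk; apply: (dE k.+1) => //; rewrite (le_trans tk).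
Qed.

End Global.
End MethodOfSteps.

(** * Coefficients of class C^3_b *)

Section MeanValue.
Context {R : realType}.

Lemma mx_norm_le (m n : nat) (A : 'M[R]_(m, n)) (K : R) : 0 <= K ->
  (forall i j, `|A i j| <= K) -> `|A| <= K.
Proof.
move=> K0 h; rewrite /Num.Def.normr /= mx_normrE; apply: bigmax_le => //.
Qed.

Lemma mx_entry_le (m n : nat) (A : 'M[R]_(m, n)) i j : `|A i j| <= `|A|.
Proof.
rewrite [leRHS]/Num.Def.normr /= mx_normrE.
exact: (le_bigmax _ (fun ij : 'I_m * 'I_n => `|A ij.1 ij.2|) (i, j)).
Qed.

Lemma mulmx_norm (m n p : nat) (A : 'M[R]_(m, n)) (B : 'M[R]_(n, p)) :
  `|A *m B| <= n%:R * `|A| * `|B|.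
Proof.
apply: mx_norm_le; first by pos.
move=> i j; rewrite mxE; apply: le_trans (ler_norm_sum _ _ _) _.
apply: (le_trans (y := \sum_(k < n) `|A| * `|B|)).
  by apply: ler_sum => k _; rewrite normrM; apply: ler_pM => //; exact: mx_entry_le.
by rewrite sumr_const card_ord -mulrA mulr_natl.
Qed.

(** The norm is the largest entry, so the scalar mean value theorem, with an intermediate point for
    each entry, loses no constant. *)
Lemma mvt_mx (m n : nat) (psi dpsi : R -> 'M[R]_(m, n)) (K : R) : 0 <= K ->
  (forall x : R, is_derive x (1 : R) psi (dpsi x)) ->
  (forall x, 0 <= x -> x <= 1 -> `|dpsi x| <= K) -> `|psi 1 - psi 0| <= K.
Proof.
move=> K0 hd hK; apply: mx_norm_le => // i j; rewrite !mxE.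
have hij (x : R) : is_derive x (1 : R) (fun t => psi t i j) (dpsi x i j).
  have [h1 h2] := hd x; split; first by move/derivable_mxP: h1; apply.
  by rewrite -h2 derive_mx // mxE.
have [|c /[!in_itv]/= /andP[c0 c1]] := @MVT_segment R (fun t => psi t i j) (fun t => dpsi t i j) 0 1
    ler01 (fun x _ => hij x).
  apply: continuous_subspaceT => x.
  by apply: differentiable_continuous; apply/derivable1_diffP; have [] := hij x.
rewrite subr0 mulr1 => ->; apply: le_trans (mx_entry_le _ _ _) _; exact: hK.
Qed.

Lemma line_derive (U W : normedModType R) (f : U -> W) (q v : U) (x : R) :
  (forall p, differentiable f p) ->
  is_derive x (1 : R) (fun t : R => f (q + t *: v)) ('d f (q + x *: v) v).
Proof.
move=> hf.
have h1 : is_diff x (fun t : R => q + t *: v) (fun t : R => 0 + t *: v).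
  exact: (is_diffD (is_diff_cst q x) (is_diff_scalel x v)).
have h2 : is_diff (q + x *: v) f ('d f (q + x *: v)) by split.
have h3 := @is_diff_comp _ _ _ _ _ _ _ _ _ h1 h2.
split; first by apply: diff_derivable; case: h3.
rewrite deriveE; last by case: h3.
have [_ ->] := h3.
by rewrite /= add0r scale1r.
Qed.

End MeanValue.

(** * Taylor and four-point estimates *)

Section CbEstimates.
Context {R : realType} {n k l : nat}.
Local Notation U := ('rV[R]_n * 'rV[R]_n)%type.
Local Notation W := 'M[R]_(k, l).
Implicit Types (f : U -> W) (p q v : U).

Definition pair_basis (i : bool * 'I_n) : U :=
  if i.1 then (delta_mx 0 i.2, 0) else (0, delta_mx 0 i.2).
Definition pair_coord v (i : bool * 'I_n) : R := if i.1 then v.1 0 i.2 else v.2 0 i.2.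

Lemma pair_coord_le v i : `|pair_coord v i| <= `|v|.
Proof.
rewrite /pair_coord prod_normE le_max; case: i.1; first by rewrite mx_entry_le.
by rewrite mx_entry_le orbT.
Qed.

Lemma sum_inl (I : finType) (F : I -> 'rV[R]_n) :
  \sum_j ((F j, 0) : U) = (\sum_j F j, 0).
Proof. by elim/big_rec2: _ => // i x y _ ->; congr pair; rewrite addr0. Qed.

Lemma sum_inr (I : finType) (F : I -> 'rV[R]_n) :
  \sum_j ((0, F j) : U) = (0, \sum_j F j).
Proof. by elim/big_rec2: _ => // i x y _ ->; congr pair; rewrite addr0. Qed.

Lemma pair_basisE v : v = \sum_i pair_coord v i *: pair_basis i.
Proof.
rewrite (bigID (fun i : bool * 'I_n => i.1)) /=.
rewrite (reindex (fun j : 'I_n => (true, j))) /=; last first.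
  by exists (fun i => i.2) => [i|[b i]] //=; rewrite inE; case: b.
rewrite [X in _ + X](reindex (fun j : 'I_n => (false, j))) /=; last first.
  by exists (fun i => i.2) => [i|[b i]] //=; rewrite inE; case: b.
rewrite (eq_bigr (fun j => (v.1 0 j *: delta_mx 0 j, 0) : U)); last first.
  by move=> i _; rewrite /pair_basis /pair_coord /=; congr pair; rewrite scaler0.
rewrite [X in _ + X](eq_bigr (fun j => (0, v.2 0 j *: delta_mx 0 j) : U)); last first.
  by move=> i _; rewrite /pair_basis /pair_coord /=; congr pair; rewrite scaler0.
rewrite sum_inl sum_inr -!row_sum_delta; case: v => x y /=.
by congr pair; rewrite ?addr0 ?add0r.
Qed.

(** [Cb] controls derivatives one direction at a time. Expanding v in the 2 n basis vectors makes
    the bounds uniform in the direction. *)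
Lemma basis_bound (h : U -> W) v c : 0 <= c -> linear h ->
  (forall i, `|h (pair_basis i)| <= c) -> `|h v| <= (2 * n)%:R * c * `|v|.
Proof.
move=> c0 hl hb.
have E : h v = \sum_i pair_coord v i *: h (pair_basis i).
  pose hL : {linear U -> W} := HB.pack h (GRing.isLinear.Build _ _ _ _ h hl).
  rewrite {1}(pair_basisE v) -[LHS]/(hL _) linear_sum; apply: eq_bigr => i _.
  by rewrite linearZ.
rewrite E; apply: le_trans (ler_norm_sum _ _ _) _.
apply: (le_trans (y := \sum_(i : bool * 'I_n) `|v| * c)).
  by apply: ler_sum => i _; rewrite normrZ; apply: ler_pM => //; exact: pair_coord_le.
by rewrite sumr_const card_prod card_bool card_ord -[leLHS]mulr_natl -mulrA (mulrC c).
Qed.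

Lemma fin_bound (I : finType) (A : Type) (F : I -> A -> W) :
  (forall i, exists M, forall x, `|F i x| <= M) ->
  exists2 M, 0 <= M & forall i x, `|F i x| <= M.
Proof.
move=> /choice[M hM]; exists (\sum_i `|M i|); first exact: sumr_ge0.
move=> i x; apply: le_trans (hM i x) _; apply: le_trans (ler_norm _) _.
by rewrite (bigD1 i) //= lerDl sumr_ge0.
Qed.

Lemma line1 (p q : U) : q + 1 *: (p - q) = p.
Proof. by rewrite scale1r addrC subrK. Qed.

Lemma line0 (v q : U) : q + 0 *: v = q.
Proof. by rewrite scale0r addr0. Qed.

Lemma diff_linear f p : linear ('d f p).
Proof. by move=> a x y; exact: linearP. Qed.

Lemma linearB2 (g1 g2 : U -> W) : linear g1 -> linear g2 -> linear (fun v => g1 v - g2 v).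
Proof. by move=> h1 h2 a x y; rewrite h1 h2 scalerBr opprD addrACA. Qed.

Lemma linear_sub (g : U -> W) (x y : U) : linear g -> g (x - y) = g x - g y.
Proof. by move=> h; rewrite -scaleN1r addrC h scaleN1r addrC. Qed.

Lemma two_linear (g1 g2 : U -> W) (x y : U) : linear g1 ->
  g1 x - g2 y = g1 (x - y) + (g1 y - g2 y).
Proof. by move=> h; rewrite linear_sub // addrA subrK. Qed.

Lemma four_linear (g1 g2 g1' g2' : U -> W) (x y : U) : linear g1' -> linear g2' ->
  g1 x - g2 x - (g1' y - g2' y) = (g1 x - g2 x - (g1' x - g2' x)) + (g1' (x - y) - g2' (x - y)).
Proof.
move=> h1 h2; rewrite (linear_sub _ _ h1) (linear_sub _ _ h2).
by move: (g1 x) (g2 x) (g1' x) (g2' x) (g1' y) (g2' y) => *; mxring.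
Qed.

Lemma subr_regroup (x1 x2 x3 x4 x5 x6 : W) :
  x1 - x2 - (x3 - x4) - (x5 - x6) = x1 - x5 - x2 - (x3 - x6 - x4).
Proof. by mxring. Qed.

Lemma CbS j f : Cb j.+1 f -> Cb j f.
Proof.
elim: j f => [|j IH] f [h1 h2 h3]; first by split.
split=> //; have [h4 h5] := h3; split=> // v; exact: IH.
Qed.

Lemma Cb1_bound f : Cb 1 f -> exists2 c, 0 <= c &
  (forall p v, `|'d f p v| <= c * `|v|) /\ (forall p q, `|f p - f q| <= c * `|p - q|).
Proof.
move=> [_ _ [hd hb]].
have [M M0 hM] := @fin_bound _ _ (fun i p => 'd f p (pair_basis i))
  (fun i => let: And3 _ h _ := hb (pair_basis i) in h).
pose c := (2 * n)%:R * M.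
have c0 : 0 <= c by rewrite mulr_ge0.
have h1 p v : `|'d f p v| <= c * `|v|.
  by apply: basis_bound => //; apply: diff_linear.
exists c => //; split=> // p q.
have := @mvt_mx R _ _ (fun t => f (q + t *: (p - q))) (fun t => 'd f (q + t *: (p - q)) (p - q))
  (c * `|p - q|) _ _ _.
rewrite line1 line0; apply.
- by pos.
- by move=> x; apply: line_derive.
- by move=> x _ _; apply: h1.
Qed.

(** The first estimate applies [Cb1_bound] to the finitely many derivatives along basis vectors. The
    four-point estimate is the mean value theorem for the difference of f along the segments from q
    to p and from q' to p'. *)
Lemma Cb2_bound f : Cb 2 f -> exists2 c, 0 <= c &
  (forall p q v, `|'d f p v - 'd f q v| <= c * `|p - q| * `|v|) /\
  (forall p q p' q', `|f p - f q - (f p' - f q')| <=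
    c * (`|(p - q) - (p' - q')| + (`|p - p'| + `|q - q'|) * `|p' - q'|)).
Proof.
move=> hf; have [c1 c10 [hc1 _]] := Cb1_bound (CbS hf).
have [_ _ [hd hb]] := hf.
have /choice[c hc] : forall i, exists c, 0 <= c /\ forall p q,
    `|'d f p (pair_basis i) - 'd f q (pair_basis i)| <= c * `|p - q|.
  by move=> i; have [c c0 [_ h]] := Cb1_bound (hb (pair_basis i)); exists c.
pose C := \sum_i c i.
have C0 : 0 <= C by apply: sumr_ge0 => i _; have [] := hc i.
have hC i p q : `|'d f p (pair_basis i) - 'd f q (pair_basis i)| <= C * `|p - q|.
  have [_ h] := hc i; apply: le_trans (h p q) _; rewrite ler_wpM2r //.
  by rewrite /C (bigD1 i) //= lerDl sumr_ge0 // => j _; have [] := hc j.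
pose c2 := (2 * n)%:R * C.
have c20 : 0 <= c2 by rewrite mulr_ge0.
have h2 p q v : `|'d f p v - 'd f q v| <= c2 * `|p - q| * `|v|.
  rewrite /c2 -(mulrA _ C); apply: (@basis_bound (fun v => 'd f p v - 'd f q v)).
  - by pos.
  - by apply: linearB2; apply: diff_linear.
  - by move=> i; apply: hC.
exists (c1 + c2); first exact: addr_ge0.
have H4 p q v : `|'d f p v - 'd f q v| <= (c1 + c2) * `|p - q| * `|v|.
  by apply: le_trans (h2 p q v) _; rewrite ler_wpM2r // ler_wpM2r // lerDr.
split=> // p q p' q'.
set Dl := p - q; set Dl' := p' - q'.
have hx (x : R) : is_derive x (1 : R) (fun t : R => f (q + t *: Dl) - f (q' + t *: Dl'))
    ('d f (q + x *: Dl) Dl - 'd f (q' + x *: Dl') Dl').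
  by apply: is_deriveB; apply: line_derive.
have := @mvt_mx R _ _ _ _ ((c1 + c2) * (`|Dl - Dl'| + (`|p - p'| + `|q - q'|) * `|Dl'|)) _ hx _.
rewrite /= !line1 !line0.
rewrite (_ : f p - f p' - (f q - f q') = f p - f q - (f p' - f q')); last first.
  by move: (f p) (f p') (f q) (f q') => *; mxring.
apply; first by rewrite mulr_ge0 ?addr_ge0 // mulr_ge0 // addr_ge0.
move=> x x0 x1.
(* Corresponding points of the two segments differ by a convex combination of the differences of
   their end points. *)
have xb : `|(q + x *: Dl) - (q' + x *: Dl')| <= `|p - p'| + `|q - q'|.
  have -> : (q + x *: Dl) - (q' + x *: Dl') = x *: (p - p') + (1 - x) *: (q - q').
    rewrite /Dl /Dl' scalerBl scale1r !scalerBr !opprD !opprK.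
    rewrite -!addrA; congr pair; rewrite /=; mxring.
  apply: le_trans (ler_normD _ _) _; rewrite !normrZ !ger0_norm ?subr_ge0 //.
  by apply: lerD; rewrite ler_piMl // gerBl.
rewrite (_ : _ - _ = 'd f (q + x *: Dl) (Dl - Dl')
   + ('d f (q + x *: Dl) Dl' - 'd f (q' + x *: Dl') Dl')); last first.
  by apply: two_linear; apply: diff_linear.
apply: le_trans (ler_normD _ _) _; rewrite [leRHS]mulrDr; apply: lerD.
  by apply: le_trans (hc1 _ _) _; rewrite ler_wpM2r // lerDl.
apply: le_trans (H4 _ _ _) _; rewrite -[leLHS]mulrA ler_wpM2l ?addr_ge0 //.
by rewrite ler_wpM2r.
Qed.

(** The argument of [Cb2_bound] one order higher: the mean value theorem is applied to f along a
    segment minus its linear part at the starting point. The last estimate is the four-point bound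
    for the derivatives along basis vectors. *)
Lemma Cb3_bound f : Cb 3 f -> exists2 c, 0 <= c &
  [/\ forall p q, `|f q - f p - 'd f p (q - p)| <= c * `|q - p| ^+ 2,
   forall p q p' q',
    `|(f q - f p - 'd f p (q - p)) - (f q' - f p' - 'd f p' (q' - p'))| <=
    c * (`|(q - p) - (q' - p')| * (`|q - p| + `|q' - p'|)
         + (`|p - p'| + `|q - q'|) * (`|q - p| + `|q' - p'|) ^+ 2)
   & forall p q p' q' v, `|'d f p v - 'd f q v - ('d f p' v - 'd f q' v)| <=
    c * (`|(p - q) - (p' - q')| + (`|p - p'| + `|q - q'|) * `|p' - q'|) * `|v|].
Proof.
move=> hf; have [c2 c20 [hc2 _]] := Cb2_bound (CbS hf).
have [_ _ [hd hb]] := hf.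
have /choice[c hc] : forall i, exists c, 0 <= c /\ forall p q p' q',
    `|'d f p (pair_basis i) - 'd f q (pair_basis i)
      - ('d f p' (pair_basis i) - 'd f q' (pair_basis i))| <=
    c * (`|(p - q) - (p' - q')| + (`|p - p'| + `|q - q'|) * `|p' - q'|).
  by move=> i; have [c c0 [_ h]] := Cb2_bound (hb (pair_basis i)); exists c.
pose C := \sum_i c i.
have C0 : 0 <= C by apply: sumr_ge0 => i _; have [] := hc i.
pose B p q p' q' := `|(p - q) - (p' - q')| + (`|p - p'| + `|q - q'|) * `|p' - q'| : R.
have B0 p q p' q' : 0 <= B p q p' q' by rewrite /B; pos.
pose c3 := (2 * n)%:R * C.
have c30 : 0 <= c3 by rewrite mulr_ge0.
have h3 p q p' q' v : `|'d f p v - 'd f q v - ('d f p' v - 'd f q' v)| <= c3 * B p q p' q' * `|v|.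
  rewrite /c3 -(mulrA _ C); apply: (@basis_bound (fun v => 'd f p v - 'd f q v - ('d f p' v - 'd f q' v))).
  - by rewrite mulr_ge0.
  - by do 2!apply: linearB2; apply: diff_linear.
  - move=> i; have [_ h] := hc i; apply: le_trans (h p q p' q') _; rewrite ler_wpM2r //.
    by rewrite /C (bigD1 i) //= lerDl sumr_ge0 // => j _; have [] := hc j.
pose c4 := c2 + 2 * c3.
have c40 : 0 <= c4 by rewrite /c4; pos.
have c24 : c2 <= c4 by rewrite /c4 lerDl; pos.
have c34 : c3 <= c4 by rewrite /c4; lra.
have hlin (p v : U) (x : R) : is_derive x (1 : R) (fun t : R => t *: 'd f p v) ('d f p v).
  have h := is_diff_scalel x ('d f p v : 'M[R]_(k, l)).
  split; first by apply: diff_derivable; case: h.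
  by rewrite deriveE; [have [_ ->] := h; rewrite scale1r|case: h].
have xq (p q : U) (x : R) : p + x *: q - p = x *: q by rewrite addrC addKr.
exists c4 => //; split.
- move=> p q; set v := q - p.
  have hx (x : R) : is_derive x (1 : R) (fun t : R => f (p + t *: v) - t *: 'd f p v)
     ('d f (p + x *: v) v - 'd f p v).
    by apply: is_deriveB; apply: line_derive.
  have := @mvt_mx R _ _ _ _ (c4 * `|v| ^+ 2) _ hx _.
  rewrite /= line1 line0 scale0r scale1r subr0 addrAC; apply.
    by pos.
  move=> x x0 x1; apply: le_trans (hc2 _ _ _) _; rewrite expr2 mulrA ler_wpM2r //.
  apply: ler_pM => //; rewrite xq normrZ ger0_norm // ler_piMl //.
- move=> p q p' q'; set v := q - p; set v' := q' - p'.
  have hx (x : R) : is_derive x (1 : R) (fun t : R => (f (p + t *: v) - t *: 'd f p v)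
      - (f (p' + t *: v') - t *: 'd f p' v'))
     (('d f (p + x *: v) v - 'd f p v) - ('d f (p' + x *: v') v' - 'd f p' v')).
    by apply: is_deriveB; apply: is_deriveB; (apply: line_derive || apply: hlin).
  have := @mvt_mx R _ _ _ _ (c4 * (`|v - v'| * (`|v| + `|v'|) + (`|p - p'| + `|q - q'|) * (`|v| + `|v'|) ^+ 2)) _ hx _.
  rewrite /= !line1 !line0 !scale0r !scale1r !subr0.
  rewrite subr_regroup.
  apply; first by pos.
  move=> x x0 x1.
  pose D := `|p - p'| + `|q - q'|.
  have D0 : 0 <= D by rewrite /D; pos.
  have vv : v - v' = (q - q') - (p - p').
    by rewrite /v /v'; congr pair; rewrite /=; mxring.
  have xb : `|(p + x *: v) - (p' + x *: v')| <= D.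
    have -> : (p + x *: v) - (p' + x *: v') = (1 - x) *: (p - p') + x *: (q - q').
      by rewrite /v /v'; congr pair; rewrite /=; mxring.
    apply: le_trans (ler_normD _ _) _; rewrite !normrZ !ger0_norm ?subr_ge0 //.
    by apply: lerD; rewrite ler_piMl // gerBl.
  rewrite (_ : _ - _ - (_ - _) = ('d f (p + x *: v) v - 'd f p v - ('d f (p' + x *: v') v - 'd f p' v))
     + ('d f (p' + x *: v') (v - v') - 'd f p' (v - v'))); last first.
    by apply: four_linear; apply: diff_linear.
  have n1 := normr_ge0 v; have n2 := normr_ge0 v'; have n3 := normr_ge0 (v - v').
  have b1 : B (p + x *: v) p (p' + x *: v') p' <= `|v - v'| + 2 * D * `|v'|.
    rewrite /B !xq -scalerBr normrZ ger0_norm //; apply: lerD; first by rewrite ler_piMl.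
    apply: ler_pM; rewrite ?addr_ge0 // ?normrZ ?ger0_norm //; last by rewrite ler_piMl.
    by rewrite mulr_natl mulr2n; apply: lerD => //; rewrite /D lerDl.
  have t1 := h3 (p + x *: v) p (p' + x *: v') p' v.
  have t2 : `|'d f (p' + x *: v') (v - v') - 'd f p' (v - v')| <= c2 * `|v'| * `|v - v'|.
    apply: le_trans (hc2 _ _ _) _; rewrite ler_wpM2r // ler_wpM2l // xq normrZ ger0_norm //.
    by rewrite ler_piMl.
  apply: le_trans (ler_normD _ _) _; apply: le_trans (lerD t1 t2) _.
  apply: (le_trans (y := c3 * (`|v - v'| + 2 * D * `|v'|) * `|v| + c2 * `|v'| * `|v - v'|)).
    by rewrite lerD2r ler_wpM2r // ler_wpM2l.
  rewrite -/D /c4; move: c20 c30 D0 n1 n2 n3; move: (`|v|) (`|v'|) (`|v - v'|) => a b e.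
  move=> c20' c30' D0' a0 b0 e0.
  have p1 : 0 <= c3 * e * a by pos.
  have p2 : 0 <= c3 * e * b by pos.
  have p3 : 0 <= c2 * e * a by pos.
  have p4 : 0 <= c2 * D * (a + b) ^+ 2 by pos.
  have p5 : 0 <= c3 * D * (a ^+ 2 + b ^+ 2) by pos.
  have p6 : 0 <= c3 * D * (a * b) by pos.
  rewrite -subr_ge0 (_ : _ - _ = c2 * e * a + c3 * e * a + 2 * (c3 * e * b) + c2 * D * (a + b) ^+ 2
     + 2 * (c3 * D * (a ^+ 2 + b ^+ 2)) + 2 * (c3 * D * (a * b))); last by ring.
  by pos.
- move=> p q p' q' v; apply: le_trans (h3 _ _ _ _ _) _; rewrite ler_wpM2r // ler_wpM2r //.
Qed.

End CbEstimates.

(** * Contraction of the derivative of G with the areas *)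

Section Contraction.
Context {R : realType} {n d : nat}.
Local Notation V := 'rV[R]_n.
Local Notation M := 'M[R]_(d, n).
Local Notation U := (V * V)%type.
Local Notation H := (M * M)%type.
Local Notation W := ('M[R]_d * 'M[R]_d)%type.

(** The two area terms of the delayed rough integral, [F] being the derivative of G. The form
    follows [contract], so that the germ is the summand of [rough_sum]. *)
Definition pair_contract (F : U -> M) (a : H) (t : W) : V :=
  Defs.contract (fun v => F (v *m a.1, 0)) t.1 + Defs.contract (fun v => F (0, v *m a.2)) t.2.

Lemma linear0_fun (F : U -> M) : linear F -> F 0 = 0.
Proof. by move=> h; rewrite -(subrr 0) linear_sub // subrr. Qed.

Lemma linearD_fun (F : U -> M) x y : linear F -> F (x + y) = F x + F y.
Proof. by move=> h; rewrite -[x]scale1r h !scale1r. Qed.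

Lemma linearZ_fun (F : U -> M) (a : R) x : linear F -> F (a *: x) = a *: F x.
Proof. by move=> h; rewrite -[a *: x]addr0 h linear0_fun // addr0. Qed.

Lemma linear_sum_fun (F : U -> M) m (x : 'I_m -> U) : linear F -> F (\sum_i x i) = \sum_i F (x i).
Proof.
move=> h; elim/big_rec2: _ => [|i y z _ <-]; first exact: linear0_fun.
by rewrite linearD_fun.
Qed.

Lemma contract_bound (F : 'rV[R]_d -> M) (T : 'M[R]_d) c : 0 <= c ->
  (forall v, `|v| <= 1 -> `|F v| <= c) -> `|Defs.contract F T| <= d%:R ^+ 2 * c * `|T|.
Proof.
move=> c0 hF; rewrite /Defs.contract; apply: le_trans (ler_norm_sum _ _ _) _.
apply: (le_trans (y := \sum_(i < d) d%:R * `|T| * c)).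
  apply: ler_sum => i _; apply: le_trans (mulmx_norm _ _) _.
  apply: ler_pM; rewrite ?mulr_ge0 //.
    rewrite ler_wpM2l // mx_norm_le // => j k; rewrite mxE; exact: mx_entry_le.
  apply: hF; apply: mx_norm_le => // j k; rewrite mxE.
  by case: (_ && _); rewrite ?normr1 ?normr0.
rewrite sumr_const card_ord -mulr_natl le_eqVlt; apply/orP; left; apply/eqP; ring.
Qed.

Lemma norm_fst (V1 V2 : normedModType R) (x : V1 * V2) : `|x.1| <= `|x|.
Proof. by rewrite prod_normE le_max lexx. Qed.
Lemma norm_snd (V1 V2 : normedModType R) (x : V1 * V2) : `|x.2| <= `|x|.
Proof. by rewrite prod_normE le_max lexx orbT. Qed.

Lemma pair_contract_bound F a t c : 0 <= c -> (forall w, `|F w| <= c * `|w|) ->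
  `|pair_contract F a t| <= (2 * d%:R ^+ 3) * c * `|a| * `|t|.
Proof.
move=> c0 hF.
have h0 : forall A : M, forall v : 'rV[R]_d, `|v| <= 1 -> `|v *m A| <= d%:R * `|A|.
  move=> A v hv; apply: le_trans (mulmx_norm _ _) _; rewrite -mulrA ler_wpM2l //.
  by rewrite ler_piMl.
apply: le_trans (ler_normD _ _) _.
have b0 : 0 <= c * (d%:R * `|a|) by pos.
have := @contract_bound (fun v => F (v *m a.1, 0)) t.1 _ b0.
have := @contract_bound (fun v => F (0, v *m a.2)) t.2 _ b0.
move=> /(_ _)B2 /(_ _)B1.
apply: (le_trans (y := d%:R ^+ 2 * (c * (d%:R * `|a|)) * `|t.1|
   + d%:R ^+ 2 * (c * (d%:R * `|a|)) * `|t.2|)).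
  apply: lerD.
    apply: B1 => v hv; apply: le_trans (hF _) _; rewrite ler_wpM2l //.
    apply: pair_le; rewrite ?normr0; last by pos.
    by apply: le_trans (h0 _ _ hv) _; rewrite ler_wpM2l // norm_fst.
  apply: B2 => v hv; apply: le_trans (hF _) _; rewrite ler_wpM2l //.
  apply: pair_le; rewrite ?normr0; first by pos.
  by apply: le_trans (h0 _ _ hv) _; rewrite ler_wpM2l // norm_snd.
apply: (le_trans (y := d%:R ^+ 2 * (c * (d%:R * `|a|)) * `|t|
   + d%:R ^+ 2 * (c * (d%:R * `|a|)) * `|t|)).
  by apply: lerD; rewrite ler_wpM2l ?norm_fst ?norm_snd //; pos.
by rewrite le_eqVlt; apply/orP; left; apply/eqP; ring.
Qed.

Lemma contractB (F F' : 'rV[R]_d -> M) T :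
  Defs.contract F T - Defs.contract F' T = Defs.contract (fun v => F v - F' v) T.
Proof. by rewrite /Defs.contract -sumrB; apply: eq_bigr => i _; rewrite mulmxBr. Qed.

Lemma contractD (F : 'rV[R]_d -> M) T T' : Defs.contract F (T + T') = Defs.contract F T + Defs.contract F T'.
Proof. by rewrite /Defs.contract -big_split; apply: eq_bigr => i _; rewrite linearD mulmxDl. Qed.

Lemma pair_contractB F F' a t :
  pair_contract F a t - pair_contract F' a t = pair_contract (fun w => F w - F' w) a t.
Proof. by rewrite /pair_contract opprD addrACA !contractB. Qed.

Lemma pair_contractB4 F1 F2 F3 F4 a t :
  pair_contract F1 a t - pair_contract F2 a t - (pair_contract F3 a t - pair_contract F4 a t)
  = pair_contract (fun w => F1 w - F2 w - (F3 w - F4 w)) a t.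
Proof. by rewrite !pair_contractB. Qed.

Lemma pair_contract_subl F a b t : linear F ->
  pair_contract F (a - b) t = pair_contract F a t - pair_contract F b t.
Proof.
move=> hF; rewrite /pair_contract opprD addrACA !contractB /Defs.contract.
congr (_ + _); apply: eq_bigr => i _; congr (_ *m _).
  by rewrite mulmxBr -linear_sub //; congr F; congr pair; rewrite subr0.
by rewrite mulmxBr -linear_sub //; congr F; congr pair; rewrite subr0.
Qed.

Lemma pair_contractD F a t t' :
  pair_contract F a (t + t') = pair_contract F a t + pair_contract F a t'.
Proof. by rewrite /pair_contract !contractD addrACA. Qed.

Lemma contract_tens (F : 'rV[R]_d -> M) (z x : 'rV[R]_d) :
  Defs.contract F (z^T *m x) = x *m (\sum_i z 0 i *: F (delta_mx 0 i)).
Proof.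
rewrite /Defs.contract mulmx_sumr; apply: eq_bigr => i _.
rewrite -scalemxAr scalemxAl; congr (_ *m _).
apply/matrixP => j k; rewrite !mxE big_ord1 !mxE.
by rewrite (ord1 j).
Qed.

(** On a pure tensor, contraction is evaluation: by linearity, the sum over the coordinates of z
    reassembles F. *)
Lemma pair_contract_chen F a z x : linear F ->
  pair_contract F a (pair_tens z x) = x *m F (pair_act z a).
Proof.
move=> hF; rewrite /pair_contract /pair_tens /= !contract_tens -mulmxDr; congr (_ *m _).
have E1 : \sum_i z.1 0 i *: F (delta_mx 0 i *m a.1, 0) = F (z.1 *m a.1, 0).
  rewrite [in RHS](row_sum_delta z.1) mulmx_suml.
  rewrite (_ : (\sum_i _, 0) = \sum_i z.1 0 i *: ((delta_mx 0 i *m a.1, 0) : U)); last first.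
    rewrite -sum_inl; apply: eq_bigr => i _; congr pair; first by rewrite scalemxAl.
    by rewrite scaler0.
  by rewrite linear_sum_fun //; apply: eq_bigr => i _; rewrite linearZ_fun.
have E2 : \sum_i z.2 0 i *: F (0, delta_mx 0 i *m a.2) = F (0, z.2 *m a.2).
  rewrite [in RHS](row_sum_delta z.2) mulmx_suml.
  rewrite (_ : (0, \sum_i _) = \sum_i z.2 0 i *: ((0, delta_mx 0 i *m a.2) : U)); last first.
    rewrite -sum_inr; apply: eq_bigr => i _; congr pair; last by rewrite scalemxAl.
    by rewrite scaler0.
  by rewrite linear_sum_fun //; apply: eq_bigr => i _; rewrite linearZ_fun.
rewrite E1 E2 -linearD_fun //; congr F; rewrite /pair_act; congr pair.
  by rewrite /= addr0.
by rewrite /= add0r.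
Qed.

(** L collects all constants: d enters through matrix products in the largest-entry norm, 2 d^3
    through [pair_contract_bound]. The third derivative is used for the four-point estimates [gc_T4]
    and [gc_P4]. *)
Lemma Cb3_germ_coeff (G : U -> M) : Cb 3 G -> exists L,
  germ_coeff L G (fun p => 'd G p) pair_act (fun p => pair_contract ('d G p)) pair_tens.
Proof.
move=> hG.
have [_ [M0 hM0] _] := hG.
have [c1 c10 [h1 h1']] := Cb1_bound (CbS (CbS hG)).
have [c2 c20 [h2 h2']] := Cb2_bound (CbS hG).
have [c3 c30 [h3 h3' h3'']] := Cb3_bound hG.
have hl p : linear ('d G p) by apply: diff_linear.
pose D : R := 2 * d%:R ^+ 3.
have D0 : 0 <= D by rewrite /D; pos.
pose c := c1 + c2 + c3.
have cc0 : 0 <= c by rewrite /c; pos.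
pose L := 1 + `|M0| + d%:R + c + D * c.
have Dc0 : 0 <= D * c by rewrite mulr_ge0.
have d0 : 0 <= d%:R :> R by [].
have m0 := normr_ge0 M0.
have dL : d%:R <= L by rewrite /L; lra.
have c1L : c1 <= L by rewrite /L /c in Dc0 *; lra.
have c2L : c2 <= L by rewrite /L /c in Dc0 *; lra.
have c3L : c3 <= L by rewrite /L /c in Dc0 *; lra.
have DL x : 0 <= x -> x <= c -> D * x <= L.
  move=> x0 xc; apply: (le_trans (y := D * c)); first by rewrite ler_wpM2l.
  by rewrite /L; lra.
have D1 : D * c1 <= L by apply: DL => //; rewrite /c; lra.
have D2 : D * c2 <= L by apply: DL => //; rewrite /c; lra.
have D3 : D * c3 <= L by apply: DL => //; rewrite /c; lra.
have up (x y w : R) : 0 <= w -> x <= y -> x * w <= y * w by move=> *; rewrite ler_wpM2r.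
exists L; split.
- by rewrite /L; lra.
- by move=> p; apply: le_trans (hM0 p) _; apply: le_trans (ler_norm M0) _; rewrite /L; lra.
- by move=> p q; apply: le_trans (h1' p q) _; apply: (up).
- by move=> p q p' q'; apply: le_trans (h2' p q p' q') _; apply: (up) => //; pos.
- by move=> p v w; apply: linear_sub.
- by move=> p v; apply: le_trans (h1 p v) _; apply: (up).
- by move=> p q v; apply: le_trans (h2 p q v) _; apply: (up) => //; apply: (up).
- by move=> p q; apply: le_trans (h3 p q) _; apply: (up) => //; pos.
- by move=> p q p' q'; apply: le_trans (h3' p q p' q') _; apply: (up) => //; pos.
- by move=> z a b; rewrite /pair_act; congr pair; rewrite /= mulmxBr.
- move=> z a; apply: pair_le; apply: le_trans (mulmx_norm _ _) _.
    apply: ler_pM; rewrite ?mulr_ge0 ?norm_fst //.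
    by apply: ler_pM; rewrite ?norm_fst.
  apply: ler_pM; rewrite ?mulr_ge0 ?norm_snd //.
  by apply: ler_pM; rewrite ?norm_snd.
- by move=> p a b t; apply: pair_contract_subl.
- by move=> p a t t'; apply: pair_contractD.
- move=> p a t; apply: le_trans (pair_contract_bound a t c10 (h1 p)) _.
  by apply: (up) => //; apply: (up).
- move=> p q a t; rewrite pair_contractB.
  have b0 : 0 <= c2 * `|p - q| by pos.
  apply: le_trans (pair_contract_bound a t b0 (h2 p q)) _.
  by apply: (up) => //; apply: (up) => //; rewrite mulrA; apply: (up).
- move=> p q p' q' a t; rewrite pair_contractB4.
  pose B := `|p - q - (p' - q')| + (`|p - p'| + `|q - q'|) * `|p' - q'|; rewrite -/B.
  have B0 : 0 <= B by rewrite /B; pos.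
  have b0 : 0 <= c3 * B by pos.
  apply: le_trans (pair_contract_bound a t b0 (h3'' p q p' q')) _.
  by apply: (up) => //; apply: (up) => //; rewrite mulrA; apply: (up).
- by move=> p a z x; apply: pair_contract_chen.
- move=> x g; apply: le_trans (mulmx_norm _ _) _.
  by apply: (up) => //; apply: (up).
Qed.

End Contraction.

(** * The drift *)

Section Integrals.
Context {R : realType}.
Variable mu : {measure set (measurableTypeR R) -> \bar R}.
Implicit Types (a b : R) (g h : R -> R).

Lemma cont_integrable a b g : (mu `[a, b]%classic < +oo)%E -> continuous g ->
  mu.-integrable `[a, b] (EFin \o g).
Proof.
move=> mab cg; apply: measurable_bounded_integrable => //.
  apply: measurable_funS (measurableT) (@subsetT _ _) _.
  exact: continuous_measurable_fun.
have cgw : {within `[a, b], continuous g} by exact: continuous_subspaceT.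
have /compact_bounded[K [_ hK]] := continuous_compact cgw (@segment_compact R a b).
by exists K; split; rewrite ?num_real // => x Kx y yab; apply: hK => //; exists y.
Qed.

Lemma Rintegral_diff_le a b g h m : (mu `[a, b]%classic < +oo)%E -> continuous g -> continuous h ->
  (forall x, a <= x -> x <= b -> `|g x - h x| <= m) ->
  `|\int[mu]_(x in `[a, b]) g x - \int[mu]_(x in `[a, b]) h x| <= m * fine (mu `[a, b]%classic).
Proof.
move=> mab cg ch hm.
have mD : measurable (`[a, b]%classic : set (measurableTypeR R)) by exact: measurable_itv.
have ig := cont_integrable mab cg; have ih := cont_integrable mab ch.
have cgh : continuous (fun x => g x - h x) by move=> x; apply: cvgB; [exact: cg|exact: ch].
have igh := cont_integrable mab cgh.
have cn : continuous (fun x => `|g x - h x|).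
  by move=> x; apply: cvg_norm; exact: cgh.
have ic : mu.-integrable `[a, b] (EFin \o cst m).
  by apply: cont_integrable => // x; apply: cvg_cst.
rewrite -RintegralB //.
apply: le_trans (le_normr_Rintegral mD igh) _.
rewrite -(Rintegral_cst mu mD m); apply: le_Rintegral => //.
  exact: cont_integrable.
by move=> x; rewrite /= in_itv /= => /andP[]; exact: hm.
Qed.

Lemma Rintegral_ext a b g h : (forall x : R, a <= x -> x <= b -> g x = h x) ->
  \int[mu]_(x in `[a, b]) g x = \int[mu]_(x in `[a, b]) h x.
Proof.
by move=> e; apply: eq_Rintegral => x; rewrite inE /= in_itv /= => /andP[]; exact: e.
Qed.

End Integrals.

Section Continuity.
Context {R : realType} {V : normedModType R}.
Variable beta : R.
Hypothesis beta_gt : 3^-1 < beta.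
Local Notation pw := (hpow beta).

Lemma holder_continuous (g : R -> V) K :
  (forall s t, s <= t -> `|g t - g s| <= K * pw s t) -> continuous g.
Proof.
move=> h x; apply/cvgrPdist_le => /= e e0.
pose q := Num.min 1 (e / (`|K| + 1)).
have q0 : 0 < q by rewrite lt_min ltr01 divr_gt0 // ltr_wpDl.
have q1 : q <= 1 by rewrite ge_min lexx.
have Kq : `|K| * q <= e.
  have : (`|K| + 1) * q <= e.
    by rewrite mulrC -ler_pdivlMr ?ltr_wpDl // ge_min lexx orbT.
  by apply: le_trans; rewrite ler_wpM2r ?(ltW q0) // lerDl.
have key s t : s <= t -> t - s <= q ^+ 3 -> `|g t - g s| <= e.
  move=> st hst; apply: le_trans (h _ _ st) _.
  apply: le_trans (ler_wpM2r (pw_ge0 _ _ _) (ler_norm K)) _.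
  apply: le_trans Kq; apply: ler_wpM2l => //.
  apply: le_trans (pw_le beta_gt st hst) _.
  by apply: pow_small; rewrite // ltW.
near=> t.
have ht : `|x - t| <= q ^+ 3.
  by near: t; apply: (@cvgr_dist_le _ _ _ _ (nbhs_filter x) id x) => //; rewrite exprn_gt0.
move: ht; rewrite ler_norml => /andP[h1 h2].
have [xt|/ltW tx] := leP x t; last by exact: key.
by rewrite distrC; apply: key => //; lra.
Unshelve. all: by end_near.
Qed.

End Continuity.

Section Drift.
Context {R : realType} {n : nat}.
Variables (r beta : R).
Hypotheses (beta_gt : 3^-1 < beta) (r_ge0 : 0 <= r).
Variable pi : 'I_n -> 'I_n -> {charge set (measurableTypeR R) -> \bar R}.
Local Notation V := 'rV[R]_n.
Local Notation pw := (hpow beta).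

(** The total variation of [nu] on [-r, 0], through the Jordan decomposition. *)
Definition charge_mass (nu : {charge set (measurableTypeR R) -> \bar R}) : R :=
  fine (charge_pos nu `[- r, 0]%classic) + fine (charge_neg nu `[- r, 0]%classic).

Lemma charge_mass_ge0 nu : 0 <= charge_mass nu.
Proof. by rewrite addr_ge0 // fine_ge0 // measure_ge0. Qed.

Lemma charge_integral_diff (nu : {charge set (measurableTypeR R) -> \bar R}) (g h : R -> R) m : continuous g -> continuous h ->
  (forall x, - r <= x -> x <= 0 -> `|g x - h x| <= m) ->
  `|charge_integral nu `[- r, 0] g - charge_integral nu `[- r, 0] h|
    <= m * charge_mass nu.
Proof.
move=> cg ch hm; have mD : measurable (`[- r, 0]%classic : set (measurableTypeR R)).
  exact: measurable_itv.
have E (a b c d : R) : a - b - (c - d) = (a - c) + (d - b) by ring.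
rewrite /charge_integral /charge_mass E mulrDr.
apply: le_trans (ler_normD _ _) _; apply: lerD.
  apply: Rintegral_diff_le => //.
  by rewrite /charge_pos -ge0_fin_numE ?measure_ge0 // fin_num_measure.
rewrite distrC; apply: Rintegral_diff_le => //.
by rewrite /charge_neg -ge0_fin_numE ?measure_ge0 // fin_num_measure.
Qed.

Definition pi_mass : R := \sum_j \sum_i charge_mass (pi i j).

Lemma pi_mass_ge0 : 0 <= pi_mass.
Proof. by do 2![apply: sumr_ge0 => ? _]; exact: charge_mass_ge0. Qed.

Lemma entry_continuous (y : R -> V) i : continuous y -> continuous (fun t => y t 0 i).
Proof.
move=> cy x; apply/cvgrPdist_le => /= e e0.
have /cvgrPdist_le/(_ e e0) := cy x; apply: filterS => t; apply: le_trans.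
by have := mx_entry_le (y x - y t) 0 i; rewrite !mxE.
Qed.

(** Two paths and two times at once: equal times give the Lipschitz dependence on the path, equal
    paths the continuity in time. *)
Lemma delay_average_diff (y z : R -> V) t t' m : continuous y -> continuous z -> 0 <= m ->
  (forall x, - r <= x -> x <= 0 -> `|y (x + t) - z (x + t')| <= m) ->
  `|delay_average r pi y t - delay_average r pi z t'| <= m * pi_mass.
Proof.
move=> cy cz m0 hm.
have shift_cont (w : R -> V) c i : continuous w -> continuous (fun x => w (x + c) 0 i).
  move=> cw x; apply: (@continuous_comp _ _ _ (fun x => x + c) (fun t => w t 0 i)).
    by apply: cvgD; [exact: cvg_id|exact: cvg_cst].
  exact: entry_continuous.
apply: mx_norm_le; first by rewrite mulr_ge0 // pi_mass_ge0.
move=> i0 j; rewrite !mxE -sumrB; apply: le_trans (ler_norm_sum _ _ _) _.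
apply: le_trans (_ : \sum_i m * charge_mass (pi i j) <= _).
  apply: ler_sum => i _; apply: charge_integral_diff; [exact: shift_cont|exact: shift_cont|].
  move=> x x1 x2; apply: le_trans (hm x x1 x2).
  by have := mx_entry_le (y (x + t) - z (x + t')) 0 i; rewrite !mxE.
rewrite -mulr_sumr ler_wpM2l // /pi_mass [leRHS](bigD1 j) //= lerDl.
by do 2![apply: sumr_ge0 => ? _]; exact: charge_mass_ge0.
Qed.

Variable A : 'M[R]_(n + n, n).

(** A enters through its norm only, which is why the polynomial of the theorem can be chosen from
    |A|. The factor n + n is the cost of a matrix product in the largest-entry norm. *)
Definition drift_const : R := (n + n)%:R * (1 + pi_mass) * `|A|.

Lemma drift_const_ge0 : 0 <= drift_const.
Proof. by rewrite /drift_const; have := pi_mass_ge0 => ?; pos. Qed.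

Let field (y : R -> V) (t : R) : V := row_mx (y t) (delay_average r pi y t) *m A.

Lemma field_diff (y z : R -> V) t t' m : continuous y -> continuous z -> 0 <= m ->
  (forall x, - r <= x -> x <= 0 -> `|y (x + t) - z (x + t')| <= m) ->
  `|field y t - field z t'| <= drift_const * m.
Proof.
move=> cy cz m0 hm; rewrite /field -mulmxBl opp_row_mx add_row_mx.
have P0 := pi_mass_ge0.
apply: le_trans (mulmx_norm _ _) _; rewrite /drift_const [leRHS]mulrAC ler_wpM2r //.
rewrite -mulrA ler_wpM2l //; apply: mx_norm_le; first by pos.
move=> i j; rewrite mxE; case: splitP => k _.
  apply: le_trans (mx_entry_le _ _ _) _.
  have := hm 0; rewrite !add0r => /(_ _ _)/le_trans; apply; rewrite ?oppr_le0 //.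
  by rewrite mulrDl mul1r lerDl mulr_ge0.
apply: le_trans (mx_entry_le _ _ _) _.
apply: le_trans (delay_average_diff cy cz m0 hm) _.
by rewrite mulrDl mul1r mulrC lerDr.
Qed.

(* Freezing a path outside [-r, T] makes it globally Hoelder continuous. *)
Let clamp (T : R) (y : R -> V) (t : R) : V := y (Num.max (- r) (Num.min t T)).

Let clamp_holder K T y s t : hol r beta K T y -> - r <= T -> s <= t ->
  `|clamp T y t - clamp T y s| <= `|K| * pw s t.
Proof.
move=> hy rT st; rewrite /clamp.
pose c x := Num.max (- r) (Num.min x T); rewrite -/(c s) -/(c t).
have [c1 c2 c3 c4] : [/\ - r <= c s, c s <= c t, c t <= T & c t - c s <= t - s].
  rewrite /c; split.
  - by rewrite le_max lexx.
  - by rewrite ge_max le_max lexx /= le_max le_min !ge_min lexx st !orbT.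
  - by rewrite ge_max rT ge_min lexx orbT.
  - by case: (leP s T) => ?; case: (leP t T) => ?; case: (leP (- r) s) => ?;
      case: (leP (- r) t) => ?; case: (leP (- r) T) => ?; lra.
apply: le_trans (hy _ _ c1 c2 c3) _.
apply: le_trans (ler_wpM2r (pw_ge0 _ _ _) (ler_norm K)) _; apply: ler_wpM2l => //.
by apply: (powR_le beta_gt); rewrite ?subr_ge0.
Qed.

Let clamp_cont K T y : hol r beta K T y -> - r <= T -> continuous (clamp T y).
Proof.
by move=> hy rT; apply: (holder_continuous beta_gt) => s t st; exact: clamp_holder hy rT st.
Qed.

Let clampE T y t : - r <= t -> t <= T -> clamp T y t = y t.
Proof. by move=> h1 h2; rewrite /clamp (min_idPl h2) (max_idPr h1). Qed.

Let field_cont K T y j : hol r beta K T y -> - r <= T ->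
  continuous (fun t => field (clamp T y) t 0 j).
Proof.
move=> hy rT; apply: (@entry_continuous (field (clamp T y))).
apply: (holder_continuous beta_gt (K := drift_const * `|K|)) => s t st.
rewrite -mulrA; apply: field_diff; try exact: clamp_cont hy rT.
  by rewrite mulr_ge0 // pw_ge0.
move=> x _ _; apply: le_trans (clamp_holder hy rT (_ : x + s <= x + t)) _.
  by rewrite lerD2l.
by rewrite /hpow (_ : x + t - (x + s) = t - s) //; ring.
Qed.

Let drift_clamp T y s t : 0 <= s -> t <= T ->
  drift r A pi y s t =
  \row_j \int[lebesgue_measure]_(tau in `[s, t]) field (clamp T y) tau 0 j.
Proof.
move=> s0 tT; apply/rowP => j.
rewrite [LHS]mxE [RHS]mxE.
apply: Rintegral_ext => x h1 h2; rewrite /field clampE.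
2: { have h := le_trans s0 h1.
  by rewrite (le_trans _ h) // oppr_le0.
  }
2: by have := le_trans h2 tT; lra.
congr ((row_mx _ _ *m A) 0 j); apply/rowP => k; rewrite [LHS]mxE [RHS]mxE; apply: eq_bigr => i _.
have h5 (u : R) : - r <= u -> - r <= u + x by move=> h; have := lerD h (le_trans s0 h1); rewrite addr0.
have h6 (u : R) : u <= 0 -> u + x <= T by move=> h; have := lerD h (le_trans h2 tT); rewrite add0r.
by rewrite /charge_integral; congr (_ - _); apply: Rintegral_ext => u h3 h4; rewrite clampE //; auto.
Qed.

Let itv_fin (s t : R) : (lebesgue_measure (`[s, t]%classic : set (measurableTypeR R)) < +oo)%E.
Proof. by rewrite lebesgue_measure_itv /=; case: ifP => // _; rewrite -EFinB ltry. Qed.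

(** Comparison with the zero path reduces the growth bound [dr_bd] to [dr_diff]. *)
Let drift0 s t : drift r A pi (fun _ : R => 0) s t = 0.
Proof.
have I0 (mu : {measure set (measurableTypeR R) -> \bar R}) (a b : R) (g : R -> R) :
    (forall x, g x = 0) -> \int[mu]_(x in `[a, b]) g x = 0.
  move=> hg; rewrite (_ : g = cst 0); last exact/funext.
  by rewrite Rintegral_cst ?mul0r.
apply/rowP => j; rewrite [LHS]mxE [RHS]mxE; apply: (I0) => x.
rewrite (_ : row_mx _ _ = 0) ?mul0mx ?mxE //.
rewrite -[RHS]row_mx0; congr row_mx; apply/rowP => k; rewrite !mxE big1 // => i _.
by rewrite /charge_integral /charge_pos /charge_neg !I0 ?subr0 // => ?; rewrite mxE.
Qed.

Lemma drift_is_ok : drift_ok r beta drift_const (drift r A pi).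
Proof.
have r0 := r_ge0.
have df : forall (y z : R -> V) K m T, hol r beta K T y -> hol r beta K T z ->
    (forall t, - r <= t -> t <= T -> `|y t - z t| <= m) ->
    forall s t, 0 <= s -> s <= t -> t <= T ->
    `|drift r A pi y s t - drift r A pi z s t| <= drift_const * m * (t - s).
  move=> y z K m T hy hz hm s t s0 st tT.
  have rT : - r <= T by lra.
  have m0 : 0 <= m by apply: le_trans (hm T rT (lexx T)).
  rewrite !(drift_clamp _ s0 tT); apply: mx_norm_le.
    by have := drift_const_ge0 => ?; have : 0 <= t - s by [lra|]; pos.
  move=> i j; rewrite !mxE.
  rewrite (_ : t - s = fine (lebesgue_measure (`[s, t]%classic : set (measurableTypeR R)))); last first.
    by rewrite lebesgue_measure_itv /= lte_fin; case: (ltP s t) => //= ts; apply/eqP;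
    rewrite subr_eq0 eq_le ts st.
  apply: Rintegral_diff_le; [exact: itv_fin|exact: field_cont hy rT|exact: field_cont hz rT|].
  move=> x x1 x2; apply: le_trans (_ : `|field (clamp T y) x - field (clamp T z) x| <= _).
    by have := mx_entry_le (field (clamp T y) x - field (clamp T z) x) 0 j; rewrite !mxE.
  apply: field_diff; [exact: clamp_cont hy rT|exact: clamp_cont hz rT|by []|].
  by move=> u u1 u2; rewrite !clampE; [apply: hm; lra|lra..].
split; [exact: drift_const_ge0| |exact: df|].
- move=> y K T hy s v t s0 sv vt tT; have rT : - r <= T by lra.
  rewrite (drift_clamp _ s0 tT) (drift_clamp _ s0 (_ : v <= T)); last by lra.
  rewrite (drift_clamp _ (_ : 0 <= v) tT); last by lra.
  apply/rowP => j; rewrite !mxE; apply/eqP; rewrite addrC -subr_eq.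
  have ig a b : lebesgue_measure.-integrable `[a, b] (EFin \o (fun x => field (clamp T y) x 0 j)).
    by apply: cont_integrable; [exact: itv_fin|exact: field_cont hy rT].
  rewrite Rintegral_itvB //; [|by rewrite bnd_simp..].
  rewrite Rintegral_itv_obnd_cbnd //.
  by apply: integrableS (ig v t) => //; exact: subset_itv_oc_cc.
- move=> y K m T hy hm s t s0 st tT.
  have rT : - r <= T by lra.
  have h0 K' : 0 <= K' -> hol r beta K' T (fun _ : R => 0 : V).
    by move=> K'0 a b _ _ _; rewrite subrr normr0 mulr_ge0 // pw_ge0.
  have hyK : hol r beta `|K| T y.
    move=> a b ha hb hc; apply: le_trans (hy _ _ ha hb hc) _.
    by rewrite ler_wpM2r ?pw_ge0 // ler_norm.
  have := df y (fun=> 0) `|K| m T hyK (h0 _ (normr_ge0 _)) _ s t s0 st tT.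
  by rewrite drift0 subr0; apply => u u1 u2; rewrite subr0; exact: hm.
Qed.

End Drift.

(** * Norms and bounds *)

Section Norms.
Context {R : realType} {V : normedModType R}.
Implicit Types (J : set R) (m : R -> V) (F : R -> R -> V) (a b K al : R).

Lemma incr_norm_le al J F K :
  (forall s t, J s -> J t -> s != t -> `|F s t| <= K * `|t - s| `^ al) ->
  (incr_norm al J F <= K%:E)%E.
Proof.
move=> h; apply: ge_ereal_sup => _ [[s t] [/= Js Jt st] <-] /=.
by rewrite lee_fin ler_pdivrMr ?h // powR_gt0 // normr_gt0 subr_eq0 eq_sym.
Qed.

Lemma incr_norm_bound al J F K : (incr_norm al J F <= K%:E)%E ->
  forall s t, J s -> J t -> s != t -> `|F s t| <= K * `|t - s| `^ al.
Proof.
move=> h s t Js Jt st.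
rewrite -ler_pdivrMr ?powR_gt0 ?normr_gt0 ?subr_eq0 1?eq_sym // -lee_fin.
by apply: le_trans h; apply: ereal_sup_ubound; exists (s, t).
Qed.

Lemma incr_norm_ge0 al a b F : a < b -> (0 <= incr_norm al `[a, b] F)%E.
Proof.
move=> ab; apply: (@le_trans _ _ (`|F a b| / `|b - a| `^ al)%:E).
  by rewrite lee_fin divr_ge0 // powR_ge0.
apply: ereal_sup_ubound; exists (a, b) => //=.
by rewrite !in_itv /= !lexx ltW // lt_eqF.
Qed.

Lemma sup_norm_le J m K : (forall t, J t -> `|m t| <= K) -> (sup_norm J m <= K%:E)%E.
Proof. by move=> h; apply: ge_ereal_sup => _ [t Jt <-]; rewrite lee_fin h. Qed.

Lemma sup_norm_bound J m K : (sup_norm J m <= K%:E)%E -> forall t, J t -> `|m t| <= K.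
Proof.
by move=> h t Jt; rewrite -lee_fin; apply: le_trans h; apply: ereal_sup_ubound; exists t.
Qed.

Lemma sup_norm_ge0 a b m : a <= b -> (0 <= sup_norm `[a, b] m)%E.
Proof.
move=> ab; apply: (@le_trans _ _ `|m a|%:E); first by rewrite lee_fin.
by apply: ereal_sup_ubound; exists a; rewrite //= in_itv /= lexx.
Qed.

Lemma holder_norm_le al a b m K :
  (forall s t, a <= s -> s <= t -> t <= b -> `|m t - m s| <= K * hpow al s t) ->
  (holder_norm al `[a, b] m <= K%:E)%E.
Proof.
move=> h; apply: incr_norm_le => s t /=; rewrite !in_itv /= => /andP[s1 s2] /andP[t1 t2] _.
have [st|/ltW ts] := leP s t; rewrite /incr.
  by rewrite (ger0_norm (_ : 0 <= t - s)) ?subr_ge0 //; exact: h.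
by rewrite distrC (ler0_norm (_ : t - s <= 0)) ?subr_le0 // opprB; exact: h.
Qed.

(** The norm ignores the pairs s = t, where the power vanishes; the bound extends to them because F
    is zero on the diagonal. *)
Lemma incr_norm_pw al a b F K : al != 0 -> (forall s, a <= s -> s <= b -> F s s = 0) ->
  (incr_norm al `[a, b] F <= K%:E)%E ->
  forall s t, a <= s -> s <= t -> t <= b -> `|F s t| <= K * hpow al s t.
Proof.
move=> al0 F0 h s t s1; rewrite le_eqVlt => /orP[/eqP<- sb|st tb].
  by rewrite F0 // normr0 /hpow subrr powR0 // mulr0.
have := incr_norm_bound h (_ : `[a, b]%classic s) (_ : `[a, b]%classic t).
rewrite /= !in_itv /= s1 tb (ltW (lt_le_trans st tb)) (ltW (le_lt_trans s1 st)).
by rewrite (gtr0_norm (_ : 0 < t - s)) ?subr_gt0 // lt_eqF //; apply.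
Qed.

Lemma ge0_fin_num (x : \bar R) K : (0 <= x)%E -> (x <= K%:E)%E -> x \is a fin_num.
Proof. by move=> x0 xK; rewrite ge0_fin_numE // (le_lt_trans xK) // ltry. Qed.

End Norms.

(** * Controlled norms and one-sided bounds *)

Section Dictionary.
Context {R : realType} {n d : nat}.
Variable beta : R.
Hypothesis beta_gt : 3^-1 < beta.
Local Notation pw := (hpow beta).
Variable X : delayed_path R d.
Implicit Types (y : cpath R d n) (a b K : R).

Let beta0 : 0 < beta. Proof. by apply: lt_trans beta_gt. Qed.
Let beta_neq0 : beta != 0. Proof. by rewrite gt_eqF. Qed.
Let beta2_neq0 : 2 * beta != 0. Proof. by rewrite gt_eqF // mulr_gt0. Qed.

Lemma pw_sq s t : hpow (2 * beta) s t = pw s t ^+ 2.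
Proof. by rewrite /hpow powR_sq. Qed.

(** Norms run over both orders of s and t, bounds over s <= t. The identity R_{t,s} = - R_{s,t} +
    X_{s,t} (y'_t - y'_s) shows that swapping the times adds a term of order 2 beta. *)
Lemma remainder_swap K KX y s t : s <= t -> `|incr (base X) s t| <= KX * pw s t ->
  `|y.2 t - y.2 s| <= K * pw s t -> `|remainder X y s t| <= K * pw s t ^+ 2 ->
  0 <= KX -> `|remainder X y t s| <= (K + d%:R * KX * K) * pw s t ^+ 2.
Proof.
move=> st hX hy hr KX0.
have -> : remainder X y t s = - remainder X y s t + incr (base X) s t *m (y.2 t - y.2 s).
  rewrite /remainder mulmxBr (_ : incr (base X) t s = - incr (base X) s t); last by rewrite /incr opprB.
  rewrite mulNmx /incr; move: (_ *m y.2 t) (_ *m y.2 s) => *; mxring.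
apply: le_trans (ler_normD _ _) _; rewrite normrN mulrDl lerD //.
apply: le_trans (mulmx_norm _ _) _.
rewrite (_ : d%:R * KX * K * pw s t ^+ 2 = d%:R * (KX * pw s t) * (K * pw s t)); last by ring.
by apply: ler_pM => //; rewrite ?mulr_ge0 // ler_wpM2l.
Qed.

(* Extends a remainder bound from increasing to arbitrary pairs of times. *)
Lemma remainder_norm_le K KX a b y : 0 <= K -> 0 <= KX ->
  (forall s t, a <= s -> s <= t -> t <= b -> `|incr (base X) s t| <= KX * pw s t) ->
  holder_bd beta K a b y -> rem_bd beta X K a b y ->
  (incr_norm (2 * beta) `[a, b] (remainder X y) <= (K + d%:R * KX * K)%:E)%E.
Proof.
move=> K0 KX0 hX h2 h3; apply: incr_norm_le => s t /=.
rewrite !in_itv /= => /andP[s1 s2] /andP[t1 t2] _.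
have [st|/ltW ts] := leP s t.
  rewrite (ger0_norm (_ : 0 <= t - s)) ?subr_ge0 // -[_ `^ _]/(hpow (2 * beta) s t) pw_sq.
  apply: le_trans (h3 _ _ s1 st t2) _; rewrite ler_wpM2r ?pw2_ge0 // lerDl; pos.
rewrite (ler0_norm (_ : t - s <= 0)) ?subr_le0 // opprB.
rewrite -[_ `^ _]/(hpow (2 * beta) t s) pw_sq.
by apply: remainder_swap => //; [exact: hX|exact: h2|exact: h3].
Qed.

Lemma ctrl_norm_le K KX M a b y : a < b -> 0 <= K -> 0 <= KX ->
  (forall s t, a <= s -> s <= t -> t <= b -> `|incr (base X) s t| <= KX * pw s t) ->
  (forall t, a <= t -> t <= b -> `|y.1 t| <= M) -> ctrl_bd beta X K a b y ->
  controlled X beta `[a, b] y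
  /\ (ctrl_norm X beta `[a, b] y <= (M + K + K + (K + d%:R * KX * K))%:E)%E.
Proof.
move=> ab K0 KX0 hX h1 [h2 h3 h4].
have n1 := holder_norm_le h3.
have n2 := remainder_norm_le K0 KX0 hX h3 h4.
split; first by split; [apply: ge0_fin_num n1|apply: ge0_fin_num n2]; exact: incr_norm_ge0.
rewrite /ctrl_norm !EFinD; apply: leeD => //; apply: leeD => //; apply: leeD.
  by apply: sup_norm_le => t /=; rewrite in_itv /= => /andP[]; exact: h1.
by apply: sup_norm_le => t /=; rewrite in_itv /= => /andP[]; exact: h2.
Qed.

Lemma remainderxx y s : remainder X y s s = 0.
Proof. by rewrite /remainder /incr !subrr mul0mx subrr. Qed.

Lemma ctrl_norm_bound K a b y : a <= b -> (ctrl_norm X beta `[a, b] y <= K%:E)%E -> a < b ->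
  [/\ 0 <= K, (forall t, a <= t -> t <= b -> `|y.1 t| <= K) & ctrl_bd beta X K a b y].
Proof.
move=> ab' h ab.
have p1 := sup_norm_ge0 y.1 ab'; have p2 := sup_norm_ge0 y.2 ab'.
have p3 := incr_norm_ge0 beta (incr y.2) ab.
have p4 := incr_norm_ge0 (2 * beta) (remainder X y) ab.
have K0 : 0 <= K by rewrite -lee_fin; apply: le_trans h; rewrite /ctrl_norm !adde_ge0.
have le4 (x1 x2 x3 x4 : \bar R) : (0 <= x1 -> 0 <= x2 -> 0 <= x3 -> 0 <= x4 ->
    x1 + x2 + x3 + x4 <= K%:E -> [/\ x1 <= K%:E, x2 <= K%:E, x3 <= K%:E & x4 <= K%:E])%E.
  move=> q1 q2 q3 q4 hK; split; apply: le_trans hK.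
  - by rewrite -!addeA leeDl // !adde_ge0.
  - by rewrite -!addeA addeCA leeDl // !adde_ge0.
  - by rewrite -addeA addeCA leeDl // !adde_ge0.
  - by rewrite leeDr // !adde_ge0.
have [g1 g2 g3 g4] := le4 _ _ _ _ p1 p2 p3 p4 h.
have itv t : a <= t -> t <= b -> `[a, b]%classic t by move=> ? ?; rewrite /= in_itv /=; apply/andP.
split=> //; first by move=> t ? ?; apply: sup_norm_bound g1 _ _; exact: itv.
split.
- by move=> t ? ?; apply: sup_norm_bound g2 _ _; exact: itv.
- by apply: incr_norm_pw g3 => // s _ _; rewrite /incr subrr.
- move=> s t h1 h2 h3; rewrite -pw_sq; apply: incr_norm_pw g4 _ _ h1 h2 h3 => // ? _ _.
  exact: remainderxx.
Qed.

Lemma controlled_bd a b y : a < b -> controlled X beta `[a, b] y ->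
  exists2 K, 0 <= K & ctrl_bd beta X K a b y.
Proof.
move=> ab [f1 f2].
have g1 : 0 <= fine (holder_norm beta `[a, b] y.2) by rewrite fine_ge0 // incr_norm_ge0.
have g2 : 0 <= fine (incr_norm (2 * beta) `[a, b] (remainder X y)) by rewrite fine_ge0 // incr_norm_ge0.
set K1 := fine _ in g1; set K2 := fine _ in g2.
have h1 : holder_bd beta K1 a b y.
  apply: (incr_norm_pw beta_neq0) => [s _ _|]; first by rewrite /incr subrr.
  by rewrite fineK.
have h2 : rem_bd beta X K2 a b y.
  move=> s t q1 q2 q3; rewrite -pw_sq; apply: (incr_norm_pw beta2_neq0 _ _ q1 q2 q3) => [? _ _|].
    exact: remainderxx.
  by rewrite fineK.
have p0 := pw_ge0 beta a b.
exists (`|y.2 a| + K1 * pw a b + K1 + K2); first by pos.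
split.
- move=> t ta tb; rewrite -[y.2 t](subrK (y.2 a)) addrC.
  apply: le_trans (ler_normD _ _) _; rewrite -!addrA lerD // -[leLHS]addr0 lerD //; last by rewrite addr_ge0.
  by apply: le_trans (h1 _ _ (lexx a) ta tb) _; rewrite ler_wpM2l // pw_mono.
- move=> s t q1 q2 q3; apply: le_trans (h1 s t q1 q2 q3) _; rewrite ler_wpM2r ?pw_ge0 //.
  by rewrite addrAC lerDr; pos.
- move=> s t q1 q2 q3; apply: le_trans (h2 s t q1 q2 q3) _; rewrite ler_wpM2r ?pw2_ge0 //.
  by rewrite lerDr; pos.
Qed.

Lemma path_holder K KX a b y s t : 0 <= K -> 0 <= KX ->
  (forall s t, a <= s -> s <= t -> t <= b -> `|incr (base X) s t| <= KX * pw s t) ->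
  ctrl_bd beta X K a b y -> a <= s -> s <= t -> t <= b ->
  `|y.1 t - y.1 s| <= (d%:R * KX * K + K * pw a b) * pw s t.
Proof.
move=> K0 KX0 hX [h1 _ h3] as_ st tb.
have -> : y.1 t - y.1 s = incr (base X) s t *m y.2 s + remainder X y s t.
  by rewrite [RHS]addrC /remainder subrK.
apply: le_trans (ler_normD _ _) _; rewrite mulrDl lerD //.
  apply: le_trans (mulmx_norm _ _) _.
  rewrite (_ : _ * K * pw s t = d%:R * (KX * pw s t) * K); last by ring.
  by apply: ler_pM; rewrite ?mulr_ge0 ?ler_wpM2l ?hX // h1 // (le_trans st).
apply: le_trans (h3 s t as_ st tb) _; rewrite expr2 mulrA ler_wpM2r ?pw_ge0 //.
by rewrite ler_wpM2l // pw_mono.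
Qed.

Lemma controlled_norm_fin KX a b y : a < b -> 0 <= KX ->
  (forall s t, a <= s -> s <= t -> t <= b -> `|incr (base X) s t| <= KX * pw s t) ->
  controlled X beta `[a, b] y -> ctrl_norm X beta `[a, b] y \is a fin_num.
Proof.
move=> ab KX0 hX cy; have [K K0 hK] := controlled_bd ab cy.
have h1 t : a <= t -> t <= b ->
    `|y.1 t| <= `|y.1 a| + (d%:R * KX * K + K * pw a b) * pw a b.
  move=> ta tb; rewrite -[y.1 t](subrK (y.1 a)) addrC.
  apply: le_trans (ler_normD _ _) _; rewrite lerD2l.
  apply: le_trans (path_holder K0 KX0 hX hK (lexx a) ta tb) _.
  have p0 := pw_ge0 beta a b.
  by rewrite ler_wpM2l ?pw_mono //; pos.
have [_ hn] := ctrl_norm_le ab K0 KX0 hX h1 hK.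
apply: ge0_fin_num hn.
by rewrite /ctrl_norm !adde_ge0 // ?sup_norm_ge0 ?incr_norm_ge0 // ltW.
Qed.

End Dictionary.

(** * Bounds for the rough path *)

Section RoughPathBounds.
Context {R : realType} {d : nat}.
Variables (r beta gamma : R).
Hypotheses (beta_gt : 3^-1 < beta) (beta_gamma : beta <= gamma).
Local Notation pw := (hpow beta).
Variable X : delayed_path R d.
Hypothesis Xrp : delayed_rough_path r gamma X.
Implicit Types (a b K : R).

Let gamma0 : 0 < gamma.
Proof. by apply: lt_le_trans beta_gamma; apply: lt_trans beta_gt. Qed.

Lemma pw_gamma s t T : s <= t -> t - s <= T -> hpow gamma s t <= T `^ (gamma - beta) * pw s t.
Proof.
rewrite le_eqVlt => /orP[/eqP<- _|st sT].
  by rewrite /hpow subrr powR0 ?gt_eqF // mulr_ge0 // powR_ge0.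
have st0 : 0 < t - s by rewrite subr_gt0.
rewrite /hpow (_ : (t - s) `^ gamma = (t - s) `^ (gamma - beta) * (t - s) `^ beta); last first.
  by rewrite -powRD ?subrK // (gt_eqF st0) implybT.
rewrite ler_wpM2r ?powR_ge0 // ge0_ler_powR ?subr_ge0 // nnegrE ltW //.
exact: lt_le_trans sT.
Qed.

(** Neither the norms nor Chen's relation, assumed for s < u < t, speak about the diagonal. The
    Hoelder bound makes F small at nearby pairs of distinct times, and continuity carries this to
    (s, s). *)
Lemma area_diag (V : normedModType R) (F : R -> R -> V) :
  continuous (fun p : R * R => F p.1 p.2) ->
  (forall a b, a < b -> incr_norm (2 * gamma) `[a, b] F \is a fin_num) -> forall s, F s s = 0.
Proof.
move=> cF fF s; apply/eqP; rewrite -normr_le0; apply/ler_addgt0Pr => e e0; rewrite add0r.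
have g2 : 2 * gamma != 0 by rewrite gt_eqF // mulr_gt0.
have ss : s < s + 1 by rewrite ltrDl.
set N := fine (incr_norm (2 * gamma) `[s, s + 1] F).
have N0 : 0 <= N by rewrite fine_ge0 // incr_norm_ge0.
have hN : (incr_norm (2 * gamma) `[s, (s + 1)%R] F <= N%:E)%E by rewrite fineK // fF.
have /cvgrPdist_le := cF (s, s); move=> /(_ (e / 2)); rewrite divr_gt0 // => /(_ isT).
move=> /nbhs_ballP[del /= del0 hdel].
(* The point s + q^3 is within distance del of s, and (q^3)^(2 gamma) <= q makes F at most e / 2
   there. *)
pose q := Num.min 1 (Num.min (del / 2) (e / 2 / (N + 1))).
have N1 : 0 < N + 1 by rewrite ltr_wpDl.
have q0 : 0 < q by rewrite !lt_min ltr01 !divr_gt0.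
have [q1 q2 q3] : [/\ q <= 1, q <= del / 2 & q <= e / 2 / (N + 1)].
  by rewrite /q !ge_min !lexx !orbT.
have q3' : q ^+ 3 <= q by have q0' := ltW q0; rewrite exprS ler_piMr // exprn_ile1.
have q30 : 0 < q ^+ 3 by rewrite exprn_gt0.
have h1 : `|F s s - F s (s + q ^+ 3)| <= e / 2.
  apply: (hdel (s, s + q ^+ 3)); split; first exact: ballxx.
  rewrite /ball /= opprD addrA subrr sub0r normrN gtr0_norm //.
  by apply: le_lt_trans q3' _; apply: le_lt_trans q2 _; lra.
have h2 : `|F s (s + q ^+ 3)| <= e / 2.
  have := incr_norm_bound hN (_ : `[s, s + 1]%classic s) (_ : `[s, s + 1]%classic (s + q ^+ 3)).
  rewrite /= !in_itv /= lexx !lerDl ler01 (ltW q30) lerD2l (le_trans q3' q1).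
  move=> /(_ isT isT); rewrite (addrC s) addrK (gtr0_norm q30) => h2.
  have sq : s != q ^+ 3 + s by rewrite lt_eqF // ltrDr.
  apply: le_trans (h2 sq) _; rewrite -powR_sq mulrC.
  have z0 : 0 <= (q ^+ 3) `^ gamma by exact: powR_ge0.
  have zq : (q ^+ 3) `^ gamma <= q.
    by apply: pow_small; rewrite ?(ltW q0) //; apply: lt_le_trans beta_gamma.
  have {}zq : (q ^+ 3) `^ gamma ^+ 2 <= q.
    by rewrite expr2 -[leRHS]mul1r ler_pM // (le_trans zq).
  apply: le_trans (ler_wpM2r N0 zq) _.
  apply: le_trans (_ : q * (N + 1) <= _); first by rewrite ler_wpM2l ?(ltW q0) // lerDl.
  by rewrite -ler_pdivlMr.
rewrite -[F s s](subrK (F s (s + q ^+ 3))).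
by apply: le_trans (ler_normD _ _) _; rewrite [leRHS]splitr lerD.
Qed.

(** The degenerate cases u = s and u = t hold because the areas vanish on the diagonal. *)
Lemma rough_path_chen : chen r X.
Proof.
have [hf c1 c2 ch1 ch2] := Xrp.
have d1 : forall s, area X s s = 0.
  by apply: area_diag => // a b ab; have [] := hf _ _ ab.
have d2 : forall s, delayed_area X s s = 0.
  by apply: area_diag => // a b ab; have [] := hf _ _ ab.
have I0 s : incr (base X) s s = 0 by rewrite /incr subrr.
split=> s u t; rewrite le_eqVlt => /orP[/eqP<-|su];
  rewrite ?d1 ?d2 ?I0 ?trmx0 ?mul0mx ?add0r ?addr0 //;
  rewrite le_eqVlt => /orP[/eqP<-|ut]; rewrite ?d1 ?d2 ?I0 ?mulmx0 ?addr0 //.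
  exact: ch1.
exact: ch2.
Qed.

(** Passing from gamma to beta costs T^(gamma - beta) for the path and its square for the areas; as
    T >= 1, the square serves for both. *)
Lemma rough_path_bd N a b T : a < b -> b - a <= T -> 1 <= T -> 0 <= N ->
  (holder_norm gamma `[a, b] (base X) <= N%:E)%E ->
  (holder_norm gamma `[(a - r)%R, (b - r)%R] (base X) <= N%:E)%E ->
  (incr_norm (2 * gamma) `[a, b] (area X) <= N%:E)%E ->
  (incr_norm (2 * gamma) `[a, b] (delayed_area X) <= N%:E)%E ->
  rough_bd r beta X ((T `^ (gamma - beta)) ^+ 2 * N) a b.
Proof.
move=> ab abT T1 N0 n1 n2 n3 n4 s t as_ st tb.
have g0 : gamma != 0 by rewrite gt_eqF.
have g2 : 2 * gamma != 0 by rewrite gt_eqF // mulr_gt0.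
have [hf c1 c2 _ _] := Xrp.
have d1 : forall s, area X s s = 0.
  by apply: area_diag => // ? ? h; have [] := hf _ _ h.
have d2 : forall s, delayed_area X s s = 0.
  by apply: area_diag => // ? ? h; have [] := hf _ _ h.
have I0 (s' : R) : incr (base X) s' s' = 0 by rewrite /incr subrr.
set c := T `^ (gamma - beta).
have c_ge1 : 1 <= c.
  have gb : 0 <= gamma - beta by rewrite subr_ge0.
  have := ge0_ler_powR gb (_ : 1 \in Num.nneg) (_ : T \in Num.nneg) T1.
  by rewrite powR1; apply; rewrite nnegrE // (le_trans _ T1).
have c0 : 0 <= c by apply: le_trans c_ge1.
have sT : t - s <= T by lra.
have hp := pw_gamma st sT; rewrite -/c in hp.
have cc : c <= c ^+ 2 by rewrite expr2 ler_peMr.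
have p0 := pw_ge0 beta s t.
have lin x : x <= N * hpow gamma s t -> x <= c ^+ 2 * N * pw s t.
  move=> /le_trans; apply; apply: le_trans (ler_wpM2l N0 hp) _.
  by rewrite mulrA (mulrC N) ler_wpM2r // ler_wpM2r.
have quad x : x <= N * hpow (2 * gamma) s t -> x <= c ^+ 2 * N * pw s t ^+ 2.
  move=> /le_trans; apply; rewrite pw_sq.
  rewrite (_ : c ^+ 2 * N * pw s t ^+ 2 = N * (c * pw s t) ^+ 2); last by ring.
  by rewrite ler_wpM2l // lerXn2r // nnegrE ?pw_ge0 // mulr_ge0.
split.
- by apply: lin; apply: (incr_norm_pw g0 _ n1).
- apply: lin; rewrite -(pw_shift gamma r s t).
  by apply: (incr_norm_pw g0 _ n2); rewrite ?lerD2r.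
- by apply: quad; apply: (incr_norm_pw g2 _ n3).
- by apply: quad; apply: (incr_norm_pw g2 _ n4).
Qed.

Lemma rough_path_norms a b : a < b -> exists2 N, 0 <= N &
  [/\ (holder_norm gamma `[a, b] (base X) <= N%:E)%E,
      (holder_norm gamma `[(a - r)%R, (b - r)%R] (base X) <= N%:E)%E,
      (incr_norm (2 * gamma) `[a, b] (area X) <= N%:E)%E &
      (incr_norm (2 * gamma) `[a, b] (delayed_area X) <= N%:E)%E].
Proof.
move=> ab; have abr : a - r < b - r by rewrite ltrD2r.
have [hf _ _ _ _] := Xrp; have [f1 f3 f4] := hf _ _ ab; have [f2 _ _] := hf _ _ abr.
pose N1 := fine (holder_norm gamma `[a, b] (base X)).
pose N2 := fine (holder_norm gamma `[a - r, b - r] (base X)).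
pose N3 := fine (incr_norm (2 * gamma) `[a, b] (area X)).
pose N4 := fine (incr_norm (2 * gamma) `[a, b] (delayed_area X)).
have [p1 p2] : 0 <= N1 /\ 0 <= N2 by split; rewrite fine_ge0 // incr_norm_ge0.
have [p3 p4] : 0 <= N3 /\ 0 <= N4 by split; rewrite fine_ge0 // incr_norm_ge0.
exists (N1 + N2 + N3 + N4); first by rewrite !addr_ge0.
split; [rewrite -(fineK f1)|rewrite -(fineK f2)|rewrite -(fineK f3)|rewrite -(fineK f4)];
  rewrite lee_fin -/N1 -/N2 -/N3 -/N4; lra.
Qed.

Lemma rough_path_bd_ex a b : exists K, rough_bd r beta X K a b.
Proof.
have [ab|ba] := ltP a (b + 1); last first.
  by exists 0 => s t h1 h2 h3; lra.
have [N N0 [n1 n2 n3 n4]] := rough_path_norms ab.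
have T1 : 1 <= 1 + `|b + 1 - a| by rewrite lerDl.
have abT : b + 1 - a <= 1 + `|b + 1 - a| by apply: le_trans (ler_norm _) _; rewrite lerDr.
have h := rough_path_bd ab abT T1 N0 n1 n2 n3 n4.
exists ((1 + `|b + 1 - a|) `^ (gamma - beta) ^+ 2 * N) => s t h1 h2 h3; apply: h => //; lra.
Qed.

End RoughPathBounds.

(** * Rough integrals *)

Section Partitions.
Context {R : realType}.
Implicit Types (a b : R) (l : seq R).

Lemma sum_zip_telescope (V : zmodType) (phi : R -> V) a l :
  \sum_(p <- zip (a :: l) l) (phi p.2 - phi p.1) = phi (last a l) - phi a.
Proof.
elim: l a => [|x l IH] a /=; first by rewrite big_nil subrr.
by rewrite big_cons IH addrC addrA subrK.
Qed.

Lemma sum_zip_nth (V : nmodType) (F : R -> R -> V) b a l :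
  \sum_(p <- zip (a :: l) l) F p.1 p.2 =
  \sum_(0 <= i < size l) F (nth b (a :: l) i) (nth b (a :: l) i.+1).
Proof.
elim: l a => [|x l IH] a /=; first by rewrite big_nil big_geq.
by rewrite big_cons IH big_nat_recl.
Qed.

Lemma path_zip_le (P : R -> R -> Prop) a b l :
  (forall s t, a <= s -> s < t -> t <= b -> P s t) -> path <%R a l -> last a l <= b ->
  forall p, p \in zip (a :: l) l -> P p.1 p.2.
Proof.
elim: l a => [|x l IH] a //= hP /andP[ax xl] lb p.
have xlast : x <= last x l.
  elim: (l) x xl {IH lb hP ax p} => //= z l' IH x /andP[xz zl].
  exact: le_trans (ltW xz) (IH _ zl).
rewrite inE => /orP[/eqP->|].
  by apply: hP => //; exact: le_trans lb.
apply: IH => // s t xs; apply: hP; exact: le_trans (ltW ax) xs.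
Qed.

Lemma zip_bound (V : normedModType R) (F : R -> R -> V) c a l :
  (forall p, p \in zip (a :: l) l -> `|F p.1 p.2| <= c * (p.2 - p.1)) ->
  `|\sum_(p <- zip (a :: l) l) F p.1 p.2| <= c * (last a l - a).
Proof.
elim: l a => [|x l IH] a h; first by rewrite /= big_nil normr0 subrr mulr0.
rewrite [zip _ _]/= big_cons; apply: le_trans (ler_normD _ _) _.
rewrite (_ : c * (last a (x :: l) - a) = c * (x - a) + c * (last x l - x)); last by rewrite /=; ring.
apply: lerD; first by apply: (h (a, x)); rewrite inE eqxx.
by apply: IH => p hp; apply: h; rewrite [zip _ _]/= inE hp orbT.
Qed.

(** Partitions of every mesh exist, so that convergence along [mesh_to0] has content; [cvg_davie]
    draws its partition from here. *)
Lemma uniform_partition a b e : a < b -> 0 < e -> exists2 l, itv_partition a b l &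
  forall p, p \in zip (a :: l) l -> p.2 - p.1 < e.
Proof.
move=> ab e0; have ba0 : 0 < b - a by rewrite subr_gt0.
have [N hN N0] := nat_above (divr_ge0 (ltW ba0) (ltW e0)).
pose M := N.+1; pose h := (b - a) / M%:R; pose f i := a + i%:R * h.
have M0 : 0 < M%:R :> R by rewrite ltr0n.
have h0 : 0 < h by rewrite divr_gt0.
have he : h < e.
  rewrite ltr_pdivrMr // mulrC -ltr_pdivrMr //; apply: le_lt_trans hN _; by rewrite ltr_nat.
have fS i : f i.+1 - f i = h by rewrite /f -natr1; ring.
have key k m : [/\ path <%R (f k) [seq f i | i <- iota k.+1 m],
    last (f k) [seq f i | i <- iota k.+1 m] = f (k + m)%N &
    forall p, p \in zip (f k :: [seq f i | i <- iota k.+1 m]) [seq f i | i <- iota k.+1 m] ->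
      p.2 - p.1 < e].
  elim: m k => [|m IH] k; first by rewrite addn0.
  have [p1 p2 p3] := IH k.+1; split=> /=.
  - by rewrite p1 andbT -subr_gt0 fS.
  - by rewrite p2 addnS.
  - by move=> p; rewrite inE => /orP[/eqP->/=|]; [rewrite fS|exact: p3].
have f0 : f 0%N = a by rewrite /f mul0r addr0.
have [p1 p2 p3] := key 0%N M; rewrite f0 in p1 p2 p3.
exists [seq f i | i <- iota 1 M] => //; split=> //.
by apply/eqP; rewrite p2 add0n /f /h mulrCA divff ?gt_eqF // mulr1 addrC subrK.
Qed.

End Partitions.

Section CubeSmall.
Context {R : realType}.
Variable beta : R.
Hypothesis beta_gt : 3^-1 < beta.
Local Notation pw := (hpow beta).

(** As 3 beta > 1, errors of this order are small against the length and vanish in the sum over fine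
    partitions. *)
Lemma pw3_small (e : R) : 0 < e -> exists2 del, 0 < del & forall s t, s <= t -> t - s < del ->
  pw s t ^+ 3 <= e * (t - s).
Proof.
move=> e0; pose k := 3 * beta - 1.
have k0 : 0 < k by rewrite /k; move: beta_gt; lra.
exists (e `^ k^-1); first exact: powR_gt0.
move=> s t; rewrite le_eqVlt => /orP[/eqP<- _|st h].
  by rewrite pwxx // expr0n subrr mulr0.
have st0 : 0 < t - s by rewrite subr_gt0.
rewrite /hpow powR_cube (_ : 3 * beta = k + 1); last by rewrite /k; ring.
rewrite powRD; last by rewrite (gt_eqF st0) implybT.
rewrite powRr1 ?(ltW st0) // ler_wpM2r ?(ltW st0) //.
apply: le_trans (_ : (e `^ k^-1) `^ k <= _).
  by apply: ge0_ler_powR; rewrite ?nnegrE ?powR_ge0 ?(ltW k0) ?(ltW st0) ?(ltW h).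
by rewrite -powRrM mulVf ?gt_eqF // powRr1 // ltW.
Qed.

End CubeSmall.

Section RoughIntegrals.
Context {R : realType} {n d : nat}.
Variables (r beta L : R) (G : 'rV[R]_n * 'rV[R]_n -> 'M[R]_(d, n)).
Hypothesis beta_gt : 3^-1 < beta.
Local Notation PP := (fun p => pair_contract ('d G p)).
Hypothesis gc : germ_coeff L G (fun p => 'd G p) (@pair_act R n d) PP (@pair_tens R d).
Variable X : delayed_path R d.
Local Notation pw := (hpow beta).
Local Notation dgerm := (delay_germ r G PP X).
Implicit Types (y e : cpath R d n) (a b : R).

Lemma rough_sum_germ y (w : R -> 'M[R]_(d, n)) a l :
  rough_sum X (G_path r G y.1) (G_path0 r G y) (G_path1 r G y w) a l =
  \sum_(p <- zip (a :: l) l) dgerm y (y.1, w) p.1 p.2.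
Proof. by apply: eq_bigr => p _; rewrite -addrA. Qed.

(** The increments of phi telescope, and the errors of order 3 beta add up to less than any eps over
    fine partitions. *)
Lemma davie_cvg y w a b C (phi : R -> 'rV[R]_n) : a < b ->
  (forall s t, a <= s -> s <= t -> t <= b ->
    `|phi t - phi s - dgerm y (y.1, w) s t| <= C * pw s t ^+ 3) ->
  rough_sum X (G_path r G y.1) (G_path0 r G y) (G_path1 r G y w) a @ mesh_to0 a b
    --> phi b - phi a.
Proof.
move=> ab h S /nbhs_ballP[eps /= eps0 hS].
have C1 : 0 < `|C| + 1 by rewrite ltr_wpDl.
have ba : 0 < b - a by rewrite subr_gt0.
have q0 : 0 < eps / 2 / (`|C| + 1) / (b - a) by rewrite !divr_gt0.
have [del del0 hdel] := pw3_small beta_gt q0.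
exists del => // l [pl /eqP lb] hm; apply: hS; rewrite -ball_normE /=.
rewrite -lb -sum_zip_telescope rough_sum_germ -sumrB.
have lb' : last a l <= b by rewrite lb.
pose F s t := phi t - phi s - dgerm y (y.1, w) s t.
have hF : forall p, p \in zip (a :: l) l -> `|F p.1 p.2| <= eps / 2 / (b - a) * (p.2 - p.1).
  move=> p pz; have hp := hm _ pz.
  move: p pz hp; apply: (path_zip_le (P := fun s t => t - s < del -> `|F s t| <= eps / 2 / (b - a) * (t - s))
     _ pl lb') => s t as_ st tb std.
  apply: le_trans (h s t as_ (ltW st) tb) _.
  apply: le_trans (_ : (`|C| + 1) * pw s t ^+ 3 <= _).
    by rewrite ler_wpM2r ?pw3_ge0 // (le_trans (ler_norm C)) // lerDl.
  apply: le_trans (ler_wpM2l (ltW C1) (hdel s t (ltW st) std)) _.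
  rewrite le_eqVlt; apply/orP; left; apply/eqP; field.
  by rewrite !gt_eqF.
have := zip_bound hF; rewrite lb divfK ?gt_eqF // => /le_lt_trans; apply; lra.
Qed.

(** The converse of [davie_cvg]: by [sew_max] every partition sum is within the stated distance of
    the germ, and so is the limit. *)
Lemma cvg_davie y w a b K (J : 'rV[R]_n) : a < b -> 0 <= K ->
  (forall s v t, a <= s -> s <= v -> v <= t -> t <= b ->
    `|dgerm y (y.1, w) s t - dgerm y (y.1, w) s v - dgerm y (y.1, w) v t| <= K * pw s t ^+ 3) ->
  (forall s, a <= s -> s <= b -> dgerm y (y.1, w) s s = 0) ->
  rough_sum X (G_path r G y.1) (G_path0 r G y) (G_path1 r G y w) a @ mesh_to0 a b --> J ->
  `|J - dgerm y (y.1, w) a b| <= sew_const beta * K * pw a b ^+ 3.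
Proof.
move=> ab K0 hK h0 hJ; apply/ler_addgt0Pr => eps eps0.
have [del del0 hdel] := hJ _ (nbhsx_ballx J eps eps0).
have [l lp lm] := uniform_partition ab del0.
have := hdel l lp lm; rewrite -ball_normE /= rough_sum_germ (sum_zip_nth _ b) => h1.
case: lp => pl /eqP lb.
pose sg i := nth b (a :: l) i.
have sgb i : (size l <= i)%N -> sg i = b.
  rewrite leq_eqVlt => /orP[/eqP<-|li]; last by rewrite /sg nth_default.
  by rewrite /sg -lb -last_nth.
have mono i : sg i <= sg i.+1.
  have [il|li] := ltnP i (size l).
    by apply/ltW; move/(pathP b): pl => /(_ i il).
  by rewrite (sgb i li) (sgb i.+1) // ltnW.
have := sew_max beta_gt K0 h0 hK mono (_ : a <= sg 0%N) (_ : sg (0 + size l)%N <= b).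
rewrite add0n (sgb _ (leqnn _)) => /(_ (lexx a) (lexx b)) h2.
rewrite -[J - _](subrKA (\sum_(0 <= i < size l) dgerm y (y.1, w) (sg i) (sg i.+1))).
by apply: le_trans (ler_normD _ _) _; rewrite [leRHS]addrC lerD // ltW.
Qed.

Lemma subtractive_pair (U1 U2 W : zmodType) (F : U1 * U2 -> W) x z :
  (forall v w, F (v - w) = F v - F w) -> F (x, 0) + F (0, z) = F (x, z).
Proof.
move=> hF; rewrite (_ : (x, 0) = (x, z) - (0, z)) ?hF ?subrK //.
by congr pair; rewrite ?subr0 ?subrr.
Qed.

Lemma holder_abs (V : normedModType R) K a b (m : R -> V) :
  (forall s t, a <= s -> s <= t -> t <= b -> `|m t - m s| <= K * pw s t) ->
  forall s t, a <= s <= b -> a <= t <= b -> `|m t - m s| <= K * `|t - s| `^ beta.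
Proof.
move=> h s t /andP[s1 s2] /andP[t1 t2]; have [st|/ltW ts] := leP s t.
  by rewrite (ger0_norm (_ : 0 <= t - s)) ?subr_ge0 //; exact: h.
by rewrite distrC (ler0_norm (_ : t - s <= 0)) ?subr_le0 // opprB; exact: h.
Qed.

(** After removal of both derivative terms, the increment of G along the pair is its Taylor
    remainder plus the derivative of G applied to the two controlled remainders, all of order 2
    beta. *)
Lemma delayed_controlled_ctrl y w a b K : a < b -> 0 <= K -> rough_bd r beta X K a b ->
  ctrl_bd beta X K a b y -> ctrl_bd beta X K (a - r) (b - r) (y.1, w) ->
  delayed_controlled r X beta a b (G_path r G y.1) (G_path0 r G y) (G_path1 r G y w).
Proof.
move=> ab K0 hX hy he.
have L0 : 0 <= L by apply: le_trans (gc_L gc).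
have X1 s t : a <= s -> s <= t -> t <= b -> `|incr (base X) s t| <= K * pw s t.
  by move=> h1 h2 h3; have [] := hX s t h1 h2 h3.
have X2 s t : a - r <= s -> s <= t -> t <= b - r -> `|incr (base X) s t| <= K * pw s t.
  move=> h1 h2 h3.
  have h1' : a <= s + r by lra. have h2' : s + r <= t + r by lra. have h3' : t + r <= b by lra.
  by have [_ h _ _] := hX _ _ h1' h2' h3'; rewrite -(pw_shift beta r (s + r) (t + r)) !addrK in h.
have [y1 y2 y3] := hy; have [e1 e2 e3] := he.
pose u t := (y.1 t, y.1 (t - r)).
have hu : exists2 Ku, 0 <= Ku & forall s t, a <= s -> s <= t -> t <= b -> `|u t - u s| <= Ku * pw s t.
  have p1 := pw_ge0 beta a b; have p2 := pw_ge0 beta (a - r) (b - r).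
  exists ((d%:R * K * K + K * pw a b) + (d%:R * K * K + K * pw (a - r) (b - r))); first by pos.
  move=> s t h1 h2 h3; have p3 := pw_ge0 beta s t.
  apply: (@pair_le _ _ _ (y.1 t - y.1 s) (y.1 (t - r) - y.1 (s - r))); rewrite mulrDl.
    apply: le_trans (path_holder beta_gt K0 K0 X1 hy h1 h2 h3) _.
    by rewrite lerDl; pos.
  have := path_holder beta_gt (s := s - r) (t := t - r) K0 K0 X2 he.
  rewrite !lerD2r (pw_shift beta r s t) => /(_ h1 h2 h3) /le_trans; apply.
  by rewrite lerDr; pos.
have [Ku Ku0 hu'] := hu.
have Gl := gc_D gc; have Gdl := gc_Dl gc; have GB := gc_DB gc.
have zeta_holder (al : R -> 'M[R]_(d, n)) (j : 'rV[R]_n -> 'rV[R]_n * 'rV[R]_n) v :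
    (forall x, `|j x| <= `|x|) -> (forall x z, j (x - z) = j x - j z) ->
    (forall t, a <= t -> t <= b -> `|al t| <= K) ->
    (forall s t, a <= s -> s <= t -> t <= b -> `|al t - al s| <= K * pw s t) ->
    holder_norm beta `[a, b] (fun t => 'd G (u t) (j (v *m al t))) \is a fin_num.
  move=> j1 jB al1 al2.
  apply: (@ge0_fin_num _ _ (L * Ku * (d%:R * `|v| * K) + L * (d%:R * `|v| * K))).
    exact: incr_norm_ge0.
  apply: holder_norm_le => s t h1 h2 h3.
  have vx (x : 'M[R]_(d, n)) k : `|x| <= k -> `|j (v *m x)| <= d%:R * `|v| * k.
    move=> xk; apply: le_trans (j1 _) _; apply: le_trans (mulmx_norm _ _) _.
    by rewrite ler_wpM2l // mulr_ge0.
  have tri (x z q : 'M[R]_(d, n)) : `|x - z| <= `|x - q| + `|q - z|.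
    by rewrite -[x - z](subrKA q) ler_normD.
  apply: le_trans (tri _ _ ('d G (u s) (j (v *m al t)))) _; rewrite mulrDl; apply: lerD.
    apply: le_trans (Gdl _ _ _) _.
    rewrite (_ : L * Ku * _ * _ = L * (Ku * pw s t) * (d%:R * `|v| * K)); last by ring.
    apply: ler_pM => //; first by rewrite mulr_ge0.
      by rewrite ler_wpM2l // hu'.
    by apply: vx; apply: al1 => //; apply: le_trans h2.
  rewrite -GB -jB -mulmxBr; apply: le_trans (Gl _ _) _.
  rewrite (_ : L * _ * _ = L * (d%:R * `|v| * (K * pw s t))); last by ring.
  by rewrite ler_wpM2l //; apply: (vx (al t - al s)); exact: al2.
split.
- by split=> s c v v'; rewrite /G_path0 /G_path1 mulmxDl -scalemxAl -linearP;
    congr ('d G _ _); congr pair; rewrite /= ?scaler0 ?addr0.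
- move=> v; apply: (zeta_holder y.2 (fun x => (x, 0)) v) => //.
  + by move=> x; apply: pair_le; rewrite ?normr0.
  + by move=> x z; congr pair; rewrite subr0.
- move=> v; apply: (zeta_holder (fun t => w (t - r)) (fun x => (0, x)) v).
  + by move=> x; apply: pair_le; rewrite ?normr0.
  + by move=> x z; congr pair; rewrite subr0.
  + by move=> t ta tb; apply: e1; rewrite lerD2r.
  + move=> s t h1 h2 h3; rewrite -(pw_shift beta r).
    by apply: e2; rewrite lerD2r.
have n1 := remainder_norm_le K0 K0 X1 y2 y3.
have n2 := remainder_norm_le K0 K0 X2 e2 e3.
apply: (@ge0_fin_num _ _ (L * Ku ^+ 2 + L * (K + d%:R * K * K))); first exact: incr_norm_ge0.
apply: incr_norm_le => s t /=; rewrite !in_itv /= => hs ht st.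
have str : s - r != t - r by rewrite (inj_eq (addIr _)).
have B1 := incr_norm_bound n1 (_ : `[a, b]%classic s) (_ : `[a, b]%classic t) st.
have B2 := incr_norm_bound n2 (_ : `[a - r, b - r]%classic (s - r)) (_ : `[a - r, b - r]%classic (t - r)) str.
rewrite /= !in_itv /= in B1 B2; move: (B1 hs ht) => {}B1.
rewrite !lerD2r in B2; move: (B2 hs ht) => {}B2.
have trs : t - r - (s - r) = t - s by ring.
rewrite trs in B2.
have B3 := holder_abs hu' hs ht.
have -> : incr (G_path r G y.1) s t - G_path0 r G y s (incr (base X) s t)
     - G_path1 r G y w s (incr (base X) (s - r) (t - r)) =
   (G (u t) - G (u s) - 'd G (u s) (u t - u s))
   + 'd G (u s) (remainder X y s t, remainder X (y.1, w) (s - r) (t - r)).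
  rewrite -addrA -opprD /G_path0 /G_path1 (subtractive_pair _ _ (GB (u s))).
  have -> : (remainder X y s t, remainder X (y.1, w) (s - r) (t - r)) = (u t - u s) -
      (incr (base X) s t *m y.2 s, incr (base X) (s - r) (t - r) *m w (s - r)) by [].
  by rewrite (GB _ (u t - u s)) addrA subrK.
apply: le_trans (ler_normD _ _) _; rewrite mulrDl; apply: lerD.
  apply: le_trans (gc_T gc _ _) _; rewrite -mulrA ler_wpM2l //.
  rewrite -[_ `^ (2 * beta)]powR_sq -exprMn lerXn2r ?nnegrE // mulr_ge0 // powR_ge0.
apply: le_trans (Gl _ _) _; rewrite -mulrA ler_wpM2l //.
exact: pair_le.
Qed.

End RoughIntegrals.

(** * Solutions *)

(** When [p, q] meets [s, t] in at most one point, its end points clamped to [s, t] coincide, so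
    that it contributes nothing in [state_solution]. *)
Lemma clamp_step (R : realType) (s t p q : R) : p <= q -> s <= t ->
  Num.min t q <= Num.max s p -> Num.max s (Num.min t q) = Num.max s (Num.min t p).
Proof.
case: (leP s p) => ?; case: (leP t q) => ?; case: (leP t p) => ?; case: (leP s q) => ?;
  case: (leP s t) => ?; case: (leP s p) => *; lra.
Qed.

Section Equation.
Context {R : realType} {n d : nat}.
Variables (r beta gamma L : R) (G : 'rV[R]_n * 'rV[R]_n -> 'M[R]_(d, n)).
Hypotheses (beta_gt : 3^-1 < beta) (beta_le : beta <= 2^-1) (beta_gamma : beta <= gamma)
  (r_gt0 : 0 < r).
Local Notation V := 'rV[R]_n.
Local Notation PP := (fun p => pair_contract ('d G p)).
Hypothesis gc : germ_coeff L G (fun p => 'd G p) (@pair_act R n d) PP (@pair_tens R d).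
Variable X : delayed_path R d.
Hypothesis Xrp : delayed_rough_path r gamma X.
Variables (A : 'M[R]_(n + n, n)).
Variable pi : 'I_n -> 'I_n -> {charge set (measurableTypeR R) -> \bar R}.
Local Notation pw := (hpow beta).
Local Notation dgerm := (delay_germ r G PP X).
Local Notation davie := (davie r beta G PP X).
Local Notation hol := (hol r beta).
Local Notation rough_bd := (rough_bd r beta X).
Local Notation ctrl_bd := (ctrl_bd beta X).
Local Notation f := (drift r A pi).
Local Notation sol_path := (sol_pair r G).
Local Notation delay_datum := (datum_at r G).
Implicit Types (xi z e : cpath R d n) (a b : R).

Let fok : drift_ok r beta (drift_const r pi A) f.
Proof. by apply: drift_is_ok => //; exact: ltW. Qed.
Let L0 : 0 <= L. Proof. exact: le_trans (gc_L gc). Qed.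
Let Xch : chen r X := rough_path_chen beta_gt beta_gamma Xrp.
Let r_ge0 : 0 <= r := ltW r_gt0.

(** The solution concept without rough integrals; [solution_state] and [state_solution] give the
    passage in both directions. *)
Definition delay_state xi (y : R -> V) := forall k,
  [/\ exists K, hol K (k%:R * r) y,
    exists K, ctrl_bd K (k%:R * r - r) (k%:R * r) (delay_datum xi k y)
  & let e := delay_datum xi k y in
    davie (f y) (sol_path y e) e y (k%:R * r) (k%:R * r + r)].

Definition gubinelli_pair (y : R -> V) : cpath R d n := (y, fun t => G (y t, y (t - r))).

Lemma rough_bd_mono K K' a b : K <= K' -> rough_bd K a b -> rough_bd K' a b.
Proof.
move=> KK h s t g1 g2 g3; have [q1 q2 q3 q4] := h s t g1 g2 g3.
by split; [apply: le_trans q1 _|apply: le_trans q2 _|apply: le_trans q3 _|apply: le_trans q4 _];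
  rewrite ler_wpM2r ?pw_ge0 ?pw2_ge0.
Qed.

Lemma rough_incr K a b s t : rough_bd K a b -> a <= s -> s <= t -> t <= b ->
  `|incr (base X) s t| <= K * pw s t.
Proof. by move=> h h1 h2 h3; have [] := h s t h1 h2 h3. Qed.

Lemma dgerm_ext (y e y' e' : cpath R d n) s t : y.1 s = y'.1 s -> y.2 s = y'.2 s ->
  e.1 (s - r) = e'.1 (s - r) -> e.2 (s - r) = e'.2 (s - r) -> dgerm y e s t = dgerm y' e' s t.
Proof. by rewrite /delay_germ /germ /delay_pair /delay_deriv => -> -> -> ->. Qed.

Lemma common_bound k z e K1 K2 : ctrl_bd K1 (k%:R * r) (k%:R * r + r) z ->
  ctrl_bd K2 (k%:R * r - r) (k%:R * r) e ->
  exists K, [/\ L <= K, 0 <= K, rough_bd K (k%:R * r) (k%:R * r + r),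
    ctrl_bd K (k%:R * r) (k%:R * r + r) z
  & ctrl_bd K (k%:R * r - r) (k%:R * r + r - r) e].
Proof.
move=> h1 h2; have [K3 h3] := rough_path_bd_ex beta_gt beta_gamma Xrp (k%:R * r) (k%:R * r + r).
have [n1 n2 n3] := And3 (normr_ge0 K1) (normr_ge0 K2) (normr_ge0 K3).
have [m1 m2 m3] := And3 (ler_norm K1) (ler_norm K2) (ler_norm K3).
have L0' := L0.
exists (L + `|K1| + `|K2| + `|K3|); split; try lra.
- by apply: rough_bd_mono h3; lra.
- by apply: ctrl_bd_mono h1; lra.
- by rewrite addrK; apply: ctrl_bd_mono h2; lra.
Qed.

Lemma holder_patch (W : normedModType R) (y : R -> W) K1 K2 a c b :
  (forall s t, a <= s -> s <= t -> t <= c -> `|y t - y s| <= K1 * pw s t) ->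
  (forall s t, c <= s -> s <= t -> t <= b -> `|y t - y s| <= K2 * pw s t) ->
  forall s t, a <= s -> s <= t -> t <= b -> `|y t - y s| <= (`|K1| + `|K2|) * pw s t.
Proof.
move=> h1 h2 s t as_ st tb.
have p0 := pw_ge0 beta s t.
have g1 s' t' : a <= s' -> s' <= t' -> t' <= c -> `|y t' - y s'| <= `|K1| * pw s' t'.
  move=> ? ? ?; apply: le_trans (h1 _ _ _ _ _) _ => //.
  by rewrite ler_wpM2r ?pw_ge0 ?ler_norm.
have g2 s' t' : c <= s' -> s' <= t' -> t' <= b -> `|y t' - y s'| <= `|K2| * pw s' t'.
  move=> ? ? ?; apply: le_trans (h2 _ _ _ _ _) _ => //.
  by rewrite ler_wpM2r ?pw_ge0 ?ler_norm.
rewrite mulrDl; have [tc|ct] := leP t c.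
  by apply: le_trans (g1 _ _ as_ st tc) _; rewrite lerDl mulr_ge0.
have [cs|sc] := leP c s.
  by apply: le_trans (g2 _ _ cs st tb) _; rewrite lerDr mulr_ge0.
rewrite -[y t - y s](subrKA (y c)) addrC; apply: le_trans (ler_normD _ _) _; apply: lerD.
  by apply: le_trans (g1 _ _ as_ (ltW sc) (lexx c)) _; rewrite ler_wpM2l // pw_mono // ltW.
by apply: le_trans (g2 _ _ (lexx c) (ltW ct) tb) _; rewrite ler_wpM2l // pw_mono // ltW.
Qed.

Lemma solution_hol xi z k : controlled X beta `[- r, 0] xi -> solution r beta A G pi X xi z ->
  exists K, hol K (k%:R * r) z.1.
Proof.
move=> cxi [z0 _ zc _]; have r0 := r_gt0.
have rr : - r < 0 by rewrite oppr_lt0.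
have [K1 K10 h1] := controlled_bd beta_gt rr cxi.
have [X1 hX1] := rough_path_bd_ex beta_gt beta_gamma Xrp (- r) 0.
have kr := kr_ge0 r_gt0 k.+1; rewrite krS in kr.
have kr0 : 0 < k%:R * r + r by rewrite ltr_wpDl // kr_ge0.
have [K2 K20 h2] := controlled_bd beta_gt kr0 (zc _ _ (lexx 0) kr0).
have [X2 hX2] := rough_path_bd_ex beta_gt beta_gamma Xrp 0 (k%:R * r + r).
have {}hX1 := rough_bd_mono (ler_norm X1) hX1; have {}hX2 := rough_bd_mono (ler_norm X2) hX2.
eexists => s t as_ st tb.
apply: (@holder_patch _ z.1 _ _ (- r) 0 (k%:R * r + r)) => //; last 1 first.
- by apply: le_trans tb _; rewrite lerDl.
- move=> s' t' q1 q2 q3; rewrite !z0; [|apply/andP; split..]; rewrite ?(le_trans q2) ?(le_trans q1) //.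
  apply: (path_holder beta_gt K10 (normr_ge0 X1) _ h1) q1 q2 q3 => ? ? ? ? ?.
  exact: rough_incr hX1 _ _ _.
move=> s' t' q1 q2 q3.
apply: (path_holder beta_gt K20 (normr_ge0 X2) _ h2) q1 q2 q3 => ? ? ? ? ?.
exact: rough_incr hX2 _ _ _.
Qed.

Lemma solution_datum xi z k : controlled X beta `[- r, 0] xi -> solution r beta A G pi X xi z ->
  exists K, ctrl_bd K (k%:R * r - r) (k%:R * r) (delay_datum xi k z.1).
Proof.
move=> cxi [z0 zG zc _]; have r0 := r_gt0.
case: k => [|k].
  have rr : - r < 0 by rewrite oppr_lt0.
  have [K1 K10 h1] := controlled_bd beta_gt rr cxi.
  exists K1; rewrite mul0r sub0r; apply: ctrl_ext h1 => // t t1 t2.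
  by rewrite /= z0 // t1 t2.
rewrite krS addrK.
have kk : k%:R * r < k%:R * r + r by rewrite ltrDl.
have [K1 K10 h1] := controlled_bd beta_gt kk (zc _ _ (kr_ge0 r_gt0 k) kk).
exists K1; apply: ctrl_ext h1 => // t t1 t2.
by rewrite /= zG // (le_trans _ t1) // kr_ge0.
Qed.

(** For s and t in one interval [k r, (k + 1) r], the other terms of the defining sum belong to
    degenerate intersections and vanish. *)
Lemma solution_rough_integral xi z k s t : solution r beta A G pi X xi z ->
  k%:R * r <= s -> s < t -> t <= k%:R * r + r ->
  is_rough_integral r X beta s t (G_path r G z.1) (G_path0 r G z)
    (G_path1 r G z (if k is 0%N then xi.2 else z.2)) (incr z.1 s t - f z.1 s t).
Proof.
move=> [_ _ _ zI] ks st tk; have s0 := le_trans (kr_ge0 r_gt0 k) ks.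
have r0 := r_gt0; have [I [J -> hJ] ->] := zI s t s0 st.
have t0 : 0 <= t / r by rewrite divr_ge0 // ?(le_trans s0 (ltW st)).
have kN : (k < (Num.truncn (t / r)).+1)%N.
  have /andP[_] := truncn_itv t0; rewrite ltr_pdivrMr // => h.
  by rewrite -(ltr_nat R) -(ltr_pM2r r0) (le_lt_trans _ h) // (le_trans ks) ?ltW.
rewrite addrC addKr (bigD1 (Ordinal kN)) //= big1 ?addr0; last first.
  move=> [i iN] /= ik; have := hJ i; rewrite /= ltNge.
  suff -> : Num.min t (i.+1%:R * r) <= Num.max s (i%:R * r) by [].
  rewrite ge_min !le_max.
  have [ik'|] := ltnP i k.
    suff -> : i.+1%:R * r <= s by rewrite !orbT.
    by apply: le_trans ks; rewrite ler_pM2r // ler_nat.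
  rewrite leq_eqVlt => /orP[/eqP ki|ki]; first by move: ik; rewrite -val_eqE /= ki eqxx.
  suff -> : t <= i%:R * r by rewrite !orbT.
  by apply: le_trans tk _; rewrite -krS ler_pM2r // ler_nat.
by have := hJ k; rewrite /= (max_idPl ks) (min_idPl (_ : t <= _)) ?krS // st.
Qed.

(** The integrals over all subintervals [s, t] are limits of germ sums, so [cvg_davie] yields a
    Davie constant independent of s and t. *)
Lemma solution_state xi z : controlled X beta `[- r, 0] xi -> solution r beta A G pi X xi z ->
  delay_state xi z.1.
Proof.
move=> cxi zs k; have r0 := r_gt0.
split; [exact: solution_hol zs|exact: solution_datum zs|].
move=> e; have [z0 zG zc _] := zs.
have kk : k%:R * r < k%:R * r + r by rewrite ltrDl.
have k0 := kr_ge0 r_gt0 k.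
have [K1 _ h1] := controlled_bd beta_gt kk (zc _ _ k0 kk).
have [K2 h2] := solution_datum k cxi zs.
have {}h1 : ctrl_bd K1 (k%:R * r) (k%:R * r + r) (sol_path z.1 e).
  apply: ctrl_ext h1 => // t t1 t2; rewrite /= zG // (le_trans k0) //.
have [K [LK K0 hX hz he]] := common_bound h1 h2.
have [C C0 hC] := germ_cross beta_gt gc LK (lexx _) Xch hX he hz.
have [Kh hh] := solution_hol k.+1 cxi zs.
pose w := if k is 0%N then xi.2 else z.2.
have E s t : k%:R * r <= s -> dgerm z (z.1, w) s t = dgerm (sol_path z.1 e) e s t.
  move=> ks; apply: dgerm_ext => //=; first by rewrite zG // (le_trans k0).
  rewrite /w /e; case: (k) ks => //= k' ks; rewrite zG // subr_ge0.
  by apply: le_trans ks; rewrite krS lerDr kr_ge0.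
have diag s : k%:R * r <= s -> s <= k%:R * r + r -> dgerm (sol_path z.1 e) e s s = 0.
  by move=> q1 q2; apply: (dgermxx beta_gt gc _ _ hX).
exists (sew_const beta * C) => s t ks; rewrite le_eqVlt => /orP[/eqP<- sk|st tk].
  have := dr_add fok hh (s := s) (v := s) (t := s).
  rewrite krS => /(_ (le_trans k0 ks) (lexx _) (lexx _) sk) /esym/eqP.
  rewrite -subr_eq0 addrK => /eqP fss.
  by rewrite fss subrr diag // !subr0 normr0 pwxx // expr0n mulr0.
have [_ cvg] := solution_rough_integral zs ks st tk.
rewrite -E //; apply: (cvg_davie beta_gt st C0 _ _ cvg).
  move=> s' v t' q1 q2 q3 q4.
  have ks' := le_trans ks q1.
  rewrite !E //; [|exact: le_trans q2..].
  apply: hC => //; [|exact: le_trans tk].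
  by apply: le_trans q3 _; apply: le_trans tk.
move=> s' q1 q2; have ks' := le_trans ks q1.
by rewrite E // diag // (le_trans q2).
Qed.

(** At the joint, R_{s,t} = R_{s,c} + R_{c,t} + X_{c,t} (y'_c - y'_s), and the last term is of order
    2 beta. *)
Lemma ctrl_patch K1 K2 a c b (y : cpath R d n) : ctrl_bd K1 a c y -> ctrl_bd K2 c b y ->
  exists K, ctrl_bd K a b y.
Proof.
move=> [h1 h2 h3] [g1 g2 g3].
have [KX hX] := rough_path_bd_ex beta_gt beta_gamma Xrp a b.
have {}hX := rough_bd_mono (ler_norm KX) hX.
have [m1 m2] := conj (normr_ge0 K1) (normr_ge0 K2).
have [n1 n2] := conj (ler_norm K1) (ler_norm K2).
pose K := `|K1| + `|K2| + d%:R * `|KX| * `|K1|.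
have dK : 0 <= d%:R * `|KX| * `|K1| by pos.
have KK1 : `|K1| <= K by rewrite /K; lra.
have KK2 : `|K2| <= K by rewrite /K; lra.
have K12 : `|K1| + `|K2| <= K by rewrite /K; lra.
have wk Ki K' (x w : R) : Ki <= `|Ki| -> `|Ki| <= K' -> 0 <= w -> x <= Ki * w -> x <= K' * w.
  move=> q1 q2 w0 /le_trans; apply; rewrite ler_wpM2r //; exact: le_trans q2.
exists K; split.
- move=> t ta tb; have [tc|/ltW ct] := leP t c.
    by apply: le_trans (h1 t ta tc) _; apply: le_trans KK1.
  by apply: le_trans (g1 t ct tb) _; apply: le_trans KK2.
- move=> s t q1 q2 q3; apply: le_trans (holder_patch h2 g2 q1 q2 q3) _.
  by rewrite ler_wpM2r ?pw_ge0.
- move=> s t as_ st tb; have p0 := pw_ge0 beta s t; have p2 := pw2_ge0 beta s t.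
  have [tc|ct] := leP t c; first by apply: (wk K1 K _ _ n1) => //; exact: h3.
  have [cs|sc] := leP c s; first by apply: (wk K2 K _ _ n2) => //; exact: g3.
  have [sc' ct'] := conj (ltW sc) (ltW ct).
  have -> : remainder X y s t = remainder X y s c + remainder X y c t
      + incr (base X) c t *m (y.2 c - y.2 s).
    rewrite /remainder (incrD (base X) s c t) mulmxBr mulmxDl /incr.
    by move: (_ *m _) (_ *m _) (_ *m _) => *; mxring.
  have pc1 : pw s c <= pw s t by apply: pw_mono.
  have pc2 : pw c t <= pw s t by apply: pw_mono.
  have [pp1 pp2] := conj (pw_ge0 beta s c) (pw_ge0 beta c t).
  have w2 Ki w : 0 <= w -> w <= pw s t -> Ki * w ^+ 2 <= `|Ki| * pw s t ^+ 2.
    move=> w0 wp; apply: le_trans (ler_wpM2r (exprn_ge0 _ w0) (ler_norm Ki)) _.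
    by rewrite ler_wpM2l // lerXn2r ?nnegrE.
  apply: le_trans (ler_normD _ _) _; rewrite /K mulrDl; apply: lerD.
    apply: le_trans (ler_normD _ _) _; rewrite mulrDl; apply: lerD.
      by apply: le_trans (h3 s c as_ sc' (lexx c)) _; exact: w2.
    by apply: le_trans (g3 c t (lexx c) ct' tb) _; exact: w2.
  apply: le_trans (mulmx_norm _ _) _.
  rewrite (_ : _ * `|K1| * _ = d%:R * (`|KX| * pw s t) * (`|K1| * pw s t)); last by ring.
  apply: ler_pM => //.
    rewrite ler_wpM2l //; apply: le_trans (rough_incr hX (le_trans as_ sc') ct' tb) _.
    by rewrite ler_wpM2l.
  apply: le_trans (h2 s c as_ sc' (lexx c)) _; apply: le_trans (ler_wpM2r pp1 n1) _.
  by rewrite ler_wpM2l.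
Qed.

Lemma ctrl_controlled K a b (y : cpath R d n) : a < b -> ctrl_bd K a b y -> controlled X beta `[a, b] y.
Proof.
move=> ab /(ctrl_bd_mono (ler_norm K)) [_ h2 h3].
have [KX hX] := rough_path_bd_ex beta_gt beta_gamma Xrp a b.
have {}hX := rough_bd_mono (ler_norm KX) hX.
have n1 := holder_norm_le h2.
have hX' s t : a <= s -> s <= t -> t <= b -> `|incr (base X) s t| <= `|KX| * pw s t.
  exact: rough_incr hX.
have n2 := remainder_norm_le (normr_ge0 K) (normr_ge0 KX) hX' h2 h3.
by split; [apply: ge0_fin_num n1|apply: ge0_fin_num n2]; exact: incr_norm_ge0.
Qed.

Section State.
Variables (xi : cpath R d n) (y : R -> V).
Hypothesis ys : delay_state xi y.

Lemma state_ctrl k : exists K, ctrl_bd K (k%:R * r) (k%:R * r + r) (gubinelli_pair y).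
Proof. by have [_ [K hK] _] := ys k.+1; exists K; move: hK; rewrite krS addrK. Qed.

Lemma state_ctrl_all b : exists K, ctrl_bd K 0 b (gubinelli_pair y).
Proof.
have r0 := r_gt0.
have all k : exists K, ctrl_bd K 0 (k%:R * r + r) (gubinelli_pair y).
  elim: k => [|k [K1 h1]]; first by have [K hK] := state_ctrl 0; exists K; move: hK; rewrite mul0r.
  have [K2 h2] := state_ctrl k.+1; rewrite -krS in h1.
  exact: ctrl_patch h1 h2.
have [k hk _] := nat_above (divr_ge0 (normr_ge0 b) r_ge0).
have [K hK] := all k; exists K; apply: ctrl_sub hK => //.
rewrite ler_pdivrMr // in hk; apply: le_trans (ler_norm b) _; apply: le_trans hk _.
by rewrite lerDl.
Qed.

Lemma state_hol T : exists K, hol K T y.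
Proof.
have r0 := r_gt0; have [k hk _] := nat_above (divr_ge0 (normr_ge0 T) r_ge0).
have [[K hK] _ _] := ys k; exists K => s t h1 h2 h3; apply: hK => //.
rewrite ler_pdivrMr // in hk.
by apply: le_trans h3 _; apply: le_trans (ler_norm T) _.
Qed.

Lemma state_add T : add_incr (f y) 0 T.
Proof. by have [K hK] := state_hol T; exact: dr_add fok _ _ _ hK. Qed.

(** [y t - f y a t] is an indefinite integral, to which [davie_cvg] applies. *)
Lemma state_rough_integral k a b : k%:R * r <= a -> a < b -> b <= k%:R * r + r ->
  is_rough_integral r X beta a b (G_path r G y) (G_path0 r G (gubinelli_pair y))
    (G_path1 r G (gubinelli_pair y) (if k is 0%N then xi.2 else (gubinelli_pair y).2)) (y b - y a - f y a b).
Proof.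
move=> ka ab bk; have k0 := kr_ge0 r_gt0 k.
have [_ [K2 h2] [C hC]] := ys k; have [K1 h1] := state_ctrl k.
have [K [LK K0 hX hy he]] := common_bound h1 h2.
have hX' : rough_bd K a b by apply: rough_sub hX.
have hy' : ctrl_bd K a b (gubinelli_pair y) by apply: ctrl_sub hy.
have he' : ctrl_bd K (a - r) (b - r) (delay_datum xi k y).
  by apply: ctrl_sub he; rewrite lerB.
split; first exact: (delayed_controlled_ctrl beta_gt gc ab K0 hX' hy' he').
have fa s t : a <= s -> s <= t -> t <= b -> f y a t = f y a s + f y s t.
  by move=> q1 q2 q3; apply: (state_add (T := b)) => //; apply: le_trans ka.
have -> : y b - y a - f y a b = (y b - f y a b) - (y a - f y a a).
  have /esym/eqP := fa a a (lexx _) (lexx _) (ltW ab); rewrite -subr_eq0 addrK => /eqP ->.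
  by rewrite subr0 addrAC.
apply: (davie_cvg beta_gt (C := C) (y := gubinelli_pair y) (phi := fun t => y t - f y a t) ab) => s t q1 q2 q3.
rewrite (_ : y t - f y a t - (y s - f y a s) = y t - y s - f y s t).
  by apply: hC => //; [exact: le_trans q1|exact: le_trans bk].
by rewrite (fa s t q1 q2 q3); move: (f y a s) (f y s t) (y s) (y t) => *; mxring.
Qed.

Hypothesis y0 : forall t, - r <= t -> t <= 0 -> y t = xi.1 t.

Lemma state_solution : solution r beta A G pi X xi (gubinelli_pair y).
Proof.
have r0 := r_gt0.
split=> //.
- by move=> s /andP[s1 s2]; exact: y0.
- move=> a b a0 ab; have [K hK] := state_ctrl_all b.
  by apply: ctrl_controlled (ctrl_sub a0 (lexx b) hK).
move=> s t s0 st.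
(* The points k r clamped to [s, t]. The integral over the k-th interval is the increment of [Hf]
   between consecutive ones, and the sum telescopes. *)
pose c k := Num.max s (Num.min t (k%:R * r)).
pose Hf v := y v - y s - f y s v.
have t0 : 0 <= t / r by rewrite divr_ge0 // ?(le_trans s0 (ltW st)).
have fs v w : s <= v -> v <= w -> f y s w = f y s v + f y v w.
  by move=> q1 q2; apply: (state_add (T := w)) => //; exact: lexx.
have fss : f y s s = 0.
  by have /esym/eqP := fs s s (lexx _) (lexx _); rewrite -subr_eq0 addrK => /eqP ->.
pose J k := Hf (c k.+1) - Hf (c k).
have Jsum N : \sum_(k < N) J k = Hf (c N) - Hf (c 0%N).
  rewrite -(big_mkord xpredT J); exact: (telescope_sumr (fun k => Hf (c k))).
have c0 : c 0%N = s by rewrite /c mul0r (min_idPr _) ?(max_idPl s0) // (le_trans s0) ?ltW.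
have cN : c (Num.truncn (t / r)).+1 = t.
  have /andP[_] := truncn_itv t0; rewrite ltr_pdivrMr // => /ltW h.
  by rewrite /c (min_idPl h) (max_idPr _) // ltW.
exists (\sum_(k < (Num.truncn (t / r)).+1) J k); last first.
  have Hs : Hf s = 0 by rewrite /Hf subrr fss subr0.
  by rewrite Jsum c0 cN Hs subr0 [RHS]addrC subrK.
exists J => // k /=.
have kk : k%:R * r <= k.+1%:R * r by rewrite krS lerDl.
have [ab|ba] := ltP (Num.max s (k%:R * r)) (Num.min t (k.+1%:R * r)).
  have [a1 a2] : s <= Num.max s (k%:R * r) /\ k%:R * r <= Num.max s (k%:R * r).
    by rewrite !le_max !lexx orbT.
  have [b1 b2] : Num.min t (k.+1%:R * r) <= t /\ Num.min t (k.+1%:R * r) <= k.+1%:R * r.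
    by rewrite !ge_min !lexx orbT.
  set a := Num.max _ _ in ab a1 a2 *; set b := Num.min _ _ in ab b1 b2 *.
  have -> : J k = y b - y a - f y a b.
    have cb : c k.+1 = b by rewrite /c -/b (max_idPr _) // ltW // (le_lt_trans a1).
    have ca : c k = a by rewrite /c (min_idPr _) // (le_trans a2) // (le_trans (ltW ab)).
    rewrite /J ca cb /Hf (fs a b a1 (ltW ab)).
    by move: (f y s a) (f y a b) (y s) (y a) (y b) => *; mxring.
  by apply: state_rough_integral => //; rewrite -krS.
rewrite /J; suff -> : c k.+1 = c k by rewrite subrr.
exact: clamp_step kk (ltW st) ba.
Qed.

End State.

(** Induction over the intervals: solutions that agree up to k r have the same datum on the next
    interval, and [global_diff] with distance 0 applies. *)
Lemma state_unique xi y1 y2 : delay_state xi y1 -> delay_state xi y2 ->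
  (forall t, - r <= t -> t <= 0 -> y1 t = xi.1 t) ->
  (forall t, - r <= t -> t <= 0 -> y2 t = xi.1 t) -> forall t, - r <= t -> y1 t = y2 t.
Proof.
move=> s1 s2 i1 i2; have r0 := r_gt0.
have key k : forall t, - r <= t -> t <= k%:R * r -> y1 t = y2 t.
  elim: k => [|k IH]; first by move=> t h1; rewrite mul0r => h2; rewrite i1 // i2.
  have k0 := kr_ge0 r_gt0 k.
  have [_ [Ka ha] da] := s1 k; have [_ [Kb hb] db] := s2 k.
  have [Kc hc] := state_ctrl s1 k; have [Kd hd] := state_ctrl s2 k.
  have [K1 [LK1 K10 X1 z1 e1]] := common_bound hc ha.
  have [K2 [LK2 K20 X2 z2 e2]] := common_bound hd hb.
  have KK1 : K1 <= K1 + K2 by rewrite lerDl.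
  have KK2 : K2 <= K1 + K2 by rewrite lerDr.
  have [C C0 hC] := global_diff beta_gt beta_le gc fok r_gt0 (le_trans LK1 KK1) Xch.
  have E2 t : k%:R * r - r <= t -> t <= k%:R * r ->
      (delay_datum xi k y1).2 t = (delay_datum xi k y2).2 t.
    case: (k) IH => //= k' IH t1 t2; rewrite krS addrK in t1.
    have h := kr_ge0 r_gt0 k'.
    by rewrite !IH //; lra.
  have E1 t : k%:R * r - r <= t -> t <= k%:R * r -> y1 t = y2 t.
    by move=> t1 t2; apply: IH => //; lra.
  have Z t : k%:R * r - r <= t -> t <= k%:R * r ->
      (delay_datum xi k y1 - delay_datum xi k y2).2 t = 0.
    move=> t1 t2; rewrite -[LHS]/((delay_datum xi k y1).2 t - (delay_datum xi k y2).2 t).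
    by rewrite E2 // subrr.
  have kk : k%:R * r <= k%:R * r + r by rewrite lerDl.
  have := hC y1 y2 (delay_datum xi k y1) (delay_datum xi k y2) (k%:R * r) (k%:R * r + r) 0 (lexx _) k0 kk.
  have hr : k%:R * r + r - k%:R * r <= r by rewrite addrC addKr.
  move=> /(_ hr (rough_bd_mono KK1 X1) (ctrl_bd_mono KK1 e1) (ctrl_bd_mono KK2 e2)
    (ctrl_bd_mono KK1 z1) (ctrl_bd_mono KK2 z2) (state_hol s1 _) (state_hol s2 _) da db).
  rewrite addrK => /(_ _ _)[|t t1 t2|h _ _].
  - split=> [t t1 t2|t t1 t2|a b t1 t2 t3|a b t1 t2 t3].
    + by rewrite /datum_at /= E1 // subrr normr0.
    + by rewrite E2 // subrr normr0.
    + have t4 := le_trans t1 t2; have t5 := le_trans t2 t3.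
      by rewrite !Z // subrr normr0 mul0r.
    + have t4 := le_trans t1 t2; have t5 := le_trans t2 t3.
      by rewrite /remainder /incr E2 // /datum_at /= !E1 // subrr normr0 mul0r.
  - by rewrite IH // subrr normr0.
  move=> t t1; rewrite krS => t2; have := h t t1 t2.
  by rewrite mulr0 normr_le0 subr_eq0 => /eqP.
move=> t t1; have [k hk _] := nat_above (divr_ge0 (normr_ge0 t) r_ge0).
apply: (key k) => //; rewrite ler_pdivrMr // in hk.
by apply: le_trans (ler_norm t) _.
Qed.

End Equation.

(** * The first interval *)

Lemma le_sum4 (R : realFieldType) (x1 x2 x3 x4 : R) :
  0 <= x1 -> 0 <= x2 -> 0 <= x3 -> 0 <= x4 ->
  [/\ x1 <= x2 + (x1 + x3 + x4), x2 <= x2 + (x1 + x3 + x4),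
      x3 <= x2 + (x1 + x3 + x4) & x4 <= x2 + (x1 + x3 + x4)].
Proof. by move=> *; split; lra. Qed.

Lemma fineD3 (R : realType) (x1 x2 x3 : \bar R) :
  x1 \is a fin_num -> x2 \is a fin_num -> x3 \is a fin_num ->
  fine (x1 + x2 + x3)%E = fine x1 + fine x2 + fine x3.
Proof. by move=> *; rewrite !fineD // fin_numD; apply/andP. Qed.

Section BivariateEval.
Context {R : comNzRingType}.
Variables (p q : {poly {poly R}}) (u v c : R).

Lemma hornerXYD : (p + q).[u, v] = p.[u, v] + q.[u, v].
Proof. by rewrite !hornerD. Qed.

Lemma hornerXYM : (p * q).[u, v] = p.[u, v] * q.[u, v].
Proof. by rewrite !hornerM. Qed.

Lemma hornerXYexp k : (p ^+ k).[u, v] = p.[u, v] ^+ k.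
Proof. by rewrite !horner_exp. Qed.

Lemma hornerXYC : (c%:P%:P : {poly {poly R}}).[u, v] = c.
Proof. by rewrite !hornerC. Qed.

Lemma hornerXYX : ('X : {poly {poly R}}).[u, v] = u.
Proof. by rewrite hornerX hornerC. Qed.

Lemma hornerXYY : (('X)%:P : {poly {poly R}}).[u, v] = v.
Proof. by rewrite hornerC hornerX. Qed.

End BivariateEval.

Section FirstInterval.
Context {R : realType} {n d : nat}.
Variables (r beta gamma L : R) (G : 'rV[R]_n * 'rV[R]_n -> 'M[R]_(d, n)).
Hypotheses (beta_gt : 3^-1 < beta) (beta_le : beta <= 2^-1) (beta_gamma : beta <= gamma)
  (r_gt0 : 0 < r).
Local Notation V := 'rV[R]_n.
Local Notation PP := (fun p => pair_contract ('d G p)).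
Hypothesis gc : germ_coeff L G (fun p => 'd G p) (@pair_act R n d) PP (@pair_tens R d).
Variable pi : 'I_n -> 'I_n -> {charge set (measurableTypeR R) -> \bar R}.
Local Notation pw := (hpow beta).
Local Notation delay_state := (delay_state r beta G).
Local Notation gubinelli_pair := (gubinelli_pair r G).
Implicit Types (X : delayed_path R d) (xi eta : cpath R d n) (a b : R).

Let L0 : 0 <= L. Proof. exact: le_trans (gc_L gc). Qed.
Let r_ge0 : 0 <= r := ltW r_gt0.

Let fok A : drift_ok r beta (drift_const r pi A) (drift r A pi).
Proof. by apply: drift_is_ok => //; exact: ltW. Qed.

Let datumE xi (y : R -> V) X K : (forall t, - r <= t -> t <= 0 -> y t = xi.1 t) ->
  ctrl_bd beta X K (- r) 0 xi -> ctrl_bd beta X K (0 - r) (r - r) (y, xi.2).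
Proof. by move=> yxi; rewrite sub0r subrr; apply: ctrl_ext => // t t1 t2; rewrite /= yxi. Qed.

(** The constants are fixed before A, X and xi and depend on A through its norm; the polynomial of
    the theorem is quantified in this order. *)
Lemma state_apriori (al : R) : exists C1 C2, [/\ 0 <= C1, 0 <= C2 &
  forall A X xi y Lam m0, `|A| = al -> delayed_rough_path r gamma X ->
    delay_state X A pi xi y -> (forall t, - r <= t -> t <= 0 -> y t = xi.1 t) ->
    L <= Lam -> 0 <= m0 -> rough_bd r beta X Lam 0 r ->
    (forall t, - r <= t -> t <= 0 -> `|xi.1 t| <= m0) -> ctrl_bd beta X Lam (- r) 0 xi ->
    let M := C1 * (m0 + Lam ^+ 18) in
    (forall t, - r <= t -> t <= r -> `|y t| <= M) /\
    ctrl_bd beta X (C2 * (Lam + M) ^+ 40) 0 r (gubinelli_pair y)].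
Proof.
pose CA := (n + n)%:R * (1 + pi_mass r pi) * `|al|.
have CA0 : 0 <= CA by have := pi_mass_ge0 r pi; rewrite /CA => ?; pos.
have [C1 C10 h1] := apriori_sup beta_gt beta_le gc CA0 r_gt0.
have [C2 C20 h2] := apriori_ctrl beta_gt beta_le gc CA0 r_gt0.
exists C1, C2; split=> // A X xi y Lam m0 Aal Xrp ys yxi LLam m00 hX hm hxi M.
have r0 := r_gt0; have Lam0 : 0 <= Lam by apply: le_trans LLam.
have fA : drift_ok r beta CA (drift r A pi).
  by have := fok A; rewrite /drift_const /CA -Aal normr_id.
have Xch := rough_path_chen beta_gt beta_gamma Xrp.
have yh : exists K, hol r beta K r y := state_hol r_gt0 ys r.
have [_ _ yd] := ys 0%N; rewrite mul0r add0r in yd.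
have he := datumE yxi hxi.
have rr : r - 0 <= r by rewrite subr0.
have ym t : - r <= t -> t <= r -> `|y t| <= M.
  apply: (h1 X _ fA Xch Lam 0 r m0 y (y, xi.2)) => // t' t1 t2.
  by rewrite yxi // hm.
split=> //.
have M0 : 0 <= M by rewrite /M; pos.
exact: (h2 X _ fA Xch Lam 0 r M y (y, xi.2)).
Qed.

Lemma state_exists X A xi : delayed_rough_path r gamma X -> controlled X beta `[- r, 0] xi ->
  exists2 y, delay_state X A pi xi y & forall t, - r <= t -> t <= 0 -> y t = xi.1 t.
Proof.
move=> Xrp cxi; have rr : - r < 0 by rewrite oppr_lt0.
have Xch := rough_path_chen beta_gt beta_gamma Xrp.
have Xbd a b : 0 <= a -> exists K, rough_bd r beta X K a b.
  by move=> _; exact: (rough_path_bd_ex beta_gt beta_gamma Xrp).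
have [K K0 hK] := controlled_bd beta_gt rr cxi.
have [KX hX] := rough_path_bd_ex beta_gt beta_gamma Xrp (- r) 0.
have {}hX := rough_bd_mono (ler_norm KX) hX.
have xh : exists K, hol r beta K 0 xi.1.
  eexists => s t t1 t2 t3; apply: (path_holder beta_gt K0 (normr_ge0 KX) _ hK) t1 t2 t3.
  by move=> *; apply: rough_incr hX _ _ _.
have [y [y0 ys]] := global_exists beta_gt beta_le gc (fok A) r_gt0 Xch Xbd
  (ex_intro _ K hK) xh.
by exists y => // t _; exact: y0.
Qed.

Lemma remainderB X (y1 y2 : cpath R d n) s t :
  remainder X (y1 - y2) s t = remainder X y1 s t - remainder X y2 s t.
Proof.
rewrite /remainder -[(y1 - y2).2 s]/(y1.2 s - y2.2 s) mulmxBr.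
rewrite /incr -[(y1 - y2).1 s]/(y1.1 s - y2.1 s) -[(y1 - y2).1 t]/(y1.1 t - y2.1 t).
by move: (_ *m _) (_ *m _) => *; mxring.
Qed.

Lemma ctrl_bdD X K1 K2 a b (y1 y2 : cpath R d n) : ctrl_bd beta X K1 a b y1 ->
  ctrl_bd beta X K2 a b (y2 - y1) -> ctrl_bd beta X (K1 + K2) a b y2.
Proof.
move=> [h1 h2 h3] [g1 g2 g3].
have sp (W : normedModType R) (p q : W) k1 k2 : `|p| <= k1 -> `|q - p| <= k2 -> `|q| <= k1 + k2.
  by move=> e1 e2; rewrite -[q](subrK p) addrC; apply: le_trans (ler_normD _ _) _; exact: lerD.
split.
- by move=> t t1 t2; apply: sp (h1 t t1 t2) (g1 t t1 t2).
- move=> s t q1 q2 q3; rewrite mulrDl; apply: sp (h2 s t q1 q2 q3) _.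
  apply: le_trans (g2 s t q1 q2 q3); rewrite le_eqVlt; apply/orP; left; apply/eqP; congr `|_|.
  rewrite -[(y2 - y1).2 s]/(y2.2 s - y1.2 s) -[(y2 - y1).2 t]/(y2.2 t - y1.2 t); mxring.
- move=> s t q1 q2 q3; rewrite mulrDl; apply: sp (h3 s t q1 q2 q3) _.
  by rewrite -remainderB; exact: g3.
Qed.

(** 1 + r instead of r keeps the base at least 1, as [rough_path_bd] requires. *)
Definition rough_scale : R := ((1 + r) `^ (gamma - beta)) ^+ 2.
Local Notation c := rough_scale.
Let c0 : 0 <= c. Proof. by rewrite exprn_ge0 // powR_ge0. Qed.

Definition initial_size X xi := fine (ctrl_norm X beta `[- r, 0] xi).
Definition rough_size X :=
  fine (holder_norm gamma `[- r, 0] (base X)) + fine (rough_norm gamma `[0, r] X).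

Lemma rough_size_bd X : delayed_rough_path r gamma X ->
  0 <= rough_size X /\ rough_bd r beta X (c * rough_size X) 0 r.
Proof.
move=> Xrp; have r0 := r_gt0; have rr : - r < 0 by rewrite oppr_lt0.
have [hf _ _ _ _] := Xrp; have [f1 f3 f4] := hf _ _ r0; have [f2 _ _] := hf _ _ rr.
have [p1 p2] := conj (incr_norm_ge0 gamma (incr (base X)) r0) (incr_norm_ge0 gamma (incr (base X)) rr).
have [p3 p4] := conj (incr_norm_ge0 (2 * gamma) (area X) r0) (incr_norm_ge0 (2 * gamma) (delayed_area X) r0).
have [q1 q2] := conj (fine_ge0 p1) (fine_ge0 p2).
have [q3 q4] := conj (fine_ge0 p3) (fine_ge0 p4).
have E : rough_size X = fine (holder_norm gamma `[- r, 0] (base X)) +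
    (fine (holder_norm gamma `[0, r] (base X)) + fine (incr_norm (2 * gamma) `[0, r] (area X))
     + fine (incr_norm (2 * gamma) `[0, r] (delayed_area X))).
  by rewrite /rough_size /rough_norm (fineD3 f1 f3 f4).
have N0 : 0 <= rough_size X by rewrite E; apply: addr_ge0 => //; apply: addr_ge0 => //; apply: addr_ge0.
split=> //.
have [k1 k2 k3 k4] := le_sum4 q1 q2 q3 q4.
have T1 : 1 <= 1 + r by rewrite lerDl ltW.
have rT : r - 0 <= 1 + r by rewrite subr0 lerDr.
apply: (rough_path_bd beta_gt beta_gamma Xrp r0 rT T1 N0).
- by rewrite -(fineK f1) lee_fin E.
- by rewrite sub0r subrr -(fineK f2) lee_fin E.
- by rewrite -(fineK f3) lee_fin E.
- by rewrite -(fineK f4) lee_fin E.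
Qed.

Lemma initial_size_bd X xi : delayed_rough_path r gamma X -> controlled X beta `[- r, 0] xi ->
  [/\ 0 <= initial_size X xi, (forall t, - r <= t -> t <= 0 -> `|xi.1 t| <= initial_size X xi)
    & ctrl_bd beta X (initial_size X xi) (- r) 0 xi].
Proof.
move=> Xrp cxi; have r0 := r_gt0; have rr : - r < 0 by rewrite oppr_lt0.
have [KX hX] := rough_path_bd_ex beta_gt beta_gamma Xrp (- r) 0.
have {}hX := rough_bd_mono (ler_norm KX) hX.
apply: ctrl_norm_bound => //; first exact: ltW.
rewrite fineK //; apply: (controlled_norm_fin beta_gt rr (normr_ge0 KX) _ cxi) => s t q1 q2 q3.
exact: rough_incr hX q1 q2 q3.
Qed.

Lemma state_poly (al : R) : exists q : {poly {poly R}}, forall A X xi y,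
  `|A| = al -> delayed_rough_path r gamma X -> controlled X beta `[- r, 0] xi ->
  delay_state X A pi xi y -> (forall t, - r <= t -> t <= 0 -> y t = xi.1 t) ->
  (ctrl_norm X beta `[0%R, r] (gubinelli_pair y) <=
    (q.[initial_size X xi, rough_size X])%:E)%E.
Proof.
have [C1 [C2 [C10 C20 H]]] := state_apriori al.
(* The parameter [Lam] of the a priori bounds as a polynomial: the outer variable stands for the
   norm of xi, the inner one for that of the rough path. *)
pose lam : {poly {poly R}} := L%:P%:P + c%:P%:P * ('X)%:P + 'X.
pose mm := C1%:P%:P * ('X + lam ^+ 18).
pose kk := C2%:P%:P * (lam + mm) ^+ 40.
exists (mm + kk + kk + (kk + (d%:R)%:P%:P * lam * kk)) => A X xi y Aal Xrp cxi ys yxi.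
have [v0 hX] := rough_size_bd Xrp; have [u0 hu hxi] := initial_size_bd Xrp cxi.
set u := initial_size X xi in u0 hu hxi *; set v := rough_size X in v0 hX *.
have cv : 0 <= c * v by rewrite mulr_ge0.
pose Lam := L + c * v + u; have L0' := L0.
have Lam0 : 0 <= Lam by rewrite /Lam; lra.
have := H A X xi y Lam u Aal Xrp ys yxi.
have hX' : rough_bd r beta X Lam 0 r by apply: rough_bd_mono hX; rewrite /Lam -/v; lra.
move=> /(_ _ u0 hX' hu (ctrl_bd_mono _ hxi)) /=.
have q1 : L <= Lam by rewrite /Lam; lra.
have q2 : u <= Lam by rewrite /Lam; lra.
move=> /(_ q1 q2).
set M := C1 * _; set K := C2 * _ => -[h1 h2].
have M0 : 0 <= M by rewrite /M; pos.
have K0 : 0 <= K by rewrite /K; pos.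
have hX1 s t : 0 <= s -> s <= t -> t <= r -> `|incr (base X) s t| <= Lam * pw s t.
  exact: rough_incr hX'.
have h1' t : 0 <= t -> t <= r -> `|y t| <= M.
  by move=> t0 tr; apply: h1 => //; rewrite (le_trans _ t0) // oppr_le0.
have [_ hn] := ctrl_norm_le (y := gubinelli_pair y) r_gt0 K0 Lam0 hX1 h1' h2.
have elam : lam.[u, v] = Lam by rewrite /lam !hornerXYD hornerXYM !hornerXYC hornerXYX hornerXYY.
have emm : mm.[u, v] = M by rewrite /mm hornerXYM hornerXYD hornerXYexp elam hornerXYC hornerXYX.
have ekk : kk.[u, v] = K by rewrite /kk hornerXYM hornerXYexp hornerXYD elam emm hornerXYC.
have hq (p1 p2 p3 : {poly {poly R}}) : (p2 + p3 + p3 + (p3 + (d%:R)%:P%:P * p1 * p3)).[u, v] =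
    p2.[u, v] + p3.[u, v] + p3.[u, v] + (p3.[u, v] + d%:R * p1.[u, v] * p3.[u, v]).
  by rewrite !hornerXYD !hornerXYM hornerXYC.
by rewrite hq elam emm ekk.
Qed.

(** Data within distance 1 of xi obey common a priori bounds, with u + 1 in place of u; on this ball
    [global_diff] gives one Lipschitz constant. *)
Lemma state_continuous X A xi y e : 0 < e -> delayed_rough_path r gamma X ->
  controlled X beta `[- r, 0] xi ->
  delay_state X A pi xi y -> (forall t, - r <= t -> t <= 0 -> y t = xi.1 t) ->
  exists2 del : R, 0 < del & forall eta z, controlled X beta `[- r, 0] eta ->
    delay_state X A pi eta z -> (forall t, - r <= t -> t <= 0 -> z t = eta.1 t) ->
    (ctrl_norm X beta `[(- r)%R, 0%R] (eta - xi)%R < del%:E)%E ->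
    (ctrl_norm X beta `[0%R, r] (gubinelli_pair z - gubinelli_pair y)%R < e%:E)%E.
Proof.
move=> e0 Xrp cxi ys yxi; have r0 := r_gt0; have rr : - r < 0 by rewrite oppr_lt0.
have L0' := L0; have L1 := gc_L gc.
have [C1 [C2 [C10 C20 H]]] := state_apriori `|A|.
have [v0 hX] := rough_size_bd Xrp; have [u0 hu hxi] := initial_size_bd Xrp cxi.
set u := initial_size X xi in u0 hu hxi *; set v := rough_size X in v0 hX *.
have cv : 0 <= c * v by rewrite mulr_ge0.
pose Lam := L + c * v + (u + 1).
have Lam0 : 0 <= Lam by rewrite /Lam; lra.
have LLam : L <= Lam by rewrite /Lam; lra.
have uLam : u + 1 <= Lam by rewrite /Lam; lra.
have u1 : 0 <= u + 1 by lra.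
have uu : u <= u + 1 by lra.
have hX' : rough_bd r beta X Lam 0 r by apply: rough_bd_mono hX; rewrite /Lam -/v; lra.
pose M := C1 * ((u + 1) + Lam ^+ 18).
pose Kc := C2 * (Lam + M) ^+ 40.
have M0 : 0 <= M by rewrite /M; pos.
have Kc0 : 0 <= Kc by rewrite /Kc; pos.
pose K := Lam + Kc.
have LamK : Lam <= K by rewrite /K; lra.
have KcK : Kc <= K by rewrite /K; lra.
have LK : L <= K by apply: le_trans LamK.
have Xch := rough_path_chen beta_gt beta_gamma Xrp.
have bd eta z : delay_state X A pi eta z -> (forall t, - r <= t -> t <= 0 -> z t = eta.1 t) ->
    (forall t, - r <= t -> t <= 0 -> `|eta.1 t| <= u + 1) -> ctrl_bd beta X (u + 1) (- r) 0 eta ->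
    ctrl_bd beta X K 0 r (gubinelli_pair z) /\ ctrl_bd beta X K (0 - r) (r - r) (z, eta.2).
  move=> zs zeta h1 h2; have h2' := ctrl_bd_mono uLam h2.
  have [_ h3] := H A X eta z Lam (u + 1) erefl Xrp zs zeta LLam u1 hX' h1 h2'.
  split; first exact: ctrl_bd_mono h3.
  by apply: datumE => //; apply: ctrl_bd_mono h2'.
have [C C0 hC] := global_diff beta_gt beta_le gc (fok A) r_gt0 LK Xch.
pose Kd := L * C + C; have Kd0 : 0 <= Kd by rewrite /Kd; pos.
pose Z := C + Kd + Kd + (Kd + d%:R * Lam * Kd).
have Z0 : 0 <= Z by rewrite /Z; pos.
have Z1 : 0 < Z + 1 by lra.
(* The bound 1 keeps [eta] in that ball; [Z] is the Lipschitz constant in the controlled norms. *)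
exists (Num.min 1 (e / (Z + 1))); first by rewrite lt_min ltr01 divr_gt0.
move=> eta z ceta zs zeta; set del := Num.min _ _ => hdel.
have del1 : del <= 1 by rewrite ge_min lexx.
have dele : Z * del < e.
  have : (Z + 1) * del <= e by rewrite mulrC -ler_pdivlMr // ge_min lexx orbT.
  have del0 : 0 < del by rewrite lt_min ltr01 divr_gt0.
  rewrite mulrDl mul1r; lra.
have [D0 hD1 hD2] := ctrl_norm_bound beta_gt (ltW rr) (ltW hdel) rr.
have he1 t : - r <= t -> t <= 0 -> `|eta.1 t - xi.1 t| <= del by exact: hD1.
have heta1 t : - r <= t -> t <= 0 -> `|eta.1 t| <= u + 1.
  move=> t1 t2; rewrite -[eta.1 t](subrK (xi.1 t)) addrC.
  by apply: le_trans (ler_normD _ _) _; apply: lerD; [exact: hu|apply: le_trans del1; exact: he1].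
have heta2 : ctrl_bd beta X (u + 1) (- r) 0 eta.
  by apply: ctrl_bd_mono (ctrl_bdD hxi hD2); rewrite lerD2l.
have [y1 y2] := bd _ _ ys yxi (fun t (t1 : - r <= t) (t2 : t <= 0) => le_trans (hu t t1 t2) uu) (ctrl_bd_mono uu hxi).
have [z1 z2] := bd _ _ zs zeta heta1 heta2.
have [_ _ yd] := ys 0%N; rewrite mul0r add0r in yd.
have [_ _ zd] := zs 0%N; rewrite mul0r add0r in zd.
have rr0 : r - 0 <= r by rewrite subr0.
have hXK := rough_bd_mono LamK hX'.
have close : data_close beta X del (0 - r) (r - r) (z, eta.2) (y, xi.2).
  have [d1 d2 d3] := hD2.
  rewrite sub0r subrr; split.
  - by move=> t t1 t2; rewrite /= zeta // yxi // he1.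
  - by move=> t t1 t2; exact: d1.
  - by move=> s t t1 t2 t3; exact: d2.
  - move=> s t t1 t2 t3; have := d3 s t t1 t2 t3; rewrite remainderB.
    have t4 := le_trans t1 t2; have t5 := le_trans t2 t3.
    by rewrite /remainder /incr /= !zeta ?yxi.
have past t : - r <= t -> t <= 0 -> `|z t - y t| <= del.
  by move=> t1 t2; rewrite zeta // yxi // he1.
have [g1 g2 g3] := hC z y (z, eta.2) (y, xi.2) 0 r del D0 (lexx 0) r_ge0 rr0 hXK z2 y2 z1 y1
  (state_hol r_gt0 zs r) (state_hol r_gt0 ys r) zd yd close past.
have CKd : C * del <= Kd * del by rewrite ler_wpM2r // /Kd lerDr; pos.
have hdiff : ctrl_bd beta X (Kd * del) 0 r (gubinelli_pair z - gubinelli_pair y).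
  split.
  - move=> t t1 t2.
    apply: le_trans (_ : L * (C * del) <= _); last first.
      by rewrite mulrA ler_wpM2r // /Kd lerDl.
    apply: le_trans (gc_Gl gc (z t, z (t - r)) (y t, y (t - r))) _; rewrite ler_wpM2l //.
    have b1 : - r <= t by apply: le_trans t1; rewrite oppr_le0.
    have b2 : - r <= t - r by rewrite lerBrDr addNr.
    have b3 : t - r <= r by apply: le_trans t2; rewrite gerBl.
    by apply: (@pair_le _ _ _ (z t - y t) (z (t - r) - y (t - r))); apply: g1.
  - by move=> s t t1 t2 t3; apply: le_trans (g2 s t t1 t2 t3) _; rewrite ler_wpM2r ?pw_ge0.
  - move=> s t t1 t2 t3; rewrite remainderB; apply: le_trans (g3 s t t1 t2 t3) _.
    by rewrite ler_wpM2r ?pw2_ge0.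
have hX1 s t : 0 <= s -> s <= t -> t <= r -> `|incr (base X) s t| <= Lam * pw s t.
  exact: rough_incr hX'.
have g1' t : 0 <= t -> t <= r -> `|(gubinelli_pair z - gubinelli_pair y).1 t| <= C * del.
  by move=> t1 t2; apply: g1 => //; apply: le_trans t1; rewrite oppr_le0.
have Kd1 : 0 <= Kd * del by rewrite mulr_ge0.
have [_ /le_lt_trans] := ctrl_norm_le (y := gubinelli_pair z - gubinelli_pair y) r_gt0 Kd1 Lam0 hX1 g1' hdiff; apply.
rewrite lte_fin; apply: le_lt_trans dele; rewrite /Z le_eqVlt; apply/orP; left; apply/eqP; ring.
Qed.

End FirstInterval.

Theorem theorem2 (R : realType) (n d : nat) (r gamma beta : R)
    (G : 'rV[R]_n * 'rV[R]_n -> 'M[R]_(d, n))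
    (pi : 'I_n -> 'I_n -> {charge set (measurableTypeR R) -> \bar R})
    (r_gt0 : 0 < r) (gamma_rng : 3^-1 < gamma <= 2^-1)
    (beta_rng : 3^-1 < beta <= gamma) (beta_gamma : 1 < 2 * beta + gamma) :
  exists Q : R -> {poly {poly R}},
  forall (A : 'M[R]_(n + n, n)) (X : delayed_path R d),
    (Cb 4 G \/ (A = 0 /\ Cb 3 G)) ->
    delayed_rough_path r gamma X ->
  exists phi : cpath R d n -> cpath R d n,
    [/\ forall xi, controlled X beta `[- r, 0] xi ->
          solution r beta A G pi X xi (phi xi)
          /\ forall z, solution r beta A G pi X xi z ->
               (forall t, - r <= t -> z.1 t = (phi xi).1 t)
               /\ (forall t, 0 <= t -> z.2 t = (phi xi).2 t),
        forall xi, controlled X beta `[- r, 0] xi ->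
          (ctrl_norm X beta `[0%R, r] (phi xi) <=
            ((Q `|A|).[fine (ctrl_norm X beta `[(- r)%R, 0%R] xi),
                       fine (holder_norm gamma `[(- r)%R, 0%R] (base X))
                       + fine (rough_norm gamma `[0%R, r] X)])%:E)%E
      & forall xi, controlled X beta `[- r, 0] xi ->
          forall e : R, 0 < e -> exists2 del : R, 0 < del &
            forall eta, controlled X beta `[- r, 0] eta ->
              (ctrl_norm X beta `[(- r)%R, 0%R] (eta - xi)%R < del%:E)%E ->
              (ctrl_norm X beta `[0%R, r] (phi eta - phi xi)%R < e%:E)%E].
Proof.
have [beta_gt beta_le] := andP beta_rng; have [_ gamma_le] := andP gamma_rng.
have beta_le2 : beta <= 2^-1 by apply: le_trans gamma_le.
(* [Q] has to be given before A is known. Both alternatives of the hypothesis on G contain [Cb 3 G];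
   when it fails, no A is left to treat. *)
have [G3|nG3] := pselect (Cb 3 G); last first.
  exists (fun=> 0) => A X [G4|[_ G3]] _; last by case: nG3.
  by case: nG3; apply: CbS.
have [L gc] := Cb3_germ_coeff G3.
have /choice[Q hQ] := state_poly beta_gt beta_le2 beta_le r_gt0 gc pi.
exists Q => A X _ Xrp.
have /choice[phi hphi] : forall xi : cpath R d n, exists z, controlled X beta `[- r, 0] xi ->
    exists2 y, z = gubinelli_pair r G y & delay_state r beta G X A pi xi y /\
      (forall t, - r <= t -> t <= 0 -> y t = xi.1 t).
  (* For paths that are not controlled the value of phi is arbitrary; xi itself is taken. *)
  move=> xi; have [cxi|ncxi] := pselect (controlled X beta `[- r, 0] xi); last by exists xi.
  have [y ys yxi] := state_exists beta_gt beta_le2 beta_le r_gt0 gc pi A Xrp cxi.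
  by exists (gubinelli_pair r G y) => _; exists y.
exists phi; split=> xi cxi; have [y -> [ys yxi]] := hphi xi cxi.
- split; first exact: (state_solution beta_gt beta_le r_gt0 gc Xrp ys yxi).
  move=> z zs; have zst := solution_state beta_gt beta_le r_gt0 gc Xrp cxi zs.
  have [z0 zG _ _] := zs.
  have zxi t : - r <= t -> t <= 0 -> z.1 t = xi.1 t by move=> t1 t2; rewrite z0 // t1 t2.
  have E := state_unique beta_gt beta_le2 beta_le r_gt0 gc Xrp zst ys zxi yxi.
  split=> // t t0; rewrite zG //= !E //; lra.
- exact: hQ Xrp cxi ys yxi.
- move=> e e0.
  have [del del0 hdel] := state_continuous beta_gt beta_le2 beta_le r_gt0 gc e0 Xrp cxi ys yxi.
  exists del => // eta ceta heta; have [z -> [zs zxi]] := hphi eta ceta.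
  exact: (hdel eta z ceta zs zxi heta).
Qed.
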